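(* Let $(X_i)_{i\ge 1}$ be iid real random variables with generic element $X$, $\mathbb{E}[X]=0$, $\mathbb{E}[X^2]=1$, let $S_n=X_1+\cdots+X_n$, and let $(S_n^{(i)})_{i\ge1}$ be iid copies of $S_n$. Let $p=p_n$ be a sequence of positive integers with $p_n\to\infty$ as $n\to\infty$. Assume that one of the following three conditions holds: (1) There exists $s>2$ with $\mathbb{E}[|X|^s]<\infty$, and $p=O(n^{(s-2)/2})$. (2) There exists an increasing differentiable function $g$ on $(0,\infty)$ such that $\mathbb{E}[\exp(g(|X|))]<\infty$, $g'(x)\le \tau g(x)/x$ for all sufficiently large $x$ and some $\tau<1$, and $\lim_{x\to\infty}g(x)/\log x=\infty$; and $p=\exp(o(g_n^2\wedge n^{1/3}))$, where $g_n$ is the solution of the equation $g_n^2=g(g_n\sqrt n)$. (3) There exists a constant $h>0$ with $\mathbb{E}[\exp(h|X|)]<\infty$, and $p=\exp(o(n^{1/3}))$. Then the relation $$p\,\mathbb{P}\big(S_n/\sqrt n> d_p+x/d_p\big)\sim p\,\overline{\Phi}(d_p+x/d_p)\to \mathrm{e}^{-x},\qquad n\to\infty,\quad x\in\mathbb{R},$$ is equivalent to either of the following two limit relations: (a) $\displaystyle \mathbb{P}\Big(d_p\max_{i=1,\ldots,p}(S_n^{(i)}/\sqrt n-d_p)\le x\Big)\to\Lambda(x)$ as $n\to\infty$, for all $x\in\mathbb{R}$; (b) $\displaystyle N_n=\sum_{i=1}^p\varepsilon_{d_p(S_n^{(i)}/\sqrt n-d_p)}\stackrel{d}{\rightarrow}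 N=\sum_{i=1}^\infty\varepsilon_{-\log\Gamma_i}$ as $n\to\infty$, where $\Gamma_i=E_1+\cdots+E_i$, $i\ge1$, and $(E_i)$ is iid standard exponential; that is, $N$ is a Poisson random measure on $\mathbb{R}$ with mean measure $\mu(x,\infty)=\mathrm{e}^{-x}$, $x\in\mathbb{R}$.
   Context: $\Phi$ is the standard normal distribution function, $\overline\Phi=1-\Phi$, $a\wedge b=\min(a,b)$, $\Lambda(x)=\exp(-\mathrm{e}^{-x})$ is the standard Gumbel distribution function, and $\varepsilon_x$ is the Dirac measure at $x$. For real $q$ large enough, $$d_q=\sqrt{2\log q}-\frac{\log\log q+\log 4\pi}{2(2\log q)^{1/2}},$$ and $d_p$ means $d_{p_n}$. The notation $a_n\sim b_n$ means $a_n/b_n\to1$. The convergence $N_n\stackrel{d}{\rightarrow}N$ is convergence in distribution of point processes (with respect to the vague topology on the space of point measures). *)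

(* Defs.v *)
From HB Require Import structures.
From mathcomp Require Import all_boot all_order all_algebra.
From mathcomp Require Import all_classical all_reals all_analysis.
From mathcomp Require Import measurable_realfun.

Set Implicit Arguments.
Unset Strict Implicit.
Unset Printing Implicit Defensive.

Import Order.TTheory GRing.Theory Num.Theory.
Import numFieldNormedType.Exports.

Local Open Scope classical_set_scope.
Local Open Scope ring_scope.

Section random_variables.
Context {d : measure_display} {T : measurableType d} {R : realType}.
Variable P : probability T R.

Definition independent {d' : measure_display} {U : measurableType d'}
    {I : eqType} (Y : I -> T -> U) : Prop :=
  forall (s : seq I) (A : I -> set U), uniq s ->
    (forall i, measurable (A i)) ->
    fine (P (\bigcap_(i in [set` s]) Y i @^-1` A i)) =
    \prod_(i <- s) fine (P (Y i @^-1` A i)).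

(* Only Borel sets are compared: the value of a measure on a non-measurable set
   is unspecified, so [pushforward P Y = pushforward P Z] would be too strong. *)
Definition same_law (Y Z : T -> R) : Prop :=
  forall A : set R, measurable A -> P (Y @^-1` A) = P (Z @^-1` A).

Definition iid (Y : nat -> T -> R) : Prop :=
  independent Y /\ forall i, same_law (Y i) (Y 0%N).

Definition standard_exponential (Y : T -> R) : Prop :=
  forall A : set R, measurable A -> P (Y @^-1` A) = exponential_prob 1 A.

(* [partial_sum Y n] is Y_1 + ... + Y_n, the sequence being indexed from 0. *)
Definition partial_sum (Y : nat -> T -> R) (n : nat) (w : T) : R :=
  \sum_(i < n) Y i w.

(* Convergence of the expectations of bounded continuous functionals. *)
Definition cvg_in_distribution {M : topologicalType}
    (Y : nat -> T -> M) (Z : T -> M) : Prop :=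
  forall H : M -> R, continuous H -> (exists C, forall m, `|H m| <= C) ->
    ('E_P[H \o Y n] @[n --> \oo] --> 'E_P[H \o Z])%E.

End random_variables.

Section point_measures.
Context {R : realType}.

(* A countable (finite or infinite) sum of Dirac measures, finite on compacts. *)
Definition is_point_measure (m : {measure set R -> \bar R}) : Prop :=
  (exists (D : set nat) (x : nat -> R), forall A : set R, measurable A ->
     m A = (\esum_(i in D) \d_(x i) A)%E) /\
  (forall K : set R, compact K -> (m K < +oo)%E).

Lemma is_point_measure0 : is_point_measure (mzero : {measure set R -> \bar R}).
Proof.
split; last by move=> K _; rewrite /mzero /= ltry.
by exists set0, (fun=> 0) => A _; rewrite esum_set0.
Qed.

End point_measures.

Record pointMeasure (R : realType) := PointMeasure {
  pm_measure :> {measure set R -> \bar R};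
  pm_is_point_measure : is_point_measure pm_measure }.

HB.instance Definition _ (R : realType) := gen_eqMixin (pointMeasure R).
HB.instance Definition _ (R : realType) := gen_choiceMixin (pointMeasure R).

(* A random sum of Dirac measures is usually locally finite only almost surely;
   off that event its value is replaced by the zero measure. *)
Definition to_pointMeasure (R : realType) (m : {measure set R -> \bar R}) :
    pointMeasure R :=
  match pselect (is_point_measure m) with
  | left h => PointMeasure h
  | right _ => PointMeasure (@is_point_measure0 R)
  end.

(* C_c^+(R) *)
Definition Cc_nonneg (R : realType) : Type :=
  {f : R -> R | [/\ continuous f, forall x, 0 <= f x &
                    compact (closure [set x | f x != 0])]}.

Definition vague_eval (R : realType) (m : pointMeasure R) :
    {ptws Cc_nonneg R -> R} :=
  fun f => \int[m]_x (sval f x).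

(* The vague topology: the coarsest topology for which m |-> \int f dm is
   continuous for every f in C_c^+(R). *)
HB.instance Definition _ (R : realType) :=
  Topological.copy (pointMeasure R) (initial_topology (@vague_eval R)).

Section poisson.
Context {d : measure_display} {T : measurableType d} {R : realType}.
Variable P : probability T R.

(* The library's [poisson_pmf] is not used: it is constantly 1 at rate 0. *)
Definition poisson_random_measure (mu : {measure set R -> \bar R})
    (N : T -> pointMeasure R) : Prop :=
  [/\ forall A : set R, measurable A ->
        measurable_fun setT (fun w : T => N w A : \bar R),
      forall (A : set R) (k : nat), measurable A -> (mu A < +oo)%E ->
        P [set w | N w A = k%:R%:E] =
        (expR (- fine (mu A)) * fine (mu A) ^+ k / k`!%:R)%:E,
      forall A : set R, measurable A -> mu A = +oo%E ->
        P [set w | N w A = +oo%E] = 1%E &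
      forall (k : nat) (A : 'I_k -> set R), (forall i, measurable (A i)) ->
        trivIset setT A -> independent P (fun i (w : T) => N w (A i) : \bar R)].

End poisson.

Section extremes.
Context {R : realType}.

Definition Phi (x : R) : R := fine (normal_prob 0 1 `]-oo, x]).
Definition Phibar (x : R) : R := 1 - Phi x.
Definition Lambda (x : R) : R := expR (- expR (- x)).

Definition norming (q : R) : R :=
  Num.sqrt (2 * ln q) - (ln (ln q) + ln (4 * pi)) / (2 * Num.sqrt (2 * ln q)).

(* a_n ~ b_n *)
Definition asymp_equiv (a b : nat -> R) : Prop :=
  a n / b n @[n --> \oo] --> (1 : R).

(* The maximum over i < p; the initial value [f 0] is one of the entries as
   soon as p > 0, which is the only case used. *)
Definition maximum (p : nat) (f : nat -> R) : R :=
  \big[Num.max/f 0%N]_(i < p) f i.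

Definition dirac_sum (p : nat) (x : nat -> R) : pointMeasure R :=
  to_pointMeasure (msum (fun i => \d_(x i)) p).

Definition dirac_series (x : nat -> R) : pointMeasure R :=
  to_pointMeasure (mseries (fun i => \d_(x i)) 0).

End extremes.

Section conditions.
Context {d : measure_display} {T : measurableType d} {R : realType}.
Variable P : probability T R.
Variables (X : T -> R) (p : nat -> nat).

Definition condition_moment : Prop :=
  exists s : R, [/\ 2 < s, ('E_P[fun w => (`|X w| `^ s)%R] < +oo)%E &
    (fun n => (p n)%:R : R) =O_\oo (fun n => n%:R `^ ((s - 2) / 2))].

(* g is only constrained on (0, oo), its value at 0 being an arbitrary real;
   the sequence gn is a positive solution of gn^2 = g (gn * sqrt n), which is
   only required for large n since there may be none for small n. *)
Definition condition_subexponential : Prop :=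
  exists (g : R -> R) (gn : nat -> R),
    [/\ {in `]0, +oo[ &, {homo g : x y / x <= y}},
        (forall x, 0 < x -> derivable g x 1),
        ('E_P[fun w => expR (g `|X w|%R)] < +oo)%E,
        (exists2 tau : R, tau < 1 &
           \forall x \near +oo, derive1 g x <= tau * g x / x) &
        g x / ln x @[x --> +oo] --> +oo] /\
    [/\ (\forall n \near \oo,
           0 < gn n /\ gn n ^+ 2 = g (gn n * Num.sqrt n%:R)) &
        (fun n => ln (p n)%:R : R) =o_\oo
          (fun n => Num.min (gn n ^+ 2) (n%:R `^ 3^-1))].

Definition condition_exponential : Prop :=
  (exists2 h : R, 0 < h & ('E_P[fun w => expR (h * `|X w|)%R] < +oo)%E) /\
  (fun n => ln (p n)%:R : R) =o_\oo (fun n => n%:R `^ 3^-1 : R).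

End conditions.

Section relations.
Context {d : measure_display} {T : measurableType d} {R : realType}.
Variable P : probability T R.
Variable p : nat -> nat.

Definition tail_relation (S : nat -> T -> R) : Prop :=
  forall x : R,
    let t n := norming (p n)%:R + x / norming (p n)%:R in
    asymp_equiv
      (fun n => (p n)%:R * fine (P [set w | S n w / Num.sqrt n%:R > t n]))
      (fun n => (p n)%:R * Phibar (t n)) /\
    ((p n)%:R * Phibar (t n) @[n --> \oo] --> expR (- x)).

(* Sc n i is the (i+1)-st copy of S_n. *)
Variable Sc : nat -> nat -> T -> R.

Definition gumbel_relation : Prop :=
  forall x : R,
    P [set w | norming (p n)%:R *
         maximum (p n) (fun i => Sc n i w / Num.sqrt n%:R - norming (p n)%:R)
         <= x] @[n --> \oo] --> (Lambda x)%:E.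

Definition point_process (n : nat) (w : T) : pointMeasure R :=
  dirac_sum (p n) (fun i =>
    norming (p n)%:R * (Sc n i w / Num.sqrt n%:R - norming (p n)%:R)).

(* [partial_sum E i.+1] is Gamma_(i+1) = E_1 + ... + E_(i+1). *)
Definition limit_process (E : nat -> T -> R) (w : T) : pointMeasure R :=
  dirac_series (fun i => - ln (partial_sum E i.+1 w)).

End relations.

(* Main.v *)
Require Import Defs.
From HB Require Import structures.
From mathcomp Require Import all_boot all_order all_algebra.
From mathcomp Require Import all_classical all_reals all_analysis.
From mathcomp Require Import measurable_realfun.
From mathcomp Require Import ring lra.

Set Implicit Arguments.
Unset Strict Implicit.
Unset Printing Implicit Defensive.

Import Order.TTheory GRing.Theory Num.Theory.
Import numFieldNormedType.Exports.

Local Open Scope classical_set_scope.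
Local Open Scope ring_scope.

(** The Gaussian tail satisfies [p * Phibar (d_p + x / d_p) --> exp (- x)] by the
    Mills ratio and the choice of [d_p], so the tail relation says that
    [p * P (S_n / sqrt n > d_p + x / d_p)] tends to [exp (- x)] for every [x]
    ([tail_relationE]). The probability that the maximum of the [p] copies stays
    below a level is [(1 - a)^p], where [a] is the probability of exceeding it,
    and [(1 - a)^p --> exp (- A)] is equivalent to [p a --> A]; this gives the
    Gumbel limit ([tail_gumbelE]).

    From the tail relation to the point process ([point_process_cvg]): the
    ordered sample is realised as a nonincreasing function, depending on [n], of the
    order statistics of [p] exponential variables, and these are by Renyi's
    representation partial sums of [E_j / (p - j)] for one fixed exponential
    sequence [E]. After multiplication by [p] they converge to the arrival times
    [Gamma_k] of the sequence [E], so that the points of the coupled process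
    converge almost surely to [- ln Gamma_k], vaguely as point measures.

    From the point process to the tail: the Laplace functional at test functions
    approximating indicators gives the limit [exp (- a) - exp (- b)] for [p] times
    the probability of a window ]a, b] ([window_cvg]). Vague convergence does not
    see mass escaping to [+ oo], and this is where the growth of [p] enters.
    Replace the first [m ~ D n / d_p^2] terms of [S_n] by fresh ones. On the event
    that [S_n] exceeds a level near [sqrt n d_p] and the sample is regular (few
    large terms, sum of squares of order [n], truncated sum of order
    [sqrt n d_p]), the terms are exchangeable and carry equal shares of the sum,
    so the sum drops by a quantity of order
    [sqrt n / d_p] with high probability. The sum and its resampled version are an
    exchangeable pair, so the same transitions read backwards are untypical rises
    from lower values, and the tail above a level is bounded by the probability of
    a window of fixed width below it, up to the probability of irregular samples
    ([resampling_tail], [no_escape]). Each of the three moment conditions makes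
    irregular samples negligible at the scale [1 / p] ([moderate_moment],
    [moderate_subexponential], [moderate_exponential]), and letting the level grow
    shows that no mass escapes ([tail_from_windows]).

    The limiting process is Poisson because the Laplace functional of the arrival
    times is that of Lebesgue measure on the half-line ([arrival_laplace], by
    conditioning on the first arrival), whose image under [- ln] has the tail
    [exp (- x)]; Laplace transforms at the integers determine joint laws of counts
    ([poisson_limit_process]). *)

(** * Sequences of real random variables *)

(** The cylinders generate the product sigma-algebra on real sequences; they are
    closed under intersection, so laws of sequences are determined by them. *)
Definition cylinders (R : realType) : set (set (nat -> R)) :=
  [set B | exists n (A : nat -> set R), (forall i, measurable (A i)) /\
     B = [set x | forall i, (i < n)%N -> A i (x i)]].

Notation seqR R := (g_sigma_algebraType (@cylinders R)).

Section sequence_space.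
Context {R : realType}.

Lemma measurable_coord i : measurable_fun setT (fun x : seqR R => x i : R).
Proof.
move=> _ B mB; rewrite setTI; apply: sub_sigma_algebra.
exists i.+1, (fun j => if j == i then B else setT); split.
  by move=> j; case: ifP.
apply/seteqP; split => [x /= Bx j ji|x /= /(_ i (ltnSn i))]; last by rewrite eqxx.
by case: eqP => // ->.
Qed.

Lemma measurable_seqP d (T : measurableType d) (f : T -> seqR R) :
  (forall i, measurable_fun setT (fun w => f w i : R)) -> measurable_fun setT f.
Proof.
move=> mf; 
  apply: (@measurability _ _ T (seqR R) setT f (@cylinders R)) => //.
move=> _ [_ [n [A [mA ->]]] <-]; rewrite setTI.
rewrite (_ : _ @^-1` _ = \bigcap_(i < n) ((fun w => f w i : R) @^-1` A i)).
  apply: bigcap_measurableType => i _; rewrite -[X in measurable X]setTI.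
  exact: mf.
by apply/seteqP; split => w /=.
Qed.

Lemma setI_closed_cylinders : setI_closed (@cylinders R).
Proof.
move=> _ _ [n [A [mA ->]]] [k [B [mB ->]]].
exists (maxn n k), (fun i => (if (i < n)%N then A i else setT) `&`
                             (if (i < k)%N then B i else setT)); split.
  by move=> i; apply: measurableI; case: ifP.
apply/seteqP; split => [x /= [Ax Bx] i _|x /= ABx].
  by split; case: ifPn => // ?; [exact: Ax|exact: Bx].
split=> i ilt.
  by have := ABx i; rewrite leq_max ilt => /(_ isT)[].
by have := ABx i; rewrite leq_max ilt orbT => /(_ isT)[_].
Qed.

Definition scons (x : R) (s : nat -> R) : seqR R :=
  fun i => if i is j.+1 then s j else x.

Lemma measurable_scons d (T : measurableType d) (f : T -> R) (g : T -> seqR R) :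
  measurable_fun setT f -> measurable_fun setT g ->
  measurable_fun setT (fun w => scons (f w) (g w) : seqR R).
Proof.
move=> mf mg; apply: measurable_seqP => -[|i] //=.
exact: measurableT_comp (measurable_coord i) mg.
Qed.

End sequence_space.

Section iid_law.
Context {R : realType}.

(** [Y] is an iid sequence with common law [nu], in terms of finite rectangles
    only; a law in place of a random variable lets one compare sequences living
    on different probability spaces. *)
Definition iid_law d (T : measurableType d) (P : probability T R)
    (Y : nat -> T -> R) (nu : probability R R) : Prop :=
  (forall i, measurable_fun setT (Y i)) /\
  forall n (A : nat -> set R), (forall i, measurable (A i)) ->
    P [set w | forall i, (i < n)%N -> A i (Y i w)] = (\prod_(i < n) nu (A i))%E.

Lemma measurable_iid d (T : measurableType d) (P : probability T R) Y nu :
  iid_law P Y nu -> measurable_fun setT (fun w => (fun i => Y i w) : seqR R).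
Proof. by move=> [mY _]; exact: measurable_seqP. Qed.

(** Two measures agreeing on the cylinders agree on the product sigma-algebra,
    and the joint laws of [Y1] and [Y2] are such measures. *)
Lemma iid_law_integral d1 d2 (T1 : measurableType d1) (T2 : measurableType d2)
    (P1 : probability T1 R) (P2 : probability T2 R) Y1 Y2 nu
    (Phi : seqR R -> \bar R) :
  iid_law P1 Y1 nu -> iid_law P2 Y2 nu ->
  measurable_fun setT Phi -> (forall x, 0 <= Phi x)%E ->
  (\int[P1]_w Phi (fun i => Y1 i w) = \int[P2]_w Phi (fun i => Y2 i w))%E.
Proof.
move=> iid1 iid2 mPhi Phi0.
pose f1 w : seqR R := fun i => Y1 i w.
pose f2 w : seqR R := fun i => Y2 i w.
have mf1 : measurable_fun setT f1 := measurable_iid iid1.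
have mf2 : measurable_fun setT f2 := measurable_iid iid2.
pose F1 : {mfun T1 >-> seqR R} := HB.pack f1 (isMeasurableFun.Build _ _ _ _ _ mf1).
pose F2 : {mfun T2 >-> seqR R} := HB.pack f2 (isMeasurableFun.Build _ _ _ _ _ mf2).
transitivity (\int[distribution P1 F1]_x Phi x)%E.
  by rewrite ge0_integral_distribution.
transitivity (\int[distribution P2 F2]_x Phi x)%E; last first.
  by rewrite ge0_integral_distribution.
apply: eq_measure_integral => A mA _.
apply: (@measure_unique _ R (seqR R) (@cylinders R) (fun=> setT)) => //.
- exact: setI_closed_cylinders.
- move=> _; exists 0%N, (fun=> setT); split => //.
  by apply/seteqP; split.
- by rewrite bigcup_const.
- move=> _ [n [B [mB ->]]].
  exact: etrans (iid1.2 n B mB) (esym (iid2.2 n B mB)).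
- move=> _; exact: le_lt_trans (probability_le1 _ measurableT) (ltry 1).
Qed.

End iid_law.

Section iid_constructions.
Context {R : realType} d (T : measurableType d) (P : probability T R).
Variables (Y : nat -> T -> R) (nu : probability R R).
Hypothesis iidY : iid_law P Y nu.

Lemma measurable_iid_rectangle n (A : nat -> set R) :
  (forall i, measurable (A i)) ->
  measurable [set w | forall i, (i < n)%N -> A i (Y i w)].
Proof.
move=> mA; rewrite (_ : mkset _ = \bigcap_(i < n) (Y i @^-1` A i)); last first.
  by apply/seteqP; split.
apply: bigcap_measurableType => i _; rewrite -[X in measurable X]setTI.
by apply: iidY.1.
Qed.

Lemma iid_law_seq (s : seq nat) (A : nat -> set R) : uniq s ->
  (forall i, measurable (A i)) ->
  P [set w | forall i, i \in s -> A i (Y i w)] = (\prod_(i <- s) nu (A i))%E.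
Proof.
move=> us mA; pose n := (\max_(i <- s) i).+1.
have sn i : i \in s -> (i < n)%N by move=> si; rewrite ltnS leq_bigmax_seq.
pose B i := if i \in s then A i else setT.
have mB i : measurable (B i) by rewrite /B; case: ifP.
transitivity (P [set w | forall i, (i < n)%N -> B i (Y i w)]).
  congr (P _); apply/seteqP; split => w /= Aw i; rewrite /B.
    by move=> _; case: ifPn => // /Aw.
  by move=> si; have := Aw i (sn _ si); rewrite /B si.
rewrite iidY.2//.
transitivity (\prod_(i < n | val i \in s) nu (A i))%E.
  rewrite [RHS]big_mkcond/=; apply: eq_bigr => i _; rewrite /B.
  by case: ifP => // _; rewrite probability_setT.
rewrite -(big_mkord (fun i => i \in s) (fun i => nu (A i))) -big_filter.
apply: perm_big; apply: uniq_perm => //.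
  by rewrite filter_uniq// iota_uniq.
move=> i; rewrite mem_filter mem_index_iota /=.
by case: (boolP (i \in s)) => // /sn.
Qed.

Lemma iid_law_reindex (f : nat -> nat) :
  injective f -> iid_law P (fun i => Y (f i)) nu.
Proof.
move=> injf; split=> [i|n A mA]; first exact: iidY.1.
pose g := 'pinv_(fun=> 0%N) setT f.
have gK i : g (f i) = i by apply: pinvKV => //; [move=> ? ? _ _ /injf|rewrite inE].
have us : uniq (map f (iota 0 n)) by rewrite map_inj_uniq ?iota_uniq.
have := iid_law_seq us (fun i => mA (g i)).
rewrite big_map /index_iota -[in X in _ = X -> _](subn0 n) -/(index_iota 0 n).
rewrite big_mkord; under eq_bigr do rewrite gK; move=> <-.
congr (P _); apply/seteqP; split => w /= Aw i.
  by move=> /mapP[j]; rewrite mem_iota /= add0n => jn ->; rewrite gK; exact: Aw.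
move=> ilt; rewrite -[X in A X](gK i); apply: Aw.
by rewrite map_f// mem_iota add0n.
Qed.

Lemma iid_law_comp (h : R -> R) (nu' : probability R R) :
  measurable_fun setT h ->
  (forall A, measurable A -> nu' A = nu (h @^-1` A)) ->
  iid_law P (fun i w => h (Y i w)) nu'.
Proof.
move=> mh nu'E; split=> [i|n A mA]; first exact: measurableT_comp (iidY.1 i).
under [RHS]eq_bigr do rewrite nu'E//.
rewrite -(iidY.2 n (fun i => h @^-1` A i))// => i.
by rewrite -[X in measurable X]setTI; apply: mh.
Qed.

Lemma iid_law_scons :
  iid_law (nu \x P)%E (fun i z => scons z.1 (fun j => Y j z.2) i) nu.
Proof.
split=> [[|i]/=|[|n] A mA].
- exact: measurable_fst.
- by apply: measurableT_comp measurable_snd; exact: iidY.1.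
- rewrite big_ord0 -[RHS](probability_setT (nu \x P)%E).
  by congr ((nu \x P)%E _); apply/seteqP; split.
rewrite big_ord_recl /= -(iidY.2 n (fun i => A i.+1))//.
rewrite -product_measure1E//; last exact: (@measurable_iid_rectangle n (fun i => A i.+1)).
congr ((nu \x P)%E _); apply/seteqP; split => -[x w] /=.
  by move=> Axw; split => [|i ilt]; [exact: (Axw 0%N)|exact: (Axw i.+1)].
by move=> [A0 AS] [|i] //=; exact: AS.
Qed.

(** The first [n] terms of one copy followed by another copy: this separates a
    functional of the first terms from the terms beyond them. *)
Lemma iid_law_cat n : iid_law (P \x P)%E
  (fun i z => if (i < n)%N then Y i z.1 else Y (i - n) z.2) nu.
Proof.
split=> [i|N A mA].
  case: (i < n)%N.
    exact: (measurableT_comp (iidY.1 _) measurable_fst).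
  exact: (measurableT_comp (iidY.1 _) measurable_snd).
rewrite -(big_mkord xpredT (fun i => nu (A i))).
rewrite (big_cat_nat (leq0n (minn N n)) (geq_minl N n))/= [X in (X * _)%E]big_mkord.
rewrite -[X in index_iota X N](add0n (minn N n)) big_addn [X in (_ * X)%E]big_mkord.
rewrite -iidY.2// -(iidY.2 _ (fun i => A (i + minn N n)%N))//.
rewrite -product_measure1E//; first last.
- exact: (@measurable_iid_rectangle _ (fun i => A (i + minn N n)%N)).
- exact: measurable_iid_rectangle.
congr ((P \x P)%E _); apply/seteqP; split => -[w w'] /=.
  move=> Aw; split => i ilt.
    by have := Aw i; move: ilt; rewrite leq_min => /andP[iN ->]; exact.
  have := leqP N n; case=> [Nn|nN].
    by move: ilt; rewrite (minn_idPl Nn) subnn.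
  rewrite (minn_idPr (ltnW nN)) in ilt *.
  have := Aw (i + n)%N; rewrite [X in if X then _ else _]ltnNge leq_addl /= addnK.
  by apply; rewrite addnC -ltn_subRL.
move=> [Aw Aw'] i iN; case: ifPn => [ilt|]; first by apply: Aw; rewrite leq_min iN.
rewrite -leqNgt => ni; have nN : (n <= N)%N by rewrite (leq_trans ni)// ltnW.
have := Aw' (i - n)%N; rewrite (minn_idPr nN) subnK//; apply.
by rewrite ltn_sub2r// (leq_ltn_trans ni).
Qed.

Lemma iid_integral_scons (Phi : seqR R -> \bar R) :
  measurable_fun setT Phi -> (forall x, 0 <= Phi x)%E ->
  (\int[P]_w Phi (fun i => Y i w) =
   \int[nu]_x \int[P]_w Phi (scons x (fun j => Y j w)))%E.
Proof.
move=> mPhi Phi0; rewrite (iid_law_integral iidY iid_law_scons mPhi Phi0).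
rewrite (fubini_tonelli1 (fun z => Phi (scons z.1 (fun j => Y j z.2))))//.
by apply: measurableT_comp mPhi _; exact: measurable_iid iid_law_scons.
Qed.

Lemma iid_integral_cat n (Phi : seqR R -> \bar R) :
  measurable_fun setT Phi -> (forall x, 0 <= Phi x)%E ->
  (\int[P]_w Phi (fun i => Y i w) = \int[P]_w \int[P]_w'
     Phi (fun i => if (i < n)%N then Y i w else Y (i - n) w'))%E.
Proof.
move=> mPhi Phi0; rewrite (iid_law_integral iidY (iid_law_cat n) mPhi Phi0).
rewrite (fubini_tonelli1 (fun z => Phi (fun i =>
  if (i < n)%N then Y i z.1 else Y (i - n) z.2)))//.
by apply: measurableT_comp mPhi _; exact: measurable_iid (iid_law_cat n).
Qed.

End iid_constructions.

Lemma iid_iid_law {R : realType} d (T : measurableType d) (P : probability T R)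
    (Y : nat -> {RV P >-> R}) : iid P Y -> iid_law P Y (distribution P (Y 0%N)).
Proof.
move=> [indY sameY]; split=> [//|n A mA].
have mYA i : measurable (Y i @^-1` A i).
  by rewrite -[X in measurable X]setTI; exact: measurable_funP.
have := indY (iota 0 n) A (iota_uniq _ _) mA.
rewrite /= -[in RHS](subn0 n) -/(index_iota 0 n) big_mkord.
rewrite (_ : \bigcap_(_ in _) _ = [set w | forall i, (i < n)%N -> A i (Y i w)]);
  last first.
  apply/seteqP; split => w /= Aw i.
    by move=> ilt; apply: Aw; rewrite /= mem_iota.
  by rewrite /= mem_iota => ilt; exact: Aw.
have mrect : measurable [set w | forall i, (i < n)%N -> A i (Y i w)].
  rewrite (_ : mkset _ = \bigcap_(i < n) (Y i @^-1` A i)); last first.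
    by apply/seteqP; split.
  exact: bigcap_measurableType.
move=> h; rewrite -[LHS]fineK ?fin_num_measure// h -prodEFin.
apply: eq_bigr => i _; rewrite fineK ?fin_num_measure//.
exact: sameY.
Qed.

(** * The exponential law *)

Section density.
Local Open Scope ereal_scope.
Context d (T : measurableType d) (R : realType).
Variables (mu nu : {measure set T -> \bar R}) (h : T -> R).
Hypotheses (mh : measurable_fun setT h) (h0 : forall x, (0 <= h x)%R).
Hypothesis nuE : forall A, measurable A -> nu A = \int[mu]_(x in A) (h x)%:E.

Import HBNNSimple.

Let integral_density_indic A : measurable A ->
  \int[nu]_x (\1_A x)%:E = \int[mu]_x ((\1_A x)%:E * (h x)%:E).
Proof.
move=> mA; rewrite integral_indic// setIT nuE// integral_mkcond.
apply: eq_integral => x _; rewrite patchE indicE.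
by case: ifP => _; rewrite ?mul1e ?mul0e.
Qed.

Let integral_density_nnsfun (f : {nnsfun T >-> R}) :
  \int[nu]_x (f x)%:E = \int[mu]_x ((f x)%:E * (h x)%:E).
Proof.
under [LHS]eq_integral do rewrite fimfunE -fsumEFin//.
rewrite [LHS]ge0_integral_fsum//; last 2 first.
- by move=> r; exact/measurable_EFinP/measurableT_comp.
- by move=> n x _; rewrite EFinM nnfun_muleindic_ge0.
under [RHS]eq_integral.
  move=> x _; rewrite fimfunE -fsumEFin// ge0_mule_fsuml; last first.
    by move=> r; rewrite EFinM nnfun_muleindic_ge0.
  over.
rewrite [RHS]ge0_integral_fsum//; last 2 first.
- move=> r; apply: emeasurable_funM; last exact/measurable_EFinP.
  by apply/measurable_EFinP; exact: measurableT_comp.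
- by move=> r x _; rewrite mule_ge0 ?[(_ * _)%R%:E]EFinM ?nnfun_muleindic_ge0 ?lee_fin.
apply: eq_fsbigr => r _.
rewrite integralZl_indic_nnsfun//= integral_density_indic//.
have [r0|r0] := ltP r 0%R.
  rewrite preimage_nnfun0//.
  under eq_integral do rewrite indic0 mul0e.
  by under [RHS]eq_integral do rewrite indic0 mulr0 mul0e; rewrite !integral0 mule0.
rewrite -ge0_integralZl//.
- by apply: eq_integral => x _; rewrite EFinM muleA.
- by apply: emeasurable_funM; last (by exact/measurable_EFinP); exact/measurable_EFinP/measurable_indic.
- by move=> x _; rewrite mule_ge0 ?lee_fin.
Qed.

Lemma ge0_integral_density (f : T -> \bar R) :
  measurable_fun setT f -> (forall x, 0 <= f x) ->
  \int[nu]_x f x = \int[mu]_x (f x * (h x)%:E).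
Proof.
move=> mf f0; pose f_ := nnsfun_approx measurableT mf.
transitivity (limn (fun n => \int[nu]_x (f_ n x)%:E)).
  rewrite -monotone_convergence//=.
  - apply: eq_integral => ? _; apply/esym/cvg_lim => //=.
    exact: cvg_nnsfun_approx.
  - by move=> n; exact/measurable_EFinP/measurable_funTS.
  - by move=> n ? _; rewrite lee_fin.
  - by move=> ? _ ? ? mn; rewrite lee_fin; exact/lefP/nd_nnsfun_approx.
under eq_fun do rewrite integral_density_nnsfun.
rewrite -monotone_convergence//=.
- apply: eq_integral => x _; apply/cvg_lim => //=.
  apply: cvgeMr => //; exact: cvg_nnsfun_approx.
- by move=> n; apply: emeasurable_funM; last (by exact/measurable_EFinP); exact/measurable_EFinP/measurable_funTS.
- by move=> n ? _; rewrite mule_ge0 ?lee_fin//.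
- move=> ? _ ? ? mn; apply: lee_wpmul2r; rewrite lee_fin//.
  exact/lefP/nd_nnsfun_approx.
Qed.

End density.

Section exponential_law.
Context {R : realType}.
Local Notation leb := (@lebesgue_measure R).

Lemma measurable_affine (k c : R) : measurable_fun setT (fun x : R => k * x + c).
Proof. by apply: measurable_funD => //; exact: measurable_funM. Qed.

Lemma ge0_integral_affine (k c : R) (f : R -> \bar R) : 0 < k ->
  measurable_fun setT f -> (forall x, 0 <= f x)%E ->
  (\int[leb]_x f x = k%:E * \int[leb]_x f (k * x + c)%R)%E.
Proof.
move=> k0 mf f0.
pose phi : measurableTypeR R -> measurableTypeR R := fun x => k * x + c.
have mphi : measurable_fun setT phi := measurable_affine k c.
pose m := measure_function_pushforward__canonical__measure_function_Measure leb mphi.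
pose r : {nonneg R} := NngNum (ltW k0).
transitivity (\int[mscale r m]_x f x)%E; last first.
  rewrite ge0_integral_mscale// ge0_integral_pushforward//.
apply: eq_measure_integral => A mA _.
apply: lebesgue_measure_unique => // _ [[a b]] _ <-.
transitivity (k%:E * leb (phi @^-1` `]a, b]%classic))%E; last by [].
rewrite (_ : _ @^-1` _ = `](a - c) / k, (b - c) / k]%classic).
  rewrite !lebesgue_measure_itv/= !lte_fin ltr_pM2r ?invr_gt0// ltrD2r.
  case: ifPn => ab; last by rewrite mule0.
  rewrite -!EFinB -EFinM; congr EFin; field.
  by rewrite gt_eqF.
apply/seteqP; split => x /=; rewrite !in_itv/= ltr_pdivrMr// ler_pdivlMr//;
  by rewrite ltrBlDr lerBrDr mulrC.
Qed.

Variable nu : probability R R.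
Hypothesis nuE : forall A, measurable A -> nu A = exponential_prob 1 A.

Lemma integral_exponential (f : R -> \bar R) :
  measurable_fun setT f -> (forall x, 0 <= f x)%E ->
  (\int[nu]_x f x = \int[leb]_x (f x * (exponential_pdf 1 x)%:E))%E.
Proof.
move=> mf f0.
(* the Borel sets carry two displays, hence the transfer along the identity *)
have mid : measurable_fun setT (id : R -> measurableTypeR R) by [].
pose m := measure_function_pushforward__canonical__measure_function_Measure nu mid.
transitivity (\int[m]_x f x)%E; first by rewrite ge0_integral_pushforward.
apply: (@ge0_integral_density _ _ R leb m (exponential_pdf 1)) => //.
- exact: measurable_exponential_pdf.
- by move=> x; exact: exponential_pdf_ge0.
Qed.

Let pdf1E (x : R) : exponential_pdf 1 x = if 0 <= x then expR (- x) else 0.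
Proof.
case: ifPn => x0; last by rewrite lt0_exponential_pdf// ltNge.
by rewrite exponential_pdfE// mul1r mulN1r.
Qed.

(** Memorylessness of the exponential law. *)
Lemma exponential_shift (x : R) (f : R -> \bar R) : 0 <= x ->
  measurable_fun setT f -> (forall x, 0 <= f x)%E ->
  (\int[nu]_y (f y * (x <= y)%R%:R%:E) =
   (expR (- x))%:E * \int[nu]_y f (x + y)%R)%E.
Proof.
move=> x0 mf f0.
have mle : measurable_fun setT (fun y : R => (x <= y)%R%:R%:E : \bar R).
  apply/measurable_EFinP/measurableT_comp => //.
  exact: measurable_fun_ler.
have mfx : measurable_fun setT (fun y => f (x + y)).
  by apply: measurableT_comp mf _; exact: measurable_funD.
rewrite !integral_exponential//; last 2 first.
- exact: emeasurable_funM.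
- by move=> y; rewrite mule_ge0// lee_fin.
have mpdf := @measurable_exponential_pdf R 1.
have m1 : measurable_fun setT
    (fun y : R => f y * (x <= y)%R%:R%:E * (exponential_pdf 1 y)%:E)%E.
  apply: emeasurable_funM; last exact/measurable_EFinP.
  exact: emeasurable_funM.
have m2 : measurable_fun setT
    (fun y : R => f (x + y)%R * (exponential_pdf 1 y)%:E)%E.
  by apply: emeasurable_funM => //; exact/measurable_EFinP.
rewrite -ge0_integralZl//; last first.
  by move=> y _; rewrite mule_ge0// lee_fin exponential_pdf_ge0.
rewrite (@ge0_integral_affine 1 x)//; last first.
- by move=> y; rewrite !mule_ge0// lee_fin ?exponential_pdf_ge0.
rewrite mul1e; apply: eq_integral => y _.
rewrite mul1r -muleA [RHS]muleCA [x + y]addrC; congr (f _ * _)%E.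
rewrite -!EFinM; congr EFin; rewrite !pdf1E lerDr.
have [y0|y0] := boolP (0 <= y); last by rewrite mul0r mulr0.
by rewrite addr_ge0// mul1r opprD expRD mulrC.
Qed.

Lemma exponential_scale (k : R) (f : R -> \bar R) : 0 < k ->
  measurable_fun setT f -> (forall x, 0 <= f x)%E ->
  (\int[nu]_y (f y * (k * expR (- (k - 1) * y))%:E) = \int[nu]_y f (y / k)%R)%E.
Proof.
move=> k0 mf f0.
have mexp : measurable_fun setT (fun y : R => (k * expR (- (k - 1) * y))%:E).
  apply/measurable_EFinP; apply: measurable_funM => //.
  by apply: measurableT_comp => //; exact: measurable_funM.
have mfk : measurable_fun setT (fun y : R => f (y / k)).
  by apply: measurableT_comp mf _; exact: measurable_funM.
rewrite !integral_exponential//; last 2 first.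
- exact: emeasurable_funM.
- by move=> y; rewrite mule_ge0// lee_fin mulr_ge0 ?expR_ge0// ltW.
have mpdf := @measurable_exponential_pdf R 1.
have m1 : measurable_fun setT (fun y : R => f (y / k)%R * (exponential_pdf 1 y)%:E)%E.
  by apply: emeasurable_funM => //; exact/measurable_EFinP.
rewrite [RHS](@ge0_integral_affine k 0)//; last first.
- by move=> y; rewrite mule_ge0// lee_fin exponential_pdf_ge0.
have m2 : measurable_fun setT (fun y : R => f ((k * y + 0) / k)%R *
    (exponential_pdf 1 (k * y + 0))%:E)%E.
  exact: measurableT_comp m1 (measurable_affine k 0).
rewrite -ge0_integralZl//; last 2 first.
- by move=> y _; rewrite mule_ge0// lee_fin exponential_pdf_ge0.
- by rewrite lee_fin ltW.
apply: eq_integral => y _.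
rewrite addr0 [k * y / k]mulrAC divff ?gt_eqF// mul1r -muleA [RHS]muleCA.
congr (f _ * _)%E; rewrite -!EFinM; congr EFin; rewrite !pdf1E pmulr_rge0//.
case: ifPn => y0; last by rewrite !mulr0.
by rewrite -mulrA -expRD; congr (_ * expR _); ring.
Qed.

Lemma exponential_ge0 : nu `[0, +oo[%classic = 1%E.
Proof.
rewrite nuE// -[RHS](@integral_exponential_pdf R 1 ltr01) /exponential_prob.
rewrite integral_mkcond; apply: eq_integral => x _; rewrite patchE.
case: ifPn => //; rewrite notin_setE /= in_itv /= andbT => /negP.
by rewrite -ltNge => x0; rewrite lt0_exponential_pdf.
Qed.

Lemma exponential_set1 (a : R) : nu [set a] = 0%E.
Proof. by rewrite nuE// /exponential_prob integral_set1. Qed.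

End exponential_law.

(** * The arrival times of a unit-rate renewal process *)

Section tail_integral.
Context {R : realType}.
Local Notation leb := (@lebesgue_measure R).
Variable g : R -> R.
Hypotheses (mg : measurable_fun setT g) (g0 : forall z, 0 <= g z).
Hypothesis gfin : (\int[leb]_z (g z)%:E < +oo)%E.

Definition tail_integral (x : R) : R := fine (\int[leb]_(z in `[x, +oo[) (g z)%:E)%E.
Local Notation I := tail_integral.

Let mgE : measurable_fun setT (EFin \o g).
Proof. exact/measurable_EFinP. Qed.

Lemma tail_integralE x : (\int[leb]_(z in `[x, +oo[) (g z)%:E = (I x)%:E)%E.
Proof.
rewrite /tail_integral fineK// ge0_fin_numE; last first.
  by apply: integral_ge0 => z _; rewrite lee_fin.
apply: le_lt_trans gfin; apply: ge0_subset_integral => //.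
by move=> z _; rewrite lee_fin.
Qed.

Lemma tail_integral_ge0 x : 0 <= I x.
Proof.
by rewrite -lee_fin -tail_integralE; apply: integral_ge0 => z _; rewrite lee_fin.
Qed.

Lemma tail_integral_split x z : x <= z ->
  (\int[leb]_(y in `[x, z[) (g y)%:E = (I x - I z)%:E)%E.
Proof.
move=> xz; have := tail_integralE x.
rewrite (@itv_bndbnd_setU _ _ (BLeft x) (BLeft z) +oo%O)//.
rewrite ge0_integral_setU//=; last 3 first.
- exact: measurable_funTS.
- by move=> y _; rewrite lee_fin.
- apply/disj_set2P/seteqP; split => // y /=; rewrite !in_itv/= andbT => -[/andP[_ yz]].
  by rewrite leNgt yz.
rewrite tail_integralE EFinB => <-.
by rewrite addeK.
Qed.

Lemma measurable_tail_integral : measurable_fun setT I.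
Proof.
have mono : {homo I : x y / x <= y >-> y <= x}.
  move=> x y xy; rewrite -lee_fin -!tail_integralE.
  apply: ge0_subset_integral => //.
  - exact: measurable_funTS.
  - by move=> z _; rewrite lee_fin.
  - by apply: subset_itvr; rewrite bnd_simp.
by apply: nonincreasing_measurable => // x y _ _; exact: mono.
Qed.

(** Since [- g] is the derivative of the tail integral [I], this is the
    antiderivative of [g I^k]; for a merely measurable [g] the induction on [k]
    exchanges the two integrals instead. *)
Lemma integral_tail_integral_pow k x :
  (\int[leb]_(z in `[x, +oo[) (g z * I z ^+ k)%:E = (I x ^+ k.+1 / k.+1%:R)%:E)%E.
Proof.
elim: k x => [|k IH] x.
  under eq_integral do rewrite expr0 mulr1.
  by rewrite tail_integralE expr1 divr1.
have mI := measurable_tail_integral.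
have I0 := tail_integral_ge0.
pose h j z := g z * I z ^+ j.
have h0 j z : 0 <= h j z by rewrite mulr_ge0// exprn_ge0.
have mh j : measurable_fun setT (h j) by apply: measurable_funM => //; exact: measurable_funX.
have mhE j D : measurable_fun D (fun z => (h j z)%:E).
  by apply: measurable_funTS; exact/measurable_EFinP.
pose J := (\int[leb]_(z in `[x, +oo[) (h k.+1 z)%:E)%E.
have Jfin : J \is a fin_num.
  rewrite ge0_fin_numE; last by apply: integral_ge0 => z _; rewrite lee_fin.
  apply: (@le_lt_trans _ _ (\int[leb]_(z in `[x, +oo[) ((I x ^+ k.+1)%:E * (g z)%:E))%E).
    apply: ge0_le_integral => //.
    - by move=> z _; rewrite lee_fin.
    - exact: mhE.
    - by apply: emeasurable_funM => //; exact: measurable_funTS.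
    - move=> z; rewrite /= in_itv/= andbT => xz.
      rewrite -EFinM lee_fin /h mulrC ler_wpM2r// lerXn2r ?nnegrE//.
      rewrite -subr_ge0 -lee_fin -tail_integral_split//.
      by apply: integral_ge0 => y _; rewrite lee_fin.
  rewrite ge0_integralZl//; last 3 first.
  - exact: measurable_funTS.
  - by move=> z _; rewrite lee_fin.
  - by rewrite lee_fin exprn_ge0.
  by rewrite tail_integralE -EFinM ltry.
(* the integral of h k z * g y over x <= y < z, computed in both orders *)
pose f (u : R * R) := ((g u.1 * (x <= u.1)%R%:R * (h k u.2 * (u.1 < u.2)%R%:R))%:E).
have mf : measurable_fun setT f.
  apply/measurable_EFinP; apply: measurable_funM; apply: measurable_funM.
  - exact: measurableT_comp mg measurable_fst.
  - by apply: measurableT_comp => //; exact: measurable_fun_ler.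
  - exact: measurableT_comp (mh k) measurable_snd.
  - by apply: measurableT_comp => //; exact: measurable_fun_ltr.
have f0 u : (0 <= f u)%E.
  by rewrite /f lee_fin; apply: mulr_ge0; apply: mulr_ge0 => //; rewrite ler0n.
have := fubini_tonelli (m1 := leb) (m2 := leb) f mf f0.
have -> : (\int[leb]_y \int[leb]_z f (y, z) = J * (k.+1%:R^-1)%:E)%E.
  rewrite -ge0_integralZr; [|by []|exact: mhE|
    by move=> z _; rewrite lee_fin; exact: h0|by rewrite lee_fin].
  rewrite [RHS]integral_mkcond; apply: eq_integral => y _; rewrite patchE.
  case: ifPn; rewrite ?notin_setE ?inE /= in_itv/= andbT => xy; last first.
    rewrite integral0_eq// => z _; rewrite /f /=.
    by rewrite (negbTE (introN idP xy)) mulr0 mul0r.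
  rewrite -EFinM {1}/h -mulrA EFinM -IH -integral_itv_obnd_cbnd; last first.
    exact: (mhE k).
  rewrite -ge0_integralZl; [|by []|exact: mhE|
    by move=> z _; rewrite lee_fin; exact: h0|by rewrite lee_fin].
  rewrite [RHS]integral_mkcond; apply: eq_integral => z _.
  rewrite /f /= xy mulr1 patchE; case: ifPn; rewrite ?notin_setE ?inE /= in_itv/= andbT => yz.
    by rewrite yz mulr1.
  by rewrite (negbTE (introN idP yz)) !mulr0.
have -> : (\int[leb]_z \int[leb]_y f (y, z) =
    (I x)%:E * (I x ^+ k.+1 / k.+1%:R)%:E - J)%E.
  transitivity (\int[leb]_(z in `[x, +oo[) ((h k z)%:E * ((I x)%:E - (I z)%:E)))%E.
    rewrite [RHS]integral_mkcond; apply: eq_integral => z _; rewrite patchE.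
    case: ifPn; rewrite ?notin_setE ?inE /= in_itv/= andbT => xz; last first.
      rewrite integral0_eq// => y _; rewrite /f /=.
      case: (leP x y) => xy; last by rewrite mulr0 mul0r.
      case: (ltP y z) => yz; last by rewrite !mulr0.
      by case: xz; rewrite (le_trans xy)// ltW.
    rewrite -EFinB -tail_integral_split// -ge0_integralZl//; last 3 first.
    - exact: measurable_funTS.
    - by move=> y _; rewrite lee_fin.
    - by rewrite lee_fin.
    rewrite [RHS]integral_mkcond; apply: eq_integral => y _; rewrite patchE /f /=.
    case: ifPn; rewrite ?notin_setE ?inE /= in_itv/=.
      by move=> /andP[-> ->]; rewrite !mulr1 mulrC EFinM.
    by move=> /negP; rewrite negb_and => /orP[] /negbTE ->; rewrite !(mulr0, mul0r).
  rewrite -IH -ge0_integralZl; [|by []|exact: (mhE k)|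
    by move=> z _; rewrite lee_fin; exact: h0|by rewrite lee_fin].
  set B := (X in _ = (X - _)%E); set A := LHS.
  suff <- : (A + J = B)%E by rewrite addeK.
  rewrite /A /J /B -ge0_integralD; last 5 first.
  - by [].
  - move=> z; rewrite /= in_itv/= andbT => xz.
    apply: mule_ge0; first by rewrite lee_fin.
    rewrite -EFinB -tail_integral_split//.
    by apply: integral_ge0 => y _; rewrite lee_fin.
  - apply: emeasurable_funM; first exact: mhE.
    by apply: measurable_funTS; apply/measurable_EFinP; exact: measurable_funB.
  - by move=> z _; rewrite lee_fin.
  - exact: mhE.
  apply: eq_integral => z _; rewrite /h -EFinB -!EFinM -EFinD; congr EFin.
  by rewrite exprS; ring.
move=> /eqP; rewrite -/(h k.+1) -/J.
rewrite -[J](fineK Jfin) -!EFinM -EFinB eqe => /eqP JE; congr EFin.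
have n0 : k.+1%:R != 0 :> R by [].
apply: (@mulIf _ k.+2%:R) => //; rewrite divfK//.
rewrite -[k.+2%:R]natr1; set n : R := k.+1%:R in n0 JE *.
have e1 : fine J = n * (I x * (I x ^+ k.+1 / n) - fine J).
  by rewrite -JE mulrCA mulfV// mulr1.
have <- : n * (I x * (I x ^+ k.+1 / n)) = I x ^+ k.+2.
  by rewrite [RHS]exprS mulrCA [n * _]mulrC divfK.
by rewrite mulrDr mulr1 {2}e1 mulrBr; ring.
Qed.

End tail_integral.

Definition ssum (R : realType) (s : nat -> R) (k : nat) : R := \sum_(j < k) s j.

Lemma ssum_scons (R : realType) (x : R) (s : nat -> R) k :
  ssum (scons x s) k.+1 = x + ssum s k.
Proof. by rewrite /ssum big_ord_recl. Qed.

Lemma measurable_ssum (R : realType) k :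
  measurable_fun setT (fun s : seqR R => ssum s k).
Proof. by apply: measurable_sum => i; exact: measurable_coord. Qed.

Section renewal_window.
Context {R : realType} d (T : measurableType d) (P : probability T R).
Variables (Y : nat -> T -> R) (nu : probability R R).
Hypotheses (iidY : iid_law P Y nu).
Hypothesis nuE : forall A, measurable A -> nu A = exponential_prob 1 A.
Local Notation leb := (@lebesgue_measure R).

Section window.
Variables (g : R -> R) (M : R).
Hypotheses (mg : measurable_fun setT g) (g0 : forall z, 0 <= g z).
Hypotheses (gM : forall z, M <= z -> g z = 0).
Hypothesis gfin : (\int[leb]_z (g z)%:E < +oo)%E.
Local Notation I := (tail_integral g).

Definition window_prod (x : R) (k : nat) (s : seqR R) : R :=
  (M <= x + ssum s k.+1)%R%:R * \prod_(i < k) g (x + ssum s i.+1).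

Lemma window_prod_ge0 x k s : 0 <= window_prod x k s.
Proof. by rewrite mulr_ge0 ?ler0n// prodr_ge0. Qed.

Lemma measurable_window_prod x k : measurable_fun setT (window_prod x k).
Proof.
apply: measurable_funM.
  apply: measurableT_comp => //; apply: measurable_fun_ler => //.
  by apply: measurable_funD => //; exact: measurable_ssum.
apply: measurable_prod => i _; apply: measurableT_comp mg _.
by apply: measurable_funD => //; exact: measurable_ssum.
Qed.

Let mwE x k : measurable_fun setT (fun s : seqR R => (window_prod x k s)%:E).
Proof. by apply/measurable_EFinP; exact: measurable_window_prod. Qed.

Let window_prod_scons x k y s :
  window_prod x k.+1 (scons y s) = g (x + y) * window_prod (x + y) k s.
Proof.
rewrite /window_prod ssum_scons big_ord_recl /= ssum_scons.
rewrite [ssum s 0]big_ord0 addr0 addrA mulrCA; congr (_ * (_ * _)).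
by apply: eq_bigr => i _; rewrite ssum_scons addrA.
Qed.

(** Conditioning on the first arrival turns the formula for [k] arrivals into
    the one for [k.+1] arrivals; it is the antiderivative computed above. *)
Lemma integral_window_prod k x : x <= M ->
  (\int[P]_w (window_prod x k (fun i => Y i w))%:E =
   (expR (- (M - x)) * (I x ^+ k / k`!%:R))%:E)%E.
Proof.
elim: k x => [|k IH] x xM; have scons_int := iid_integral_scons iidY.
  rewrite (scons_int _ (mwE x 0%N)); last first.
    by move=> s; rewrite lee_fin window_prod_ge0.
  transitivity (\int[nu]_y (cst 1%E y * (M - x <= y)%R%:R%:E))%E.
    apply: eq_integral => y _; rewrite mul1e.
    under eq_integral.
      move=> w _; rewrite /window_prod big_ord0 mulr1 ssum_scons.
      by rewrite /ssum big_ord0 addr0 -lerBlDl; over.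
    by rewrite integral_cst//= probability_setT mule1.
  rewrite (exponential_shift nuE)//; last by rewrite subr_ge0.
  by rewrite integral_cst//= probability_setT !mule1 expr0 divr1 mulr1.
rewrite (scons_int _ (mwE x k.+1)); last first.
  by move=> s; rewrite lee_fin window_prod_ge0.
pose c := expR (- (M - x)) / k`!%:R.
pose h z := g z * I z ^+ k.
have I0 := tail_integral_ge0 mg g0 gfin.
have mI := measurable_tail_integral mg g0 gfin.
have mh : measurable_fun setT h by apply: measurable_funM => //; exact: measurable_funX.
have h0 z : 0 <= h z by rewrite mulr_ge0// exprn_ge0.
transitivity (\int[nu]_y (c * expR y * h (x + y))%:E)%E.
  apply: eq_integral => y _.
  under eq_integral do rewrite window_prod_scons EFinM.
  rewrite ge0_integralZl//; last 3 first.
  - exact: measurableT_comp (mwE _ _) (measurable_iid iidY).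
  - by move=> w _; rewrite lee_fin window_prod_ge0.
  - by rewrite lee_fin.
  have [xyM|Mxy] := leP (x + y) M; last first.
    by rewrite /h gM ?(ltW Mxy)// mul0e mul0r mulr0.
  rewrite IH// -EFinM; congr EFin; rewrite /c /h.
  by rewrite (_ : - (M - (x + y)) = - (M - x) + y) ?expRD; ring.
have mcomp : measurable_fun setT (fun y : R => (c * expR y * h (x + y))%:E).
  apply/measurable_EFinP; apply: measurable_funM; first exact: measurable_funM.
  by apply: measurableT_comp mh _; exact: measurable_funD.
have c0 : 0 <= c by rewrite divr_ge0 ?expR_ge0.
rewrite (integral_exponential nuE)//; last first.
  by move=> y; rewrite lee_fin mulr_ge0// mulr_ge0 ?expR_ge0.
pose H z : \bar R := (c%:E * ((h z)%:E * (x <= z)%R%:R%:E))%E.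
have mH : measurable_fun setT H.
  apply: emeasurable_funM => //; apply: emeasurable_funM; apply/measurable_EFinP => //.
  by apply: measurableT_comp => //; exact: measurable_fun_ler.
transitivity (\int[leb]_z H z)%E.
  rewrite [RHS](@ge0_integral_affine _ 1 x)//; last first.
    by move=> z; rewrite /H !mule_ge0// lee_fin.
  rewrite mul1e; apply: eq_integral => y _; rewrite /H -!EFinM; congr EFin.
  rewrite mul1r lerDr [y + x]addrC; have [y0|y0] := leP 0 y; last first.
    by rewrite lt0_exponential_pdf// !mulr0.
  rewrite exponential_pdfE// mul1r mulN1r expRN mulr1.
  by field; rewrite gt_eqF// expR_gt0.
have mhE : measurable_fun setT (fun z : R => ((h z)%:E * (x <= z)%R%:R%:E)%E).
  apply: emeasurable_funM; apply/measurable_EFinP => //.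
  by apply: measurableT_comp => //; exact: measurable_fun_ler.
rewrite /H ge0_integralZl//; last by move=> z _; rewrite mule_ge0// lee_fin.
transitivity (c%:E * \int[leb]_(z in `[x, +oo[) (g z * I z ^+ k)%:E)%E.
  congr (_ * _)%E; rewrite [RHS]integral_mkcond; apply: eq_integral => z _.
  rewrite patchE; case: ifPn; rewrite ?notin_setE ?inE /= in_itv/= andbT.
    by move=> ->; rewrite mule1.
  by move=> /negP/negbTE ->; rewrite mule0.
rewrite integral_tail_integral_pow// -EFinM; congr EFin; rewrite /c factS natrM.
by field; rewrite nat1r !pnatr_eq0 -lt0n fact_gt0.
Qed.

End window.

End renewal_window.

(** * The Laplace functional of the arrival times *)

Section laplace_exponential.
Context {R : realType}.

Definition expNe (x : \bar R) : R := if x is r%:E then expR (- r) else 0.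

Lemma expNe_ge0 x : 0 <= expNe x.
Proof. by case: x => [r| |] //=; exact: expR_ge0. Qed.

Lemma expNe_le1 x : (0 <= x)%E -> expNe x <= 1.
Proof. by case: x => [r| |] //=; rewrite lee_fin => r0; rewrite expR_le1 oppr_le0. Qed.

Lemma expNe_cvg (a : nat -> \bar R) l : (forall n, (0 <= a n)%E) ->
  a n @[n --> \oo] --> l -> expNe (a n) @[n --> \oo] --> expNe l.
Proof.
move=> a0 al.
have l0 : (0 <= l)%E.
  by rewrite -(cvg_lim _ al)//; apply: lime_ge; [exact: cvgP al|exact: nearW].
case: l => [r| |] in al l0 *; last by rewrite leeNy_eq in l0.
  have [afin ar] := (fine_cvgP _ _).1 al.
  have : expR (- fine (a n)) @[n --> \oo] --> expR (- r).
    by apply: continuous_cvg; [exact: continuous_expR|exact: cvgN].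
  apply: cvg_trans; apply: near_eq_cvg.
  near=> n; have : a n \is a fin_num by near: n.
  by case: (a n).
apply/cvgrPdist_le => e e0; near=> n.
rewrite sub0r normrN ger0_norm ?expNe_ge0//.
have : ((- ln e)%:E <= a n)%E.
  by near: n; move/cvgeyPge : al; exact.
case: (a n) => [s| |] //=; last by move=> _; exact: ltW.
by rewrite lee_fin => es; rewrite -[leRHS](@lnK _ e)// ler_expR lerNl.
Unshelve. all: by end_near. Qed.

Lemma expNe_nneseries_cvg (a : nat -> R) : (forall i, 0 <= a i) ->
  expR (- \sum_(i < n) a i) @[n --> \oo] --> expNe (\sum_(i <oo) (a i)%:E)%E.
Proof.
move=> a0; have : (\sum_(0 <= i < n) (a i)%:E)%E @[n --> \oo] -->
    (\sum_(i <oo) (a i)%:E)%E.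
  by apply: is_cvg_nneseries => n _ _; rewrite lee_fin.
move=> /expNe_cvg; have h n : (0 <= \sum_(0 <= i < n) (a i)%:E)%E.
  by apply: sume_ge0 => i _; rewrite lee_fin.
move=> /(_ h); apply: cvg_trans; apply: near_eq_cvg.
by near=> n; rewrite big_mkord sumEFin.
Unshelve. all: by end_near. Qed.

End laplace_exponential.

Section measurable_point_series.
Context {R : realType}.

Definition arrival_series (f : R -> R) (s : nat -> R) : \bar R :=
  (\sum_(i <oo) (f (ssum s i.+1))%:E)%E.

Variable f : R -> R.
Hypotheses (mf : measurable_fun setT f) (f0 : forall x, 0 <= f x).

Lemma measurable_arrival_series :
  measurable_fun setT (arrival_series f : seqR R -> \bar R).
Proof.
apply: ge0_emeasurable_sum => [i s _ _|i _]; first by rewrite lee_fin.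
by apply/measurable_EFinP; apply: measurableT_comp mf _; exact: measurable_ssum.
Qed.

Lemma measurable_expNe_arrival_series :
  measurable_fun setT (fun s : seqR R => expNe (arrival_series f s)).
Proof.
apply: (@measurable_fun_cvg _ (seqR R) R setT (fun n (s : seqR R) =>
  expR (- \sum_(i < n) f (ssum s i.+1)))).
  move=> n; apply: measurableT_comp => //; apply: measurableT_comp => //.
  apply: measurable_sum => i; apply: measurableT_comp mf _.
  exact: measurable_ssum.
by move=> s _; exact: expNe_nneseries_cvg.
Qed.

End measurable_point_series.

Section regular_arrivals.
Context {R : realType}.

Definition regular_arrivals (s : nat -> R) : Prop :=
  (forall i, 0 < s i) /\ forall M : nat, exists k, M%:R <= ssum s k.+1.

Lemma ssumS (s : nat -> R) k : ssum s k.+1 = ssum s k + s k.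
Proof. by rewrite /ssum big_ord_recr. Qed.

Lemma arrival_lt (s : nat -> R) i j : (forall i, 0 < s i) -> (i < j)%N ->
  ssum s i < ssum s j.
Proof.
move=> s0; elim: j => // j IH; rewrite ltnS leq_eqVlt => /predU1P[->|/IH ij].
  by rewrite ssumS ltrDl.
by rewrite (lt_trans ij)// ssumS ltrDl.
Qed.

Lemma arrival_le (s : nat -> R) i j : (forall i, 0 < s i) -> (i <= j)%N ->
  ssum s i <= ssum s j.
Proof.
by move=> s0; rewrite leq_eqVlt => /predU1P[->//|/(arrival_lt s0)/ltW].
Qed.

Lemma arrival_gt0 (s : nat -> R) i : (forall i, 0 < s i) -> 0 < ssum s i.+1.
Proof.
by move=> s0; have := arrival_lt s0 (ltn0Sn i); rewrite {1}/ssum big_ord0.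
Qed.

(** The number of arrivals before [M] is the only index of a non-vanishing
    term, so the sum over that number of arrivals is a single product. *)
Lemma sum_window_prod (g : R -> R) (M : R) (s : seqR R) k :
  (forall z, 0 <= g z) -> (forall z, M <= z -> g z = 0) ->
  M <= ssum s k.+1 -> (forall i, (i < k)%N -> ssum s i.+1 < M) ->
  (\sum_(j <oo) (window_prod g M 0 j s)%:E = (\prod_(i < k) g (ssum s i.+1))%:E)%E.
Proof.
move=> g0 gM Mk kM; rewrite (@nneseriesD1 _ _ k)//; last first.
  by move=> j _; rewrite lee_fin window_prod_ge0.
rewrite eseries0 ?adde0.
  by rewrite /window_prod add0r Mk mul1r; under eq_bigr do rewrite add0r.
move=> j _ /= /eqP jk; congr EFin; rewrite /window_prod add0r.
have [jk'|kj] := ltnP j k; first by rewrite leNgt (kM _ jk') mul0r.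
have {jk kj}kj : (k < j)%N by rewrite ltn_neqAle kj eq_sym; apply/andP; split => //; exact/eqP.
by rewrite (bigD1 (Ordinal kj))//= add0r gM// mul0r mulr0.
Qed.

Lemma sum_window_prod0 (g : R -> R) (M : R) (s : seqR R) :
  (forall k, ssum s k.+1 < M) ->
  (\sum_(j <oo) (window_prod g M 0 j s)%:E = 0)%E.
Proof.
move=> sM; rewrite eseries0// => j _ _.
by rewrite /window_prod add0r leNgt sM mul0r.
Qed.

Lemma first_arrival_after (M : R) (s : nat -> R) : (exists k, M <= ssum s k.+1) ->
  exists k, M <= ssum s k.+1 /\ forall i, (i < k)%N -> ssum s i.+1 < M.
Proof.
move=> ex; exists (ex_minn ex); case: ex_minnP => k Mk kmin; split => // i ik.
by rewrite ltNge; apply/negP => /kmin; rewrite leqNgt ik.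
Qed.

End regular_arrivals.

Section arrival_laplace.
Context {R : realType} d (T : measurableType d) (P : probability T R).
Variables (Y : nat -> T -> R) (nu : probability R R).
Hypotheses (iidY : iid_law P Y nu).
Hypothesis nuE : forall A, measurable A -> nu A = exponential_prob 1 A.
Local Notation leb := (@lebesgue_measure R).

Lemma poisson_series (M a : R) :
  (\sum_(k <oo) (expR (- M) * (a ^+ k / k`!%:R))%:E = (expR (- M) * expR a)%:E)%E.
Proof.
apply/cvg_lim => //; under eq_fun do rewrite big_mkord sumEFin -mulr_sumr.
apply/cvg_EFin; first by apply: nearW.
rewrite /comp/=; apply: cvgM; first exact: cvg_cst.
have h : series (exp_coeff a) n @[n --> \oo] --> expR a.
  exact: is_cvg_series_exp_coeff.
apply: cvg_trans h; apply: near_eq_cvg; near=> n.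
by rewrite /series/= big_mkord; apply: eq_bigr.
Unshelve. all: by end_near. Qed.

Lemma ae_pos_iid : {ae P, forall w, forall i, 0 < Y i w}.
Proof.
apply: ae_foralln => i.
have mY := iidY.1 i.
have mpos : measurable (Y i @^-1` `]0, +oo[%classic).
  by rewrite -[X in measurable X]setTI; exact: mY.
exists (~` (Y i @^-1` `]0, +oo[%classic)); split.
- exact: measurableC.
- rewrite [LHS]probability_setC//.
  have := iid_law_seq iidY (s := [:: i]) isT (fun=> measurable_itv `]0, +oo[).
  rewrite big_seq1 => h.
  have -> : Y i @^-1` `]0, +oo[%classic =
      [set w | forall j, j \in [:: i] -> `]0, +oo[%classic (Y j w)].
    apply/seteqP; split => w /= h'; last by apply: h'; rewrite mem_head.
    by move=> j; rewrite mem_seq1 => /eqP ->.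
  rewrite h; have := exponential_ge0 nuE.
  rewrite -(@setU1itv _ _ +oo%O (0 : R) false)// measureU//; last first.
    by apply/seteqP; split => // x /= [->]; rewrite in_itv/= ltxx.
  move=> nu1; have : (0 + nu `]0%R, +oo[%classic = 1)%E.
    by rewrite -[X in (X + _)%E](exponential_set1 nuE 0); exact: nu1.
  by rewrite add0e => ->; rewrite subee.
by move=> w /=; rewrite in_itv/= andbT.
Qed.

Lemma integral_sum_window_prod (g : R -> R) (M : R) :
  measurable_fun setT g -> (forall z, 0 <= g z) -> (forall z, M <= z -> g z = 0) ->
  (\int[leb]_z (g z)%:E < +oo)%E -> 0 <= M ->
  (\int[P]_w \sum_(j <oo) (window_prod g M 0 j (fun i => Y i w))%:E =
   (expR (- M) * expR (tail_integral g 0))%:E)%E.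
Proof.
move=> mg g0 gM gfin M0; rewrite integral_nneseries//; last 2 first.
- move=> j; apply/measurable_EFinP.
  exact: measurableT_comp (measurable_window_prod _ mg _ _) (measurable_iid iidY).
- by move=> j w _; rewrite lee_fin window_prod_ge0.
rewrite -poisson_series; apply: eq_eseriesr => j _.
by rewrite (integral_window_prod iidY nuE mg g0 gM gfin)// subr0.
Qed.

End arrival_laplace.

Lemma cvg_EFinr {R : realType} (u : nat -> R) (l : R) :
  u n @[n --> \oo] --> l -> (u n)%:E @[n --> \oo] --> l%:E.
Proof. by move=> ul; apply/fine_cvgP; split => //; exact: nearW. Qed.

Lemma cvg_integral_bounded {R : realType} d (T : measurableType d)
    (P : probability T R) (u : nat -> T -> R) (v : T -> R) (C : R) :
  (forall n, measurable_fun setT (u n)) -> measurable_fun setT v ->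
  (forall n w, `|u n w| <= C) ->
  {ae P, forall w, u n w @[n --> \oo] --> v w} ->
  (\int[P]_w (u n w)%:E @[n --> \oo] --> \int[P]_w (v w)%:E)%E.
Proof.
move=> mu mv uC uv.
have [] := @dominated_convergence _ _ _ P setT measurableT
  (fun n w => (u n w)%:E) (fun w => (v w)%:E) (cst C%:E).
- by move=> n; exact/measurable_EFinP.
- exact/measurable_EFinP.
- by apply: filterS uv => w uvw _; exact: cvg_EFinr.
- exact: finite_measure_integrable_cst.
- by apply: aeW => w n _; rewrite lee_fin.
by [].
Qed.

Section arrival_series_limit.
Context {R : realType}.

Lemma arrival_series_ge0 (f : R -> R) s : (forall z, 0 <= f z) ->
  (0 <= arrival_series f s)%E.
Proof. by move=> f0; apply: nneseries_ge0 => i _ _; rewrite lee_fin. Qed.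

Lemma arrival_seriesE (f : R -> R) s :
  measurable_fun setT f -> (forall z, 0 <= f z) ->
  arrival_series f s =
  (\int[mseries (fun i => \d_(ssum s i.+1)) 0]_z (f z)%:E)%E.
Proof.
move=> mf f0; rewrite ge0_integral_measure_series//; last 2 first.
- by move=> z _; rewrite lee_fin.
- exact/measurable_EFinP.
apply: eq_eseriesr => i _; rewrite integral_dirac//; last exact/measurable_EFinP.
by rewrite diracT mul1e.
Qed.

Lemma arrival_series_cvg (h : nat -> R -> R) (f : R -> R) s :
  (forall n, measurable_fun setT (h n)) -> measurable_fun setT f ->
  (forall n z, 0 <= h n z) -> (forall z, 0 <= f z) ->
  (forall z m n, (m <= n)%N -> h m z <= h n z) ->
  (forall z, h n z @[n --> \oo] --> f z) ->
  arrival_series (h n) s @[n --> \oo] --> arrival_series f s.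
Proof.
move=> mh mf h0 f0 hh hf; rewrite arrival_seriesE//.
under eq_fun do rewrite arrival_seriesE//.
have -> : (fun z => (f z)%:E) = (fun z => limn (fun n => (h n z)%:E)).
  apply/funext => z; apply/esym/cvg_lim => //.
  exact: cvg_EFinr.
apply: cvg_monotone_convergence => //.
- by move=> n; exact/measurable_EFinP.
- by move=> n z _; rewrite lee_fin.
- by move=> z _ m n mn; rewrite lee_fin hh.
Qed.

End arrival_series_limit.

Section arrival_laplace.
Context {R : realType} d (T : measurableType d) (P : probability T R).
Variables (Y : nat -> T -> R) (nu : probability R R).
Hypotheses (iidY : iid_law P Y nu).
Hypothesis nuE : forall A, measurable A -> nu A = exponential_prob 1 A.
Local Notation leb := (@lebesgue_measure R).

(** For the indicator of the numbers below [M], the sum over the numbers of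
    arrivals before [M] has expectation 1, so some arrival lies beyond [M] almost
    surely. *)
Lemma ae_regular_arrivals : {ae P, forall w, regular_arrivals (fun i => Y i w)}.
Proof.
suff h (M : nat) : {ae P, forall w, exists k, M%:R <= ssum (fun i => Y i w) k.+1}.
  by apply: filterS2 (ae_pos_iid iidY nuE) (ae_foralln h) => w; split.
pose g (z : R) : R := \1_(`[0, M%:R[%classic : set R) z.
have mg : measurable_fun setT g by exact: measurable_indic.
have g0 z : 0 <= g z by rewrite /g indicE ler0n.
have gM z : M%:R <= z -> g z = 0.
  move=> Mz; rewrite /g indicE memNset//= in_itv/= => /andP[_].
  by rewrite ltNge Mz.
have gint : (\int[leb]_z (g z)%:E = M%:R%:E)%E.
  rewrite integral_indic//= setIT lebesgue_measure_itv/= lte_fin ltr0n.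
  by case: M {g mg g0 gM} => [//|M]; rewrite /= sube0.
have gfin : (\int[leb]_z (g z)%:E < +oo)%E by rewrite gint ltry.
have I0 : tail_integral g 0 = M%:R.
  apply: EFin_inj; rewrite -(tail_integralE mg g0 gfin) -gint integral_mkcond.
  apply: eq_integral => z _; rewrite patchE; case: ifPn => //.
  rewrite notin_setE/= in_itv/= andbT => /negP z0; rewrite /g indicE memNset//=.
  by rewrite in_itv/= (negbTE z0).
have := integral_sum_window_prod iidY nuE mg g0 gM gfin (ler0n _ M).
rewrite I0 -expRD addNr expR0.
pose A := [set w | exists k, M%:R <= ssum (fun i => Y i w) k.+1].
have mA : measurable A.
  rewrite (_ : A = \bigcup_k [set w | M%:R <= ssum (fun i => Y i w) k.+1]); last first.
    by apply/seteqP; split => [w [k ?]|w [k _ ?]]; exists k.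
  apply: bigcupT_measurable => k; rewrite -[X in measurable X]setTI.
  apply: measurable_fun_ler => //.
  exact: measurableT_comp (measurable_ssum k.+1) (measurable_iid iidY).
move=> sum1; have PA : (1 <= P A)%E.
  have -> : P A = (\int[P]_w (\1_A w)%:E)%E by rewrite integral_indic// setIT.
  rewrite -sum1; apply: ge0_le_integral => //.
  - by move=> w _; apply: nneseries_ge0 => j _ _; rewrite lee_fin window_prod_ge0.
  - apply: ge0_emeasurable_sum => [j w _ _|j _]; first by rewrite lee_fin window_prod_ge0.
    apply/measurable_EFinP.
    exact: measurableT_comp (measurable_window_prod _ mg _ _) (measurable_iid iidY).
  - by apply/measurable_EFinP; exact: measurable_indic.
  move=> w _; rewrite indicE; have [|/negP] := boolP (w \in A).
    rewrite inE => /first_arrival_after[k [Mk kM]].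
    rewrite (sum_window_prod g0 gM Mk kM) lee_fin; apply: prodr_ile1 => i _.
    by rewrite g0 /g indicE lern1 leq_b1.
  rewrite inE => nA; rewrite sum_window_prod0// => k; rewrite ltNge.
  by apply/negP => kM; apply: nA; exists k.
exists (~` A); split => //.
- exact: measurableC.
- rewrite [LHS]probability_setC//.
  have -> : P A = 1%E by apply/le_anti; rewrite PA andbT; exact: probability_le1.
  by rewrite subee.
Qed.

Section laplace_functional.
Variable f : R -> R.
Hypotheses (mf : measurable_fun setT f) (f0 : forall z, 0 <= f z).

Let mexp : measurable_fun setT (fun z : R => 1 - expR (- f z)).
Proof.
apply: measurable_funB => //; apply: measurableT_comp => //.
exact: measurableT_comp.
Qed.

Let exp0 z : 0 <= 1 - expR (- f z).
Proof. by rewrite subr_ge0 expR_le1 oppr_le0. Qed.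

Lemma arrival_laplace_bounded (M : R) : 0 <= M -> (forall z, M <= z -> f z = 0) ->
  (\int[P]_w (expNe (arrival_series f (fun i => Y i w)))%:E =
   (expNe (\int[leb]_(z in `[0%R, +oo[) (1 - expR (- f z))%:E))%:E)%E.
Proof.
move=> M0 fM.
pose g (z : R) : R := expR (- f z) * \1_(`[0, M[%classic : set R) z.
have m1 : measurable_fun setT (\1_(`[0, M[%classic : set R) : R -> R).
  exact: measurable_indic.
have mg : measurable_fun setT g.
  by apply: measurable_funM => //; do 2 apply: measurableT_comp => //.
have g0 z : 0 <= g z by rewrite mulr_ge0// ?expR_ge0// indicE ler0n.
have gM z : M <= z -> g z = 0.
  move=> Mz; rewrite /g indicE memNset ?mulr0//= in_itv/= => /andP[_].
  by rewrite ltNge Mz.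
have ind_int : (\int[leb]_z (\1_(`[0, M[%classic : set R) z)%:E = M%:E)%E.
  rewrite integral_indic//= setIT lebesgue_measure_itv/= lte_fin.
  by case: ltgtP M0 => //= [_ _|<- _]; rewrite ?sube0.
have gle z : g z <= \1_(`[0, M[%classic : set R) z.
  by rewrite ler_piMl ?indicE ?ler0n// expR_le1 oppr_le0.
have gfin : (\int[leb]_z (g z)%:E < +oo)%E.
  apply: (@le_lt_trans _ _ M%:E); last by rewrite ltry.
  rewrite -ind_int; apply: ge0_le_integral => //.
  - by move=> z _; rewrite lee_fin.
  - exact/measurable_EFinP.
  - exact/measurable_EFinP.
  - by move=> z _; rewrite lee_fin.
have -> : (\int[leb]_(z in `[0%R, +oo[) (1 - expR (- f z))%:E =
    (M - tail_integral g 0)%:E)%E.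
  rewrite EFinB -(tail_integralE mg g0 gfin) -ind_int.
  have mexpE (D : set R) : measurable_fun D (fun z : R => (1 - expR (- f z))%:E).
    by apply: measurable_funTS; exact/measurable_EFinP.
  have mgE (D : set R) : measurable_fun D (fun z : R => (g z)%:E).
    by apply: measurable_funTS; exact/measurable_EFinP.
  set B := (\int[leb]_(z in `[0%R, +oo[) (g z)%:E)%E; set A := LHS.
  have Bfin : B \is a fin_num by rewrite /B (tail_integralE mg g0 gfin).
  suff <- : (A + B = \int[leb]_z (\1_(`[0, M[%classic : set R) z)%:E)%E.
    by rewrite addeK.
  rewrite /A /B -ge0_integralD; last 5 first.
  - by [].
  - by move=> z _; rewrite lee_fin.
  - exact: mexpE.
  - by move=> z _; rewrite lee_fin.
  - exact: mgE.
  rewrite integral_mkcond; apply: eq_integral => z _; rewrite patchE.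
  case: ifPn; rewrite ?notin_setE ?inE /= in_itv/= andbT => z0; last first.
    by rewrite indicE memNset//= in_itv/= (negbTE (introN idP z0)).
  rewrite -EFinD; congr EFin; rewrite /g indicE.
  have [zM|Mz] := ltP z M.
    by rewrite mem_set ?mulr1 ?subrK//= in_itv/= z0 zM.
  rewrite memNset ?mulr0 ?addr0 ?fM ?oppr0 ?expR0 ?subrr//= in_itv/= => /andP[_].
  by rewrite ltNge Mz.
have -> : expNe (M - tail_integral g 0)%:E = expR (- M) * expR (tail_integral g 0).
  by rewrite -expRD /= opprB addrC.
rewrite -(integral_sum_window_prod iidY nuE mg g0 gM gfin M0).
apply: ae_eq_integral => //.
- apply/measurable_EFinP.
  exact: measurableT_comp (measurable_expNe_arrival_series mf f0) (measurable_iid iidY).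
- apply: ge0_emeasurable_sum => [j w _ _|j _]; first by rewrite lee_fin window_prod_ge0.
  apply/measurable_EFinP.
  exact: measurableT_comp (measurable_window_prod _ mg _ _) (measurable_iid iidY).
apply: filterS ae_regular_arrivals => w [pos unb] _.
set s := (fun i => Y i w) in pos unb *.
have [k [Mk kM]] : exists k, M <= ssum s k.+1 /\
    forall i, (i < k)%N -> ssum s i.+1 < M.
  apply: first_arrival_after; have [k Mk] := unb (Num.bound M).
  by exists k; rewrite (le_trans _ Mk)// ltW// archi_boundP.
rewrite (sum_window_prod g0 gM Mk kM); congr EFin.
rewrite /arrival_series (nneseries_split 0 k)//; last by move=> i _; rewrite lee_fin.
rewrite add0n eseries0 ?adde0; last first.
  move=> i ki _; rewrite fM// (le_trans Mk)// arrival_le//.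
rewrite big_mkord sumEFin /= -sumrN expR_sum; apply: eq_bigr => i _.
rewrite /g indicE mem_set ?mulr1//= in_itv/= kM// andbT.
by rewrite ltW// arrival_gt0.
Qed.

End laplace_functional.

(** This is the Laplace functional of a Poisson process with Lebesgue intensity
    on the half-line. *)
Lemma arrival_laplace (f : R -> R) :
  measurable_fun setT f -> (forall z, 0 <= f z) ->
  (\int[P]_w (expNe (arrival_series f (fun i => Y i w)))%:E =
   (expNe (\int[leb]_(z in `[0%R, +oo[) (1 - expR (- f z))%:E))%:E)%E.
Proof.
move=> mf f0.
pose h (n : nat) z := if z < n%:R then f z else 0.
have h0 n z : 0 <= h n z by rewrite /h; case: ifP.
have mh n : measurable_fun setT (h n).
  by apply: measurable_fun_ifT => //; exact: measurable_fun_ltr.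
have hh z m n : (m <= n)%N -> h m z <= h n z.
  move=> mn; rewrite /h; case: ifPn => [zm|_]; last by case: ifP.
  by rewrite (lt_le_trans zm)// ler_nat.
have hf z : h n z @[n --> \oo] --> f z.
  apply: cvg_near_cst; near=> n; rewrite /h ifT//.
  by near: n; exact: nbhs_infty_gtr.
have bounded n := arrival_laplace_bounded (mh n) (h0 n) (ler0n R n).
have {}bounded n := bounded n (fun z zn => ifF _ _ (le_gtF zn)).
have lapl : (\int[P]_w (expNe (arrival_series (h n) (fun i => Y i w)))%:E
    @[n --> \oo] --> \int[P]_w (expNe (arrival_series f (fun i => Y i w)))%:E)%E.
  apply: (cvg_integral_bounded (C := 1)).
  - move=> n; exact: measurableT_comp
      (measurable_expNe_arrival_series (mh n) (h0 n)) (measurable_iid iidY).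
  - exact: measurableT_comp (measurable_expNe_arrival_series mf f0) (measurable_iid iidY).
  - by move=> n w; rewrite ger0_norm ?expNe_ge0// expNe_le1// arrival_series_ge0.
  apply: aeW => w; apply: expNe_cvg; first by move=> n; exact: arrival_series_ge0.
  exact: arrival_series_cvg.
have lapr : (expNe (\int[leb]_(z in `[0%R, +oo[) (1 - expR (- h n z))%:E))%:E%E
    @[n --> \oo] --> (expNe (\int[leb]_(z in `[0%R, +oo[) (1 - expR (- f z))%:E))%:E%E.
  apply: cvg_EFinr.
  apply: expNe_cvg => [n|].
    by apply: integral_ge0 => z _; rewrite lee_fin subr_ge0 expR_le1 oppr_le0.
  have -> : (\int[leb]_(z in `[0%R, +oo[) (1 - expR (- f z))%:E =
      \int[leb]_(z in `[0%R, +oo[) limn (fun n => (1 - expR (- h n z))%:E))%E.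
    apply: eq_integral => z _; apply/esym/cvg_lim => //.
    apply: cvg_EFinr.
    apply: cvgB; first exact: cvg_cst.
    by apply: continuous_cvg; [exact: continuous_expR|apply: cvgN; exact: hf].
  apply: cvg_monotone_convergence => //.
  - move=> n; apply: measurable_funTS; apply/measurable_EFinP.
    apply: measurable_funB => //; do 2 apply: measurableT_comp => //.
    exact: mh.
  - by move=> n z _; rewrite lee_fin subr_ge0 expR_le1 oppr_le0.
  - by move=> z _ m n mn; rewrite lee_fin lerB// ler_expR lerN2 hh.
by move: lapl; rewrite (funext bounded) => /(cvg_unique _)/(_ lapr); exact.
Unshelve. all: by end_near. Qed.

End arrival_laplace.

(** * Expectations of bounded measurable functions *)

Section bounded_measurable.
Context {R : realType} d (T : measurableType d).
Implicit Types f g : T -> R.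

Definition bounded_measurable f :=
  measurable_fun setT f /\ exists C, forall w, `|f w| <= C.

Lemma bounded_measurable_cst (c : R) : bounded_measurable (fun=> c).
Proof. by split => //; exists `|c|. Qed.

Lemma bounded_measurableD f g : bounded_measurable f -> bounded_measurable g ->
  bounded_measurable (fun w => f w + g w).
Proof.
move=> [mf [C fC]] [mg [D gD]]; split; first exact: measurable_funD.
by exists (C + D) => w; rewrite (le_trans (ler_normD _ _))// lerD.
Qed.

Lemma bounded_measurableN f : bounded_measurable f -> bounded_measurable (fun w => - f w).
Proof.
move=> [mf [C fC]]; split; first exact: measurableT_comp.
by exists C => w; rewrite normrN.
Qed.

Lemma bounded_measurableB f g : bounded_measurable f -> bounded_measurable g ->
  bounded_measurable (fun w => f w - g w).
Proof. by move=> bf bg; apply: bounded_measurableD => //; exact: bounded_measurableN. Qed.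

Lemma bounded_measurableM f g : bounded_measurable f -> bounded_measurable g ->
  bounded_measurable (fun w => f w * g w).
Proof.
move=> [mf [C fC]] [mg [D gD]]; split; first exact: measurable_funM.
by exists (C * D) => w; rewrite normrM ler_pM.
Qed.

Lemma bounded_measurable_indic (A : set T) : measurable A ->
  bounded_measurable (\1_A : T -> R).
Proof.
move=> mA; split; first exact: measurable_indic.
by exists 1 => w; rewrite indicE ger0_norm ?ler0n// lern1 leq_b1.
Qed.

Lemma bounded_measurable_sum (I : Type) (s : seq I) (F : I -> T -> R) :
  (forall i, bounded_measurable (F i)) ->
  bounded_measurable (fun w => \sum_(i <- s) F i w).
Proof.
move=> bF; elim: s => [|i s IH].
  by under eq_fun do rewrite big_nil; exact: bounded_measurable_cst.
by under eq_fun do rewrite big_cons; exact: bounded_measurableD.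
Qed.

Lemma bounded_measurable_prod (I : Type) (s : seq I) (F : I -> T -> R) :
  (forall i, bounded_measurable (F i)) ->
  bounded_measurable (fun w => \prod_(i <- s) F i w).
Proof.
move=> bF; elim: s => [|i s IH].
  by under eq_fun do rewrite big_nil; exact: bounded_measurable_cst.
by under eq_fun do rewrite big_cons; exact: bounded_measurableM.
Qed.

Lemma bounded_measurable_le1 f : measurable_fun setT f ->
  (forall w, 0 <= f w <= 1) -> bounded_measurable f.
Proof.
by move=> mf f01; split => //; exists 1 => w; have /andP[? ?] := f01 w; rewrite ger0_norm.
Qed.

Variable P : probability T R.

Local Notation E f := (\int[P]_w f w)%R.

Lemma integrable_bounded f : bounded_measurable f -> P.-integrable setT (EFin \o f).
Proof.
move=> [mf [C fC]]; apply: measurable_bounded_integrable => //.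
  by rewrite (le_lt_trans (probability_le1 _ measurableT))// ltry.
by exists C; split; [exact: num_real|move=> x Cx w _; exact: le_trans (fC w) (ltW Cx)].
Qed.

Lemma expect_cst (c : R) : E (fun=> c) = c.
Proof. by rewrite Rintegral_cst// [X in fine X](probability_setT P) mulr1. Qed.

Lemma expectD f g : bounded_measurable f -> bounded_measurable g ->
  E (fun w => f w + g w) = E f + E g.
Proof. by move=> bf bg; rewrite RintegralD//; exact: integrable_bounded. Qed.

Lemma expectB f g : bounded_measurable f -> bounded_measurable g ->
  E (fun w => f w - g w) = E f - E g.
Proof. by move=> bf bg; rewrite RintegralB//; exact: integrable_bounded. Qed.

Lemma expectZl c f : bounded_measurable f -> E (fun w => c * f w) = c * E f.
Proof. by move=> bf; rewrite RintegralZl//; exact: integrable_bounded. Qed.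

Lemma expect_sum (I : Type) (s : seq I) (F : I -> T -> R) :
  (forall i, bounded_measurable (F i)) ->
  E (fun w => \sum_(i <- s) F i w) = \sum_(i <- s) E (F i).
Proof.
move=> bF; elim: s => [|i s IH].
  by rewrite big_nil -[RHS](expect_cst 0); apply: eq_Rintegral => w _; rewrite big_nil.
rewrite big_cons -IH -expectD//; last exact: bounded_measurable_sum.
by apply: eq_Rintegral => w _; rewrite big_cons.
Qed.

Lemma expect_le f g : bounded_measurable f -> bounded_measurable g ->
  (forall w, f w <= g w) -> E f <= E g.
Proof. by move=> bf bg fg; apply: le_Rintegral => //; exact: integrable_bounded. Qed.

Lemma expect_indic (A : set T) : measurable A -> E (\1_A : T -> R) = fine (P A).
Proof. by move=> mA; rewrite /Rintegral integral_indic// setIT. Qed.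

Lemma EFin_expect f : bounded_measurable f -> ((E f)%:E = \int[P]_w (f w)%:E)%E.
Proof.
by move=> /integrable_bounded bf; rewrite /Rintegral fineK// integrable_fin_num.
Qed.

Lemma expect_ae f g : bounded_measurable f -> bounded_measurable g ->
  {ae P, forall w, f w = g w} -> E f = E g.
Proof.
move=> bf bg fg; congr fine; apply: ae_eq_integral => //.
- by apply/measurable_EFinP; case: bf.
- by apply/measurable_EFinP; case: bg.
- by apply: filterS fg => w -> _.
Qed.

Lemma expect_cvg (u : nat -> T -> R) (v : T -> R) (C : R) :
  (forall n, measurable_fun setT (u n)) -> bounded_measurable v ->
  (forall n w, `|u n w| <= C) ->
  {ae P, forall w, u n w @[n --> \oo] --> v w} ->
  E (u n) @[n --> \oo] --> E v.
Proof.
move=> mu bv uC uv; have := cvg_integral_bounded mu bv.1 uC uv.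
by rewrite -EFin_expect// => /fine_cvg.
Qed.

End bounded_measurable.

(** * Counts of arrivals *)

Section laplace_counts.
Context {R : realType}.

Definition nat_valued (x : \bar R) : Prop := x = +oo%E \/ exists k : nat, x = k%:R%:E.

Definition expNen (n : nat) (x : \bar R) : R := expNe (n%:R%:E * x)%E.

Lemma expNen_nat n k : expNen n k%:R%:E = expR (- (n * k)%:R).
Proof. by rewrite /expNen -EFinM -natrM. Qed.

Lemma expNe0 (x : \bar R) : expNen 0 x = 1.
Proof. by rewrite /expNen mul0e /= oppr0 expR0. Qed.

Lemma expNeSy n : expNen n.+1 +oo%E = 0.
Proof. by rewrite /expNen gt0_muley// lte_fin. Qed.

Lemma nat_valued_ge0 x : nat_valued x -> (0 <= x)%E.
Proof. by move=> [->|[k ->]]; rewrite ?leey// lee_fin. Qed.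

Lemma expNeD (x y : \bar R) : (0 <= x)%E -> (0 <= y)%E ->
  expNe (x + y)%E = expNe x * expNe y.
Proof.
case: x => [x| |] //; case: y => [y| |] //= _ _; rewrite ?mul0r ?mulr0//.
by rewrite opprD expRD.
Qed.

Lemma measurable_expNe : measurable_fun setT (@expNe R).
Proof.
have -> : @expNe R = (fun x => expR (- fine x) * (1 - \1_([set +oo; -oo]%E) x)).
  apply/funext => -[r| |]; rewrite indicE /=.
  - by rewrite memNset ?subr0 ?mulr1// => -[].
  - by rewrite mem_set ?subrr ?mulr0//; left.
  - by rewrite mem_set ?subrr ?mulr0//; right.
apply: measurable_funM.
  by apply: measurableT_comp => //; apply: measurableT_comp.
apply: measurable_funB => //; apply: measurable_indic.
by apply: measurableU; exact: emeasurable_set1.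
Qed.

Lemma measurable_expNen n : measurable_fun setT (expNen n).
Proof.
apply: measurableT_comp measurable_expNe _.
exact: measurable_funeM.
Qed.

Lemma expNen_itv n x : (0 <= x)%E -> 0 <= expNen n x <= 1.
Proof.
by move=> x0; rewrite expNe_ge0 expNe_le1// mule_ge0// lee_fin.
Qed.

Section uniqueness.
Context d1 d2 (T1 : measurableType d1) (T2 : measurableType d2)
  (P1 : probability T1 R) (P2 : probability T2 R)
  (Z1 : T1 -> R) (Z2 : T2 -> R) (N1 : T1 -> \bar R) (N2 : T2 -> \bar R).
Hypotheses (bZ1 : bounded_measurable Z1) (bZ2 : bounded_measurable Z2).
Hypotheses (mN1 : measurable_fun setT N1) (mN2 : measurable_fun setT N2).
Hypotheses (natN1 : forall w, nat_valued (N1 w)) (natN2 : forall w, nat_valued (N2 w)).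
Hypothesis laplaceN : forall n, (\int[P1]_w (Z1 w * expNen n (N1 w)) =
  \int[P2]_w (Z2 w * expNen n (N2 w)))%R.

Local Notation ind k := (\1_([set k%:R%:E : \bar R]) : \bar R -> R).

Let mind k : measurable_fun setT (ind k).
Proof. by apply: measurable_indic; exact: emeasurable_set1. Qed.

Let ind_nat k l : ind k l%:R%:E = (l == k)%:R.
Proof.
rewrite indicE; congr (nat_of_bool _)%:R; apply/idP/eqP; rewrite inE /=; last by move->.
by move=> [] /eqP; rewrite eqr_nat => /eqP.
Qed.

Let indy k : ind k +oo%E = 0.
Proof. by rewrite indicE memNset. Qed.

Let bcomp d (T : measurableType d) (N : T -> \bar R) (h : \bar R -> R) :
  measurable_fun setT N -> (forall w, nat_valued (N w)) -> measurable_fun setT h ->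
  (exists C, forall x, nat_valued x -> `|h x| <= C) ->
  bounded_measurable (h \o N).
Proof.
move=> mN natN mh [C hC]; split; first exact: measurableT_comp.
by exists C => w; apply: hC.
Qed.

Let h k n (x : \bar R) : R :=
  expR (n * k)%:R * (expNen n x - \sum_(j < k) expR (- (n * j)%:R) * ind j x).

Let mh k n : measurable_fun setT (h k n).
Proof.
apply: measurable_funM => //; apply: measurable_funB; first exact: measurable_expNen.
by apply: measurable_sum => j; exact: measurable_funM.
Qed.

Let h_nat k n l : h k n l%:R%:E = if (l < k)%N then 0 else expR (- (n * (l - k))%:R).
Proof.
rewrite /h expNen_nat; case: ltnP => [lk|kl].
  rewrite (bigD1 (Ordinal lk))//= ind_nat eqxx mulr1 big1 ?addr0 ?subrr ?mulr0//.
  move=> j /eqP jl; rewrite ind_nat; case: eqP => [lj|]; last by rewrite mulr0.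
  by case: jl; apply: val_inj.
rewrite big1 ?subr0; last first.
  move=> j _; rewrite ind_nat; case: eqP => [lj|]; last by rewrite mulr0.
  by move: (ltn_ord j); rewrite -lj ltnNge kl.
rewrite -expRD; congr expR; rewrite mulnBr natrB ?leq_mul2l ?kl ?orbT//.
by rewrite opprB.
Qed.

Let hy k n : h k n.+1 +oo%E = 0.
Proof.
rewrite /h expNeSy big1 ?subr0 ?mulr0// => j _.
by rewrite indy mulr0.
Qed.

Let h_le1 k n x : nat_valued x -> `|h k n.+1 x| <= 1.
Proof.
move=> [->|[l ->]]; first by rewrite hy normr0.
rewrite h_nat; case: ifP => _; first by rewrite normr0.
by rewrite ger0_norm ?expR_ge0// expR_le1 oppr_le0.
Qed.

Let h_cvg k x : nat_valued x -> h k n.+1 x @[n --> \oo] --> ind k x.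
Proof.
move=> [->|[l ->]].
  by rewrite indy; under eq_fun do rewrite hy; exact: cvg_cst.
rewrite ind_nat; under eq_fun do rewrite h_nat.
have [lk|kl|->] := ltngtP l k; rewrite ?eqxx.
- exact: cvg_cst.
- have lk0 : (0 < l - k)%N by rewrite subn_gt0.
  apply: (@squeeze_cvgr _ _ _ _ (fun=> 0) (fun n : nat => (n.+1%:R)^-1)).
  + apply: nearW => n; rewrite expR_ge0/= expRN lef_pV2 ?posrE ?expR_gt0//.
    rewrite (le_trans _ (expR_ge1Dx _))// -natr1 addrC lerD2l -?natrD ler_nat.
    by rewrite (leq_trans (leqnSn n))// leq_pmulr.
  + exact: cvg_cst.
  + exact: cvg_harmonic.
- rewrite subnn; under eq_fun do rewrite muln0 oppr0 expR0.
  exact: cvg_cst.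
Qed.

Let bh d (T : measurableType d) (N : T -> \bar R) k n :
  measurable_fun setT N -> (forall w, nat_valued (N w)) ->
  bounded_measurable (fun w => h k n.+1 (N w)).
Proof.
move=> mN natN; apply: (bcomp mN natN (mh k n.+1)).
by exists 1 => x; exact: h_le1.
Qed.

Let bind d (T : measurableType d) (N : T -> \bar R) k :
  measurable_fun setT N -> bounded_measurable (fun w => ind k (N w)).
Proof.
move=> mN; split; first exact: measurableT_comp (mind k) mN.
by exists 1 => w; rewrite indicE ger0_norm ?ler0n// lern1 leq_b1.
Qed.

(** The probability of the value [k] is the limit of the Laplace transform,
    freed from the contributions of the smaller values and rescaled. *)
Let laplace_ind_unique k :
  (\int[P1]_w (Z1 w * ind k (N1 w)) = \int[P2]_w (Z2 w * ind k (N2 w)))%R.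
Proof.
elim/ltn_ind: k => k IH.
have lim d (T : measurableType d) (P : probability T R) (Z : T -> R) (N : T -> \bar R) :
    bounded_measurable Z -> measurable_fun setT N -> (forall w, nat_valued (N w)) ->
    \int[P]_w (Z w * h k n.+1 (N w)) @[n --> \oo] --> (\int[P]_w (Z w * ind k (N w)))%R.
  move=> bZ mN natN; have [C ZC] := bZ.2.
  apply: (expect_cvg (C := C)).
  - by move=> n; apply: (bounded_measurableM bZ (bh k n mN natN)).1.
  - exact: bounded_measurableM bZ (bind k mN).
  - move=> n w; rewrite normrM -[leRHS]mulr1 ler_pM//; exact: h_le1.
  - by apply: aeW => w; apply: cvgM; [exact: cvg_cst|exact: h_cvg].
have {}lim1 := lim _ _ P1 Z1 N1 bZ1 mN1 natN1.
have {lim}lim2 := lim _ _ P2 Z2 N2 bZ2 mN2 natN2.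
suff e : (fun n => \int[P1]_w (Z1 w * h k n.+1 (N1 w)))%R =
    (fun n => \int[P2]_w (Z2 w * h k n.+1 (N2 w)))%R.
  by move: lim1; rewrite e => /(cvg_unique _)/(_ lim2); exact.
have expand d (T : measurableType d) (P : probability T R) (Z : T -> R) (N : T -> \bar R) n :
    bounded_measurable Z -> measurable_fun setT N -> (forall w, nat_valued (N w)) ->
    (\int[P]_w (Z w * h k n (N w)) = expR (n * k)%:R *
     (\int[P]_w (Z w * expNen n (N w)) -
      \sum_(j < k) expR (- (n * j)%:R) * \int[P]_w (Z w * ind j (N w))))%R.
  move=> bZ mN natN.
  have bZN : bounded_measurable (fun w => Z w * expNen n (N w)).
    apply: bounded_measurableM => //; apply: bounded_measurable_le1.
      exact: measurableT_comp (measurable_expNen n) mN.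
    by move=> w; rewrite expNen_itv// nat_valued_ge0.
  have bZi j : bounded_measurable (fun w => expR (- (n * j)%:R) * (Z w * ind j (N w))).
    apply: bounded_measurableM; first exact: bounded_measurable_cst.
    by apply: bounded_measurableM => //; exact: bind.
  have bZi' j : bounded_measurable (fun w => Z w * ind j (N w)).
    by apply: bounded_measurableM => //; exact: bind.
  under [in RHS]eq_bigr do rewrite -expectZl//.
  rewrite -expect_sum// -expectB//; last exact: bounded_measurable_sum.
  rewrite -expectZl; last by apply: bounded_measurableB => //; exact: bounded_measurable_sum.
  apply: eq_Rintegral => w _; rewrite /h mulrCA mulrBr; congr (_ * (_ - _)).
  by rewrite mulr_sumr; apply: eq_bigr => j _; rewrite mulrCA.
apply/funext => n; rewrite !expand// laplaceN; congr (_ * (_ - _)).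
by apply: eq_bigr => j _; rewrite IH.
Qed.

Let cut (B : set (\bar R)) n (x : \bar R) : R :=
  \1_B +oo%E + \sum_(k < n) (\1_B k%:R%:E - \1_B +oo%E) * ind k x.

Let cut_nat B n l : cut B n l%:R%:E = if (l < n)%N then \1_B l%:R%:E else \1_B +oo%E.
Proof.
rewrite /cut; case: ltnP => [ln|nl].
  rewrite (bigD1 (Ordinal ln))//= ind_nat eqxx mulr1 big1 ?addr0; last first.
    move=> j /eqP jl; rewrite ind_nat; case: eqP => [lj|]; last by rewrite mulr0.
    by case: jl; apply: val_inj.
  by rewrite addrC subrK.
rewrite big1 ?addr0// => j _; rewrite ind_nat; case: eqP => [lj|]; last by rewrite mulr0.
by move: (ltn_ord j); rewrite -lj ltnNge nl.
Qed.

Let cuty B n : cut B n +oo%E = \1_B +oo%E.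
Proof. by rewrite /cut big1 ?addr0// => j _; rewrite indy mulr0. Qed.

(** A bounded weight times a law on the extended naturals is determined by its
    Laplace transform at the integers. *)
Lemma laplace_nat_unique (B : set (\bar R)) : measurable B ->
  (\int[P1]_w (Z1 w * \1_B (N1 w)) = \int[P2]_w (Z2 w * \1_B (N2 w)))%R.
Proof.
move=> mB.
have bcut d (T : measurableType d) (N : T -> \bar R) n :
    measurable_fun setT N -> bounded_measurable (fun w => cut B n (N w)).
  move=> mN; apply: bounded_measurableD; first exact: bounded_measurable_cst.
  apply: bounded_measurable_sum => k; apply: bounded_measurableM; last exact: bind.
  exact: bounded_measurable_cst.
have b1B d (T : measurableType d) (N : T -> \bar R) :
    measurable_fun setT N -> bounded_measurable (fun w => \1_B (N w) : R).
  move=> mN; split; first exact: measurableT_comp (measurable_indic mB) mN.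
  by exists 1 => w; rewrite indicE ger0_norm ?ler0n// lern1 leq_b1.
have lim d (T : measurableType d) (P : probability T R) (Z : T -> R) (N : T -> \bar R) :
    bounded_measurable Z -> measurable_fun setT N -> (forall w, nat_valued (N w)) ->
    \int[P]_w (Z w * cut B n (N w)) @[n --> \oo] --> (\int[P]_w (Z w * \1_B (N w)))%R.
  move=> bZ mN natN; have [C ZC] := bZ.2.
  apply: (expect_cvg (C := C)).
  - by move=> n; apply: (bounded_measurableM bZ (bcut _ _ _ n mN)).1.
  - exact: bounded_measurableM bZ (b1B _ _ _ mN).
  - move=> n w; rewrite normrM -[leRHS]mulr1 ler_pM//.
    have [->|[l ->]] := natN w; rewrite ?cuty ?cut_nat ?indicE.
      by rewrite ger0_norm ?ler0n// lern1 leq_b1.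
    by case: ifP => _; rewrite ger0_norm ?ler0n// lern1 leq_b1.
  - apply: aeW => w; apply: cvgM; first exact: cvg_cst.
    have [->|[l ->]] := natN w.
      by under eq_fun do rewrite cuty; exact: cvg_cst.
    apply: cvg_near_cst; near=> n; rewrite cut_nat ifT//.
    by near: n; exact: nbhs_infty_gt.
have {}lim1 := lim _ _ P1 Z1 N1 bZ1 mN1 natN1.
have {lim}lim2 := lim _ _ P2 Z2 N2 bZ2 mN2 natN2.
suff e : (fun n => \int[P1]_w (Z1 w * cut B n (N1 w)))%R =
    (fun n => \int[P2]_w (Z2 w * cut B n (N2 w)))%R.
  by move: lim1; rewrite e => /(cvg_unique _)/(_ lim2); exact.
have expand d (T : measurableType d) (P : probability T R) (Z : T -> R) (N : T -> \bar R) n :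
    bounded_measurable Z -> measurable_fun setT N ->
    (\int[P]_w (Z w * cut B n (N w)) = \1_B +oo%E * \int[P]_w (Z w * expNen 0 (N w)) +
      \sum_(k < n) (\1_B k%:R%:E - \1_B +oo%E) * \int[P]_w (Z w * ind k (N w)))%R.
  move=> bZ mN.
  have bZi k : bounded_measurable (fun w => Z w * ind k (N w)).
    by apply: bounded_measurableM => //; exact: bind.
  have bZi' k : bounded_measurable (fun w =>
      (\1_B k%:R%:E - \1_B +oo%E) * (Z w * ind k (N w))).
    by apply: bounded_measurableM => //; exact: bounded_measurable_cst.
  have -> : (\int[P]_w (Z w * expNen 0 (N w)) = \int[P]_w Z w)%R.
    by apply: eq_Rintegral => w _; rewrite expNe0 mulr1.
  under [in RHS]eq_bigr do rewrite -expectZl//.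
  rewrite -expect_sum// -expectZl// -expectD; last 2 first.
  - by apply: bounded_measurableM => //; exact: bounded_measurable_cst.
  - exact: bounded_measurable_sum.
  apply: eq_Rintegral => w _; rewrite /cut mulrDr mulrC; congr (_ + _).
  by rewrite mulr_sumr; apply: eq_bigr => j _; rewrite mulrCA.
apply/funext => n; rewrite !expand// laplaceN; congr (_ + _).
by apply: eq_bigr => j _; rewrite laplace_ind_unique.
Unshelve. all: by end_near. Qed.

End uniqueness.
End laplace_counts.

Section arrival_counts.
Context {R : realType} d (T : measurableType d) (P : probability T R).
Variables (Y : nat -> T -> R) (nu : probability R R).
Hypotheses (iidY : iid_law P Y nu).
Hypothesis nuE : forall A, measurable A -> nu A = exponential_prob 1 A.
Local Notation leb := (@lebesgue_measure R).

Definition arrival_count (C : set R) (w : T) : \bar R :=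
  arrival_series (\1_C : R -> R) (fun i => Y i w).

Definition halfline_length (C : set R) : \bar R :=
  (\int[leb]_(z in `[0%R, +oo[) (\1_C z)%:E)%E.

Let ind0 (C : set R) (z : R) : 0 <= (\1_C z : R).
Proof. by rewrite indicE ler0n. Qed.

Lemma halfline_length_ge0 C : (0 <= halfline_length C)%E.
Proof. by apply: integral_ge0 => z _; rewrite lee_fin. Qed.

Lemma measurable_arrival_count C : measurable C ->
  measurable_fun setT (arrival_count C).
Proof.
move=> mC; exact: measurableT_comp
  (measurable_arrival_series (measurable_indic mC) (ind0 C)) (measurable_iid iidY).
Qed.

Lemma arrival_count_nat C w : nat_valued (arrival_count C w).
Proof.
pose c n := (\sum_(i < n) (ssum (fun i => Y i w) i.+1 \in C))%N.
have cE n : (\sum_(0 <= i < n) ((\1_C (ssum (fun i => Y i w) i.+1))%:E : \bar R) =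
    (c n)%:R%:E)%E.
  rewrite big_mkord sumEFin /c natr_sum; congr EFin; exact: eq_bigr.
have ndc : {homo c : m n / (m <= n)%N}.
  move=> m n mn; rewrite /c -!(big_mkord xpredT (fun i => nat_of_bool
    (ssum (fun i => Y i w) i.+1 \in C))) (big_cat_nat (leq0n m) mn)/=.
  exact: leq_addr.
have [[M cM]|unb] := pselect (exists M, forall n, (c n <= M)%N).
  have bd k : `[< exists n, c n = k >] -> (k <= M)%N by move=> /asboolP[n <-].
  have ex' : exists k, `[< exists n, c n = k >].
    by exists (c 0%N); apply/asboolP; exists 0%N.
  have [k /asboolP[n0 cn0] kmax] := ex_maxnP ex' bd.
  right; exists k; apply/cvg_lim => //; apply: cvg_near_cst; near=> n.
  rewrite cE; congr (_%:R%:E); apply/eqP; rewrite eqn_leq kmax/=; last first.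
    by apply/asboolP; exists n.
  by rewrite -cn0 ndc//; near: n; exists n0.
left; apply/cvg_lim => //; apply/cvgeyPge => A.
have [n0 n0A] : exists n0, (Num.bound `|A| < c n0)%N.
  apply: contrapT => h; apply: unb; exists (Num.bound `|A|) => n1.
  by rewrite leqNgt; apply/negP => ?; apply: h; exists n1.
near=> n; rewrite cE lee_fin (@le_trans _ _ (Num.bound `|A|)%:R)//.
  by rewrite (le_trans (ler_norm A))// ltW// archi_boundP.
rewrite ler_nat (leq_trans (ltnW n0A))// ndc//.
by near: n; exists n0.
Unshelve. all: by end_near. Qed.

(** This is the Laplace functional at a linear combination of indicators of
    disjoint sets, where the exponent splits into one term for each set. *)
Lemma laplace_arrival_counts (I : eqType) (C : I -> set R) (th : I -> nat) (s : seq I) :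
  (forall i, measurable (C i)) -> trivIset setT C -> uniq s ->
  (\int[P]_w \prod_(i <- s) expNen (th i) (arrival_count (C i) w) =
   \prod_(i <- s) expNe ((1 - expR (- (th i)%:R))%:E * halfline_length (C i))%E)%R.
Proof.
move=> mC tC us.
have sum_at (phi : R -> R) z : phi 0 = 0 ->
    phi (\sum_(i <- s) (th i)%:R * \1_(C i) z) =
    \sum_(i <- s) phi (th i)%:R * \1_(C i) z.
  move=> phi0; elim: s us => [|i s IH]; first by rewrite !big_nil.
  rewrite /= => /andP[si us]; rewrite !big_cons indicE.
  have [zC|zC] := boolP (z \in C i); last by rewrite !mulr0 !add0r IH.
  have big0 (a : R -> R) : \sum_(j <- s) a (th j)%:R * \1_(C j) z = 0.
    rewrite big1_seq// => j /andP[_ js]; rewrite indicE memNset ?mulr0// => zj.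
    have ij := tC i j Logic.I Logic.I (ex_intro _ z (conj (set_mem zC) zj)).
    by move: si; rewrite ij js.
  by rewrite (big0 id) big0 !mulr1 !addr0.
pose f z : R := \sum_(i <- s) (th i)%:R * \1_(C i) z.
have f0 z : 0 <= f z by apply: sumr_ge0 => i _; rewrite mulr_ge0 ?ler0n.
have mf : measurable_fun setT f.
  by apply: measurable_sum => i; apply: measurable_funM => //; exact: measurable_indic.
have fE w : expNe (arrival_series f (fun i => Y i w)) =
    \prod_(i <- s) expNen (th i) (arrival_count (C i) w).
  transitivity (expNe (\sum_(i <- s) (th i)%:R%:E * arrival_count (C i) w)%E).
    congr expNe; rewrite /arrival_count /arrival_series.
    under [RHS]eq_bigr do rewrite -nneseriesZl ?lee_fin//.
    rewrite -nneseries_sum; last by move=> i j _; rewrite mule_ge0 ?lee_fin.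
    by apply: eq_eseriesr => j _; rewrite /f -sumEFin.
  elim: s {us sum_at f f0 mf} => [|i s IH]; first by rewrite !big_nil /= oppr0 expR0.
  have c0 j : (0 <= (th j)%:R%:E * arrival_count (C j) w)%E.
    by rewrite mule_ge0 ?lee_fin ?arrival_series_ge0.
  by rewrite !big_cons expNeD ?IH// sume_ge0.
have := arrival_laplace iidY nuE mf f0.
under eq_integral do rewrite fE.
rewrite /Rintegral => -> /=.
transitivity (expNe (\sum_(i <- s) (1 - expR (- (th i)%:R))%:E * halfline_length (C i))%E).
  congr expNe; rewrite /halfline_length.
  have e0 i : 0 <= 1 - expR (- (th i)%:R) :> R by rewrite subr_ge0 expR_le1 oppr_le0.
  have mind (i : I) : measurable_fun (`[0%R, +oo[%classic : set R) (fun z : R => (\1_(C i) z)%:E : \bar R).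
    by apply: measurable_funTS; apply/measurable_EFinP; exact: measurable_indic.
  under [RHS]eq_bigr.
    move=> i _; rewrite -ge0_integralZl; [|by []|exact: mind|
      by move=> z _; rewrite lee_fin|by rewrite lee_fin].
    over.
  rewrite -ge0_integral_sum; [|by []|by move=> i; apply: emeasurable_funM => //;
    exact: mind|by move=> i z _; rewrite mule_ge0 ?lee_fin].
  apply: eq_integral => z _; rewrite /f.
  rewrite (sum_at (fun t => 1 - expR (- t))) ?oppr0 ?expR0 ?subrr//.
  by rewrite -sumEFin.
elim: s {us sum_at f f0 mf fE} => [|i s IH]; first by rewrite !big_nil /= oppr0 expR0.
have c0 j : (0 <= (1 - expR (- (th j)%:R))%:E * halfline_length (C j))%E.
  by rewrite mule_ge0 ?lee_fin ?halfline_length_ge0// subr_ge0 expR_le1 oppr_le0.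
by rewrite !big_cons expNeD ?IH// sume_ge0.
Qed.

Lemma bounded_count_ind C (B : set (\bar R)) : measurable C -> measurable B ->
  bounded_measurable (fun w => \1_B (arrival_count C w) : R).
Proof.
move=> mC mB; apply: bounded_measurable_le1.
  exact: measurableT_comp (measurable_indic mB) (measurable_arrival_count mC).
by move=> w; rewrite indicE ler0n lern1 leq_b1.
Qed.

Lemma bounded_count_exp C n : measurable C ->
  bounded_measurable (fun w => expNen n (arrival_count C w)).
Proof.
move=> mC; apply: bounded_measurable_le1.
  exact: measurableT_comp (measurable_expNen n) (measurable_arrival_count mC).
by move=> w; apply: expNen_itv; apply: nat_valued_ge0; exact: arrival_count_nat.
Qed.

(** The factorisation of the joint Laplace transform passes to indicator
    functions, one count at a time. *)
Lemma expect_prod_count_ind (I : eqType) (C : I -> set R) (B : I -> set (\bar R))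
    (th : I -> nat) (s1 s2 : seq I) :
  (forall i, measurable (C i)) -> (forall i, measurable (B i)) ->
  trivIset setT C -> uniq (s1 ++ s2) ->
  (\int[P]_w (\prod_(i <- s1) \1_(B i) (arrival_count (C i) w) *
              \prod_(i <- s2) expNen (th i) (arrival_count (C i) w)) =
   \prod_(i <- s1) \int[P]_w (\1_(B i) (arrival_count (C i) w)) *
   \prod_(i <- s2) \int[P]_w (expNen (th i) (arrival_count (C i) w)))%R.
Proof.
move=> mC mB tC.
have mN i : measurable_fun setT (arrival_count (C i)) by exact: measurable_arrival_count.
have bE i n : bounded_measurable (fun w => expNen n (arrival_count (C i) w)).
  exact: bounded_count_exp.
have bI i : bounded_measurable (fun w => \1_(B i) (arrival_count (C i) w) : R).
  exact: bounded_count_ind.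
elim: s1 s2 th => [|i s1 IH] s2 th.
  rewrite cat0s => us; rewrite big_nil mul1r; under eq_Rintegral do rewrite big_nil mul1r.
  rewrite laplace_arrival_counts//; apply: eq_bigr => i _.
  have := laplace_arrival_counts th mC tC (s := [:: i]) isT.
  by rewrite !big_seq1 => <-; apply: eq_Rintegral => w _; rewrite big_seq1.
move=> us.
pose Z w := \prod_(j <- s1) \1_(B j) (arrival_count (C j) w) *
            \prod_(j <- s2) expNen (th j) (arrival_count (C j) w) : R.
pose c : R := (\prod_(j <- s1) \int[P]_w (\1_(B j) (arrival_count (C j) w)) *
            \prod_(j <- s2) \int[P]_w (expNen (th j) (arrival_count (C j) w)))%R.
have bZ : bounded_measurable Z.
  by apply: bounded_measurableM; apply: bounded_measurable_prod => j.
have lap n : (\int[P]_w (Z w * expNen n (arrival_count (C i) w)) =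
    \int[P]_w (c * expNen n (arrival_count (C i) w)))%R.
  pose th' j := if j == i then n else th j.
  have us' : uniq (s1 ++ i :: s2).
    by move: us; rewrite cat_cons -[_ :: _]cat1s uniq_catCA /= cat_uniq.
  have is2 : i \notin s2.
    by move: us; rewrite cat_cons /= mem_cat negb_or => /andP[/andP[]].
  have same (F : nat -> I -> R) : \prod_(j <- s2) F (th' j) j = \prod_(j <- s2) F (th j) j.
    apply: eq_big_seq => j js2; rewrite /th'; case: eqP => // ji.
    by rewrite -ji js2 in is2.
  have thi : th' i = n by rewrite /th' eqxx.
  have := IH (i :: s2) th' us'; rewrite [X in _ * X]big_cons thi.
  rewrite (same (fun m j => \int[P]_w (expNen m (arrival_count (C j) w)))%R) => h.
  rewrite [RHS]expectZl// /c -mulrA [X in _ = _ * X]mulrC -h.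
  apply: eq_Rintegral => w _; rewrite big_cons thi.
  rewrite (same (fun m j => expNen m (arrival_count (C j) w))) /Z.
  by rewrite -mulrA; congr (_ * _); rewrite mulrC.
have := laplace_nat_unique bZ (bounded_measurable_cst _ c) (mN i) (mN i)
  (arrival_count_nat (C i)) (arrival_count_nat (C i)) lap (mB i).
rewrite expectZl// => e.
rewrite big_cons -mulrA mulrC -/c -e; apply: eq_Rintegral => w _.
by rewrite big_cons -mulrA mulrC.
Qed.

Lemma arrival_counts_independent (I : eqType) (C : I -> set R) :
  (forall i, measurable (C i)) -> trivIset setT C ->
  independent P (fun i => arrival_count (C i)).
Proof.
move=> mC tC s B us mB.
have := @expect_prod_count_ind _ C B (fun=> 0%N) s [::] mC mB tC.
rewrite cats0 => /(_ us); rewrite big_nil mulr1 => e.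
have mA i : measurable (arrival_count (C i) @^-1` B i).
  by rewrite -[X in measurable X]setTI; exact: measurable_arrival_count.
rewrite -expect_indic; last first.
  exact: fin_bigcap_measurable.
transitivity (\int[P]_w (\prod_(i <- s) \1_(B i) (arrival_count (C i) w) *
   \prod_(i <- [::]) expNen 0 (arrival_count (C i) w)))%R.
  apply: eq_Rintegral => w _; rewrite big_nil mulr1.
  have [ws|ws] := boolP (w \in \bigcap_(i in [set` s]) arrival_count (C i) @^-1` B i).
    rewrite indicE ws big1_seq// => i /andP[_ si]; rewrite indicE mem_set//.
    by move: ws; rewrite inE => /(_ i si).
  rewrite indicE (negbTE ws).
  have [i si wi] : exists2 i, i \in s & ~ B i (arrival_count (C i) w).
    apply: contrapT => h; move/negP: ws; apply; rewrite inE => i /= si.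
    by apply: contrapT => wi; apply: h; exists i.
  by rewrite (bigD1_seq i)//= indicE memNset// mul0r.
rewrite e; apply: eq_bigr => i _; rewrite -expect_indic//.
Qed.

Lemma laplace_arrival_count C n : measurable C ->
  (\int[P]_w expNen n (arrival_count C w) =
   expNe ((1 - expR (- n%:R))%:E * halfline_length C)%E)%R.
Proof.
move=> mC; have := @laplace_arrival_counts _ (fun=> C) (fun=> n) [:: tt] (fun=> mC).
have tC : trivIset setT (fun _ : unit => C) by move=> [] [].
move=> /(_ tC isT); rewrite big_seq1 => <-.
by apply: eq_Rintegral => w _; rewrite big_seq1.
Qed.

(** For an interval [0, M) the Poisson law comes from the formula for [k]
    arrivals before [M]; a general set has the same Laplace transform as the
    interval of the same length. *)
Lemma arrival_count_poisson C k : measurable C -> (halfline_length C < +oo)%E ->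
  P [set w | arrival_count C w = k%:R%:E] =
  (expR (- fine (halfline_length C)) * fine (halfline_length C) ^+ k / k`!%:R)%:E.
Proof.
move=> mC Cfin; set M := fine (halfline_length C).
have M0 : 0 <= M by rewrite fine_ge0// halfline_length_ge0.
have ME : halfline_length C = M%:E.
  by rewrite /M fineK// ge0_fin_numE// halfline_length_ge0.
pose C0 : set R := `[0%R, M[%classic.
have mC0 : measurable C0 by exact: measurable_itv.
pose g (z : R) : R := \1_C0 z.
have mg : measurable_fun setT g by exact: measurable_indic.
have g0 z : 0 <= g z by rewrite /g indicE ler0n.
have gM z : M <= z -> g z = 0.
  move=> Mz; rewrite /g indicE memNset//= /C0 /= in_itv/= => /andP[_].
  by rewrite ltNge Mz.
have gint : (\int[leb]_z (g z)%:E = M%:E)%E.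
  rewrite integral_indic//= setIT lebesgue_measure_itv/= lte_fin.
  by case: ltgtP M0 => //= [_ _|<- _]; rewrite ?sube0.
have gfin : (\int[leb]_z (g z)%:E < +oo)%E by rewrite gint ltry.
have lenC0 : halfline_length C0 = M%:E.
  rewrite -gint /halfline_length integral_mkcond; apply: eq_integral => z _.
  rewrite patchE; case: ifPn => //.
  rewrite notin_setE/= in_itv/= andbT => /negP z0; rewrite /g indicE memNset//=.
  by rewrite /C0 /= in_itv/= (negbTE z0).
have I0 : tail_integral g 0 = M by rewrite /tail_integral -/(halfline_length C0) lenC0.
have k1 : measurable [set k%:R%:E : \bar R] by exact: emeasurable_set1.
have := laplace_nat_unique (bounded_measurable_cst _ 1) (bounded_measurable_cst _ 1)
  (measurable_arrival_count mC) (measurable_arrival_count mC0)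
  (arrival_count_nat C) (arrival_count_nat C0) _ k1.
have lap n : (\int[P]_w (1 * expNen n (arrival_count C w)) =
    \int[P]_w (1 * expNen n (arrival_count C0 w)))%R.
  under eq_Rintegral do rewrite mul1r; under [RHS]eq_Rintegral do rewrite mul1r.
  by rewrite !laplace_arrival_count// ME lenC0.
move=> /(_ P P lap).
under eq_Rintegral do rewrite mul1r; under [in X in _ = X -> _]eq_Rintegral do rewrite mul1r.
have mA : measurable [set w | arrival_count C w = k%:R%:E].
  rewrite -[X in measurable X]setTI -[X in setT `&` X]/(arrival_count C @^-1` [set k%:R%:E]).
  exact: measurable_arrival_count.
have -> : (\int[P]_w (\1_[set k%:R%:E] (arrival_count C w)) =
    fine (P [set w | arrival_count C w = k%:R%:E]))%R by rewrite -expect_indic.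
have bw : bounded_measurable (fun w => window_prod g M 0 k (fun i => Y i w)).
  apply: bounded_measurable_le1.
    exact: measurableT_comp (measurable_window_prod _ mg _ _) (measurable_iid iidY).
  move=> w; rewrite window_prod_ge0//=; apply: mulr_ile1; rewrite ?ler0n ?prodr_ge0//.
    by rewrite lern1 leq_b1.
  by apply: prodr_ile1 => i _; rewrite g0 /g indicE lern1 leq_b1.
have -> : (\int[P]_w (\1_[set k%:R%:E] (arrival_count C0 w)) =
    \int[P]_w (window_prod g M 0 k (fun i => Y i w)))%R.
  apply: expect_ae => //; first exact: bounded_count_ind.
  apply: filterS (ae_regular_arrivals iidY nuE) => w [pos unb].
  set s := (fun i => Y i w) in pos unb *.
  have [k0 [Mk kM]] : exists k, M <= ssum s k.+1 /\
      forall i, (i < k)%N -> ssum s i.+1 < M.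
    apply: first_arrival_after; have [j Mj] := unb (Num.bound M).
    by exists j; rewrite (le_trans _ Mj)// ltW// archi_boundP.
  have g1 i : (i < k0)%N -> g (ssum s i.+1) = 1.
    move=> ik; rewrite /g indicE mem_set//= /C0 /= in_itv/= kM// andbT.
    by rewrite ltW// arrival_gt0.
  have -> : arrival_count C0 w = k0%:R%:E.
    rewrite /arrival_count /arrival_series -/s (nneseries_split 0 k0)//.
    rewrite add0n eseries0 ?adde0; last first.
      by move=> i ki _; rewrite -/(g _) gM// (le_trans Mk)// arrival_le.
    rewrite big_mkord sumEFin; congr EFin.
    transitivity (\sum_(i < k0) (1 : R)); last by rewrite sumr_const card_ord.
    by apply: eq_bigr => i _; exact: g1.
  rewrite /window_prod add0r indicE; under eq_bigr do rewrite add0r.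
  have [kk0|k0k|->] := ltngtP k k0.
  - rewrite memNset/=; first by rewrite leNgt kM// mul0r.
    by move=> [] /eqP; rewrite eqr_nat gtn_eqF.
  - rewrite memNset/=; first by rewrite (bigD1 (Ordinal k0k))//= gM// mul0r mulr0.
    by move=> [] /eqP; rewrite eqr_nat ltn_eqF.
  - by rewrite mem_set//= Mk big1 ?mulr1// => i _; rewrite g1.
move=> e; rewrite -[LHS]fineK ?fin_num_measure// e EFin_expect//.
by rewrite (integral_window_prod iidY nuE mg g0 gM gfin)// I0 subr0 mulrA.
Qed.

Lemma arrival_count_infinite C : measurable C -> halfline_length C = +oo%E ->
  P [set w | arrival_count C w = +oo%E] = 1%E.
Proof.
move=> mC Cy.
have y1 : measurable [set +oo%E : \bar R] by exact: emeasurable_set1.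
have := laplace_nat_unique (bounded_measurable_cst _ 1) (bounded_measurable_cst _ 1)
  (measurable_arrival_count mC) (measurable_cst +oo%E)
  (arrival_count_nat C) (fun=> or_introl erefl) _ y1.
have lap n : (\int[P]_w (1 * expNen n (arrival_count C w)) =
    \int[P]_w (1 * expNen n (cst +oo%E w)))%R.
  under eq_Rintegral do rewrite mul1r; under [RHS]eq_Rintegral do rewrite mul1r.
  rewrite laplace_arrival_count// Cy.
  have -> : (\int[P]_w (expNen n (cst +oo%E w)))%R = expNen n +oo%E by exact: expect_cst.
  case: n => [|n].
    by rewrite oppr0 expR0 subrr mul0e expNe0 /= oppr0 expR0.
  by rewrite expNeSy gt0_muley// lte_fin subr_gt0 expR_lt1 oppr_lt0.
move=> /(_ _ _ P P lap).
under eq_Rintegral do rewrite mul1r; under [in X in _ = X -> _]eq_Rintegral do rewrite mul1r.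
have mA : measurable [set w | arrival_count C w = +oo%E].
  rewrite -[X in measurable X]setTI -[X in setT `&` X]/(arrival_count C @^-1` [set +oo%E]).
  exact: measurable_arrival_count.
have -> : (\int[P]_w (\1_[set +oo%E] (arrival_count C w)) =
    fine (P [set w | arrival_count C w = +oo%E]))%R by rewrite -expect_indic.
move=> e; rewrite -[LHS]fineK ?fin_num_measure// e; congr EFin.
transitivity (\1_[set +oo%E] (+oo%E : \bar R) : R).
  by rewrite -[RHS](expect_cst P); exact: eq_Rintegral.
by rewrite indicE mem_set.
Qed.

End arrival_counts.

(** * The limiting point process *)

Lemma ae_eq_probability {R : realType} d (T : measurableType d) (P : probability T R)
    (A B : set T) : measurable A -> measurable B ->
  {ae P, forall w, A w <-> B w} -> P A = P B.
Proof.
move=> mA mB AB.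
have : (\int[P]_w \1_A w = \int[P]_w \1_B w)%R.
  apply: expect_ae; [exact: bounded_measurable_indic..|].
  apply: filterS AB => w AB; rewrite !indicE; congr (nat_of_bool _)%:R.
  by apply/idP/idP; rewrite !inE AB.
rewrite !expect_indic// => e.
by rewrite -[LHS]fineK ?fin_num_measure// e fineK ?fin_num_measure.
Qed.

Section point_series.
Context {R : realType}.

Local Notation point_series x :=
  (mseries (fun i => (\d_(x i) : {measure set R -> \bar R})) 0).

Definition sym_itv (L : nat) : set R := `[- L%:R, L%:R]%classic.

Lemma measurable_sym_itv L : measurable (sym_itv L).
Proof. exact: measurable_itv. Qed.

Lemma is_point_measure_series (x : nat -> R) :
  (forall L : nat, (point_series x (sym_itv L) < +oo)%E) ->
  is_point_measure (point_series x).
Proof.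
move=> fin; split.
  by exists setT, x => A mA; rewrite -nneseries_esumT.
move=> K cK.
have [M [_ MK]] := compact_bounded cK.
have [L ML] : exists L : nat, M < L%:R.
  exists (Num.bound `|M|); rewrite (le_lt_trans (ler_norm M))//.
  by rewrite archi_boundP.
apply: le_lt_trans (fin L); apply: le_measure.
- by rewrite inE; exact: compact_measurable.
- by rewrite inE; exact: measurable_sym_itv.
by move=> y Ky; rewrite /sym_itv /= in_itv/= -ler_norml; exact: (MK _ ML).
Qed.

Lemma dirac_seriesE (x : nat -> R) : is_point_measure (point_series x) ->
  pm_measure (dirac_series x) = point_series x.
Proof. by rewrite /dirac_series /to_pointMeasure; case: pselect. Qed.

Lemma dirac_series0 (x : nat -> R) : ~ is_point_measure (point_series x) ->
  pm_measure (dirac_series x) = mzero.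
Proof. by rewrite /dirac_series /to_pointMeasure; case: pselect. Qed.

Lemma dirac_series_le (x : nat -> R) A :
  is_point_measure (point_series x) -> dirac_series x A = point_series x A.
Proof. by move=> /dirac_seriesE ->. Qed.

End point_series.

Section limit_process.
Context {R : realType} d (T : measurableType d) (P : probability T R).
Variables (E : nat -> T -> R) (nu : probability R R).
Hypotheses (iidE : iid_law P E nu).
Hypothesis nuE : forall A, measurable A -> nu A = exponential_prob 1 A.
Local Notation leb := (@lebesgue_measure R).

Let log_points w i : R := - ln (partial_sum E i.+1 w).
Let log_preimage (A : set R) : set R := (fun z => - ln z) @^-1` A.

Let mlog : measurable_fun setT (fun z : R => - ln z).
Proof. by apply: measurableT_comp => //; exact: measurable_ln. Qed.

Let measurable_log_preimage A : measurable A -> measurable (log_preimage A).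
Proof. by move=> mA; rewrite -[X in measurable X]setTI; exact: mlog. Qed.

Let log_points_count w A :
  mseries (fun i => \d_(log_points w i)) 0 A = arrival_count E (log_preimage A) w.
Proof. by []. Qed.

Let finite_counts : set T :=
  [set w | forall L : nat, (arrival_count E (log_preimage (sym_itv L)) w < +oo)%E].

Let finite_countsP w : finite_counts w <->
  is_point_measure (mseries (fun i => \d_(log_points w i)) 0).
Proof.
split=> [fin|[_ fin] L].
  by apply: is_point_measure_series => L; rewrite log_points_count; exact: fin.
by rewrite -log_points_count; apply: fin; exact: segment_compact.
Qed.

Let measurable_finite_counts : measurable finite_counts.
Proof.
rewrite (_ : finite_counts = \bigcap_L
  [set w | (arrival_count E (log_preimage (sym_itv L)) w < +oo)%E]); last first.
  by apply/seteqP; split => w fin L; [move=> _|]; exact: fin.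
apply: bigcapT_measurable => L.
rewrite -[X in measurable X]setTI; apply: emeasurable_fun_infty_o => //.
apply: (measurable_arrival_count iidE); apply: measurable_log_preimage.
exact: measurable_sym_itv.
Qed.

Let limit_processE w A : limit_process E w A =
  if w \in finite_counts then arrival_count E (log_preimage A) w else 0%E.
Proof.
rewrite /limit_process; case: ifPn; rewrite ?inE ?notin_setE => fin.
  by rewrite dirac_series_le//; exact/finite_countsP.
by rewrite dirac_series0//; apply: contra_not fin => /finite_countsP.
Qed.

(** The points [- ln Gamma_i] decrease to [- oo], so only finitely many exceed
    any level. *)
Lemma ae_finite_counts : {ae P, forall w, finite_counts w}.
Proof.
apply: filterS (ae_regular_arrivals iidE nuE) => w [pos unb] L.
have [k Mk] := unb (Num.bound (expR L%:R : R)).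
rewrite /arrival_count /arrival_series (nneseries_split 0 k)//.
rewrite add0n eseries0 ?adde0 ?big_mkord ?sumEFin ?ltry// => i ki _.
rewrite indicE memNset// /log_preimage /sym_itv /= in_itv/= => /andP[+ _].
rewrite lerNr opprK leNgt => /negP; apply.
rewrite -[ltLHS]expRK ltr_ln ?posrE ?expR_gt0//; last exact: arrival_gt0.
rewrite (lt_le_trans (archi_boundP (expR_ge0 _)))// (le_trans Mk)//.
exact: arrival_le.
Qed.

Lemma measurable_limit_process A : measurable A ->
  measurable_fun setT (fun w => limit_process E w A : \bar R).
Proof.
move=> mA; under eq_fun do rewrite limit_processE.
apply: measurable_fun_ifT => //.
  apply: (measurable_fun_bool true).
  rewrite (_ : _ @^-1` _ = finite_counts) ?setTI; first exact: measurable_finite_counts.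
  by apply/seteqP; split => w /=; [move/set_mem|exact: mem_set].
by apply: (measurable_arrival_count iidE); exact: measurable_log_preimage.
Qed.

Lemma ae_point_measure : {ae P, forall w,
  is_point_measure (mseries (fun i => \d_(- ln (partial_sum E i.+1 w)) : {measure set R -> \bar R}) 0)}.
Proof. by apply: filterS ae_finite_counts => w /finite_countsP. Qed.

Lemma measurable_point_measure : measurable [set w |
  is_point_measure (mseries (fun i => \d_(- ln (partial_sum E i.+1 w)) : {measure set R -> \bar R}) 0)].
Proof.
rewrite (_ : [set w | _] = finite_counts); first exact: measurable_finite_counts.
by apply/seteqP; split => w /finite_countsP.
Qed.

Let mpos : measurable (`]0%R, +oo[%classic : set (measurableTypeR R)).
Proof. exact: measurable_itv. Qed.

Let mlog' : measurable_fun setT ((fun z => - ln z) : measurableTypeR R -> R).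
Proof. exact: mlog. Qed.

(** The image of Lebesgue measure on the positive half-line under [- ln]; its
    density is [exp (- x)]. *)
Definition exp_intensity : {measure set R -> \bar R} :=
  measure_function_pushforward__canonical__measure_function_Measure
    (measure_function_mrestr__canonical__measure_function_Measure leb mpos) mlog'.

Lemma exp_intensityE A : measurable A ->
  exp_intensity A = halfline_length (log_preimage A).
Proof.
move=> mA; rewrite /halfline_length -integral_itv_obnd_cbnd; last first.
  apply: measurable_funTS; apply/measurable_EFinP; apply: measurable_indic.
  exact: measurable_log_preimage.
by rewrite integral_indic//; exact: measurable_log_preimage.
Qed.

Lemma exp_intensity_itvoy x : exp_intensity `]x, +oo[%classic = (expR (- x))%:E.
Proof.
transitivity (leb (`]0%R, expR (- x)[%classic : set R)); last first.
  by rewrite lebesgue_measure_itv/= lte_fin expR_gt0 sube0.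
congr (leb _); apply/seteqP; split => z /=; rewrite !in_itv/= !andbT.
  move=> [xz z0]; rewrite z0 -[ltLHS]lnK ?posrE// ltr_expR ltrNr.
  exact: xz.
move=> /andP[z0 zx]; split => //.
by rewrite ltrNr -ltr_expR lnK.
Qed.

Theorem poisson_limit_process :
  poisson_random_measure P exp_intensity (limit_process E).
Proof.
have prob_eq (Q : T -> \bar R) (Q' : T -> \bar R) (B : set (\bar R)) :
    measurable_fun setT Q -> measurable_fun setT Q' -> measurable B ->
    (forall w, finite_counts w -> Q w = Q' w) -> P (Q @^-1` B) = P (Q' @^-1` B).
  move=> mQ mQ' mB QQ'; apply: ae_eq_probability.
  - by rewrite -[X in measurable X]setTI; exact: mQ.
  - by rewrite -[X in measurable X]setTI; exact: mQ'.
  by apply: filterS ae_finite_counts => w fin; rewrite /preimage /= QQ'.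
have mN := measurable_limit_process.
have mC A (mA : measurable A) :=
  measurable_arrival_count iidE (measurable_log_preimage mA).
have NC w A : finite_counts w ->
    limit_process E w A = arrival_count E (log_preimage A) w.
  by move=> fin; rewrite limit_processE mem_set.
split.
- exact: mN.
- move=> A k mA; rewrite exp_intensityE// => Afin.
  rewrite -(arrival_count_poisson iidE nuE k (measurable_log_preimage mA) Afin).
  apply: (prob_eq _ _ [set k%:R%:E]); [exact: mN|exact: mC|exact: emeasurable_set1|].
  by move=> w; exact: NC.
- move=> A mA; rewrite exp_intensityE// => Ay.
  rewrite -(arrival_count_infinite iidE nuE (measurable_log_preimage mA) Ay).
  apply: (prob_eq _ _ [set +oo%E]); [exact: mN|exact: mC|exact: emeasurable_set1|].
  by move=> w; exact: NC.
move=> k A mA tA s B us mB.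
have tlog : trivIset setT (fun i => log_preimage (A i)).
  apply/trivIsetP => i j _ _ ij; move/trivIsetP : tA => /(_ i j Logic.I Logic.I ij) Aij.
  by rewrite /log_preimage -preimage_setI Aij preimage_set0.
have := arrival_counts_independent iidE nuE (fun i => measurable_log_preimage (mA i)) tlog.
move=> /(_ s B us mB) indep.
transitivity (fine (P (\bigcap_(i in [set` s])
    arrival_count E (log_preimage (A i)) @^-1` B i))).
  congr fine; apply: ae_eq_probability.
  - apply: fin_bigcap_measurable => // i _.
    by rewrite -[X in measurable X]setTI; exact: mN.
  - apply: fin_bigcap_measurable => // i _.
    by rewrite -[X in measurable X]setTI; exact: mC.
  apply: filterS ae_finite_counts => w fin.
  by split => h i si; have := h i si; rewrite /preimage /= NC.
rewrite indep; apply: eq_bigr => i _; congr fine.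
apply: prob_eq; [exact: mC|exact: mN|exact: mB|].
by move=> w fin; rewrite NC.
Qed.

End limit_process.

(** * Resampling a few terms of a sum *)

Section exchangeable.
Context {R : realType} d (T : measurableType d) (P : probability T R).
Variables (X : nat -> T -> R) (nu : probability R R).
Hypothesis iidX : iid_law P X nu.
Local Notation E f := (\int[P]_w f w)%R.

Definition trajectory (w : T) : seqR R := fun i => X i w.
Local Notation Xs := trajectory.

Lemma measurable_trajectory : measurable_fun setT Xs.
Proof. exact: measurable_iid iidX. Qed.

Lemma bounded_trajectory (Phi : seqR R -> R) : bounded_measurable Phi ->
  bounded_measurable (fun w => Phi (Xs w)).
Proof.
move=> [mPhi [C PhiC]]; split; first exact: measurableT_comp mPhi measurable_trajectory.
by exists C => w.
Qed.

Lemma iid_expect d' (T' : measurableType d') (P' : probability T' R)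
    (X' : nat -> T' -> R) (Phi : seqR R -> R) :
  iid_law P' X' nu -> bounded_measurable Phi ->
  E (fun w => Phi (Xs w)) = (\int[P']_w (Phi (fun i => X' i w)))%R.
Proof.
move=> iid' [mPhi [C PhiC]].
have bPhi : bounded_measurable Phi by split => //; exists C.
have b1 := bounded_trajectory bPhi.
have b2 : bounded_measurable (fun w => Phi (fun i => X' i w)).
  split; last by exists C.
  exact: measurableT_comp mPhi (measurable_iid iid').
have Phi0 s : (0 <= (Phi s + C)%:E)%E.
  by have /ler_normlP[h _] := PhiC s; rewrite lee_fin; lra.
have mPhiC : measurable_fun setT (fun s => (Phi s + C)%:E).
  by apply/measurable_EFinP; exact: measurable_funD.
have := iid_law_integral iidX iid' mPhiC Phi0.
move=> /(congr1 fine) h; apply: (addIr C).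
rewrite -[X in _ + X = _](expect_cst P) -[X in _ = _ + X](expect_cst P').
by rewrite -!expectD//; exact: bounded_measurable_cst.
Qed.

Definition swap (i j k : nat) : nat := if k == i then j else if k == j then i else k.

Lemma swapK i j : involutive (swap i j).
Proof.
move=> k; rewrite /swap; have [->|ki] := eqVneq k i.
  by have [->|ji] := eqVneq j i; rewrite ?eqxx.
have [->|kj] := eqVneq k j; first by rewrite eqxx.
by rewrite (negbTE ki) (negbTE kj).
Qed.

Lemma swap_inj i j : injective (swap i j).
Proof. exact: inv_inj (@swapK i j). Qed.

Lemma swap_lt i j k n : (i < n)%N -> (j < n)%N -> (swap i j k < n)%N = (k < n)%N.
Proof.
move=> ni nj; rewrite /swap; have [->|ki] := eqVneq k i; first by rewrite ni nj.
by have [->|//] := eqVneq k j; rewrite ni nj.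
Qed.

Lemma expect_reindex (f : nat -> nat) (Phi : seqR R -> R) : injective f ->
  bounded_measurable Phi ->
  E (fun w => Phi (Xs w)) = E (fun w => Phi (fun i => X (f i) w)).
Proof.
move=> injf bPhi; exact: iid_expect (iid_law_reindex iidX injf) bPhi.
Qed.

Definition symmetric_in (n : nat) (a : seqR R -> R) :=
  forall i j s, (i < n)%N -> (j < n)%N -> a (fun k => s (swap i j k)) = a s.

Lemma bounded_coord (phi : R -> R) i : bounded_measurable phi ->
  bounded_measurable (fun s : seqR R => phi (s i)).
Proof.
move=> [mphi [C phiC]]; split; last by exists C.
exact: measurableT_comp mphi (measurable_coord i).
Qed.

Lemma exch_expect1 n (a : seqR R -> R) (phi : R -> R) i :
  bounded_measurable a -> symmetric_in n a -> bounded_measurable phi -> (i < n)%N ->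
  E (fun w => a (Xs w) * phi (X i w)) = E (fun w => a (Xs w) * phi (X 0%N w)).
Proof.
move=> ba syma bphi ni; have n0 : (0 < n)%N by exact: leq_ltn_trans ni.
rewrite (expect_reindex (f := swap 0 i) (Phi := fun s => a s * phi (s i)))//.
- apply: eq_Rintegral => w _; rewrite (syma _ _ (Xs w))//; congr (_ * phi (X _ w)).
  by rewrite /swap; case: eqVneq => [->//|]; rewrite eqxx.
- exact: swap_inj.
- by apply: bounded_measurableM => //; exact: bounded_coord.
Qed.

Section exchangeable_moments.
Variables (n : nat) (a : seqR R -> R) (phi : R -> R).
Hypotheses (ba : bounded_measurable a) (a0 : forall s, 0 <= a s).
Hypothesis syma : symmetric_in n a.
Hypothesis bphi : bounded_measurable phi.

Let bphi_at i : bounded_measurable (fun s : seqR R => phi (s i)) := bounded_coord i bphi.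

(** The weight [a] is invariant under exchanging terms, so that any two distinct
    indices can be moved to 0 and 1. *)
Lemma exch_expect2 i j : (i < n)%N -> (j < n)%N -> i != j -> (1 < n)%N ->
  E (fun w => a (Xs w) * (phi (X i w) * phi (X j w))) =
  E (fun w => a (Xs w) * (phi (X 0%N w) * phi (X 1%N w))).
Proof.
move=> ni nj ij n1; have n0 : (0 < n)%N by exact: leq_ltn_trans ni.
have bPhi k l : bounded_measurable (fun s : seqR R => a s * (phi (s k) * phi (s l))).
  by apply: bounded_measurableM => //; exact: bounded_measurableM.
rewrite (expect_reindex (f := swap 0 i) (@swap_inj 0 i) (bPhi i j)).
have -> : swap 0 i i = 0%N by rewrite /swap; case: eqVneq => [->//|]; rewrite eqxx.
set j' := swap 0 i j.
have j'0 : j' != 0%N.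
  apply: contra_neq ij => e; rewrite -[LHS](swapK 0 i).
  by rewrite (_ : swap 0 i i = j') ?swapK// e /swap; case: eqVneq => [->//|]; rewrite eqxx.
have nj' : (j' < n)%N by rewrite swap_lt.
transitivity (E (fun w => a (Xs w) * (phi (X 0%N w) * phi (X j' w)))).
  by apply: eq_Rintegral => w _; rewrite (syma (Xs w)).
rewrite (expect_reindex (f := swap 1 j') (@swap_inj 1 j') (bPhi 0%N j')).
have -> : swap 1 j' 0 = 0%N by rewrite /swap /= eq_sym (negbTE j'0).
have -> : swap 1 j' j' = 1%N by rewrite /swap; case: eqVneq => [->//|]; rewrite eqxx.
by apply: eq_Rintegral => w _; rewrite (syma (Xs w)).
Qed.

(** The weights summing to zero kill the common value of the mixed moments. *)
Lemma exch_quadratic (c : nat -> R) : \sum_(i < n) c i = 0 ->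
  E (fun w => a (Xs w) * (\sum_(i < n) c i * phi (X i w)) ^+ 2) <=
  2 * (\sum_(i < n) c i ^+ 2) * E (fun w => a (Xs w) * phi (X 0%N w) ^+ 2).
Proof.
move=> c0.
pose u w i := phi (X i w).
have bu i : bounded_measurable (fun w => u w i) := bounded_trajectory (bphi_at i).
have bA : bounded_measurable (fun w => a (Xs w)) := bounded_trajectory ba.
have bAu i j : bounded_measurable (fun w => a (Xs w) * (u w i * u w j)).
  by apply: bounded_measurableM => //; exact: bounded_measurableM.
pose be := E (fun w => a (Xs w) * (u w 0%N * u w 0%N)).
pose al := E (fun w => a (Xs w) * (u w 0%N * u w 1%N)).
have -> : E (fun w => a (Xs w) * phi (X 0%N w) ^+ 2) = be.
  by apply: eq_Rintegral => w _; rewrite expr2.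
have [n1|n1] := leqP n 1%N.
  have c00 : \sum_(i < n) c i ^+ 2 = 0.
    case: n n1 c0 => [|[|//]] _; first by rewrite !big_ord0.
    by rewrite !big_ord1 => ->; rewrite expr0n.
  rewrite c00 mulr0 mul0r -[leRHS](expect_cst P) le_eqVlt; apply/orP; left; apply/eqP.
  apply: eq_Rintegral => w _; case: n n1 c0 {c00} => [|[|//]] _.
    by rewrite !big_ord0 expr0n mulr0.
  by rewrite !big_ord1 => ->; rewrite mul0r expr0n mulr0.
have moment i j : (i < n)%N -> (j < n)%N ->
    E (fun w => a (Xs w) * (u w i * u w j)) = if i == j then be else al.
  move=> ni nj; have [<-|ij] := eqVneq i j; last exact: exch_expect2.
  have bphi2 : bounded_measurable (fun x => phi x * phi x) by exact: bounded_measurableM.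
  exact: (exch_expect1 ba syma bphi2 ni).
have be0 : 0 <= be.
  by apply: Rintegral_ge0 => w _; rewrite mulr_ge0// -expr2 sqr_ge0.
have alpha : - al <= be.
  have : 0 <= E (fun w => a (Xs w) * (u w 0%N + u w 1%N) ^+ 2).
    by apply: Rintegral_ge0 => w _; rewrite mulr_ge0// sqr_ge0.
  have -> : E (fun w => a (Xs w) * (u w 0%N + u w 1%N) ^+ 2) =
      E (fun w => (a (Xs w) * (u w 0%N * u w 0%N) + a (Xs w) * (u w 0%N * u w 1%N)) +
        (a (Xs w) * (u w 1%N * u w 0%N) + a (Xs w) * (u w 1%N * u w 1%N))).
    by apply: eq_Rintegral => w _; ring.
  rewrite !expectD//; try exact: bounded_measurableD.
  have n0 : (0 < n)%N by exact: ltnW.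
  by rewrite !moment//=; lra.
have -> : E (fun w => a (Xs w) * (\sum_(i < n) c i * u w i) ^+ 2) =
    E (fun w => \sum_(i < n) \sum_(j < n) (c i * c j) * (a (Xs w) * (u w i * u w j))).
  apply: eq_Rintegral => w _; rewrite expr2 big_distrlr /= mulr_sumr.
  apply: eq_bigr => i _; rewrite mulr_sumr; apply: eq_bigr => j _; ring.
have bcc i j : bounded_measurable (fun w => (c i * c j) * (a (Xs w) * (u w i * u w j))).
  by apply: bounded_measurableM => //; exact: bounded_measurable_cst.
rewrite expect_sum; last by move=> i; exact: bounded_measurable_sum.
under eq_bigr.
  move=> i _; rewrite expect_sum//.
  under eq_bigr do rewrite expectZl// moment//.
  over.
have -> : \sum_(i < n) \sum_(j < n) c i * c j * (if val i == val j then be else al) =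
    al * (\sum_(i < n) c i) ^+ 2 + (be - al) * \sum_(i < n) c i ^+ 2.
  rewrite expr2 big_distrlr /= !mulr_sumr -big_split/=; apply: eq_bigr => i _.
  rewrite (bigD1 i)//= eqxx [X in _ = al * X + _](bigD1 i)//=.
  rewrite (eq_bigr (fun j : 'I_n => al * (c i * c j))); last first.
    move=> j ji; rewrite ifF; first by rewrite mulrC.
    by apply/negbTE; rewrite eq_sym.
  by rewrite -mulr_sumr; ring.
have c20 : 0 <= \sum_(i < n) c i ^+ 2 by apply: sumr_ge0 => i _; exact: sqr_ge0.
by rewrite c0 expr0n mulr0 add0r; nra.
Qed.

End exchangeable_moments.

End exchangeable.

Section probability_events.
Context {R : realType} d (T : measurableType d) (P : probability T R).

Definition pr (A : set T) : R := fine (P A).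

Lemma pr_ge0 A : 0 <= pr A.
Proof. exact: fine_ge0. Qed.

Lemma prE A : measurable A -> (\int[P]_w (\1_A w))%R = pr A.
Proof. exact: expect_indic. Qed.

Lemma pr_le A B : measurable A -> measurable B -> A `<=` B -> pr A <= pr B.
Proof.
move=> mA mB AB; apply: fine_le; rewrite ?fin_num_measure//.
by apply: le_measure; rewrite ?inE.
Qed.

Lemma pr_le1 A : measurable A -> pr A <= 1.
Proof.
move=> mA; rewrite -[leRHS]/(fine 1%E) fine_le ?fin_num_measure//.
exact: probability_le1.
Qed.

Lemma pr_setU_le A B : measurable A -> measurable B -> pr (A `|` B) <= pr A + pr B.
Proof.
move=> mA mB; rewrite -lee_fin EFinD !fineK ?fin_num_measure//; last exact: measurableU.
exact: measureU2.
Qed.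

Lemma pr_cover A B C : measurable A -> measurable B -> measurable C ->
  A `<=` B `|` C -> pr A <= pr B + pr C.
Proof.
move=> mA mB mC AB; apply: le_trans (pr_setU_le mB mC).
by apply: pr_le => //; exact: measurableU.
Qed.

End probability_events.

Section second_moment.
Context {R : realType} d (T : measurableType d) (P : probability T R).
Variables (X : nat -> T -> R) (nu : probability R R).
Hypothesis iidX : iid_law P X nu.
Hypotheses (intX : nu.-integrable setT (EFin \o @id R))
  (meanX : (\int[nu]_x x%:E = 0)%E) (varX : (\int[nu]_x (x ^+ 2)%:E = 1)%E).

Let mX i : measurable_fun setT (X i) := iidX.1 i.

Lemma ge0_integral_coord (f : R -> \bar R) i : measurable_fun setT f ->
  (forall x, 0 <= f x)%E -> (\int[P]_w f (X i w) = \int[nu]_x f x)%E.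
Proof.
move=> mf f0.
have injf : injective (fun k => (i + k)%N) by move=> ? ? /addnI.
have iid' := iid_law_reindex iidX injf.
have := iid_integral_scons iid' (Phi := fun s => f (s 0%N)).
rewrite addn0 => -> //; last by apply: measurableT_comp mf _; exact: measurable_coord.
apply: eq_integral => x _ /=.
by rewrite integral_cst//= probability_setT mule1.
Qed.

Lemma integrable_coord i : P.-integrable setT (EFin \o X i).
Proof.
apply/integrableP; split; first exact/measurable_EFinP.
move/integrableP : intX => [_].
have mabs : measurable_fun setT (fun x : R => `|x%:E|%E).
  by apply: measurableT_comp => //; exact/measurable_EFinP.
by rewrite -(ge0_integral_coord i mabs).
Qed.

Lemma mean_coord i : (\int[P]_w (X i w)%:E = 0)%E.
Proof.
have mid : measurable_fun setT (EFin : R -> \bar R) by exact/measurable_EFinP.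
rewrite -meanX integralE [RHS]integralE; congr (_ - _)%E.
  rewrite -(ge0_integral_coord i (measurable_funepos mid)).
    by apply: eq_integral => w _; rewrite !funeposE.
  by move=> x; exact: funepos_ge0.
rewrite -(ge0_integral_coord i (measurable_funeneg mid)).
    by apply: eq_integral => w _; rewrite !funenegE.
  by move=> x; exact: funeneg_ge0.
Qed.

Lemma measurable_ssum_coord (m : nat) (f : nat -> nat) :
  measurable_fun setT (fun w => \sum_(i < m) X (f i) w).
Proof. by apply: measurable_sum => i. Qed.

Lemma integrable_ssum m : P.-integrable setT (fun w => (\sum_(i < m) X i w)%:E).
Proof.
under eq_fun do rewrite -sumEFin.
by apply: integrable_sum => // i _; exact: integrable_coord.
Qed.

Lemma mean_ssum m : (\int[P]_w (\sum_(i < m) X i w)%:E = 0)%E.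
Proof.
under eq_integral do rewrite -sumEFin.
rewrite integral_sum//; last by move=> i; exact: integrable_coord.
by rewrite big1// => i _; exact: mean_coord.
Qed.

Lemma second_moment_ssum m :
  (\int[P]_w ((\sum_(i < m) X i w) ^+ 2)%:E = m%:R%:E)%E.
Proof.
elim: m => [|m IH].
  by under eq_integral do rewrite big_ord0 expr0n/=; rewrite integral0.
have mPhi k : measurable_fun setT (fun s : seqR R => ((ssum s k) ^+ 2)%:E).
  by apply/measurable_EFinP; apply: measurable_funX; exact: measurable_ssum.
have m2 : measurable_fun setT (fun w => ((\sum_(i < m) X i w) ^+ 2)%:E).
  by apply/measurable_EFinP; apply: measurable_funX; exact: (measurable_ssum_coord m id).
have i2 : P.-integrable setT (fun w => ((\sum_(i < m) X i w) ^+ 2)%:E).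
  apply/integrableP; split => //.
  under eq_integral do rewrite gee0_abs ?lee_fin ?sqr_ge0//.
  by rewrite IH ltry.
have i1 := integrable_ssum m.
rewrite (iid_integral_scons iidX (mPhi m.+1)); last first.
  by move=> s; rewrite lee_fin sqr_ge0.
transitivity (\int[nu]_x ((x ^+ 2)%:E + m%:R%:E))%E.
  apply: eq_integral => x _.
  under eq_integral.
    move=> w _; rewrite ssum_scons /ssum sqrrD -mulr_natl mulrA !EFinD [X in (_ + X + _)%E]EFinM; over.
  rewrite integralD//; last first.
    by apply: integrableD => //; [exact: finite_measure_integrable_cst|exact: integrableZl].
  rewrite integralD; [|by []|exact: finite_measure_integrable_cst|exact: integrableZl].
  rewrite integral_cst//= probability_setT mule1 integralZl// mean_ssum mule0 adde0.
  by rewrite IH.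
rewrite ge0_integralD; [|by []|by move=> x _; rewrite lee_fin sqr_ge0|
  by apply/measurable_EFinP; exact: measurable_funX|by move=> x _; rewrite lee_fin|by []].
by rewrite varX integral_cst//= probability_setT mule1 -[m.+1]add1n natrD.
Qed.

Lemma chebyshev_ssum m r : 0 < r ->
  pr P [set w | r <= `|\sum_(i < m) X i w|] <= m%:R / r ^+ 2.
Proof.
move=> r0; have mS := measurable_ssum_coord m id.
have mA : measurable [set w | r <= `|\sum_(i < m) X i w|].
  rewrite -[X in measurable X]setTI; apply: measurable_fun_ler => //.
  exact: measurableT_comp.
rewrite ler_pdivlMr ?exprn_gt0// -lee_fin -second_moment_ssum mulrC EFinM.
rewrite /pr fineK ?fin_num_measure// -[X in (_ * P X)%E]setIT -integral_indic//.
rewrite -ge0_integralZl ?lee_fin ?sqr_ge0//; last first.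
  by apply/measurable_EFinP; exact: measurable_indic.
apply: ge0_le_integral => //.
- by move=> w _; rewrite -EFinM lee_fin mulr_ge0 ?sqr_ge0// indicE ler0n.
- by apply: emeasurable_funM => //; apply/measurable_EFinP; exact: measurable_indic.
- by apply/measurable_EFinP; exact: measurable_funX.
- move=> w _; rewrite -EFinM lee_fin indicE.
  have [|_] := boolP (_ \in _); last by rewrite mulr0 sqr_ge0.
  rewrite inE /= mulr1 => rS; rewrite -[leRHS]real_normK ?num_real//.
  by rewrite lerXn2r ?nnegrE// ltW.
Qed.

End second_moment.

Section resampling.
Context {R : realType} d (T : measurableType d) (P : probability T R).
Variables (X : nat -> T -> R) (nu : probability R R).
Hypothesis iidX : iid_law P X nu.
Hypotheses (intX : nu.-integrable setT (EFin \o @id R))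
  (meanX : (\int[nu]_x x%:E = 0)%E) (varX : (\int[nu]_x (x ^+ 2)%:E = 1)%E).
Variables (n m : nat) (b v kap t1 t2 r d2 : R).
Hypotheses (m0 : (0 < m)%N) (mn : (m <= n)%N) (b0 : 0 <= b) (r0 : 0 < r)
  (v0 : 0 <= v) (kap0 : 0 <= kap).

Local Notation Xs := (trajectory X).
Local Notation E f := (\int[P]_w f w)%R.

Definition truncate (z : R) : R := if `|z| <= b then z else 0.
Definition exceeds (z : R) : R := (b < `|z|)%R%:R.

Lemma bounded_truncate : bounded_measurable truncate.
Proof.
split.
  by apply: measurable_fun_ifT => //; apply: measurable_fun_ler => //; exact: measurableT_comp.
by exists b => z; rewrite /truncate; case: ifP => // _; rewrite normr0.
Qed.

Lemma bounded_exceeds : bounded_measurable exceeds.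
Proof.
apply: bounded_measurable_le1; last by move=> z; rewrite ler0n lern1 leq_b1.
by apply: measurableT_comp => //; apply: measurable_fun_ltr.
Qed.

Lemma truncateE z : exceeds z = 0 -> truncate z = z.
Proof. by rewrite /exceeds /truncate ltNge; case: ifP => // _ /eqP; rewrite oner_eq0. Qed.

Definition truncated_sum (s : nat -> R) := \sum_(i < n) truncate (s i).
Definition truncated_squares (s : nat -> R) := \sum_(i < n) truncate (s i) ^+ 2.
Definition exceedances (s : nat -> R) := \sum_(i < n) exceeds (s i).

Definition regular_sample (s : nat -> R) :=
  [/\ truncated_squares s <= v, exceedances s <= kap & t1 <= truncated_sum s <= t2].

(** The drop of the sum when its first [m] terms are replaced by fresh ones. *)
Definition drop_sum (s : nat -> R) := \sum_(i < m) s i - \sum_(i < m) s (n + i)%N.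

Definition refresh (k : nat) : nat :=
  if (k < m)%N then (n + k)%N else if (n <= k < n + m)%N then (k - n)%N else k.

Lemma refreshK : involutive refresh.
Proof.
move=> k; rewrite /refresh; have [km|mk] := ltnP k m.
  by rewrite ltnNge (leq_trans mn (leq_addr _ _))/= leq_addr ltn_add2l km/= addKn.
case: (boolP (n <= k < n + m)%N) => [/andP[nk knm]|/negbTE nk]; last first.
  by rewrite ltnNge mk/= nk.
by rewrite ltn_subLR// knm subnKC.
Qed.

Lemma ssum_refresh s : ssum (fun k => s (refresh k)) n = ssum s n - drop_sum s.
Proof.
have split_sum (u : nat -> R) :
    \sum_(i < n) u i = \sum_(i < m) u i + \sum_(m <= i < n) u i.
  by rewrite -(big_mkord xpredT u) (big_cat_nat (leq0n m) mn)/= big_mkord.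
rewrite /ssum /drop_sum (split_sum (fun k => s (refresh k))) (split_sum s).
transitivity (\sum_(i < m) s (n + i)%N + \sum_(m <= i < n) s i); last by ring.
congr (_ + _); first by apply: eq_bigr => i _; rewrite /refresh ltn_ord.
apply: eq_big_nat => i /andP[mi ni].
by rewrite /refresh ltnNge mi/= leqNgt ni.
Qed.

Lemma drop_sum_refresh s : drop_sum (fun k => s (refresh k)) = - drop_sum s.
Proof.
rewrite /drop_sum opprB; congr (_ - _); apply: eq_bigr => i _; rewrite /refresh.
  by rewrite ltn_ord.
by rewrite ltnNge (leq_trans mn (leq_addr _ _))/= leq_addr ltn_add2l ltn_ord/= addKn.
Qed.

Lemma measurable_coordC (f : R -> R) i : measurable_fun setT f ->
  measurable_fun setT (fun s : seqR R => f (s i)).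
Proof. by move=> mf; apply: measurableT_comp mf _; exact: measurable_coord. Qed.

Lemma measurable_regular_sample : measurable [set s : seqR R | regular_sample s].
Proof.
have mtr := bounded_truncate.1; have mex := bounded_exceeds.1.
have mT : measurable_fun setT (truncated_sum : seqR R -> R).
  by apply: measurable_sum => i; exact: measurable_coordC.
have mV : measurable_fun setT (truncated_squares : seqR R -> R).
  apply: measurable_sum => i; apply: (@measurable_coordC (fun z => truncate z ^+ 2)).
  exact: measurable_funX.
have mC : measurable_fun setT (exceedances : seqR R -> R).
  by apply: measurable_sum => i; exact: measurable_coordC.
rewrite (_ : mkset _ = [set s | truncated_squares s <= v] `&`
  [set s | exceedances s <= kap] `&` ([set s | t1 <= truncated_sum s] `&`
  [set s | truncated_sum s <= t2])); last first.
  apply/seteqP; split => s /=; first by move=> [? ? /andP[? ?]].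
  by move=> [[? ?] [? ?]]; split => //; apply/andP.
apply: measurableI; apply: measurableI; rewrite -[X in measurable X]setTI;
  exact: measurable_fun_ler.
Qed.

Definition regular_above (x : R) : set (seqR R) :=
  [set s | x <= ssum s n] `&` [set s | regular_sample s].

Lemma measurable_ssum_ge x : measurable [set s : seqR R | x <= ssum s n].
Proof.
rewrite -[X in measurable X]setTI; apply: measurable_fun_ler => //.
exact: measurable_ssum.
Qed.

Lemma measurable_regular_above x : measurable (regular_above x).
Proof. by apply: measurableI; [exact: measurable_ssum_ge|exact: measurable_regular_sample]. Qed.

Lemma measurable_drop_sum : measurable_fun setT (drop_sum : seqR R -> R).
Proof.
by apply: measurable_funB; apply: measurable_sum => i; exact: measurable_coord.
Qed.

Lemma sum_swap (f : R -> R) (s : nat -> R) i j : (i < n)%N -> (j < n)%N ->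
  \sum_(k < n) f (s (swap i j k)) = \sum_(k < n) f (s k).
Proof.
move=> ni nj.
pose h (k : 'I_n) : 'I_n := Ordinal (etrans (swap_lt k ni nj) (ltn_ord k)).
have hK : involutive h by move=> k; apply: val_inj; exact: swapK.
rewrite [RHS](reindex_inj (inv_inj hK)).
by apply: eq_bigr.
Qed.

Lemma symmetric_regular_above x :
  symmetric_in n (\1_(regular_above x) : seqR R -> R).
Proof.
move=> i j s ni nj; rewrite !indicE; congr (nat_of_bool _)%:R.
apply/idP/idP; rewrite !inE /regular_above /regular_sample /= /ssum
  /truncated_sum /truncated_squares /exceedances (sum_swap id)//
  (sum_swap (fun z => truncate z ^+ 2))// (sum_swap exceeds)//
  (sum_swap truncate)//.
Qed.

Section drop_estimate.
Variable y : R.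
Let a : seqR R -> R := \1_(regular_above y).

Let ba : bounded_measurable a.
Proof. by apply: bounded_measurable_indic; exact: measurable_regular_above. Qed.

Let a0 s : 0 <= a s.
Proof. by rewrite /a indicE ler0n. Qed.

Let syma : symmetric_in n a := @symmetric_regular_above y.

Let n0 : (0 < n)%N := leq_trans m0 mn.

Let a_sum_le (phi : R -> R) (c : R) : bounded_measurable phi ->
  (forall s, regular_sample s -> \sum_(i < n) phi (s i) <= c) ->
  n%:R * E (fun w => a (Xs w) * phi (X 0%N w)) <= c * E (fun w => a (Xs w)).
Proof.
move=> bphi phic.
have bA : bounded_measurable (fun w => a (Xs w)) := bounded_trajectory iidX ba.
have bAphi i : bounded_measurable (fun w => a (Xs w) * phi (X i w)).
  by apply: bounded_measurableM => //; exact: (bounded_trajectory iidX (bounded_coord i bphi)).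
have -> : n%:R * E (fun w => a (Xs w) * phi (X 0%N w)) =
    E (fun w => \sum_(i < n) a (Xs w) * phi (X i w)).
  rewrite expect_sum//; under eq_bigr do rewrite (exch_expect1 iidX ba syma bphi)//.
  by rewrite sumr_const card_ord mulr_natl.
rewrite -expectZl//; apply: expect_le.
- exact: bounded_measurable_sum.
- by apply: bounded_measurableM => //; exact: bounded_measurable_cst.
move=> w; rewrite -mulr_sumr mulrC /a indicE.
have [|_] := boolP (_ \in _); last by rewrite !mulr0.
by rewrite inE => -[_ /phic]; rewrite !mulr1.
Qed.

Let exceed_part : E (fun w => \sum_(i < m) a (Xs w) * exceeds (X i w)) <=
  m%:R * kap / n%:R * E (fun w => a (Xs w)).
Proof.
have bAphi i : bounded_measurable (fun w => a (Xs w) * exceeds (X i w)).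
  apply: bounded_measurableM; first exact: (bounded_trajectory iidX ba).
  exact: (bounded_trajectory iidX (bounded_coord i bounded_exceeds)).
rewrite expect_sum//.
under eq_bigr => i _ do rewrite (exch_expect1 iidX ba syma bounded_exceeds
  (leq_trans (ltn_ord i) mn)).
rewrite sumr_const card_ord -[leLHS]mulr_natl.
have := a_sum_le bounded_exceeds (fun s hs => let: And3 _ h _ := hs in h).
rewrite mulrC -ler_pdivlMr ?ltr0n// => h.
apply: le_trans (ler_wpM2l (ler0n _ m) h) _.
by rewrite le_eqVlt; apply/orP; left; apply/eqP; ring.
Qed.

Let head_sum (F : nat -> R) : \sum_(i < n) (i < m)%N%:R * F i = \sum_(i < m) F i.
Proof.
rewrite (big_ord_widen n F mn) [RHS]big_mkcond; apply: eq_bigr => i _.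
by case: ifP => _; rewrite ?mul1r ?mul0r.
Qed.

Let weight (i : nat) : R := (i < m)%N%:R - m%:R / n%:R.

Let nR0 : n%:R != 0 :> R.
Proof. by rewrite pnatr_eq0 -lt0n. Qed.

Let weight_sum (F : nat -> R) : \sum_(i < n) weight i * F i =
  \sum_(i < m) F i - m%:R / n%:R * \sum_(i < n) F i.
Proof.
rewrite -head_sum mulr_sumr -sumrB; apply: eq_bigr => i _.
by rewrite /weight mulrBl.
Qed.

Let weight_sum1 : \sum_(i < n) weight i = 0.
Proof.
under eq_bigr do rewrite -[weight _]mulr1.
by rewrite (weight_sum (fun=> 1)) !sumr_const !card_ord divfK// subrr.
Qed.

Let weight_sum2 : \sum_(i < n) weight i ^+ 2 <= m%:R.
Proof.
under eq_bigr do rewrite expr2.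
rewrite weight_sum weight_sum1 mulr0 subr0.
apply: (@le_trans _ _ (\sum_(i < m) (1 : R))); last by rewrite sumr_const card_ord.
apply: ler_sum => i _; rewrite /weight ltn_ord gerBl.
by rewrite divr_ge0 ?ler0n.
Qed.

Let fluct (s : nat -> R) := \sum_(i < n) weight i * truncate (s i).

(** The part of the truncated sum carried by the resampled terms, centred at its
    share [m / n] of the whole, is controlled by the truncated squares. *)
Let fluct_part : E (fun w => a (Xs w) * (fluct (Xs w) ^+ 2 / r ^+ 2)) <=
  2 * m%:R * v / (n%:R * r ^+ 2) * E (fun w => a (Xs w)).
Proof.
have bsq : bounded_measurable (fun z => truncate z ^+ 2).
  under eq_fun do rewrite expr2.
  by apply: bounded_measurableM; exact: bounded_truncate.
have bfl : bounded_measurable (fun w => a (Xs w) * fluct (Xs w) ^+ 2).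
  apply: bounded_measurableM; first exact: (bounded_trajectory iidX ba).
  have bf : bounded_measurable (fun w => fluct (Xs w)).
    apply: bounded_measurable_sum => i; apply: bounded_measurableM.
      exact: bounded_measurable_cst.
    exact: (bounded_trajectory iidX (bounded_coord i bounded_truncate)).
  by under eq_fun do rewrite expr2; exact: bounded_measurableM.
have := exch_quadratic iidX ba a0 syma bounded_truncate weight_sum1.
have := a_sum_le bsq (fun s hs => let: And3 h _ _ := hs in h).
set q := E (fun w => a (Xs w) * truncate (X 0%N w) ^+ 2) => hq hfl.
have q0 : 0 <= q by apply: Rintegral_ge0 => w _; rewrite mulr_ge0// sqr_ge0.
have r20 : 0 < r ^+ 2 by rewrite exprn_gt0.
have nn0 : 0 < n%:R :> R by rewrite ltr0n.
have -> : E (fun w => a (Xs w) * (fluct (Xs w) ^+ 2 / r ^+ 2)) =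
    (r ^+ 2)^-1 * E (fun w => a (Xs w) * fluct (Xs w) ^+ 2).
  by rewrite -expectZl//; apply: eq_Rintegral => w _; ring.
rewrite mulrC ler_pdivrMr// (le_trans hfl)//.
have -> : 2 * m%:R * v / (n%:R * r ^+ 2) * E (fun w => a (Xs w)) * r ^+ 2 =
    2 * m%:R * (v * E (fun w => a (Xs w)) / n%:R).
  by field; rewrite nR0 gt_eqF.
rewrite -!mulrA ler_wpM2l// ler_pM ?sumr_ge0//; first by move=> i _; exact: sqr_ge0.
by rewrite mulrA ler_pdivlMr// mulrC.
Qed.

Let fresh (s : nat -> R) : R := (r <= `|\sum_(i < m) s (n + i)%N|)%R%:R.

Let bounded_fresh : bounded_measurable (fresh : seqR R -> R).
Proof.
apply: bounded_measurable_le1; last by move=> s; rewrite ler0n lern1 leq_b1.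
apply: measurableT_comp => //; apply: measurable_fun_ler => //.
apply: measurableT_comp => //; apply: measurable_sum => i; exact: measurable_coord.
Qed.

Let a_head (s s' : nat -> R) : (forall i, (i < n)%N -> s i = s' i) -> a s = a s'.
Proof.
move=> ss'; rewrite /a !indicE; congr (nat_of_bool _)%:R.
have sumE (f : R -> R) : \sum_(k < n) f (s k) = \sum_(k < n) f (s' k).
  by apply: eq_bigr => k _; rewrite ss'.
apply/idP/idP; rewrite !inE /regular_above /regular_sample /= /ssum
  /truncated_sum /truncated_squares /exceedances (sumE id)
  (sumE (fun z => truncate z ^+ 2)) (sumE exceeds) (sumE truncate)//.
Qed.

Let fresh_part : E (fun w => a (Xs w) * fresh (Xs w)) <=
  m%:R / r ^+ 2 * E (fun w => a (Xs w)).
Proof.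
have bA : bounded_measurable (fun w => a (Xs w)) := bounded_trajectory iidX ba.
have baf : bounded_measurable (fun s => a s * fresh s) by exact: bounded_measurableM.
pose A := [set w | r <= `|\sum_(i < m) X i w|].
have mA : measurable A.
  rewrite -[X in measurable X]setTI; apply: measurable_fun_ler => //.
  apply: measurableT_comp => //.
  exact: (measurable_ssum_coord iidX m id).
have e : E (fun w => a (Xs w) * fresh (Xs w)) = pr P A * E (fun w => a (Xs w)).
  have b1A : bounded_measurable (\1_A : T -> R) := bounded_measurable_indic mA.
  rewrite -expectZl// -prE//.
  apply: EFin_inj; rewrite !EFin_expect//; last 2 first.
  - by apply: bounded_measurableM => //; exact: bounded_measurable_cst.
  - exact: (bounded_trajectory iidX baf).
  rewrite (@iid_integral_cat _ _ _ _ _ _ iidX n (fun s => (a s * fresh s)%:E)); [|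
    by apply/measurable_EFinP; exact: baf.1|by move=> s; rewrite lee_fin mulr_ge0// ler0n].
  apply: eq_integral => w _; rewrite mulrC EFinM EFin_expect//.
  rewrite -ge0_integralZl; [|by []|by apply/measurable_EFinP; exact: b1A.1|
    by move=> w' _; rewrite lee_fin indicE ler0n|by rewrite lee_fin].
  apply: eq_integral => w' _; rewrite -EFinM; congr (_ * _)%:E.
    by apply: a_head => i ni; rewrite ni.
  rewrite /fresh indicE; congr (nat_of_bool _)%:R.
  under eq_bigr do rewrite ltnNge leq_addr/= addKn.
  by apply/idP/idP; rewrite inE.
rewrite e ler_wpM2r//; first by apply: Rintegral_ge0.
exact: (chebyshev_ssum iidX intX meanX varX).
Qed.

Let drop_bound (s : nat -> R) : 2 * r < m%:R / n%:R * t1 ->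
  m%:R / n%:R * t2 + 2 * r <= d2 -> regular_sample s ->
  ~~ (0 < drop_sum s <= d2) ->
  1 <= \sum_(i < m) exceeds (s i) + fluct s ^+ 2 / r ^+ 2 + fresh s.
Proof.
move=> rt1 rt2 [_ _ /andP[tT Tt]] bad.
have ex0 i : 0 <= exceeds (s i) by rewrite ler0n.
have fl0 : 0 <= fluct s ^+ 2 / r ^+ 2 by rewrite divr_ge0 ?sqr_ge0.
have fr0 : 0 <= fresh s by rewrite ler0n.
have exs0 : 0 <= \sum_(i < m) exceeds (s i) by apply: sumr_ge0.
case: (pselect (exists i : 'I_m, exceeds (s i) = 1)) => [[i ei]|noex].
  have : 1 <= \sum_(i < m) exceeds (s i).
    by rewrite (bigD1 i)//= ei lerDl sumr_ge0.
  by move=> h; lra.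
have [frr|frr] := leP r (`|\sum_(i < m) s (n + i)%N|).
  have -> : fresh s = 1 by rewrite /fresh frr.
  lra.
have [flr|flr] := leP r `|fluct s|.
  have : 1 <= fluct s ^+ 2 / r ^+ 2.
    rewrite ler_pdivlMr ?exprn_gt0// mul1r -[leRHS]real_normK ?num_real//.
    by rewrite lerXn2r ?nnegrE// ltW.
  by move=> h; lra.
exfalso; move/negP : bad; apply.
have eqs : \sum_(i < m) s i = \sum_(i < m) truncate (s i).
  apply: eq_bigr => i _; rewrite truncateE//.
  have : exceeds (s i) <> 1 by move=> h; apply: noex; exists i.
  by rewrite /exceeds; case: (_ < _).
have flE : fluct s = \sum_(i < m) s i - m%:R / n%:R * truncated_sum s.
  by rewrite eqs /fluct (weight_sum (fun i => truncate (s i))).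
have mn0 : 0 <= m%:R / n%:R :> R by rewrite divr_ge0.
have h1 := ler_wpM2l mn0 tT; have h2 := ler_wpM2l mn0 Tt.
move: flr frr; rewrite !ltr_norml /drop_sum flE => /andP[? ?] /andP[? ?].
by apply/andP; split; lra.
Qed.

(** Given a regular sample, replacing [m] terms lowers the sum by an amount
    between [0] and [d2], except with a small conditional probability. *)
Lemma drop_estimate : 2 * r < m%:R / n%:R * t1 -> m%:R / n%:R * t2 + 2 * r <= d2 ->
  pr P [set w | regular_above y (Xs w) /\ ~~ (0 < drop_sum (Xs w) <= d2)] <=
  (m%:R * kap / n%:R + 2 * m%:R * v / (n%:R * r ^+ 2) + m%:R / r ^+ 2) *
  pr P [set w | regular_above y (Xs w)].
Proof.
move=> rt1 rt2.
have mXs := measurable_trajectory iidX.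
have mreg : measurable [set w | regular_above y (Xs w)].
  rewrite -[X in measurable X]setTI; apply: mXs => //; exact: measurable_regular_above.
have mdrop : measurable [set w | 0 < drop_sum (Xs w) <= d2].
  have mD : measurable_fun setT (fun w => drop_sum (Xs w)).
    exact: measurableT_comp measurable_drop_sum mXs.
  rewrite (_ : mkset _ = [set w | 0 < drop_sum (Xs w)] `&` [set w | drop_sum (Xs w) <= d2]).
    by apply: measurableI; rewrite -[X in measurable X]setTI;
      [exact: measurable_fun_ltr|exact: measurable_fun_ler].
  by apply/seteqP; split => w /= => [/andP[]//|[? ?]]; apply/andP.
have mbad : measurable [set w | regular_above y (Xs w) /\ ~~ (0 < drop_sum (Xs w) <= d2)].
  rewrite (_ : mkset _ = [set w | regular_above y (Xs w)] `\`
    [set w | 0 < drop_sum (Xs w) <= d2]); first exact: measurableD.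
  by apply/seteqP; split => w /= [? /negP].
have bA : bounded_measurable (fun w => a (Xs w)) := bounded_trajectory iidX ba.
have b1 : bounded_measurable (fun w => \sum_(i < m) a (Xs w) * exceeds (X i w)).
  apply: bounded_measurable_sum => i; apply: bounded_measurableM => //.
  exact: (bounded_trajectory iidX (bounded_coord i bounded_exceeds)).
have b2 : bounded_measurable (fun w => a (Xs w) * (fluct (Xs w) ^+ 2 / r ^+ 2)).
  apply: bounded_measurableM => //.
  have bf : bounded_measurable (fun w => fluct (Xs w)).
    apply: bounded_measurable_sum => i; apply: bounded_measurableM.
      exact: bounded_measurable_cst.
    exact: (bounded_trajectory iidX (bounded_coord i bounded_truncate)).
  apply: bounded_measurableM; last exact: bounded_measurable_cst.
  by under eq_fun do rewrite expr2; exact: bounded_measurableM.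
have b3 : bounded_measurable (fun w => a (Xs w) * fresh (Xs w)).
  by apply: bounded_measurableM => //; exact: (bounded_trajectory iidX bounded_fresh).
have -> : pr P [set w | regular_above y (Xs w)] = E (fun w => a (Xs w)).
  by rewrite -prE.
rewrite -prE// [leRHS]mulrDl [X in _ <= X + _]mulrDl.
apply: (@le_trans _ _ (E (fun w => (\sum_(i < m) a (Xs w) * exceeds (X i w) +
    a (Xs w) * (fluct (Xs w) ^+ 2 / r ^+ 2)) + a (Xs w) * fresh (Xs w)))).
  apply: expect_le; first exact: bounded_measurable_indic.
    by apply: bounded_measurableD => //; exact: bounded_measurableD.
  move=> w; rewrite indicE; have [|_] := boolP (_ \in _).
    rewrite inE /= => -[rg bad]; have := drop_bound rt1 rt2 rg.2 bad.
    by rewrite /a indicE mem_set//= -mulr_sumr !mul1r.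
  rewrite !addr_ge0//; first by apply: sumr_ge0 => i _; rewrite mulr_ge0// ler0n.
    by rewrite mulr_ge0// divr_ge0 ?sqr_ge0.
  by rewrite mulr_ge0// ler0n.
rewrite expectD//; last exact: bounded_measurableD.
rewrite expectD//; apply: lerD; last exact: fresh_part.
by apply: lerD; [exact: exceed_part|exact: fluct_part].
Qed.

End drop_estimate.

Let mpre (B : set (seqR R)) : measurable B -> measurable [set w | B (Xs w)].
Proof.
move=> mB; rewrite -[X in measurable X]setTI.
exact: (measurable_trajectory iidX).
Qed.

Let mitv (f : seqR R -> R) (c c' : R) : measurable_fun setT f ->
  measurable [set s : seqR R | c < f s <= c'].
Proof.
move=> mf; rewrite (_ : mkset _ = [set s : seqR R | c < f s] `&` [set s | f s <= c']).
  by apply: measurableI; rewrite -[X in measurable X]setTI;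
    [exact: measurable_fun_ltr|exact: measurable_fun_ler].
by apply/seteqP; split => s /= => [/andP[]//|[? ?]]; apply/andP.
Qed.

Let mdrop (c c' : R) : measurable [set s : seqR R | c < drop_sum s <= c'] :=
  @mitv _ c c' measurable_drop_sum.

Let refresh_pr x : pr P [set w | x <= ssum (Xs w) n /\ 0 < drop_sum (Xs w) <= d2] =
  pr P [set w | x <= ssum (Xs w) n - drop_sum (Xs w) /\ 0 < - drop_sum (Xs w) <= d2].
Proof.
pose B := [set s : seqR R | x <= ssum s n] `&` [set s | 0 < drop_sum s <= d2].
have mB : measurable B by apply: measurableI => //; exact: measurable_ssum_ge.
have mXs := measurable_trajectory iidX.
have mXr : measurable_fun setT (fun w => (fun k => X (refresh k) w) : seqR R).
  by apply: measurable_seqP => i; exact: iidX.1.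
have e := expect_reindex iidX (inv_inj refreshK) (bounded_measurable_indic mB).
transitivity (pr P (Xs @^-1` B)); first by [].
rewrite -prE; last exact: mpre.
transitivity (E (fun w => \1_B (Xs w) : R)); first by [].
rewrite e; transitivity (pr P ((fun w => (fun k => X (refresh k) w) : seqR R) @^-1` B)).
  rewrite -prE//; rewrite -[X in measurable X]setTI; exact: mXr.
congr (pr P _); apply/seteqP; split => w /=.
  move=> [xS D]; move: xS D; rewrite /= (ssum_refresh (Xs w)) (drop_sum_refresh (Xs w)).
  by [].
move=> [xS D]; split => /=; first by rewrite (ssum_refresh (Xs w)).
by rewrite (drop_sum_refresh (Xs w)).
Qed.

(** The sum and its refreshed version form an exchangeable pair. A high value of
    the sum typically drops, and drops are as frequent as the reverse rises, which
    are untypical for the lower values where they start. Hence the tail is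
    controlled by the window just below it. *)
Lemma resampling_tail x : 0 <= d2 -> 2 * r < m%:R / n%:R * t1 -> m%:R / n%:R * t2 + 2 * r <= d2 ->
  m%:R * kap / n%:R + 2 * m%:R * v / (n%:R * r ^+ 2) + m%:R / r ^+ 2 <= 4^-1 ->
  pr P [set w | x <= ssum (Xs w) n] <=
  3 * pr P [set w | x - d2 <= ssum (Xs w) n /\ ~ regular_sample (Xs w)] +
  pr P [set w | x - d2 <= ssum (Xs w) n < x].
Proof.
move=> d20 rt1 rt2 rho4.
have mreg := measurable_regular_above.
have mge := measurable_ssum_ge.
have mirr y : measurable [set w | y <= ssum (Xs w) n /\ ~ regular_sample (Xs w)].
  apply: (mpre (B := [set s : seqR R | y <= ssum s n] `\` [set s | regular_sample s])).
  by apply: measurableD => //; exact: measurable_regular_sample.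
have mwin : measurable [set w | x - d2 <= ssum (Xs w) n < x].
  rewrite (_ : mkset _ = [set w | x - d2 <= ssum (Xs w) n] `\` [set w | x <= ssum (Xs w) n]).
    by apply: measurableD; exact: (mpre (mge _)).
  apply/seteqP; split => w /=; first by move=> /andP[-> h]; split => //; apply/negP; rewrite -ltNge.
  by move=> [-> /negP]; rewrite -ltNge.
have mS y : measurable [set w | y <= ssum (Xs w) n] by exact: (mpre (mge y)).
have mR y : measurable [set w | regular_above y (Xs w)] by exact: (mpre (mreg y)).
have mbad y : measurable
    [set w | regular_above y (Xs w) /\ ~~ (0 < drop_sum (Xs w) <= d2)].
  rewrite (_ : mkset _ = [set w | regular_above y (Xs w)] `\`
    [set w | 0 < drop_sum (Xs w) <= d2]).
    by apply: measurableD; [exact: mR|exact: (mpre (mdrop 0 d2))].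
  by apply/seteqP; split => w /= [? /negP].
have mgood : measurable [set w | x <= ssum (Xs w) n /\ 0 < drop_sum (Xs w) <= d2].
  by apply: measurableI; [exact: mS|exact: (mpre (mdrop 0 d2))].
have mrise : measurable
    [set w | x <= ssum (Xs w) n - drop_sum (Xs w) /\ 0 < - drop_sum (Xs w) <= d2].
  have mD : measurable_fun setT (fun s : seqR R => - drop_sum s).
    by apply: measurableT_comp => //; exact: measurable_drop_sum.
  apply: (mpre (B := [set s | x <= ssum s n - drop_sum s] `&`
    [set s | 0 < - drop_sum s <= d2])).
  apply: measurableI; last exact: mitv.
  rewrite -[X in measurable X]setTI; apply: measurable_fun_ler => //.
  by apply: measurable_funB; [exact: measurable_ssum|exact: measurable_drop_sum].
set e := pr P [set w | x - d2 <= ssum (Xs w) n /\ ~ regular_sample (Xs w)].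
set W := pr P [set w | x - d2 <= ssum (Xs w) n < x].
set rho := (X in X <= 4^-1) in rho4.
pose A := pr P [set w | regular_above x (Xs w)].
pose B := pr P [set w | regular_above (x - d2) (Xs w)].
have A0 : 0 <= A := pr_ge0 P _.
have B0 : 0 <= B := pr_ge0 P _.
have h1 : A <= pr P [set w | x <= ssum (Xs w) n /\ 0 < drop_sum (Xs w) <= d2] + rho * A.
  apply: le_trans (lerD (lexx _) (drop_estimate x rt1 rt2)).
  apply: pr_cover => // w [xS rg].
  by case: (boolP (0 < drop_sum (Xs w) <= d2)) => D; [left|right].
have h2 : pr P [set w | x <= ssum (Xs w) n /\ 0 < drop_sum (Xs w) <= d2] <= e + rho * B.
  rewrite refresh_pr; apply: le_trans (lerD (lexx _) (drop_estimate (x - d2) rt1 rt2)).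
  apply: pr_cover => // w /= [xS /andP[D0 Dd]].
  have xS' : x - d2 <= ssum (Xs w) n by lra.
  case: (pselect (regular_sample (Xs w))) => rg; [right|left] => //.
  by split => //; rewrite negb_and -!leNgt -ltNge; apply/orP; left; lra.
have h3 : B <= A + W.
  apply: pr_cover => // w [xS rg]; case: (leP x (ssum (Xs w) n)) => xw.
    by left.
  by right; rewrite /= xS xw.
have h4 : pr P [set w | x <= ssum (Xs w) n] <= A + e.
  apply: pr_cover => // w xS; case: (pselect (regular_sample (Xs w))) => rg; [left|right] => //.
  by split => //; apply: le_trans xS; rewrite gerBl.
have h5 : rho * A <= 4^-1 * A by exact: ler_wpM2r.
have h6 : rho * B <= 4^-1 * B by exact: ler_wpM2r.
have W0 : 0 <= W := pr_ge0 P _.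
have e0 : 0 <= e := pr_ge0 P _.
lra.
Qed.

End resampling.

(** * Products of small tail probabilities *)

Section pow_exp.
Context {R : realType}.

Lemma pow_onem_le (a : R) (p : nat) : 0 <= a <= 1 -> (1 - a) ^+ p <= expR (- (p%:R * a)).
Proof.
move=> /andP[a0 a1]; rewrite -mulrN expRM_natl lerXn2r ?nnegrE ?expR_ge0 ?subr_ge0//.
exact: expR_ge1Dx.
Qed.

Lemma pow_onem_ge (a : R) (p : nat) : 0 <= a < 1 ->
  expR (- (p%:R * (a / (1 - a)))) <= (1 - a) ^+ p.
Proof.
move=> /andP[a0 a1]; have a10 : 0 < 1 - a by rewrite subr_gt0.
rewrite -mulrN expRM_natl; apply: lerXn2r; rewrite ?nnegrE ?expR_ge0 ?(ltW a10)//.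
rewrite expRN invf_ple ?posrE ?expR_gt0//.
apply: le_trans (expR_ge1Dx _).
by rewrite le_eqVlt; apply/orP; left; apply/eqP; field; rewrite gt_eqF.
Qed.

Variables (p : nat -> nat) (a : nat -> R) (A : R).
Hypotheses (p_infty : p n @[n --> \oo] --> \oo) (a01 : forall n, 0 <= a n <= 1).

Let pR_infty : (p n)%:R @[n --> \oo] --> (+oo%R : set_system R).
Proof. exact: cvg_comp p_infty cvgr_idn. Qed.

Let vanish : (exists M, \forall n \near \oo, (p n)%:R * a n <= M) -> a n @[n --> \oo] --> 0.
Proof.
move=> [M paM]; have invp : M * ((p n)%:R : R)^-1 @[n --> \oo] --> 0.
  rewrite -[X in _ --> X](mulr0 M); apply: cvgM; first exact: cvg_cst.
  by apply/gtr0_cvgV0 => //; near=> n; rewrite ltr0n; near: n; exact: p_infty (nbhs_infty_gt 0%N).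
apply: (@squeeze_cvgr _ _ _ _ (fun=> 0) (fun n => M * ((p n)%:R : R)^-1)) => //; last exact: cvg_cst.
near=> n; have /andP[-> _] /= := a01 n.
have pn0 : 0 < (p n)%:R :> R.
  by rewrite ltr0n; near: n; exact: p_infty (nbhs_infty_gt 0%N).
rewrite ler_pdivlMr// mulrC; near: n; exact: paM.
Unshelve. all: by end_near. Qed.

Let pow_bounds : a n @[n --> \oo] --> 0 -> \forall n \near \oo,
  expR (- ((p n)%:R * (a n / (1 - a n)))) <= (1 - a n) ^+ p n <= expR (- ((p n)%:R * a n)).
Proof.
move=> acvg; near=> n; rewrite pow_onem_le// andbT pow_onem_ge//.
have /andP[-> _] /= := a01 n.
by near: n; apply: (cvgr_lt _ acvg).
Unshelve. all: by end_near. Qed.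

(** The powers lie between [exp (- p a / (1 - a))] and [exp (- p a)]. *)
Lemma pow_onem_cvg : (p n)%:R * a n @[n --> \oo] --> A ->
  (1 - a n) ^+ p n @[n --> \oo] --> expR (- A).
Proof.
move=> paA.
have acvg : a n @[n --> \oo] --> 0.
  apply: vanish; exists (A + 1).
  by apply: (cvgr_le _ paA); rewrite ltrDl.
apply: (@squeeze_cvgr _ _ _ _ (fun n => expR (- ((p n)%:R * (a n / (1 - a n)))))
  (fun n => expR (- ((p n)%:R * a n)))).
- exact: pow_bounds.
- apply: continuous_cvg; first exact: continuous_expR.
  have inv1 : (1 - a n)^-1 @[n --> \oo] --> ((1 - 0)^-1 : R).
    apply: cvgV; first by rewrite subr0 oner_eq0.
    by apply: cvgB => //; exact: cvg_cst.
  have := cvgM paA inv1; rewrite subr0 invr1 mulr1 => h.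
  apply: cvgN; under eq_cvg do rewrite mulrA.
  exact: h.
- by apply: continuous_cvg; [exact: continuous_expR|exact: cvgN].
Qed.

Lemma pow_onem_cvg_inv : (1 - a n) ^+ p n @[n --> \oo] --> expR (- A) ->
  (p n)%:R * a n @[n --> \oo] --> A.
Proof.
move=> powA.
pose l n := - ln ((1 - a n) ^+ p n).
have lA : l n @[n --> \oo] --> A.
  rewrite -[A]opprK -[- A]expRK; apply: cvgN; apply: continuous_cvg => //.
  by apply: continuous_ln; exact: expR_gt0.
have pos : \forall n \near \oo, 0 < (1 - a n) ^+ p n.
  by apply: (cvgr_gt _ powA); exact: expR_gt0.
have pal : \forall n \near \oo, (p n)%:R * a n <= l n.
  near=> n; rewrite /l lerNr -ler_expR lnK ?posrE; last by near: n.
  exact: pow_onem_le.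
have acvg : a n @[n --> \oo] --> 0.
  apply: vanish; exists (A + 1); near=> n.
  apply: (@le_trans _ _ (l n)); first by near: n.
  by near: n; apply: (cvgr_le _ lA); rewrite ltrDl.
apply: (@squeeze_cvgr _ _ _ _ (fun n => (1 - a n) * l n) l) => //.
  near=> n; apply/andP; split; last by near: n.
  have a1 : a n < 1 by near: n; apply: (cvgr_lt _ acvg).
  have := @pow_onem_ge (a n) (p n); have /andP[a0 _] := a01 n.
  rewrite a0 a1 => /(_ isT); rewrite -[(1 - a n) ^+ p n]lnK ?posrE; last by near: n.
  rewrite ler_expR lerNl -/(l n) mulrA => h.
  rewrite mulrC; have {}h : l n <= (p n)%:R * a n / (1 - a n) by [].
  by rewrite -ler_pdivlMr// subr_gt0.
have one : 1 - a n @[n --> \oo] --> (1 - 0 : R).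
  by apply: cvgB => //; exact: cvg_cst.
have h := cvgM one lA; rewrite subr0 mul1r in h; exact: h.
Unshelve. all: by end_near. Qed.

End pow_exp.

Section iid_products.
Context {R : realType} d (T : measurableType d) (P : probability T R).
Variables (Y : nat -> T -> R) (nu : probability R R).
Hypothesis iidY : iid_law P Y nu.

Lemma ge0_integral_iid_prod (g : R -> R) n : measurable_fun setT g -> (forall x, 0 <= g x) ->
  (\int[P]_w (\prod_(i < n) g (Y i w))%:E = \prod_(i < n) \int[nu]_x (g x)%:E)%E.
Proof.
move=> mg g0; have mprod k : measurable_fun setT
    (fun s : seqR R => (\prod_(i < k) g (s i))%:E).
  apply/measurable_EFinP; apply: measurable_prod => i _.
  exact: measurableT_comp mg (measurable_coord i).
elim: n => [|n IH].
  rewrite big_ord0; under eq_integral do rewrite big_ord0.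
  by rewrite integral_cst//= probability_setT mule1.
rewrite (iid_integral_scons iidY (mprod n.+1)); last first.
  by move=> s; rewrite lee_fin prodr_ge0.
rewrite big_ord_recl -IH.
have I0 : (0 <= \int[P]_w (\prod_(i < n) g (Y i w))%:E)%E.
  by apply: integral_ge0 => w _; rewrite lee_fin prodr_ge0.
rewrite -ge0_integralZr//; last 2 first.
- exact/measurable_EFinP.
- by move=> x _; rewrite lee_fin.
apply: eq_integral => x _.
transitivity (\int[P]_w ((g x)%:E * (\prod_(i < n) g (Y i w))%:E))%E.
  by apply: eq_integral => w _; rewrite big_ord_recl -EFinM.
rewrite ge0_integralZl ?lee_fin//.
- exact: measurableT_comp (mprod n) (measurable_iid iidY).
- by move=> w _; rewrite lee_fin prodr_ge0.
Qed.

Lemma expect_iid_prod (g : R -> R) n : measurable_fun setT g -> (forall x, 0 <= g x <= 1) ->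
  (\int[P]_w (\prod_(i < n) g (Y i w)) = (\int[nu]_x g x) ^+ n)%R.
Proof.
move=> mg g01; have g0 x : 0 <= g x by have /andP[] := g01 x.
rewrite /Rintegral ge0_integral_iid_prod//.
have bg : bounded_measurable g by exact: bounded_measurable_le1.
under eq_bigr do rewrite -(EFin_expect nu bg).
by rewrite prodEFin /= prodr_const card_ord.
Qed.

End iid_products.

Lemma measurable_le_set {R : realType} d (T : measurableType d) (f : T -> R) (u : R) : measurable_fun setT f ->
  measurable [set w | u <= f w].
Proof.
move=> mf; rewrite (_ : [set w | _] = f @^-1` `[u, +oo[%classic).
  by rewrite -[X in measurable X]setTI; exact: mf.
by apply/seteqP; split => w /=; rewrite in_itv/= andbT.
Qed.

Lemma measurable_lt_set {R : realType} d (T : measurableType d) (f : T -> R) (u : R) :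
  measurable_fun setT f -> measurable [set w | u < f w].
Proof.
move=> mf; rewrite (_ : [set w | _] = f @^-1` `]u, +oo[%classic).
  by rewrite -[X in measurable X]setTI; exact: mf.
by apply/seteqP; split => w /=; rewrite in_itv/= andbT.
Qed.

(** * The Gaussian tail *)

Section mills.
Context {R : realType}.
Local Notation mu := (@lebesgue_measure R).
Local Notation phi := (@normal_pdf R 0 1).

Lemma normal_pdf01 x : phi x = normal_peak 1 * expR (- (x ^+ 2 / 2)).
Proof.
rewrite normal_pdfE ?oner_neq0// /normal_fun subr0 expr1n.
by rewrite mulNr.
Qed.

Let is_derive_cast (f : R -> R) (x a b : R) :
  is_derive x (1 : R) f a -> a = b -> is_derive x (1 : R) f b.
Proof. by move=> ? <-. Qed.

Let is_derive_phi x : is_derive x (1 : R) (phi : R -> R) (- x * phi x).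
Proof.
rewrite (_ : (phi : R -> R) = fun x => normal_peak 1 * expR (- (x ^+ 2 / 2))); last first.
  by apply/funext => y; rewrite normal_pdf01.
have h : is_derive x (1:R) (fun y : R => - (y ^+ 2 / 2)) (- x).
  have hX : is_derive x (1:R) (fun y : R => y ^+ 2) (2 * x).
    rewrite (_ : (fun y : R => y ^+ 2) = (id : R -> R) ^+ 2); last first.
      by apply/funext => y; rewrite exprfctE.
    by apply: is_derive_cast (_ : _ = _); rewrite /GRing.scale /= expr1 mulr1 mulr_natl.
  pose f := fun y : R => - 2^-1 * y ^+ 2.
  rewrite (_ : (fun y : R => - (y ^+ 2 / 2)) = f); last first.
    by apply/funext => y; rewrite /f mulNr mulrC.
  apply: is_derive_cast (is_deriveZ (- 2^-1) hX) _.
  by rewrite /GRing.scale /= mulNr mulKf ?pnatr_eq0.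
have h2 := @is_derive1_comp R expR (fun y : R => - (y ^+ 2 / 2)) x _ _ (is_derive_expR _) h.
apply: is_derive_cast (is_deriveZ (normal_peak 1) h2) _.
by rewrite /GRing.scale /=; ring.
Qed.

Let is_derive_ratio (x : R) : 0 < x ->
  is_derive x (1 : R) (fun y => - (phi y / y)) (phi x * (1 + x ^- 2)).
Proof.
move=> x0; have hV : is_derive x (1:R) (fun y : R => y^-1) (- x ^- 2).
  apply: is_derive_cast (is_deriveV (lt0r_neq0 x0) (is_derive_id x (1:R))) _.
  by rewrite /GRing.scale /= mulr1.
have h := is_deriveN (is_deriveM (is_derive_phi x) hV).
apply: is_derive_cast h _; rewrite /GRing.scale /=; field; exact: lt0r_neq0.
Qed.

Let continuous_mills_density (y : R) : 0 < y ->
  {within `[y, +oo[, continuous (fun x => phi x * (1 + x ^- 2))}.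
Proof.
move=> y0; apply: continuous_in_subspaceT => x; rewrite inE /= in_itv/= andbT => yx.
apply: cvgM; first by apply: continuous_normal_pdf; exact: oner_neq0.
apply: cvgD; first exact: cvg_cst.
apply: cvgV; last exact: exprn_continuous.
by rewrite expf_neq0// gt_eqF// (lt_le_trans y0).
Qed.

Let is_derive_mills (y : R) : 0 < y ->
  (\int[mu]_(x in `[y, +oo[) (phi x * (1 + x ^- 2))%:E = (phi y / y)%:E)%E.
Proof.
move=> y0; have gt0 x : y <= x -> 0 < x by exact: lt_le_trans.
rewrite (@ge0_continuous_FTC2y R (fun x => phi x * (1 + x ^- 2)) (fun x => - (phi x / x)) y 0).
- by rewrite EFinN oppeK add0e.
- by move=> x /gt0 x0; rewrite mulr_ge0 ?normal_pdf_ge0// addr_ge0// invr_ge0 exprn_ge0// ltW.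
- exact: continuous_mills_density.
- rewrite -oppr0; apply: cvgN.
  have inv0 : x^-1 @[x --> +oo] --> (0 : R) by exact/gtr0_cvgV0/cvg_id/nbhs_pinfty_gt.
  apply: (@squeeze_cvgr _ _ _ _ (fun=> 0) (fun x => normal_peak 1 * x^-1)).
  + near=> x; have x0 : 0 < x by near: x; exact: nbhs_pinfty_gt.
    rewrite divr_ge0 ?normal_pdf_ge0 ?(ltW x0)//=.
    by rewrite ler_wpM2r ?invr_ge0 ?(ltW x0)// normal_pdf_ub ?oner_neq0.
  + exact: cvg_cst.
  + by rewrite -(mulr0 (normal_peak (1 : R))); apply: cvgM => //; exact: cvg_cst.
- by move=> x yx; have [] := is_derive_ratio (gt0 _ (ltW yx)).
- have cF : {for y, continuous (fun x => - (phi x / x))}.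
    apply: differentiable_continuous; apply/derivable1_diffP.
    by have [] := is_derive_ratio y0.
  exact: cvg_at_right_filter cF.
- move=> x; rewrite in_itv/= andbT => yx; rewrite derive1E.
  by have [_ ->] := is_derive_ratio (gt0 _ (ltW yx)).
Unshelve. all: by end_near. Qed.

Let Phibar_integral (y : R) : ((Phibar y)%:E = \int[mu]_(x in `[y, +oo[) (phi x)%:E)%E.
Proof.
rewrite /Phibar /Phi.
have -> : (\int[mu]_(x in `[y, +oo[) (phi x)%:E = normal_prob 0 1 `[y, +oo[)%E by [].
have -> : (normal_prob 0 1 `[y, +oo[ = normal_prob 0 1 `]y, +oo[ :> \bar R)%E.
  by rewrite /normal_prob integral_itv_obnd_cbnd//; apply: measurable_funTS;
    apply/measurable_EFinP; exact: measurable_normal_pdf.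
have pf : normal_prob (0 : R) 1 `]-oo, y] \is a fin_num.
  by apply: fin_num_measure; exact: measurable_itv.
rewrite -setCitvl [RHS]probability_setC; last exact: measurable_itv.
by rewrite EFinB fineK.
Qed.

(** [phi y / y] is the integral of [phi u (1 + u^-2)] over [u >= y]. *)
Lemma Phibar_bounds (y : R) : 0 < y ->
  phi y / y / (1 + y ^- 2) <= Phibar y <= phi y / y.
Proof.
move=> y0; have gt0 x : y <= x -> 0 < x by exact: lt_le_trans.
have mphi : measurable_fun `[y, +oo[ (EFin \o phi).
  by apply/measurable_EFinP; apply: measurable_funTS; exact: measurable_normal_pdf.
have m2 : measurable_fun `[y, +oo[ (fun x => (phi x * (1 + x ^- 2))%:E).
  apply/measurable_EFinP; apply: subspace_continuous_measurable_fun => //.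
  exact: continuous_mills_density.
have yV : 0 < 1 + y ^- 2 by rewrite addr_gt0// invr_gt0 exprn_gt0.
apply/andP; split.
  rewrite ler_pdivrMr// -lee_fin -(is_derive_mills y0) mulrC EFinM Phibar_integral.
  rewrite -ge0_integralZl//=.
  - apply: ge0_le_integral => //=.
    + by move=> x /=; rewrite in_itv/= andbT => /gt0 x0; rewrite lee_fin mulr_ge0 ?normal_pdf_ge0// addr_ge0// invr_ge0 exprn_ge0// ltW.
    + by apply: measurable_funeM.
    + move=> x /=; rewrite in_itv/= andbT => yx; have x0 := gt0 _ yx.
      rewrite lee_fin mulrC ler_wpM2r ?normal_pdf_ge0// lerD2l.
      by rewrite lef_pV2 ?posrE ?exprn_gt0// lerXn2r ?nnegrE ?(ltW x0) ?(ltW y0).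
  - by move=> x _; rewrite lee_fin normal_pdf_ge0.
  - by rewrite lee_fin ltW.
rewrite -lee_fin -(is_derive_mills y0) Phibar_integral.
apply: ge0_le_integral => //=.
- by move=> x _; rewrite lee_fin normal_pdf_ge0.
- move=> x /=; rewrite in_itv/= andbT => /gt0 x0.
  by rewrite lee_fin ler_peMr ?normal_pdf_ge0// lerDl invr_ge0 exprn_ge0// ltW.
Qed.

End mills.

(** * Gaussian tails at the extreme value scale *)

Lemma cvg_eq_near {T : Type} {U : topologicalType} (F : set_system T) {FF : Filter F}
    (f g : T -> U) (l : U) :
  f @ F --> l -> (\forall x \near F, f x = g x) -> g @ F --> l.
Proof.
move=> fl fg; apply: cvg_trans fl; apply: near_eq_cvg.
by apply: filterS fg => x.
Qed.

Section gaussian_norming.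
Context {R : realType}.
Implicit Types L x : R.

Let k0 : R := ln (4 * pi).

(** The norming constant as a function of the logarithm of the sample size. *)
Definition norming_log L : R :=
  Num.sqrt (2 * L) - (ln L + ln (4 * pi)) / (2 * Num.sqrt (2 * L)).

Lemma sqrt_cvgy : Num.sqrt L @[L --> +oo] --> (+oo%R : set_system R).
Proof.
apply/cvgryPge => M; near=> L.
apply: (@le_trans _ _ (Num.sqrt (M ^+ 2))); first by rewrite sqrtr_sqr ler_norm.
by apply: ler_wsqrtr; near: L; exact: nbhs_pinfty_ge (num_real _).
Unshelve. all: by end_near. Qed.

Let cvg_sqrtV : (Num.sqrt L)^-1 @[L --> +oo] --> (0 : R).
Proof.
apply/gtr0_cvgV0; last exact: sqrt_cvgy.
by near=> L; rewrite sqrtr_gt0; near: L; exact: nbhs_pinfty_gt.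
Unshelve. all: by end_near. Qed.

Lemma log_sqrt_cvg0 (k : R) : (ln L + k) / Num.sqrt L @[L --> +oo] --> (0 : R).
Proof.
pose u L := Num.sqrt (Num.sqrt L).
have uV : (u L)^-1 @[L --> +oo] --> (0 : R) by exact: cvg_comp sqrt_cvgy cvg_sqrtV.
have bnd : (4 + `|k|) * (u L)^-1 @[L --> +oo] --> (0 : R).
  by rewrite -(mulr0 (4 + `|k|)); apply: cvgM => //; exact: cvg_cst.
apply/cvgr0Pnorm_le => e e0; near=> L.
have L1 : 1 <= L by near: L; exact: nbhs_pinfty_ge.
have L0 : 0 < L by exact: lt_le_trans L1.
have u1 : 1 <= u L by rewrite -sqrtr1 ler_wsqrtr// -sqrtr1 ler_wsqrtr.
have u0 : 0 < u L by exact: lt_le_trans u1.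
have uu : u L ^+ 2 = Num.sqrt L by rewrite /u sqr_sqrtr// sqrtr_ge0.
have u4 : u L ^+ 4 = L by rewrite (exprM _ 2 2) uu sqr_sqrtr// ltW.
apply: (@le_trans _ _ ((4 + `|k|) * (u L)^-1)); last first.
  near: L; move/cvgr0Pnorm_le : bnd => /(_ _ e0); apply: filterS => L'.
  by apply: le_trans; rewrite ler_norm.
rewrite normrM normfV -uu (ger0_norm (exprn_ge0 _ (ltW u0))) ler_pdivrMr ?exprn_gt0//.
rewrite expr2 mulrA mulfVK ?gt_eqF// mulrDl.
apply: le_trans (ler_normD _ _) _; apply: lerD; last by rewrite ler_peMr.
rewrite ger0_norm ?ln_ge0//.
have -> : ln L = 4 * ln (u L) by rewrite -[in LHS]u4 lnXn// mulr_natl.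
by rewrite ler_wpM2l//; exact/ltW/ln_sublinear.
Unshelve. all: by end_near. Qed.

Lemma norming_log_sqrt : norming_log L / Num.sqrt L @[L --> +oo] --> (Num.sqrt 2 : R).
Proof.
have h : Num.sqrt 2 - (ln L + k0) / Num.sqrt L * ((Num.sqrt L)^-1 * (2 * Num.sqrt 2)^-1)
    @[L --> +oo] --> (Num.sqrt 2 - 0 * (0 * (2 * Num.sqrt 2)^-1) : R).
  apply: cvgB; first exact: cvg_cst.
  apply: cvgM; first exact: log_sqrt_cvg0.
  by apply: cvgM => //; exact: cvg_cst.
rewrite mul0r subr0 in h.
refine (cvg_eq_near h _); near=> L.
have L0 : 0 < L by near: L; exact: nbhs_pinfty_gt.
have s0 : Num.sqrt L != 0 by rewrite gt_eqF// sqrtr_gt0.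
have s2 : Num.sqrt 2 != 0 :> R by rewrite gt_eqF// sqrtr_gt0.
rewrite /norming_log sqrtrM// -/k0 /=; move: s0 s2; set a := Num.sqrt L; set b := Num.sqrt 2.
by move=> s0 s2; field; rewrite s0 s2.
Unshelve. all: by end_near. Qed.

Lemma norming_log_cvgy : norming_log L @[L --> +oo] --> (+oo%R : set_system R).
Proof.
apply/cvgryPge => M; near=> L.
have L0 : 0 < L by near: L; exact: nbhs_pinfty_gt.
apply: (@le_trans _ _ (Num.sqrt L)).
  by near: L; exact: (cvgry_ge sqrt_cvgy).
have : 1 <= norming_log L / Num.sqrt L.
  near: L; apply: (cvgr_ge _ norming_log_sqrt).
  by rewrite -[ltLHS]sqrtr1 ltr_sqrt// ltr1n.
by rewrite ler_pdivlMr ?sqrtr_gt0// mul1r.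
Unshelve. all: by end_near. Qed.

(** The last term is negligible, and the square [2 L - ln L - ln (4 pi)] is the
    one at which the normal density equals [sqrt (2 L) * exp (- L)]. *)
Lemma norming_log_sqr L : 0 < L -> norming_log L ^+ 2 =
  2 * L - (ln L + ln (4 * pi)) + (ln L + ln (4 * pi)) ^+ 2 / (8 * L).
Proof.
move=> L0; have s0 : Num.sqrt (2 * L) != 0 by rewrite gt_eqF// sqrtr_gt0 mulr_gt0.
have sE : Num.sqrt (2 * L) ^+ 2 = 2 * L by rewrite sqr_sqrtr// mulr_ge0// ltW.
rewrite /norming_log; move: s0 sE; set s := Num.sqrt _; set c := ln L + _ => s0 sE.
have -> : L = s ^+ 2 / 2 by rewrite sE mulrC mulKf// pnatr_eq0.
by field.
Qed.

Let density_norming L x : 0 < L -> 0 < norming_log L ->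
  let y := norming_log L + x / norming_log L in
  expR L * (normal_pdf 0 1 y / y) = Num.sqrt (2 * L) / y * expR (- x) *
    expR (- ((((ln L + k0) / Num.sqrt L) ^+ 2 / 16 + x ^+ 2 / 2 * (norming_log L)^-1 ^+ 2))).
Proof.
move=> L0 t0 y; rewrite normal_pdf01.
have t2 := norming_log_sqr L0; rewrite -/k0 in t2.
set c := ln L + k0 in t2 *; set t := norming_log L in t0 t2 y *.
have sL : Num.sqrt L ^+ 2 = L by rewrite sqr_sqrtr// ltW.
have yE : y ^+ 2 / 2 = L - c / 2 + (x + ((c / Num.sqrt L) ^+ 2 / 16 + x ^+ 2 / 2 * t^-1 ^+ 2)).
  have tn : t != 0 by rewrite gt_eqF.
  have -> : y ^+ 2 = t ^+ 2 + 2 * x + x ^+ 2 * t^-1 ^+ 2 by rewrite /y; field.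
  rewrite t2 (expr_div_n c) sL; field; rewrite tn; exact: lt0r_neq0.
have ec : expR (c / 2) = Num.sqrt (2 * L) * Num.sqrt (2 * pi).
  rewrite -sqrtrM ?mulr_ge0// ?(ltW L0)//.
  have -> : 2 * L * (2 * pi) = expR (c / 2) ^+ 2.
    have -> : expR (c / 2) ^+ 2 = expR c by rewrite -expRM_natl; congr expR; field.
    rewrite expRD lnK ?posrE//.
    by rewrite lnK ?posrE ?mulr_gt0 ?pi_gt0//; ring.
  by rewrite sqrtr_sqr ger0_norm// expR_ge0.
rewrite yE /normal_peak expr1n mul1r opprD expRD opprB expRD opprD expRD ec.
rewrite -[pi *+ 2]mulr_natl.
have p0 : Num.sqrt (2 * pi) != 0 :> R by rewrite gt_eqF// sqrtr_gt0 mulr_gt0// pi_gt0.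
rewrite [expR (- L)]expRN.
have e0 : expR L != 0 by rewrite gt_eqF// expR_gt0.
have [y0|y0] := eqVneq y 0; first by rewrite y0 invr0 !mulr0 !mul0r.
by field; rewrite p0 e0 y0.
Qed.

Let cvg_sqr (u : R -> R) (l : R) :
  u L @[L --> +oo] --> l -> u L ^+ 2 @[L --> +oo] --> (l ^+ 2 : R).
Proof. by move=> ul; rewrite expr2; under eq_cvg do rewrite expr2; exact: cvgM. Qed.

(** By the Mills ratio the tail is asymptotic to [phi y / y] with [y = t + x /
    t], and [y^2 / 2 = t^2 / 2 + x + o(1)]. *)
Lemma Phibar_norming_log x :
  expR L * Phibar (norming_log L + x / norming_log L) @[L --> +oo] --> expR (- x).
Proof.
pose t L := norming_log L.
have tV : (t L)^-1 @[L --> +oo] --> (0 : R).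
  apply/gtr0_cvgV0; last exact: norming_log_cvgy.
  exact: (cvgry_gt norming_log_cvgy).
pose y L := t L + x / t L.
have tpos : \forall L \near +oo, 0 < t L by exact: (cvgry_gt norming_log_cvgy).
have yinf : y L @[L --> +oo] --> (+oo%R : set_system R).
  apply/cvgryPge => M; near=> L; rewrite /y -lerBlDr.
  apply: (@le_trans _ _ (M + 1)).
    rewrite lerD2l lerNl; near: L; apply: (cvgr_ge (0 : R)); last by rewrite oppr_lt0.
    by rewrite -(mulr0 x); apply: cvgM => //; exact: cvg_cst.
  by near: L; exact: (cvgry_ge norming_log_cvgy).
have yV : (y L)^-1 @[L --> +oo] --> (0 : R).
  by apply/gtr0_cvgV0 => //; exact: (cvgry_gt yinf).
have ratio : Num.sqrt (2 * L) / y L @[L --> +oo] --> (1 : R).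
  have h : norming_log L / Num.sqrt L + x * (t L)^-1 * (Num.sqrt L)^-1 @[L --> +oo] -->
      (Num.sqrt 2 + x * 0 * 0 : R).
    apply: cvgD; first exact: norming_log_sqrt.
    by apply: cvgM => //; apply: cvgM => //; exact: cvg_cst.
  have s2 : Num.sqrt 2 != 0 :> R by rewrite gt_eqF// sqrtr_gt0.
  rewrite mulr0 addr0 in h.
  have {}h : Num.sqrt 2 / (norming_log L / Num.sqrt L + x * (t L)^-1 * (Num.sqrt L)^-1)
      @[L --> +oo] --> (Num.sqrt 2 / Num.sqrt 2 : R).
    by apply: cvgM; [exact: cvg_cst|exact: cvgV].
  rewrite mulfV// in h.
  refine (cvg_eq_near h _); near=> L.
  have L0 : 0 < L by near: L; exact: nbhs_pinfty_gt.
  have s0 : Num.sqrt L != 0 by rewrite gt_eqF// sqrtr_gt0.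
  have y0 : y L != 0 by rewrite gt_eqF//; near: L; exact: (cvgry_gt yinf).
  have -> : norming_log L / Num.sqrt L + x * (t L)^-1 * (Num.sqrt L)^-1 = y L / Num.sqrt L.
    by rewrite [in RHS]/y [RHS]mulrDl.
  by rewrite /= invf_div mulrA sqrtrM.
have dens : expR L * (normal_pdf 0 1 (y L) / y L) @[L --> +oo] --> expR (- x).
  have h : Num.sqrt (2 * L) / y L * expR (- x) *
      expR (- ((((ln L + k0) / Num.sqrt L) ^+ 2 / 16 + x ^+ 2 / 2 * (t L)^-1 ^+ 2)))
      @[L --> +oo] --> (1 * expR (- x) * expR (- (0 ^+ 2 / 16 + x ^+ 2 / 2 * 0 ^+ 2)) : R).
    apply: cvgM; first by apply: cvgM => //; exact: cvg_cst.
    apply: continuous_cvg; first exact: continuous_expR.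
    apply: cvgN; apply: cvgD; apply: cvgM; try exact: cvg_cst.
      by apply: cvg_sqr; exact: log_sqrt_cvg0.
    exact: cvg_sqr.
  rewrite expr0n/= mul0r mulr0 addr0 oppr0 expR0 mulr1 mul1r in h.
  refine (cvg_eq_near h _); near=> L.
  have L0 : 0 < L by near: L; exact: nbhs_pinfty_gt.
  have t0 : 0 < norming_log L by near: L.
  by rewrite density_norming.
have low : expR L * (normal_pdf 0 1 (y L) / y L) / (1 + (y L)^-1 ^+ 2) @[L --> +oo] --> expR (- x).
  have h : (1 + (y L)^-1 ^+ 2)^-1 @[L --> +oo] --> ((1 + 0 ^+ 2)^-1 : R).
    apply: cvgV; first by rewrite expr0n addr0 oner_neq0.
    apply: cvgD; first exact: cvg_cst.
    exact: cvg_sqr.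
  rewrite expr0n/= addr0 invr1 in h.
  have hd := cvgM dens h; rewrite mulr1 in hd; exact: hd.
apply: (squeeze_cvgr _ low dens); near=> L.
have y0 : 0 < y L by near: L; exact: (cvgry_gt yinf).
have /andP[lo hi] := Phibar_bounds y0.
by rewrite -mulrA exprVn !ler_pM2l ?expR_gt0// lo.
Unshelve. all: by end_near. Qed.

End gaussian_norming.

(** * Maxima of independent variables *)

Lemma maximum_leP {R : realType} (p : nat) (f : nat -> R) (x : R) : (0 < p)%N ->
  (maximum p f <= x) <-> (forall i, (i < p)%N -> f i <= x).
Proof.
move=> p0; rewrite /maximum; split => [h i ip|h].
  by apply: le_trans h; exact: (le_bigmax (f 0%N) (fun i : 'I_p => f i) (Ordinal ip)).
by apply/bigmax_leP; split => [|i _]; exact: h.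
Qed.

Lemma pr_iid_forall {R : realType} d (T : measurableType d) (P : probability T R)
    (Y : nat -> T -> R) (nu : probability R R) (p : nat) (A : set R) :
  iid_law P Y nu -> measurable A ->
  pr P [set w | forall i, (i < p)%N -> A (Y i w)] = pr nu A ^+ p.
Proof.
move=> iidY mA.
have mY i : measurable_fun setT (Y i) by case: iidY => mY _; exact: mY.
have setE : [set w | forall i, (i < p)%N -> A (Y i w)] = \bigcap_(i < p) (Y i @^-1` A).
  by [].
have mM : measurable [set w | forall i, (i < p)%N -> A (Y i w)].
  rewrite setE bigcap_mkord; apply: bigsetI_measurable => i _.
  by rewrite -[X in measurable X]setTI; exact: mY.
have prodE (w : T) : (\prod_(i < p) (\1_A (Y i w) : R)) =
    \1_[set w | forall i, (i < p)%N -> A (Y i w)] w.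
  rewrite [RHS]indicE; have [h|h] := boolP (w \in _).
    rewrite big1// => i _; rewrite indicE mem_set//.
    by move: h; rewrite inE => /(_ i); apply.
  have /existsNP[i /not_implyP[ip nA]] : ~ (forall i, (i < p)%N -> A (Y i w)).
    by move=> k; move/negP: h; apply; rewrite inE.
  by rewrite (bigD1 (Ordinal ip))//= indicE memNset// mul0r.
rewrite -prE//; under eq_Rintegral do rewrite -prodE.
by rewrite (expect_iid_prod iidY) ?prE// => y; rewrite ler0n lern1 leq_b1.
Qed.

Section gumbel.
Context {R : realType} d (T : measurableType d) (P : probability T R).
Variables (p : nat -> nat).
Hypothesis (p_infty : p n @[n --> \oo] --> \oo).

Lemma ln_p_infty : ln (p n)%:R @[n --> \oo] --> (+oo%R : set_system R).
Proof.
apply/cvgryPge => M; near=> n; rewrite -ler_expR lnK.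
  by near: n; apply: (cvgry_ge (cvg_comp _ _ p_infty (@cvgr_idn R))).
by rewrite posrE ltr0n; near: n; exact: p_infty (nbhs_infty_gt 0%N).
Unshelve. all: by end_near. Qed.

Lemma norming_infty : norming (p n)%:R @[n --> \oo] --> (+oo%R : set_system R).
Proof. exact: cvg_comp ln_p_infty norming_log_cvgy. Qed.

Lemma norming_gt0 : \forall n \near \oo, 0 < norming (p n)%:R :> R.
Proof. exact: (cvgry_gt norming_infty). Qed.

Lemma Phibar_norming (x : R) : (p n)%:R *
  Phibar (norming (p n)%:R + x / norming (p n)%:R) @[n --> \oo] --> expR (- x).
Proof.
have h := cvg_comp _ _ ln_p_infty (@Phibar_norming_log R x).
refine (cvg_eq_near h _); near=> n; rewrite /= lnK//.
by rewrite posrE ltr0n; near: n; exact: p_infty (nbhs_infty_gt 0%N).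
Unshelve. all: by end_near. Qed.

Variable S : nat -> T -> R.

Hypothesis mS : forall n, measurable_fun setT (S n).

Definition exceedance (x : R) (n : nat) : set T :=
  [set w | S n w / Num.sqrt n%:R > norming (p n)%:R + x / norming (p n)%:R].

Lemma measurable_exceedance (x : R) n : measurable (exceedance x n).
Proof.
rewrite (_ : exceedance x n = (fun w => S n w / Num.sqrt n%:R) @^-1`
  `]norming (p n)%:R + x / norming (p n)%:R, +oo[%classic); last first.
  by apply/seteqP; split => w; rewrite /exceedance /= in_itv/= andbT.
rewrite -[X in measurable X]setTI; apply: measurable_funM => //; exact: measurable_itv.
Qed.

(** The Gaussian tail has the limit [exp (- x)] unconditionally, so the
    asymptotic equivalence amounts to the tail of [S_n] having that limit. *)
Lemma tail_relationE : tail_relation P p S <->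
  forall x : R, (p n)%:R * pr P (exceedance x n) @[n --> \oo] --> expR (- x).
Proof.
have e0 (x : R) : expR (- x) != 0 by rewrite gt_eqF// expR_gt0.
split => [h x|h x t].
  have [ab b] := h x; have {}ab := cvgM ab b; rewrite mul1r in ab.
  refine (cvg_eq_near (ab _) _); near=> n; rewrite /= mulfVK//.
  rewrite gt_eqF//; near: n; apply: (cvgr_gt _ b); exact: expR_gt0.
split; last exact: Phibar_norming.
have inv := cvgV (e0 x) (@Phibar_norming x).
by have ratio := cvgM (h x) (inv _); rewrite mulfV// in ratio; exact: ratio.
Unshelve. all: by end_near. Qed.

Variables (Sc : nat -> nat -> {RV P >-> R}).
Hypotheses (p_gt0 : forall n, (0 < p n)%N).
Hypotheses (iidSc : forall n, iid P (Sc n)).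
Hypotheses (lawSc : forall n i, same_law P (Sc n i) (S n)).

(** The maximum stays below a level exactly when none of the [p] independent
    copies exceeds it. *)
Lemma gumbel_relationE : gumbel_relation P p Sc <->
  forall x : R, (1 - pr P (exceedance x n)) ^+ p n @[n --> \oo] --> Lambda x.
Proof.
have E (x : R) : \forall n \near \oo, P [set w | norming (p n)%:R *
         maximum (p n) (fun i => Sc n i w / Num.sqrt n%:R - norming (p n)%:R)
         <= x] = ((1 - pr P (exceedance x n)) ^+ p n)%:E.
  near=> n; have t0 : 0 < norming (p n)%:R :> R by near: n; exact: norming_gt0.
  set t := norming _ in t0 *.
  pose A := [set y : R | y / Num.sqrt n%:R <= t + x / t].
  have mA : measurable A.
    have -> : A = (fun y : R => y / Num.sqrt n%:R) @^-1` `]-oo, t + x / t].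
      by apply/seteqP; split => y; rewrite /A /= in_itv.
    by rewrite -[X in measurable X]setTI; apply: (@mulrr_measurable R setT).
  have setE : [set w | t * maximum (p n) (fun i => Sc n i w / Num.sqrt n%:R - t) <= x] =
      [set w | forall i, (i < p n)%N -> A (Sc n i w)].
    apply/seteqP; split => w /=; rewrite mulrC -ler_pdivlMr//.
      by move=> /(maximum_leP _ _ (p_gt0 n)) h i /h; rewrite lerBlDl.
    by move=> h; apply/(maximum_leP _ _ (p_gt0 n)) => i /h; rewrite /A /= lerBlDl.
  have mS' : measurable (S n @^-1` A) by rewrite -[X in measurable X]setTI; exact: mS.
  have <- : pr (distribution P (Sc n 0%N)) A = 1 - pr P (exceedance x n).
    have -> : pr (distribution P (Sc n 0%N)) A = pr P (S n @^-1` A).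
      by congr fine; exact: lawSc.
    have -> : exceedance x n = ~` (S n @^-1` A).
      by apply/seteqP; split => w /=; rewrite /A /exceedance /= ltNge => /negP.
    by rewrite /pr probability_setC// fineB ?fin_num_measure//= opprB addrCA subrr addr0.
  rewrite -(pr_iid_forall _ (iid_iid_law (iidSc n)) mA) -setE fineK// fin_num_measure//.
  rewrite setE (_ : [set w | _] = \bigcap_(i < p n) (Sc n i @^-1` A))//.
  rewrite bigcap_mkord; apply: bigsetI_measurable => i _.
  by rewrite -[X in measurable X]setTI; exact: measurable_funPT.
split => h x.
  have /fine_cvgP[_ h2] := h x.
  by refine (cvg_eq_near h2 _); apply: filterS (E x) => n /= ->.
refine (cvg_eq_near (cvg_EFinr (h x)) _).
by apply: filterS (E x) => n ->.
Unshelve. all: by end_near. Qed.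

Lemma tail_gumbelE : tail_relation P p S <-> gumbel_relation P p Sc.
Proof.
have a01 (x : R) n : 0 <= pr P (exceedance x n) <= 1.
  rewrite pr_ge0 pr_le1//; apply: measurable_exceedance.
split => [/tail_relationE h|/gumbel_relationE h].
  by apply/gumbel_relationE => x; exact: pow_onem_cvg (a01 x) (h x).
by apply/tail_relationE => x; exact: pow_onem_cvg_inv (a01 x) (h x).
Qed.

End gumbel.

(** * The vague topology *)

Lemma initial_cvg {S : choiceType} {T : topologicalType} (f : S -> T)
    (F : set_system S) {FF : Filter F} (s : S) :
  f @ F --> f s -> F --> (s : initial_topology f).
Proof.
move=> fFs A; rewrite nbhsE => -[_ [[B Bop <-] Bfs] sBA].
apply: filterS sBA _; have : nbhs (f s) B by exact: open_nbhs_nbhs.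
by move=> /fFs.
Qed.

Section vague.
Context {R : realType}.

Lemma vague_eval_continuous (f : Cc_nonneg R) :
  continuous (fun m : pointMeasure R => vague_eval m f).
Proof.
have ev : continuous (fun g : {ptws Cc_nonneg R -> R} => g f).
  move=> g A nA.
  have /cvg_sup/(_ f) h : nbhs g --> g by exact: cvg_id.
  by apply: h; exact: (@initial_continuous _ _ (fun g : Cc_nonneg R -> R => g f) g).
move=> m A nA; have nB := ev (vague_eval m) A nA.
exact: (@initial_continuous _ _ (@vague_eval R) m) nB.
Qed.

(** The vague topology is initial for the integrals of the test functions. *)
Lemma vague_cvg (m : nat -> pointMeasure R) (l : pointMeasure R) :
  (forall f : Cc_nonneg R, vague_eval (m n) f @[n --> \oo] --> vague_eval l f) ->
  m n @[n --> \oo] --> l.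
Proof.
move=> ml; apply: (@initial_cvg _ _ (@vague_eval R)).
apply/cvg_sup => f.
apply: (@initial_cvg _ _ (fun g : Cc_nonneg R -> R => g f)).
exact: ml.
Qed.

Lemma measurable_Cc (f : Cc_nonneg R) : measurable_fun setT (sval f).
Proof. by apply: continuous_measurable_fun; case: (svalP f). Qed.

Lemma Cc_ge0 (f : Cc_nonneg R) x : 0 <= sval f x.
Proof. by case: (svalP f). Qed.

Lemma Cc_support (f : Cc_nonneg R) :
  exists L : nat, forall x, ~ sym_itv L x -> sval f x = 0.
Proof.
case: f => f [_ _ cpt] /=; have [M [_ MK]] := compact_bounded cpt.
exists (Num.bound `|M|) => x; apply: contra_notP => /eqP fx.
rewrite /sym_itv /= in_itv/= -ler_norml; apply: (MK (Num.bound `|M|)%:R).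
  by rewrite (le_lt_trans (ler_norm M))// archi_boundP.
exact: subset_closure.
Qed.

Lemma Cc_bounded (f : Cc_nonneg R) : exists2 C : R, 0 <= C & forall x, sval f x <= C.
Proof.
have [L fL] := Cc_support f; case: f fL => f [cf f0 _] /= fL.
have LL : - L%:R <= L%:R :> R by rewrite lerNl (le_trans _ (ler0n _ L))// oppr_le0.
have [c _ cmax] := EVT_max LL (continuous_subspaceT cf).
exists (f c) => // x; have [xL|/fL -> //] := pselect (sym_itv L x).
exact: cmax.
Qed.

Local Notation point_sum p x :=
  (msum (fun i => (\d_(x i) : {measure set R -> \bar R})) p).

Lemma is_point_measure_sum (p : nat) (x : nat -> R) : is_point_measure (point_sum p x).
Proof.
split.
  exists `I_p, x => A mA; rewrite esum_fset; last 2 first.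
  - exact: finite_II.
  - by move=> i _.
  by rewrite -fsbig_ord.
move=> K cK; rewrite /msum /= ltey_eq; apply/orP; left.
rewrite sum_fin_num; apply/allP => _ /mapP[i _ ->].
by rewrite inE [X in X \is a fin_num]diracE.
Qed.

Lemma dirac_sumE (p : nat) (x : nat -> R) : pm_measure (dirac_sum p x) = point_sum p x.
Proof.
rewrite /dirac_sum /to_pointMeasure; case: pselect => // h.
by exfalso; apply: h; exact: is_point_measure_sum.
Qed.

Lemma vague_eval_dirac_sum (p : nat) (x : nat -> R) (f : Cc_nonneg R) :
  vague_eval (dirac_sum p x) f = \sum_(i < p) sval f (x i).
Proof.
have mf : measurable_fun setT (EFin \o sval f) by apply/measurable_EFinP; exact: measurable_Cc.
rewrite /vague_eval dirac_sumE /Rintegral ge0_integral_measure_sum//; last first.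
  by move=> y _; rewrite lee_fin Cc_ge0.
under eq_bigr do rewrite integral_dirac// diracT mul1e.
by rewrite sumEFin.
Qed.

Local Notation point_series x :=
  (mseries (fun i => (\d_(x i) : {measure set R -> \bar R})) 0).

Lemma Cc_series_fin (x : nat -> R) (f : Cc_nonneg R) : is_point_measure (point_series x) ->
  (\sum_(i <oo) (sval f (x i))%:E < +oo)%E.
Proof.
move=> [_ fin]; have [L fL] := Cc_support f; have [C C0 fC] := Cc_bounded f.
have finL : (point_series x (sym_itv L) < +oo)%E by apply: fin; exact: segment_compact.
apply: (@le_lt_trans _ _ (\sum_(i <oo) C%:E * \d_(x i) (sym_itv L)))%E.
  apply: lee_nneseries => i _; first by rewrite lee_fin Cc_ge0.
  rewrite diracE; have [xL|xL] := boolP (x i \in sym_itv L).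
    by rewrite mule1 lee_fin.
  by rewrite mule0 lee_fin fL// => /mem_set; apply/negP.
rewrite nneseriesZl//.
by apply: lte_mul_pinfty; rewrite ?lee_fin.
Qed.

Lemma vague_eval_dirac_series (x : nat -> R) (f : Cc_nonneg R) :
  is_point_measure (point_series x) ->
  vague_eval (dirac_series x) f = fine (\sum_(i <oo) (sval f (x i))%:E)%E.
Proof.
have mf : measurable_fun setT (EFin \o sval f) by apply/measurable_EFinP; exact: measurable_Cc.
move=> px; rewrite /vague_eval dirac_seriesE// /Rintegral ge0_integral_measure_series//; last first.
  by move=> y _; rewrite lee_fin Cc_ge0.
congr fine; apply: eq_eseriesr => i _.
by rewrite integral_dirac// diracT mul1e.
Qed.

Lemma vague_eval_ge0 (m : pointMeasure R) (f : Cc_nonneg R) : 0 <= vague_eval m f.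
Proof. by apply: Rintegral_ge0 => x _; exact: Cc_ge0. Qed.

Lemma dirac_sum_cvg (p : nat) (x : nat -> nat -> R) (y : nat -> R) :
  (forall i, (i < p)%N -> x k i @[k --> \oo] --> y i) ->
  dirac_sum p (x k) @[k --> \oo] --> dirac_sum p y.
Proof.
move=> xy; apply: vague_cvg => f; rewrite vague_eval_dirac_sum.
rewrite (_ : (fun k => _) = fun k => \sum_(i < p) sval f (x k i)); last first.
  by apply/funext => k; rewrite vague_eval_dirac_sum.
elim: p xy => [|q IH] xy.
  rewrite big_ord0; under eq_fun do rewrite big_ord0; exact: cvg_cst.
rewrite big_ord_recr/=; under eq_fun do rewrite big_ord_recr/=.
apply: cvgD; first by apply: IH => i iq; apply: xy; exact: ltnW.
apply: continuous_cvg; last exact: xy.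
by case: (svalP f) => cf _ _; exact: cf.
Qed.

(** A continuous functional of the limiting process is thus a limit of
    functionals of finitely many points, which is how its measurability is
    obtained. *)
Lemma dirac_series_cvg (x : nat -> R) : is_point_measure (point_series x) ->
  dirac_sum k x @[k --> \oo] --> dirac_series x.
Proof.
move=> px; apply: vague_cvg => f; rewrite vague_eval_dirac_series//.
rewrite (_ : (fun k => _) = fine \o (fun k => \sum_(0 <= i < k) (sval f (x i))%:E)%E); last first.
  by apply/funext => k; rewrite vague_eval_dirac_sum /= big_mkord sumEFin.
apply: fine_cvg.
have f0 i : (0 <= (sval f (x i))%:E)%E by rewrite lee_fin Cc_ge0.
rewrite fineK; last by rewrite ge0_fin_numE ?Cc_series_fin//; exact: nneseries_ge0.
by apply: is_cvg_nneseries.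
Qed.

End vague.

(** * Order statistics of exponential variables *)

Definition depends_on {R : realType} {V : Type} (p : nat) (f : seqR R -> V) : Prop :=
  forall s s' : nat -> R, (forall i, (i < p)%N -> s i = s' i) -> f s = f s'.

(** The ordered sample of [p] independent exponential variables is distributed
    like these sums: the minimum of [k] such variables is exponential of rate [k],
    and the excesses over the minimum are again independent exponentials. *)
Definition renyi {R : realType} (p : nat) (s : seqR R) : seqR R :=
  fun k => \sum_(j < k.+1) s j / (p - j)%:R.

Section renyi.
Context {R : realType} d (T : measurableType d) (P : probability T R).
Variables (Y : nat -> T -> R) (nu : probability R R).
Hypotheses (iidY : iid_law P Y nu).
Hypothesis nuE : forall A, measurable A -> nu A = exponential_prob 1 A.
Local Notation Ys w := (fun i => Y i w).

Definition shift_seq (x : R) (s : nat -> R) : seqR R := fun i => x + s i.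

Lemma measurable_shift_seq d' (U : measurableType d') (f : U -> R) (g : U -> seqR R) :
  measurable_fun setT f -> measurable_fun setT g ->
  measurable_fun setT (fun u => shift_seq (f u) (g u)).
Proof.
move=> mf mg; apply: measurable_seqP => i; apply: measurable_funD => //.
exact: measurableT_comp (measurable_coord i) mg.
Qed.

Lemma shift_scons x y s : shift_seq x (scons y s) = scons (x + y) (shift_seq x s).
Proof. by apply/funext => -[|i]. Qed.

Lemma renyi0 p (s : nat -> R) : renyi p.+1 s 0 = s 0%N / p.+1%:R.
Proof. by rewrite /renyi big_ord_recl big_ord0 addr0 subn0. Qed.

Lemma renyi_scons p x s :
  renyi p.+1 (scons x s) = scons (x / p.+1%:R) (shift_seq (x / p.+1%:R) (renyi p s)).
Proof.
apply/funext => -[|k]; first by rewrite renyi0.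
by rewrite /renyi /shift_seq /= big_ord_recl subn0.
Qed.

Lemma measurable_renyi p : measurable_fun setT (renyi p : seqR R -> seqR R).
Proof.
apply: measurable_seqP => k; apply: measurable_sum => i.
by apply: measurable_funM => //; exact: measurable_coord.
Qed.

Lemma measurable_integral_fst d' (U : measurableType d') (f : U * T -> \bar R) :
  measurable_fun setT f -> (forall z, 0 <= f z)%E ->
  measurable_fun setT (fun u => \int[P]_w f (u, w))%E.
Proof. by move=> mf f0; exact: measurable_fun_fubini_tonelli_F. Qed.

Lemma measurable_Ys_snd d' (U : measurableType d') :
  measurable_fun setT (fun z : U * T => (Ys z.2 : seqR R)).
Proof. exact: measurableT_comp (measurable_iid iidY) measurable_snd. Qed.

Lemma exponential_memoryless (p : nat) (x : R) (Phi : seqR R -> \bar R) : 0 <= x ->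
  measurable_fun setT Phi -> (forall s, 0 <= Phi s)%E -> depends_on p Phi ->
  (\int[P]_w (Phi (Ys w) * (\prod_(i < p) ((x <= Y i w)%R%:R : R))%:E) =
   (expR (- (p%:R * x)))%:E * \int[P]_w Phi (shift_seq x (Ys w)))%E.
Proof.
move=> x0; elim: p Phi => [|p IH] Phi mPhi Phi0 depPhi.
  rewrite mul0r oppr0 expR0 mul1e; apply: eq_integral => w _.
  by rewrite big_ord0 mule1; exact: depPhi.
have mle i : measurable_fun setT (fun s : seqR R => (x <= s i)%R%:R : R).
  by apply: measurableT_comp => //; apply: measurable_fun_ler => //; exact: measurable_coord.
have mprod q : measurable_fun setT (fun s : seqR R => (\prod_(i < q) ((x <= s i)%R%:R : R))%:E).
  by apply/measurable_EFinP; apply: measurable_prod => i _; exact: mle.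
have prod0 q (s : nat -> R) : (0 <= (\prod_(i < q) ((x <= s i)%R%:R : R))%:E)%E.
  by rewrite lee_fin prodr_ge0// => i _; rewrite ler0n.
have mscons (y : R) : measurable_fun setT (fun s : seqR R => scons y s).
  by apply: measurable_scons => //; exact: measurable_cst.
have mshift : measurable_fun setT (shift_seq x : seqR R -> seqR R).
  exact: (@measurable_shift_seq _ _ (fun=> x) id).
have mYs := measurable_iid iidY.
rewrite (iid_integral_scons iidY (Phi := fun s => Phi s *
  (\prod_(i < p.+1) ((x <= s i)%R%:R : R))%:E)%E); last 2 first.
- exact: emeasurable_funM.
- by move=> s; rewrite mule_ge0.
pose F y := (\int[P]_w Phi (scons y (shift_seq x (Ys w))))%E.
have F0 y : (0 <= F y)%E by exact: integral_ge0.
have mF : measurable_fun setT F.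
  apply: (measurable_integral_fst (f := fun z => Phi (scons z.1 (shift_seq x (Ys z.2))))) => //.
  apply: measurableT_comp mPhi _; apply: measurable_scons => //.
  apply: measurable_shift_seq; first exact: measurable_cst.
  exact: measurable_Ys_snd.
transitivity (\int[nu]_y ((expR (- (p%:R * x)))%:E * F y * (x <= y)%R%:R%:E))%E.
  apply: eq_integral => y _; rewrite /F -(IH (fun s => Phi (scons y s)))//; last 2 first.
  - exact: measurableT_comp mPhi (mscons y).
  - by move=> s s' ss'; apply: depPhi => -[//|i] ip; exact: ss'.
  rewrite -ge0_integralZr ?lee_fin ?ler0n//; last 2 first.
  - by apply: emeasurable_funM; [exact: measurableT_comp mPhi (measurableT_comp (mscons y) mYs)|
      exact: measurableT_comp (mprod p) mYs].
  - by move=> w _; rewrite mule_ge0//; exact: (prod0 p (Ys w)).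
  by apply: eq_integral => w _; rewrite big_ord_recl EFinM muleA muleAC.
rewrite (exponential_shift nuE x0) //; last 2 first.
- exact: measurable_funeM.
- by move=> y; rewrite mule_ge0// lee_fin expR_ge0.
rewrite ge0_integralZl//; last first.
  by apply: measurableT_comp mF _; exact: measurable_funD.
rewrite muleA -EFinM -expRD -opprD; congr (_%:E * _)%E.
  by rewrite -[in RHS]natr1 mulrDl mul1r addrC.
rewrite (iid_integral_scons iidY (Phi := fun s => Phi (shift_seq x s)))//; last first.
  exact: measurableT_comp mPhi mshift.
by apply: eq_integral => y _; apply: eq_integral => w _; rewrite shift_scons.
Qed.

Lemma ae_no_ties : {ae P, forall w, forall i j, i != j -> Y i w <> Y j w}.
Proof.
have mne i j : measurable [set w | Y i w = Y j w].
  have := @measurable_fun_eqr _ _ _ setT _ _ (iidY.1 i) (iidY.1 j).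
  move=> /(_ measurableT [set true] I); rewrite setTI.
  by rewrite (_ : _ @^-1` _ = [set w | Y i w = Y j w])//; apply/seteqP; split => w /= /eqP.
have tie i j : i != j -> P [set w | Y i w = Y j w] = 0%E.
  move=> ij; pose f k := swap 1 (swap 0 i j) k.
  pose h k := swap 0 i (f k).
  have hinj : injective h by apply: inj_comp; exact: swap_inj.
  have h0 : h 0%N = i.
    rewrite /h /f /swap /=; case: (eqVneq j 0%N) => [j0|j0]; case: (eqVneq j i) => [ji|ji] //=.
    - by rewrite ji eqxx in ij.
    - by rewrite eq_sym; move: ij; rewrite j0; case: (i).
    - by rewrite ji eqxx in ij.
    - by rewrite [0%N == j]eq_sym (negbTE j0).
  have h1 : h 1%N = j.
    by rewrite /h /f {2}/swap eqxx swapK.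
  have iidh := iid_law_reindex iidY hinj.
  have mD : measurable [set s : seqR R | s 0%N = s 1%N].
    have := @measurable_fun_eqr _ _ _ setT _ _ (@measurable_coord R 0) (@measurable_coord R 1).
    move=> /(_ measurableT [set true] I); rewrite setTI.
    by rewrite (_ : _ @^-1` _ = [set s | s 0%N = s 1%N])//; apply/seteqP; split => w /= /eqP.
  pose Phi (s : seqR R) : \bar R := (\1_[set s : seqR R | s 0%N = s 1%N] s)%:E.
  have mPhi : measurable_fun setT Phi by apply/measurable_EFinP; exact: measurable_indic.
  have Phi0 s : (0 <= Phi s)%E by rewrite lee_fin.
  have <- : (\int[P]_w Phi (fun k => Y (h k) w) = P [set w | Y i w = Y j w])%E.
    transitivity (\int[P]_w (\1_[set w | Y i w = Y j w] w)%:E)%E; last first.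
      by rewrite integral_indic// setIT.
    apply: eq_integral => w _.
    rewrite /Phi !indicE; congr (_%:E); congr (nat_of_bool _)%:R.
    by apply/idP/idP; rewrite !inE /= h0 h1.
  rewrite (iid_integral_scons iidh mPhi Phi0).
  apply: integral0_eq => x _.
  rewrite (_ : (\int[P]_w _) = nu [set x])%E; first by rewrite (exponential_set1 nuE).
  transitivity (\int[P]_w (\1_[set x] (Y (h 0%N) w))%:E)%E.
    apply: eq_integral => w _; rewrite /Phi !indicE; congr (_%:E); congr (nat_of_bool _)%:R.
    by apply/idP/idP; rewrite !inE /= => ->.
  rewrite (ge0_integral_coord iidh (f := fun y => (\1_[set x] y)%:E))//; last first.
  - by apply/measurable_EFinP; exact: measurable_indic.
  by rewrite integral_indic// setIT.
have : {ae P, forall w, forall i j, i != j -> Y i w <> Y j w}.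
  apply: ae_foralln => i; apply: ae_foralln => j.
  have [->|ij] := eqVneq i j; first by apply: aeW => w /eqP.
  exists [set w | Y i w = Y j w]; split => //; first exact: tie.
  by move=> w /= /not_implyP[_ /contrapT].
by [].
Qed.

Definition is_min (p i : nat) (s : nat -> R) : R := \prod_(j < p) ((s i <= s j)%R%:R).

Lemma is_min_ge0 p i s : 0 <= is_min p i s.
Proof. by apply: prodr_ge0 => j _; rewrite ler0n. Qed.

Lemma measurable_is_min p i : measurable_fun setT (is_min p i : seqR R -> R).
Proof.
apply: measurable_prod => j _; apply: measurableT_comp => //.
by apply: measurable_fun_ler; exact: measurable_coord.
Qed.

Lemma sum_is_min (p : nat) (s : nat -> R) : (forall i j, i != j -> s i <> s j) ->
  \sum_(i < p.+1) is_min p.+1 i s = 1.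
Proof.
move=> inj; pose i0 := [arg min_(i < (ord0 : 'I_p.+1)) s i]%O.
have i0min (j : 'I_p.+1) : s i0 <= s j by rewrite /i0; case: Order.TotalTheory.arg_minP => // i _ h; exact: h.
rewrite (bigD1 i0)//= big1 ?addr0.
  by rewrite /is_min big1// => j _; rewrite i0min.
move=> i ii0; rewrite /is_min (bigD1 i0)//=.
rewrite (_ : (s i <= s i0) = false) ?mul0r//; apply/negbTE; rewrite -ltNge lt_neqAle i0min andbT.
by apply/eqP => h; apply: (inj i0 i) => //; rewrite eq_sym.
Qed.

(** Without ties exactly one of the variables is the minimum, and by symmetry it
    may be taken to be the first one. The minimum of [p] variables is
    exponential of rate [p]; given its value [x], memorylessness makes the
    others [x] plus fresh exponential variables, to which the induction
    hypothesis applies. *)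
Lemma renyi_representation (p : nat) (psi : seqR R -> R) :
  measurable_fun setT psi -> (forall s, 0 <= psi s) -> symmetric_in p psi -> depends_on p psi ->
  (\int[P]_w (psi (Ys w))%:E = \int[P]_w (psi (renyi p (Ys w)))%:E)%E.
Proof.
elim: p psi => [|p IH] psi mpsi psi0 sympsi deppsi.
  by apply: eq_integral => w _; congr (_%:E); exact: deppsi.
have mE : measurable_fun setT (fun s => (psi s)%:E) by exact/measurable_EFinP.
have mYs := measurable_iid iidY.
pose M i (s : seqR R) : \bar R := (psi s * is_min p.+1 i s)%:E.
have mM i : measurable_fun setT (M i).
  by apply/measurable_EFinP; apply: measurable_funM => //; exact: measurable_is_min.
have M0 i s : (0 <= M i s)%E by rewrite lee_fin mulr_ge0// is_min_ge0.
have Msym i : (i < p.+1)%N -> (\int[P]_w M i (Ys w) = \int[P]_w M 0%N (Ys w))%E.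
  move=> ip; have iidh := iid_law_reindex iidY (@swap_inj 0 i).
  rewrite (iid_law_integral iidY iidh (mM i) (M0 i)).
  apply: eq_integral => w _; rewrite /M (sympsi 0%N i (Ys w))//; congr (_ * _)%:E.
  pose h (k : 'I_p.+1) : 'I_p.+1 := Ordinal (etrans (swap_lt k (ltn0Sn p) ip) (ltn_ord k)).
  have hK : involutive h by move=> k; apply: val_inj; exact: swapK.
  rewrite /is_min [RHS](reindex_inj (inv_inj hK)); apply: eq_bigr => j _ /=.
  by rewrite (_ : swap 0 i i = 0%N)// /swap; case: (eqVneq i 0%N) => [->//|]; rewrite eqxx.
have -> : (\int[P]_w (psi (Ys w))%:E = p.+1%:R%:E * \int[P]_w M 0%N (Ys w))%E.
  transitivity (\int[P]_w \sum_(i < p.+1) M i (Ys w))%E.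
    apply: ae_eq_integral => //.
    - exact: measurableT_comp mE mYs.
    - by apply: emeasurable_sum => i; exact: measurableT_comp (mM i) mYs.
    apply: filterS ae_no_ties => w inj _.
    by rewrite /M sumEFin -mulr_sumr sum_is_min// mulr1.
  rewrite ge0_integral_sum//; last by move=> i; exact: measurableT_comp (mM i) mYs.
  under eq_bigr do rewrite Msym//.
  by rewrite sumr_const card_ord mule_natl.
rewrite (iid_integral_scons iidY (mM 0%N) (M0 0%N)).
pose F x := (\int[P]_w (psi (scons x (shift_seq x (renyi p (Ys w)))))%:E)%E.
have F0 x : (0 <= F x)%E by apply: integral_ge0 => w _; rewrite lee_fin.
have mF : measurable_fun setT F.
  apply: (measurable_integral_fst (f := fun z =>
    (psi (scons z.1 (shift_seq z.1 (renyi p (Ys z.2)))))%:E)); last by move=> z; rewrite lee_fin.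
  apply: measurableT_comp mE _; apply: measurable_scons => //.
  apply: measurable_shift_seq => //.
  by apply: measurableT_comp (measurable_renyi p) _; exact: measurable_Ys_snd.
transitivity (p.+1%:R%:E * \int[nu]_x ((expR (- (p%:R * x)))%:E * F x))%E.
  congr (_ * _)%E; apply: ge0_ae_eq_integral => //.
  - apply: (measurable_integral_fst (f := fun z => M 0%N (scons z.1 (Ys z.2)))) => //.
    apply: measurableT_comp (mM 0%N) _; apply: measurable_scons => //.
    exact: measurable_Ys_snd.
  - apply: emeasurable_funM => //; apply/measurable_EFinP; apply: measurableT_comp => //.
    by apply: measurableT_comp => //; exact: measurable_funM.
  - by move=> x _; exact: integral_ge0.
  - by move=> x _; rewrite mule_ge0// lee_fin expR_ge0.
  have : {ae nu, forall x : R, 0 <= x}.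
    exists (~` `[0, +oo[%classic); split.
    - exact: measurableC.
    - by rewrite probability_setC// (exponential_ge0 nuE) subee.
    - by move=> x; apply: contra_not; rewrite /= in_itv/= andbT.
  apply: filterS => x x0 _.
  have mscons : measurable_fun setT (fun s : seqR R => scons x s).
    by apply: measurable_scons => //; exact: measurable_cst.
  have mshift : measurable_fun setT (shift_seq x : seqR R -> seqR R).
    exact: (@measurable_shift_seq _ _ (fun=> x) id).
  have E1 : (\int[P]_w M 0%N (scons x (Ys w)) = (expR (- (p%:R * x)))%:E *
      \int[P]_w (psi (scons x (shift_seq x (Ys w))))%:E)%E.
    rewrite -(exponential_memoryless (p := p) (Phi := fun s => (psi (scons x s))%:E) x0)//.
    - apply: eq_integral => w _; rewrite /M /is_min big_ord_recl /= lexx mul1r -EFinM.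
      by [].
    - exact: measurableT_comp mE mscons.
    - by move=> s; rewrite lee_fin.
    - by move=> s s' ss'; congr (_%:E); apply: deppsi => -[//|i] ip; exact: ss'.
  rewrite E1 (IH (fun s => psi (scons x (shift_seq x s))))//.
  - by apply: measurableT_comp mpsi _; exact: measurableT_comp mscons mshift.
  - move=> i j s ip jp; rewrite -[RHS](sympsi i.+1 j.+1)//; congr psi.
    apply/funext => -[|k]; rewrite /shift_seq /= /swap ?eqSS//=.
    by case: ifP => // _; case: ifP.
  - by move=> s s' ss'; apply: deppsi => -[//|i] ip; rewrite /= /shift_seq ss'.
rewrite (iid_integral_scons iidY (Phi := fun s => (psi (renyi p.+1 s))%:E)); last 2 first.
- exact: measurableT_comp mE (measurable_renyi p.+1).
- by move=> s; rewrite lee_fin.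
have kpos : 0 < p.+1%:R :> R by rewrite ltr0n.
transitivity (\int[nu]_x F (x / p.+1%:R)%R)%E; last first.
  by apply: eq_integral => x _; apply: eq_integral => w _; rewrite renyi_scons.
rewrite -(exponential_scale nuE kpos)// -ge0_integralZl//; last 2 first.
- apply: emeasurable_funM => //; apply/measurable_EFinP; apply: measurableT_comp => //.
  by apply: measurableT_comp => //; exact: measurable_funM.
- by move=> x _; rewrite mule_ge0// lee_fin expR_ge0.
apply: eq_integral => x _; rewrite muleA -EFinM muleC; congr (_ * (_ * expR _)%:E)%E.
by rewrite -natr1 addrK mulNr.
Qed.

End renyi.

(** * Exponential bounds for irregular samples *)

Section chernoff.
Context {R : realType} d (T : measurableType d) (P : probability T R).
Variables (X : nat -> T -> R) (nu : probability R R).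
Hypothesis iidX : iid_law P X nu.
Variable n : nat.

Lemma measurable_sum_coord (phi : R -> R) : measurable_fun setT phi ->
  measurable_fun setT (fun w => \sum_(i < n) phi (X i w)).
Proof.
by move=> mphi; apply: measurable_sum => i; apply: measurableT_comp mphi _; exact: (iidX.1 i).
Qed.

(** The exponential moment of the sum is at most [(1 + c)^n <= exp (n c)]. *)
Lemma chernoff (phi : R -> R) (c u : R) : measurable_fun setT phi -> 0 <= c ->
  (\int[nu]_x (expR (phi x))%:E <= (1 + c)%:E)%E ->
  pr P [set w | u <= \sum_(i < n) phi (X i w)] <= expR (n%:R * c - u).
Proof.
move=> mphi c0 Ephi.
have mexp : measurable_fun setT (fun x => expR (phi x)) by exact: measurableT_comp.
set A := [set w | _].
have mA : measurable A by exact/measurable_le_set/measurable_sum_coord.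
have mprod : measurable_fun setT (fun w => (\prod_(i < n) expR (phi (X i w)))%:E).
  apply/measurable_EFinP; apply: measurable_prod => i _.
  by apply: measurableT_comp mexp _; exact: (iidX.1 i).
rewrite -lee_fin /pr fineK ?fin_num_measure//.
apply: (@le_trans _ _ ((expR (- u))%:E * \int[P]_w (\prod_(i < n) expR (phi (X i w)))%:E)%E).
  rewrite -ge0_integralZl//; last first.
    by move=> w _; rewrite lee_fin prodr_ge0// => i _; exact: expR_ge0.
  rewrite -[X in (P X <= _)%E]setIT -integral_indic//.
  apply: ge0_le_integral => //.
  - by apply/measurable_EFinP; exact: measurable_indic.
  - exact: measurable_funeM.
  move=> w _; rewrite -EFinM lee_fin indicE; have [Aw|_] := boolP (w \in A); last first.
    by rewrite mulr_ge0 ?expR_ge0// prodr_ge0// => i _; exact: expR_ge0.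
  have {}Aw : u <= \sum_(i < n) phi (X i w) by move: Aw; rewrite inE.
  by rewrite -expR_sum -expRD -[X in X <= _]expR0 ler_expR addrC subr_ge0.
rewrite (ge0_integral_iid_prod iidX (g := fun x => expR (phi x)))//.
rewrite addrC expRD EFinM lee_pmul2l ?lte_fin ?expR_gt0//.
have finE : (\int[nu]_x (expR (phi x))%:E)%E \is a fin_num.
  rewrite ge0_fin_numE; first by apply: le_lt_trans Ephi _; rewrite ltry.
  by apply: integral_ge0 => x _; rewrite lee_fin expR_ge0.
rewrite -(fineK finE) prodEFin lee_fin prodr_const card_ord expRM_natl.
apply: lerXn2r; rewrite ?nnegrE ?expR_ge0//.
  by apply: fine_ge0; apply: integral_ge0 => x _; rewrite lee_fin expR_ge0.
apply: le_trans (expR_ge1Dx c); rewrite -lee_fin fineK//.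
Qed.

End chernoff.

Section truncation_moments.
Context {R : realType} (nu : probability R R).
Hypotheses (meanX : (\int[nu]_x x%:E = 0)%E) (varX : (\int[nu]_x (x ^+ 2)%:E = 1)%E).
Hypothesis intX : nu.-integrable setT (EFin \o @id R).
Variables (s b M : R).
Hypotheses (s2 : 2 <= s) (b0 : 0 < b).
Hypothesis Ms : (\int[nu]_x (`|x| `^ s)%:E <= M%:E)%E.

Lemma M_ge0 : 0 <= M.
Proof.
rewrite -lee_fin; apply: le_trans Ms.
by apply: integral_ge0 => x _; rewrite lee_fin powR_ge0.
Qed.

Lemma measurable_powRabs : measurable_fun setT (fun x : R => `|x| `^ s).
Proof.
by apply: (measurableT_comp (measurable_powR s)).
Qed.

(** Markov's inequality for the truncated moments of order [k <= s]. *)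
Lemma tail_moment (h : R -> R) (k : R) : measurable_fun setT h -> k <= s ->
  (forall x, 0 <= h x <= `|x| `^ k) -> (forall x, `|x| <= b -> h x = 0) ->
  (\int[nu]_x (h x)%:E <= (b `^ (k - s) * M)%:E)%E.
Proof.
move=> mh ks h01 hb; rewrite EFinM.
apply: (@le_trans _ _ ((b `^ (k - s))%:E * \int[nu]_x (`|x| `^ s)%:E))%E; last first.
  by apply: lee_wpmul2l => //; rewrite lee_fin powR_ge0.
rewrite -ge0_integralZl//; last 2 first.
- by apply/measurable_EFinP; exact: measurable_powRabs.
- by rewrite lee_fin powR_ge0.
apply: ge0_le_integral => //.
- by move=> x _; rewrite lee_fin; case/andP: (h01 x).
- exact/measurable_EFinP.
- by apply: measurable_funeM; apply/measurable_EFinP; exact: measurable_powRabs.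
move=> x _; rewrite -EFinM lee_fin; have [xb|bx] := leP `|x| b.
  by rewrite hb// mulr_ge0 ?powR_ge0.
have /andP[_ hx] := h01 x; apply: le_trans hx _.
have x0 : 0 < `|x| by exact: lt_trans bx.
have -> : `|x| `^ k = `|x| `^ (k - s) * `|x| `^ s.
  by rewrite -powRD ?subrK//; apply/implyP => _; rewrite gt_eqF.
rewrite ler_wpM2r ?powR_ge0//.
have -> : k - s = - (s - k) by rewrite opprB.
rewrite !powRN lef_pV2 ?posrE ?powR_gt0//.
by rewrite ge0_ler_powR ?subr_ge0 ?nnegrE ?(ltW b0) ?(ltW x0) ?(ltW bx).
Qed.

Lemma exceeds_moment : (\int[nu]_x (exceeds b x)%:E <= (b `^ (- s) * M)%:E)%E.
Proof.
rewrite -(sub0r s); apply: tail_moment; first exact: (bounded_exceeds b).1.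
- by rewrite (le_trans _ s2).
- by move=> x; rewrite powRr0 /exceeds ler0n lern1 leq_b1.
- by move=> x; rewrite /exceeds ltNge => ->.
Qed.

Lemma truncate_mean : (\int[nu]_x (truncate b x)%:E <= (b `^ (1 - s) * M)%:E)%E.
Proof.
pose h x := `|x| * exceeds b x.
have mh : measurable_fun setT h.
  by apply: measurable_funM; [exact: normr_measurable|exact: (bounded_exceeds b).1].
have hE : (\int[nu]_x (h x)%:E <= (b `^ (1 - s) * M)%:E)%E.
  apply: tail_moment => //.
  - by rewrite (le_trans _ s2)// ler1n.
  - move=> x; rewrite /h powRr1// mulr_ge0 ?ler0n//=.
    by rewrite ler_piMr// /exceeds lern1 leq_b1.
  - by move=> x xb; rewrite /h /exceeds ltNge xb mulr0.
apply: le_trans hE.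
have inth : nu.-integrable setT (EFin \o h).
  apply: le_integrable intX => //; first exact/measurable_EFinP.
  move=> x _ /=; rewrite lee_fin /h normrM normr_id ler_piMr//.
  by rewrite ger0_norm ?ler0n// /exceeds lern1 leq_b1.
have intT : nu.-integrable setT (EFin \o truncate b).
  by apply: integrable_bounded; exact: bounded_truncate (ltW b0).
have : (\int[nu]_x ((h x)%:E - (truncate b x)%:E + x%:E) >= 0)%E.
  apply: integral_ge0 => x _; rewrite -EFinB -EFinD lee_fin /h /exceeds /truncate.
  case: (leP `|x| b) => _; rewrite ?mulr0 ?mulr1 ?subr0; first by rewrite sub0r addNr.
  by have := ler_norm (- x); rewrite normrN; lra.
rewrite integralD//; last exact: integrableB.
rewrite meanX adde0 integralB//.
rewrite sube_ge0//; apply/orP; left.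
exact: integrable_fin_num.
Qed.

End truncation_moments.

Section irregular.
Context {R : realType} d (T : measurableType d) (P : probability T R).
Variables (X : nat -> T -> R) (nu : probability R R).
Hypothesis iidX : iid_law P X nu.
Hypotheses (intX : nu.-integrable setT (EFin \o @id R))
  (meanX : (\int[nu]_x x%:E = 0)%E) (varX : (\int[nu]_x (x ^+ 2)%:E = 1)%E).
Variables (s b M : R) (n : nat).
Hypotheses (s2 : 2 <= s) (b0 : 0 < b) (n0 : (0 < n)%N).
Hypothesis Ms : (\int[nu]_x (`|x| `^ s)%:E <= M%:E)%E.

Lemma expR_le_quadratic (x : R) : x <= 1 -> -1 <= x -> expR x <= 1 + x + 2 * x ^+ 2.
Proof.
move=> x1 xN1; have [x0|x0] := leP 0 x.
  (* exp(x) <= 1/(1 - x) is too weak near 1, so it is applied to x/2 *)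
  have h : expR (x / 2) <= (1 - x / 2)^-1.
    rewrite -[expR _]invrK -expRN lef_pV2 ?posrE ?expR_gt0//; last lra.
    exact: expR_ge1Dx.
  have -> : expR x = expR (x / 2) ^+ 2 by rewrite -expRM_natl; congr expR; field.
  apply: (@le_trans _ _ ((1 - x / 2)^-1 ^+ 2)).
    by apply: lerXn2r; rewrite ?nnegrE ?expR_ge0// invr_ge0; lra.
  have y0 : 0 < 1 - x / 2 by lra.
  rewrite exprVn -[_^-1]mul1r ler_pdivrMr ?exprn_gt0//.
  rewrite -subr_ge0 (_ : _ - 1 = x ^+ 2 * ((1 - x) * (5 / 4 - x / 2))); last by field.
  by rewrite mulr_ge0 ?sqr_ge0// mulr_ge0; lra.
have h : expR x <= (1 - x)^-1.
  rewrite -[expR _]invrK -expRN lef_pV2 ?posrE ?expR_gt0//; last lra.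
  exact: expR_ge1Dx.
have y0 : 0 < 1 - x by lra.
apply: le_trans h _; rewrite -[_^-1]mul1r ler_pdivrMr//.
rewrite -subr_ge0 (_ : _ - 1 = x ^+ 2 * (1 - 2 * x)); last by ring.
by rewrite mulr_ge0 ?sqr_ge0//; lra.
Qed.

Lemma squares_tail :
  pr P [set w | 3 * n%:R < truncated_squares n b (trajectory X w)] <=
  expR (- (n%:R / (2 * b ^+ 2))).
Proof.
have mtr := (bounded_truncate (ltW b0)).1.
have msq : measurable_fun setT (fun x => truncate b x ^+ 2) by exact: measurable_funX.
pose phi x := truncate b x ^+ 2 / (2 * b ^+ 2).
have mphi : measurable_fun setT phi by exact: measurable_funM.
have b2 : 0 < b ^+ 2 by rewrite exprn_gt0.
have b22 : 0 < 2 * b ^+ 2 by rewrite mulr_gt0.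
have phi01 x : 0 <= phi x <= 2^-1.
  rewrite /phi divr_ge0 ?sqr_ge0 ?(ltW b22)//= ler_pdivrMr// mulKf ?pnatr_eq0// /truncate.
  case: ifP => xb; last by rewrite expr0n ltW.
  by rewrite -(@ger0_norm _ (x ^+ 2)) ?sqr_ge0// normrX lerXn2r ?nnegrE// ltW.
have cge : 0 <= (b ^+ 2)^-1 by rewrite invr_ge0 ltW.
have Ephi : (\int[nu]_x (expR (phi x))%:E <= (1 + (b ^+ 2)^-1)%:E)%E.
  apply: (@le_trans _ _ (\int[nu]_x (1 + (b ^+ 2)^-1 * x ^+ 2)%:E)%E).
    apply: ge0_le_integral => //.
    - by apply/measurable_EFinP; exact: measurableT_comp.
    - by apply/measurable_EFinP; apply: measurable_funD => //; apply: measurable_funM => //; exact: measurable_funX.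
    move=> x _; rewrite lee_fin; have /andP[p0 p1] := phi01 x.
    apply: (@le_trans _ _ (1 + 2 * phi x)).
      apply: le_trans (expR_le_quadratic _ _) _; [lra|lra|].
      rewrite -subr_ge0 (_ : _ - _ = phi x * (1 - 2 * phi x)); last by ring.
      by rewrite mulr_ge0//; lra.
    have -> : 2 * phi x = (b ^+ 2)^-1 * truncate b x ^+ 2 by rewrite /phi; field; rewrite gt_eqF.
    rewrite lerD2l ler_wpM2l//.
    by rewrite /truncate; case: ifP => // _; rewrite expr0n sqr_ge0.
  under eq_integral do rewrite EFinD EFinM.
  rewrite ge0_integralD//; last 2 first.
  - by move=> x _; rewrite mule_ge0// lee_fin// sqr_ge0.
  - by apply: measurable_funeM; apply/measurable_EFinP; exact: measurable_funX.
  rewrite ge0_integralZl//; last 2 first.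
  - by apply/measurable_EFinP; exact: measurable_funX.
  - by move=> x _; rewrite lee_fin sqr_ge0.
  by rewrite varX mule1 integral_cst// [X in (1%:E * X)%E]probability_setT mule1.
apply: (@le_trans _ _ (pr P [set w | 3 * n%:R / (2 * b ^+ 2) <= \sum_(i < n) phi (X i w)])).
  apply: pr_le.
  - rewrite (_ : [set w | _] = (fun w => truncated_squares n b (trajectory X w)) @^-1` `]3 * n%:R, +oo[%classic).
      rewrite -[X in measurable X]setTI; apply: (measurable_sum_coord iidX n msq) => //.
    by apply/seteqP; split => w /=; rewrite in_itv/= andbT.
  - exact/measurable_le_set/(measurable_sum_coord iidX n mphi).
  - by move=> w /= h; rewrite -mulr_suml ler_wpM2r ?invr_ge0 ?(ltW b22)// ltW.
apply: le_trans (chernoff iidX n _ mphi cge Ephi) _.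
by rewrite ler_expR le_eqVlt; apply/orP; left; apply/eqP; field; rewrite gt_eqF.
Qed.

(** Chernoff's bound at slope [t / sqrt n], for which the exponent of a truncated
    variable is at most 1 and the quadratic bound of the exponential applies. *)
Lemma sum_tail (t : R) : 0 < t -> t * b <= Num.sqrt n%:R ->
  Num.sqrt n%:R * (b `^ (1 - s) * M) <= t / 2 ->
  pr P [set w | 4 * Num.sqrt n%:R * t < truncated_sum n b (trajectory X w)] <=
  expR (- (3 / 2 * t ^+ 2)).
Proof.
move=> t0 tb Mt; set q := Num.sqrt n%:R in tb Mt *.
have q0 : 0 < q by rewrite sqrtr_gt0 ltr0n.
have qq : q ^+ 2 = n%:R by rewrite sqr_sqrtr.
have mtr := (bounded_truncate (ltW b0)).1.
set l := t / q; have l0 : 0 < l by rewrite divr_gt0.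
pose phi x := l * truncate b x.
have mphi : measurable_fun setT phi by exact: measurable_funM.
have phi1 x : `|phi x| <= 1.
  rewrite normrM (gtr0_norm l0) /l mulrAC ler_pdivrMr// mul1r.
  apply: le_trans tb; rewrite ler_wpM2l ?(ltW t0)// /truncate; case: ifP => // _.
  by rewrite normr0 ltW.
set eta := b `^ (1 - s) * M in Mt.
have eta0 : 0 <= eta by rewrite mulr_ge0 ?powR_ge0// (M_ge0 Ms).
have cge : 0 <= l * eta + 2 * l ^+ 2 by apply: addr_ge0; apply: mulr_ge0; rewrite ?sqr_ge0 ?(ltW l0).
have intT : nu.-integrable setT (EFin \o truncate b).
  by apply: integrable_bounded; exact: bounded_truncate (ltW b0).
have intsq : nu.-integrable setT (fun x => (x ^+ 2)%:E).
  apply/integrableP; split; first by apply/measurable_EFinP; exact: measurable_funX.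
  rewrite (_ : (\int[nu]_x `|(x ^+ 2)%:E|)%E = 1%E) ?ltry//.
  by rewrite -varX; apply: eq_integral => x _; rewrite gee0_abs// lee_fin sqr_ge0.
have int2 : nu.-integrable setT (fun x => (2 * l ^+ 2 * x ^+ 2)%:E).
  by under eq_fun do rewrite EFinM; exact: integrableZl.
have Ephi : (\int[nu]_x (expR (phi x))%:E <= (1 + (l * eta + 2 * l ^+ 2))%:E)%E.
  apply: (@le_trans _ _ (\int[nu]_x ((1 + phi x)%:E + (2 * l ^+ 2 * x ^+ 2)%:E))%E).
    apply: ge0_le_integral => //.
    - by apply/measurable_EFinP; exact: measurableT_comp.
    - apply: emeasurable_funD; first by apply/measurable_EFinP; exact: measurable_funD.
      by apply/measurable_EFinP; apply: measurable_funM => //; exact: measurable_funX.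
    move=> x _; rewrite -EFinD lee_fin.
    have /ler_normlP[h1 h2] := phi1 x.
    apply: le_trans (expR_le_quadratic h2 _) _; first by rewrite lerNl.
    have l2 : 0 <= 2 * l ^+ 2 by apply: mulr_ge0 => //; exact: sqr_ge0.
    rewrite lerD2l /phi exprMn mulrA ler_wpM2l// /truncate.
    by case: ifP => // _; rewrite expr0n sqr_ge0.
  have intP : nu.-integrable setT (fun x => (phi x)%:E).
    by rewrite /phi; under eq_fun do rewrite EFinM; exact: integrableZl.
  have intC : nu.-integrable setT (cst 1%E : R -> \bar R).
    by apply: finite_measure_integrable_cst.
  rewrite integralD//; last by under eq_fun do rewrite EFinD; exact: integrableD.
  under eq_integral do rewrite EFinD.
  rewrite integralD//.
  rewrite integral_cst// [X in (1%:E * X)%E]probability_setT mule1.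
  have -> : (\int[nu]_x (2 * l ^+ 2 * x ^+ 2)%:E = (2 * l ^+ 2)%:E)%E.
    under eq_integral do rewrite EFinM.
    by rewrite integralZl// varX mule1.
  have -> : (\int[nu]_x (phi x)%:E = l%:E * \int[nu]_x (truncate b x)%:E)%E.
    by under eq_integral do rewrite EFinM; rewrite integralZl.
  have -> : (1 + (l * eta + 2 * l ^+ 2))%:E = (1 + (l * eta)%:E + (2 * l ^+ 2)%:E)%E.
    by rewrite !EFinD addeA.
  apply: leeD2r; apply: leeD2l; rewrite (EFinM l eta); apply: lee_wpmul2l; first by rewrite lee_fin ltW.
  exact: truncate_mean.
apply: (@le_trans _ _ (pr P [set w | 4 * t ^+ 2 <= \sum_(i < n) phi (X i w)])).
  apply: pr_le.
  - rewrite (_ : [set w | _] = (fun w => truncated_sum n b (trajectory X w)) @^-1` `]4 * q * t, +oo[%classic).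
      rewrite -[X in measurable X]setTI; apply: (measurable_sum_coord iidX n mtr) => //.
    by apply/seteqP; split => w /=; rewrite in_itv/= andbT.
  - exact/measurable_le_set/(measurable_sum_coord iidX n mphi).
  - move=> w /= /ltW h; rewrite -mulr_sumr /l mulrAC ler_pdivlMr//.
    by apply: le_trans (ler_wpM2l (ltW t0) h); rewrite le_eqVlt; apply/orP; left; apply/eqP; ring.
apply: le_trans (chernoff iidX n _ mphi cge Ephi) _.
rewrite ler_expR -qq /l.
have -> : q ^+ 2 * (t / q * eta + 2 * (t / q) ^+ 2) = t * (q * eta) + 2 * t ^+ 2.
  by field; rewrite gt_eqF.
have := ler_wpM2l (ltW t0) Mt; nra.
Qed.

Lemma exceedances_tail (kap eta : R) : 0 <= eta -> 0 <= kap ->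
  expR eta * (b `^ (- s) * M) <= M / n%:R ->
  pr P [set w | kap < exceedances n b (trajectory X w)] <= expR (M - eta * kap).
Proof.
move=> eta0 kap0 etaM; have mex := (bounded_exceeds b).1.
pose phi x := eta * exceeds b x.
have mphi : measurable_fun setT phi by exact: measurable_funM.
have M0 := M_ge0 Ms.
have cge : 0 <= M / n%:R by rewrite divr_ge0.
have Ephi : (\int[nu]_x (expR (phi x))%:E <= (1 + M / n%:R)%:E)%E.
  apply: (@le_trans _ _ (\int[nu]_x (1%:E + (expR eta)%:E * (exceeds b x)%:E))%E).
    apply: ge0_le_integral => //.
    - by apply/measurable_EFinP; exact: measurableT_comp.
    - by apply: emeasurable_funD => //; apply: measurable_funeM; exact/measurable_EFinP.
    move=> x _; rewrite -EFinM -EFinD lee_fin /phi /exceeds.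
    by case: (_ < _); rewrite ?mulr1 ?mulr0 ?expR0 ?addr0// lerDr.
  rewrite ge0_integralD//; last 2 first.
  - by move=> x _; rewrite mule_ge0// lee_fin// ?expR_ge0 ?ler0n.
  - by apply: measurable_funeM; exact/measurable_EFinP.
  rewrite ge0_integralZl ?lee_fin ?expR_ge0//; last 2 first.
  - exact/measurable_EFinP.
  - by move=> x _; rewrite lee_fin ler0n.
  rewrite integral_cst// [X in (1%:E * X)%E]probability_setT mule1 EFinD leeD2l//.
  apply: (@le_trans _ _ ((expR eta)%:E * (b `^ (- s) * M)%:E)%E).
    by rewrite lee_wpmul2l ?lee_fin ?expR_ge0//; exact: exceeds_moment.
  by rewrite -EFinM lee_fin.
apply: (@le_trans _ _ (pr P [set w | eta * kap <= \sum_(i < n) phi (X i w)])).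
  apply: pr_le.
  - rewrite (_ : [set w | _] = (fun w => exceedances n b (trajectory X w)) @^-1` `]kap, +oo[%classic).
      rewrite -[X in measurable X]setTI; apply: (measurable_sum_coord iidX n mex) => //.
    by apply/seteqP; split => w /=; rewrite in_itv/= andbT.
  - exact/measurable_le_set/(measurable_sum_coord iidX n mphi).
  - by move=> w /= /ltW h; rewrite -mulr_sumr ler_wpM2l.
apply: le_trans (chernoff iidX n _ mphi cge Ephi) _.
by rewrite ler_expR mulrCA mulfV ?mulr1// pnatr_eq0 -lt0n.
Qed.

Definition large_sum (s : nat -> R) : R := \sum_(i < n) `|s i| * exceeds b (s i).

(** If the truncated sum falls below [sqrt n t / 2] although the sum reaches
    [y], the large terms contribute at least [sqrt n t / 4]; every other
    irregularity is a large deviation of a sum of bounded variables. *)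
Lemma irregular_tail (t kap eta y : R) : 0 < t -> t * b <= Num.sqrt n%:R ->
  Num.sqrt n%:R * (b `^ (1 - s) * M) <= t / 2 -> 0 <= eta -> 0 <= kap ->
  expR eta * (b `^ (- s) * M) <= M / n%:R -> 3 / 4 * Num.sqrt n%:R * t <= y ->
  pr P [set w | y <= ssum (trajectory X w) n /\
    ~ regular_sample n b (3 * n%:R) kap (Num.sqrt n%:R * t / 2) (4 * Num.sqrt n%:R * t)
        (trajectory X w)] <=
  expR (- (n%:R / (2 * b ^+ 2))) + expR (- (3 / 2 * t ^+ 2)) + expR (M - eta * kap) +
  pr P [set w | Num.sqrt n%:R * t / 4 <= large_sum (trajectory X w)].
Proof.
move=> t0 tb Mt eta0 kap0 etaM yt; set q := Num.sqrt _ in tb Mt yt *.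
have mtr := (bounded_truncate (ltW b0)).1; have mex := (bounded_exceeds b).1.
have msq : measurable_fun setT (fun x => truncate b x ^+ 2) by exact: measurable_funX.
have mA := measurable_lt_set (3 * n%:R) (measurable_sum_coord iidX n msq).
have mB := measurable_lt_set (4 * q * t) (measurable_sum_coord iidX n mtr).
have mC := measurable_lt_set kap (measurable_sum_coord iidX n mex).
have mD : measurable [set w | q * t / 4 <= large_sum (trajectory X w)].
  apply: measurable_le_set; apply: (measurable_sum_coord iidX n (phi := fun x => `|x| * exceeds b x)).
  by apply: measurable_funM => //; exact: measurableT_comp.
apply: le_trans (lerD (lerD (lerD squares_tail (sum_tail t0 tb Mt))
  (exceedances_tail eta0 kap0 etaM)) (lexx _)).
apply: le_trans (lerD (lerD (pr_setU_le P mA mB) (lexx _)) (lexx _)).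
apply: le_trans (lerD (pr_setU_le P (measurableU _ _ mA mB) mC) (lexx _)).
apply: le_trans (pr_setU_le P (measurableU _ _ (measurableU _ _ mA mB) mC) mD).
apply: pr_le.
- apply: measurableI; first exact: measurable_le_set (measurable_ssum_coord iidX n id).
  apply: measurableC; rewrite -[X in measurable X]setTI.
  apply: (measurable_trajectory iidX) => //; apply: measurable_regular_sample; exact: ltW.
- by do 3 apply: measurableU => //.
move=> w /= [ySn notreg].
have [|sq] := ltP (3 * n%:R) (truncated_squares n b (trajectory X w)); first by do 3 left.
have [|cn] := ltP kap (exceedances n b (trajectory X w)); first by left; right.
have [|ts] := ltP (4 * q * t) (truncated_sum n b (trajectory X w)); first by do 2 left; right.
right; have ts' : truncated_sum n b (trajectory X w) < q * t / 2.
  rewrite ltNge; apply/negP => h; apply: notreg; split => //.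
  by rewrite h ts.
have : ssum (trajectory X w) n <= truncated_sum n b (trajectory X w) + large_sum (trajectory X w).
  rewrite -big_split/=; apply: ler_sum => i _; rewrite /truncate /exceeds.
  case: (leP `|trajectory X w i| b) => _; first by rewrite mulr0 addr0.
  by rewrite mulr1 add0r ler_norm.
by lra.
Qed.

End irregular.

(** * Coupling by quantile transforms *)

Section continuous_functionals.
Context {R : realType}.

Lemma floor_cvg (x : R) : (Num.floor (k.+1%:R * x))%:~R / k.+1%:R @[k --> \oo] --> x.
Proof.
have h : x - k.+1%:R^-1 @[k --> \oo] --> x - 0.
  by apply: cvgB; [exact: cvg_cst|exact: cvg_harmonic].
rewrite subr0 in h.
apply: (squeeze_cvgr _ h (cvg_cst x)); near=> k.
have k0 : 0 < k.+1%:R :> R by rewrite ltr0n.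
have /andP[lo hi] := real_floor_itv (num_real (k.+1%:R * x)).
rewrite ler_pdivrMr// [x * _]mulrC lo andbT ler_pdivlMr// mulrBl mulVf ?gt_eqF//.
rewrite lerBlDr [x * _]mulrC; apply: le_trans (ltW hi) _.
by rewrite rmorphD.
Unshelve. all: by end_near. Qed.

(** Rounding the coordinates to multiples of [1/k] exhibits such a functional as a
    limit of functionals with countably many values. *)
Lemma measurable_seq_continuous (p : nat) (f : seqR R -> R) : depends_on p f ->
  (forall (x : nat -> seqR R) (y : seqR R),
    (forall i, (i < p)%N -> x k i @[k --> \oo] --> y i) -> f (x k) @[k --> \oo] --> f y) ->
  measurable_fun setT f.
Proof.
move=> depf cf.
pose code k (s : seqR R) : nat := pickle [ffun i : 'I_p => Num.floor (k.+1%:R * s i)].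
pose decode k (c : nat) : seqR R := fun i =>
  if unpickle c is Some m then
    if insub i is Some j then ((m : {ffun 'I_p -> int}) j)%:~R / k.+1%:R else 0
  else 0.
pose h k (s : seqR R) := f (decode k (code k s)).
apply: (@measurable_fun_cvg _ _ _ setT h) => [k|s _]; last first.
  apply: (cf (fun k => decode k (code k s)) s) => i ip.
  rewrite (_ : (fun k => _) = fun k => (Num.floor (k.+1%:R * s i))%:~R / k.+1%:R).
    exact: floor_cvg.
  by apply/funext => k; rewrite /decode /code pickleK insubT/= ffunE.
have mcode : forall c : nat, measurable (code k @^-1` [set c]).
  move=> c.
  have [[m|] uc] : exists m, (unpickle c : option {ffun 'I_p -> int}) = m by eexists.
    have [pc|pc] := eqVneq (pickle m) c; last first.
      rewrite (_ : _ @^-1` _ = set0)//; apply/seteqP; split => // s /=.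
      by rewrite /code => sc; move: uc; rewrite -sc pickleK => -[mE]; move: pc; rewrite -mE sc eqxx.
    rewrite (_ : _ @^-1` _ = \big[setI/setT]_(i < p) [set s : seqR R |
      (m i)%:~R <= k.+1%:R * s i < (m i + 1)%:~R]).
      apply: bigsetI_measurable => i _.
      have mi : measurable_fun setT (fun s : seqR R => k.+1%:R * s i).
        by apply: measurable_funM => //; exact: measurable_coord.
      rewrite (_ : [set s | _] = (fun s : seqR R => k.+1%:R * s i) @^-1` `[(m i)%:~R, (m i + 1)%:~R[).
        by rewrite -[X in measurable X]setTI; exact: mi.
      by apply/seteqP; split => s /=; rewrite in_itv.
    rewrite -bigcap_seq; apply/seteqP; split => s /=.
      rewrite /code -pc => /(pcan_inj pickleK) sm i _ /=.
      by rewrite -sm ffunE; exact: (real_floor_itv (num_real _)).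
    move=> hs; rewrite /code -pc; congr pickle; apply/ffunP => i; rewrite ffunE.
    by apply: floor_def; apply: hs; rewrite /= mem_index_enum.
  rewrite (_ : _ @^-1` _ = set0)//; apply/seteqP; split => // s /= sc.
  by move: uc; rewrite -sc /code pickleK.
move=> _ B mB; rewrite setTI.
rewrite (_ : h k @^-1` B = \bigcup_c (if f (decode k c) \in B then code k @^-1` [set c] else set0)).
  by apply: bigcupT_measurable => c; case: ifP => // _; exact: mcode.
apply/seteqP; split => s /=.
  by move=> hB; exists (code k s) => //; rewrite mem_set.
by move=> [c _]; case: ifP => // /set_mem fB /= sc; rewrite /h sc.
Qed.

Variables (H : pointMeasure R -> R).
Hypothesis cH : continuous H.

Lemma continuous_seq_cvg (m : nat -> pointMeasure R) (l : pointMeasure R) :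
  m n @[n --> \oo] --> l -> H (m n) @[n --> \oo] --> H l.
Proof. by move=> ml A nA; exact: (ml _ (cH nA)). Qed.

Lemma H_vague_eq (m m' : pointMeasure R) :
  (forall f : Cc_nonneg R, vague_eval m f = vague_eval m' f) -> H m = H m'.
Proof.
move=> mm'; have h : (fun _ : nat => m) n @[n --> \oo] --> m'.
  by apply: vague_cvg => f; rewrite mm'; exact: cvg_cst.
have : (fun _ : nat => H m) n @[n --> \oo] --> H m' by exact: (@continuous_seq_cvg (fun=> m)).
by move/cvg_lim => <- //; rewrite lim_cst.
Qed.

Lemma H_dirac_sum_dep (p : nat) : depends_on p (fun s : seqR R => H (dirac_sum p s)).
Proof.
move=> s s' ss'; apply: H_vague_eq => f; rewrite !vague_eval_dirac_sum.
by apply: eq_bigr => i _; rewrite ss'.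
Qed.

Lemma H_dirac_sum_sym (p : nat) (Q : R -> R) :
  symmetric_in p (fun s : seqR R => H (dirac_sum p (fun i => Q (s i)))).
Proof.
move=> i j s ip jp; apply: H_vague_eq => f; rewrite !vague_eval_dirac_sum.
pose h (k : 'I_p) : 'I_p := Ordinal (etrans (swap_lt k ip jp) (ltn_ord k)).
have hK : involutive h by move=> k; apply: val_inj; exact: swapK.
by rewrite [RHS](reindex_inj (inv_inj hK)).
Qed.

Lemma measurable_H_dirac_sum (p : nat) :
  measurable_fun setT (fun s : seqR R => H (dirac_sum p s)).
Proof.
apply: (@measurable_seq_continuous p); first exact: H_dirac_sum_dep.
move=> x y xy; exact: continuous_seq_cvg (dirac_sum_cvg xy).
Qed.

Lemma measurable_H_limit_process d (T : measurableType d) (P : probability T R)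
    (E : nat -> T -> R) (nu : probability R R) : iid_law P E nu ->
  measurable_fun setT (fun w => H (limit_process E w)).
Proof.
move=> iidE.
pose pm w := is_point_measure (mseries (fun i =>
  \d_(- ln (partial_sum E i.+1 w)) : {measure set R -> \bar R}) 0).
have mpm : measurable [set w | pm w] by exact: measurable_point_measure iidE.
have mlog : measurable_fun setT (fun w => (fun i => - ln (partial_sum E i.+1 w)) : seqR R).
  apply: measurable_seqP => i; apply: measurableT_comp => //.
  apply: measurableT_comp; first exact: measurable_ln.
  by apply: measurable_sum => j; exact: (iidE.1 j).
pose z := H (PointMeasure (@is_point_measure0 R)).
pose h k w := if `[< pm w >] then H (dirac_sum k (fun i => - ln (partial_sum E i.+1 w))) else z.
apply: (@measurable_fun_cvg _ _ _ setT h) => [k|w _].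
  apply: measurable_fun_ifT => //.
    apply: (measurable_fun_bool true).
    rewrite (_ : _ @^-1` _ = [set w | pm w]) ?setTI//.
    by apply/seteqP; split => w /=; [move/asboolP|move=> ?; exact/asboolP].
  exact: measurableT_comp (measurable_H_dirac_sum k) mlog.
rewrite /h; case: asboolP => [pw|npw].
  exact: continuous_seq_cvg (dirac_series_cvg pw).
have -> : H (limit_process E w) = z; last exact: cvg_cst.
by rewrite /limit_process /dirac_series /to_pointMeasure; case: pselect.
Qed.

End continuous_functionals.

Section quantile.
Context {R : realType} d (T : measurableType d) (P : probability T R).
Variable X : {RV P >-> R}.

Let G (y : R) : R := fine (ccdf X y).

Let G_nincr y y' : y <= y' -> G y' <= G y.
Proof.
move=> yy'; apply: fine_le; rewrite ?fin_num_measure//; exact: ccdf_nonincreasing.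
Qed.

(** The inverse of [z |-> - ln (1 - P(X > z))], applied to a standard exponential
    variable, reproduces the law of [X]; being nonincreasing in [z], it turns
    small values of the exponential variable into large values of [X]. *)
Definition exp_quantile (z : R) : R :=
  if 0 < z then inf [set y | G y <= 1 - expR (- z)] else 0.

Lemma exp_quantile_le z y : 0 < z -> (exp_quantile z <= y) <-> (G y <= 1 - expR (- z)).
Proof.
move=> z0; rewrite /exp_quantile z0; set c := 1 - _; set A := [set y | _].
have c0 : 0 < c by rewrite subr_gt0 expR_lt1 oppr_lt0.
have c1 : c < 1 by rewrite ltrBlDr ltrDl expR_gt0.
have [y1 Gy1] : exists y1, G y1 <= c.
  have /fine_cvg h := @cvg_ccdfy0 _ _ _ P X.
  have [y1 [_ h1]] : \forall y \near +oo, fine (ccdf X y) <= c by exact: (cvgr_le _ h).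
  by exists (y1 + 1); apply: h1; rewrite ltrDl.
have [y0 Gy0] : exists y0, c < G y0.
  have /fine_cvg h := @cvg_ccdfNy1 _ _ _ P X.
  have [y0 [_ h0]] : \forall y \near -oo, c < fine (ccdf X y) by exact: (cvgr_gt _ h).
  by exists (y0 - 1); apply: h0; rewrite ltrBlDr ltrDl.
have lbA : lbound A y0.
  move=> a Aa; rewrite leNgt; apply/negP => /ltW /G_nincr; rewrite leNgt => /negP; apply.
  by apply: le_lt_trans Gy0.
have hiA : has_inf A by split; [exists y1|exists y0].
split => [infy|Gy]; last by apply: ge_inf => //; exists y0.
rewrite leNgt; apply/negP => cG.
have rc : G y' @[y' --> y^'+] --> G y.
  apply: fine_cvg; rewrite fineK ?fin_num_measure//; exact: ccdf_right_continuous.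
have : \forall y' \near y^'+, c < G y' by exact: (cvgr_gt _ rc).
have gt : \forall y' \near y^'+, y < y' by exact: nbhs_right_gt.
move=> near1; have [y' [yy' cGy']] := @filter_ex _ _ (at_right_proper_filter y) _ (filterI gt near1).
have [a Aa ay'] : exists2 a, A a & a < y'.
  have [//|none] := pselect (exists2 a, A a & a < y'); exfalso.
  have : y' <= inf A.
    apply: lb_le_inf; first by exists y1.
    by move=> a Aa; rewrite leNgt; apply/negP => ay; apply: none; exists a.
  by rewrite leNgt (le_lt_trans infy yy').
by move: cGy'; rewrite ltNge (le_trans (G_nincr (ltW ay')))//.
Qed.

Lemma exp_quantile_nincr z z' : 0 < z -> z <= z' -> exp_quantile z' <= exp_quantile z.
Proof.
move=> z0 zz'; apply/exp_quantile_le; first exact: lt_le_trans zz'.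
have /(exp_quantile_le _ z0) h : exp_quantile z <= exp_quantile z by [].
by apply: le_trans h _; rewrite lerD2l lerN2 ler_expR lerN2.
Qed.

Lemma measurable_exp_quantile : measurable_fun setT exp_quantile.
Proof.
apply: (measurability _ (RGenOInfty.measurableE R)) => //.
move=> _ [_ [y ->] <-]; rewrite setTI.
have mb : measurable_fun setT (fun z : R => if 0 < z then 1 - expR (- z) < G y else y < 0).
  apply: measurable_fun_ifT => //; first exact: measurable_fun_ltr.
  apply: measurable_fun_ltr => //; apply: measurable_funB => //.
  by apply: measurableT_comp => //; exact: measurableT_comp.
have := mb measurableT [set true] Logic.I; rewrite setTI; congr measurable.
apply/seteqP; split => z /=; rewrite in_itv/= andbT.
  case: ifPn => z0; last by rewrite /exp_quantile (negbTE z0).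
  by rewrite ltNge => /negP h; rewrite ltNge; apply/negP => /(exp_quantile_le _ z0).
case: ifPn => z0; last by rewrite /exp_quantile (negbTE z0).
by rewrite ltNge => /negP h; rewrite ltNge; apply/negP => /(exp_quantile_le _ z0).
Qed.

Variable nu : probability R R.
Hypothesis nuE : forall A, measurable A -> nu A = exponential_prob 1 A.

Lemma exponential_itvcy (a : R) : 0 <= a -> nu `[a, +oo[%classic = (expR (- a))%:E.
Proof.
move=> a0; have := exponential_shift nuE a0 (@measurable_cst _ _ _ _ setT (1%E : \bar R)) (fun=> lee01).
have e1 : (\int[nu]_y (cst 1%E (a + y)%R) = 1)%E.
  by rewrite (_ : (fun _ => _) = cst 1%E)// integral_cst// mul1e; exact: probability_setT.
rewrite e1 mule1 => <-.
rewrite -[X in nu X = _]setIT -integral_indic//; apply: eq_integral => y _.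
rewrite mul1e indicE; congr (_%:E); congr (nat_of_bool _)%:R.
by apply/idP/idP; rewrite inE/= in_itv/= andbT.
Qed.

Lemma ae_exponential_gt0 : {ae nu, forall z : R, 0 < z}.
Proof.
exists (`]-oo, 0]%classic); split => //; last by move=> z /= /negP; rewrite -leNgt in_itv.
have -> : `]-oo, 0]%classic = ~` `[0, +oo[%classic `|` [set (0 : R)].
  apply/seteqP; split => z /=; rewrite !in_itv/= ?andbT.
    by rewrite le_eqVlt => /orP[/eqP ->|z0]; [right|left; apply/negP; rewrite -ltNge].
  by move=> [/negP|->//]; rewrite -ltNge => /ltW.
apply/eqP; rewrite eq_le measure_ge0 andbT.
apply: le_trans (measureU2 _ _ _) _ => //; first exact: measurableC.
rewrite [X in (_ + X)%E](exponential_set1 nuE) adde0.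
by rewrite [leLHS]probability_setC// (exponential_ge0 nuE) subee.
Qed.

Lemma exp_quantile_law A : measurable A ->
  distribution P X A = nu (exp_quantile @^-1` A).
Proof.
pose nu' := measure_function_pushforward__canonical__measure_function_Measure nu measurable_exp_quantile.
suff : forall A : set R, measurable A -> distribution P X A = nu' A by move=> h /h.
move=> B mB.
apply: (@measure_unique _ R _ (@RGenOInfty.G R) (fun k : nat => `]- k%:R, +oo[%classic)) => //.
- exact: RGenOInfty.measurableE.
- move=> _ _ [x ->] [y ->]; exists (Num.max x y).
  by apply/seteqP; split => z /=; rewrite !in_itv/= !andbT gt_max => /andP.
- by move=> k; exists (- k%:R).
- apply/seteqP; split => // x _; exists (Num.bound `|x|) => //=.
  by rewrite in_itv/= andbT ltrNl (le_lt_trans _ (archi_boundP (normr_ge0 x)))// -normrN ler_norm.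
- move=> _ [y ->].
  have Gfin : ccdf X y = (G y)%:E by rewrite fineK// fin_num_measure.
  rewrite -[LHS]/(ccdf X y) Gfin.
  have G1 : G y <= 1 by rewrite -lee_fin -Gfin; exact: probability_le1.
  have mle : measurable [set z : R | G y <= 1 - expR (- z)].
    apply: measurable_le_set; apply: measurable_funB => //.
    by apply: measurableT_comp => //; exact: measurableT_comp.
  have nule : nu [set z : R | G y <= 1 - expR (- z)] = (1 - G y)%:E.
    have [Gy|Gy] := ltP (G y) 1; last first.
      have -> : G y = 1 by apply/eqP; rewrite eq_le G1.
      rewrite subrr (_ : [set z | _] = set0) ?measure0//.
      apply/seteqP; split => // z /=; rewrite lerBrDr -lerBrDl subrr.
      by rewrite leNgt expR_gt0.
    have G0 : 0 <= G y by rewrite -lee_fin -Gfin; exact: measure_ge0.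
    have pos : 0 < 1 - G y by rewrite subr_gt0.
    have -> : [set z : R | G y <= 1 - expR (- z)] = `[- ln (1 - G y), +oo[%classic.
      apply/seteqP; split => z /=; rewrite in_itv/= andbT lerBrDr -lerBrDl lerNl.
        by move=> h; rewrite -[leLHS]expRK ler_ln ?posrE ?expR_gt0.
      by move=> h; rewrite -[leRHS]lnK ?posrE// ler_expR.
    rewrite exponential_itvcy ?opprK ?lnK ?posrE//.
    by rewrite oppr_ge0 ln_le0// lerBlDr lerDl.
  have -> : nu' `]y, +oo[%classic = nu (~` [set z : R | G y <= 1 - expR (- z)]).
    apply: ae_eq_probability.
    - by rewrite -[X in measurable X]setTI; apply: measurable_exp_quantile => //; exact: measurable_itv.
    - exact: measurableC.
    apply: filterS ae_exponential_gt0 => z z0 /=; rewrite in_itv/= andbT ltNge.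
    by split => [/negP h /(exp_quantile_le _ z0)//|h]; apply/negP => /(exp_quantile_le _ z0).
  by rewrite probability_setC// nule -EFinB opprB addrCA subrr addr0.
- by move=> k; apply: le_lt_trans (probability_le1 _ _) _; rewrite ?ltry.
Qed.

End quantile.

Section quantile_limit.
Context {R : realType} d (T : measurableType d) (P : probability T R).
Variables (X : nat -> {RV P >-> R}) (p : nat -> nat).
Hypothesis p_infty : p n @[n --> \oo] --> \oo.
Hypothesis tail : forall y : R, (p n)%:R * fine (ccdf (X n) y) @[n --> \oo] --> expR (- y).

(** At an argument of order [g / p] the quantile transform takes a value whose
    tail probability is about [g / p], and by the tail assumption this value is
    near [- ln g]. *)
Lemma exp_quantile_cvg (z : nat -> R) (g : R) : (forall n, 0 < z n) -> 0 < g ->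
  (p n)%:R * (1 - expR (- z n)) @[n --> \oo] --> g ->
  exp_quantile (X n) (z n) @[n --> \oo] --> - ln g.
Proof.
move=> z0 g0 pz.
have pgt0 : \forall n \near \oo, 0 < (p n)%:R :> R.
  by near=> n; rewrite ltr0n; near: n; exact: p_infty (nbhs_infty_gt 0%N).
apply/cvgrPdist_le => e e0.
have up : expR (- (- ln g + e)) < g.
  by rewrite opprD opprK expRD lnK ?posrE// -[ltRHS]mulr1 ltr_pM2l// expR_lt1 oppr_lt0.
have lo : g < expR (- (- ln g - e)).
  by rewrite opprB opprK addrC expRD lnK ?posrE// -[ltLHS]mulr1 ltr_pM2l// expR_gt1.
have dup : 0 < g - expR (- (- ln g + e)) by rewrite subr_gt0.
have dlo : 0 < expR (- (- ln g - e)) - g by rewrite subr_gt0.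
have hup : (p n)%:R * (1 - expR (- z n)) - (p n)%:R * fine (ccdf (X n) (- ln g + e))
  @[n --> \oo] --> g - expR (- (- ln g + e)) by apply: cvgB => //; exact: tail.
have hlo : (p n)%:R * fine (ccdf (X n) (- ln g - e)) - (p n)%:R * (1 - expR (- z n))
  @[n --> \oo] --> expR (- (- ln g - e)) - g by apply: cvgB => //; exact: tail.
near=> n; rewrite ler_distlC; apply/andP; split.
  rewrite leNgt; apply/negP => /ltW /(exp_quantile_le _ _ (z0 n)); rewrite leNgt => /negP; apply.
  rewrite -(@ltr_pM2l _ (p n)%:R); last by near: n.
  by rewrite -subr_gt0; near: n; exact: (cvgr_gt _ hlo).
apply/(exp_quantile_le _ _ (z0 n)); apply: ltW.
rewrite -(@ltr_pM2l _ (p n)%:R); last by near: n.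
by rewrite -subr_gt0; near: n; exact: (cvgr_gt _ hup).
Unshelve. all: by end_near. Qed.

Lemma renyi_gt0 q (s : nat -> R) k : (forall i, 0 < s i) -> (k < q)%N -> 0 < renyi q s k.
Proof.
move=> s0 kq; rewrite /renyi big_ord_recl; apply: ltr_wpDr.
  by apply: sumr_ge0 => i _; rewrite divr_ge0 ?ler0n// ltW.
by rewrite divr_gt0// ltr0n subn_gt0 (leq_ltn_trans _ kq).
Qed.

Lemma renyi_le q (s : nat -> R) i k : (forall i, 0 < s i) -> (k <= i)%N ->
  renyi q s k <= renyi q s i.
Proof.
move=> s0 ki; rewrite -(subnK ki); elim: (i - k)%N => [//|m IH].
apply: le_trans IH _; rewrite addSn /renyi [leRHS]big_ord_recr/= lerDl.
by rewrite divr_ge0 ?ler0n// ltW.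
Qed.

Lemma renyi_cvg (s : nat -> R) k : (forall i, 0 < s i) ->
  (p n)%:R * (1 - expR (- renyi (p n) s k)) @[n --> \oo] --> ssum s k.+1.
Proof.
move=> s0.
have pR : ((p n)%:R : R) @[n --> \oo] --> (+oo%R : set_system R) by exact: cvg_comp p_infty cvgr_idn.
have pgt0 : \forall n \near \oo, 0 < (p n)%:R :> R.
  by near=> n; rewrite ltr0n; near: n; exact: p_infty (nbhs_infty_gt 0%N).
have pV : ((p n)%:R : R)^-1 @[n --> \oo] --> 0 by apply/gtr0_cvgV0.
have pj j : (p n)%:R / (p n - j)%:R @[n --> \oo] --> (1 : R).
  have h : (1 - j%:R * (p n)%:R^-1)^-1 @[n --> \oo] --> ((1 - j%:R * 0)^-1 : R).
    apply: cvgV; first by rewrite mulr0 subr0 oner_eq0.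
    by apply: cvgB; [exact: cvg_cst|apply: cvgM => //; exact: cvg_cst].
  rewrite mulr0 subr0 invr1 in h; refine (cvg_eq_near h _); near=> n.
  have jp : (j < p n)%N by near: n; exact: p_infty (nbhs_infty_gt j).
  have p0 : (p n)%:R != 0 :> R by rewrite pnatr_eq0 -lt0n (leq_ltn_trans _ jp).
  have pj0 : (p n - j)%:R != 0 :> R by rewrite pnatr_eq0 -lt0n subn_gt0.
  rewrite natrB ?(ltnW jp)// in pj0 *.
  by field; rewrite p0 pj0.
have pz : (p n)%:R * renyi (p n) s k @[n --> \oo] --> ssum s k.+1.
  rewrite /renyi /ssum; elim: k => [|k IH].
    rewrite big_ord1 (_ : (fun n => _) = fun n => s 0%N * ((p n)%:R / (p n - 0)%:R)).
    by rewrite -[X in _ --> X]mulr1; apply: cvgM; [exact: cvg_cst|exact: pj].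
    by apply/funext => n; rewrite big_ord1 mulrCA.
  rewrite big_ord_recr/= (_ : (fun n => _) = fun n =>
    (p n)%:R * (\sum_(j < k.+1) s j / (p n - j)%:R) + s k.+1 * ((p n)%:R / (p n - k.+1)%:R)); last first.
    by apply/funext => n; rewrite big_ord_recr/= mulrDr [in X in _ + X]mulrCA.
  by apply: cvgD => //; rewrite -[X in _ --> X]mulr1; apply: cvgM; [exact: cvg_cst|exact: pj].
have z0 : renyi (p n) s k @[n --> \oo] --> (0 : R).
  have h := cvgM pz pV; rewrite mulr0 in h; refine (cvg_eq_near (h _) _); near=> n.
  by rewrite /= mulrAC mulfV ?mul1r// gt_eqF//; near: n.
have low : (p n)%:R * renyi (p n) s k * (1 + renyi (p n) s k)^-1 @[n --> \oo] --> ssum s k.+1.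
  have hi : (1 + renyi (p n) s k)^-1 @[n --> \oo] --> ((1 + 0)^-1 : R).
    by apply: cvgV; [rewrite addr0 oner_eq0|apply: cvgD => //; exact: cvg_cst].
  by have h := cvgM pz hi; rewrite addr0 invr1 mulr1 in h; exact: h.
apply: (squeeze_cvgr _ low pz); near=> n.
have kp : (k < p n)%N by near: n; exact: p_infty (nbhs_infty_gt k).
have zp := renyi_gt0 s0 kp; set z := renyi _ _ _ in zp *.
rewrite -mulrA !ler_pM2l; try by near: n.
rewrite lerBlDr; apply/andP; split; last by have := expR_ge1Dx (- z); lra.
have h : expR (- z) <= (1 + z)^-1.
  by rewrite expRN lef_pV2 ?posrE ?expR_gt0 ?expR_ge1Dx// addr_gt0.
have -> : z * (1 + z)^-1 = 1 - (1 + z)^-1 by field; rewrite gt_eqF// addr_gt0.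
by lra.
Unshelve. all: by end_near. Qed.

(** One exponential sequence drives the processes for all [n]. Since [p] times
    the k-th order statistic tends to the k-th arrival time, the k-th largest
    point tends to the k-th point of the limit; the points are ordered, so those
    beyond a fixed rank lie to the left of the support of the test function. *)
Lemma coupled_process_cvg (s : nat -> R) : regular_arrivals s ->
  is_point_measure (mseries (fun i => \d_(- ln (ssum s i.+1)) : {measure set R -> \bar R}) 0) ->
  dirac_sum (p n) (fun i => exp_quantile (X n) (renyi (p n) s i)) @[n --> \oo] -->
  dirac_series (fun i => - ln (ssum s i.+1)).
Proof.
move=> [s0 unb] pm; apply: vague_cvg => f.
have [L fL] := Cc_support f.
have [k Mk] := unb (Num.bound (expR (L%:R + 1) : R)).
have Lk : - ln (ssum s k.+1) < - L%:R.
  rewrite ltrN2 -[ltLHS]expRK ltr_ln ?posrE ?expR_gt0//; last exact: arrival_gt0.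
  apply: lt_le_trans Mk; apply: lt_trans (archi_boundP (expR_ge0 _)).
  by rewrite ltr_expR ltrDl.
have far x : x < - L%:R -> sval f x = 0.
  by move=> xL; apply: fL; rewrite /sym_itv /= in_itv/= => /andP[+ _]; rewrite leNgt xL.
have limE : vague_eval (dirac_series (fun i => - ln (ssum s i.+1))) f =
    \sum_(i < k) sval f (- ln (ssum s i.+1)).
  rewrite vague_eval_dirac_series// (nneseries_split 0 k)//; last first.
    by move=> i _; rewrite lee_fin Cc_ge0.
  rewrite add0n eseries0 ?adde0 ?big_mkord ?sumEFin// => i ki _.
  rewrite far//; apply: le_lt_trans Lk; rewrite lerN2 ler_ln ?posrE; try exact: arrival_gt0.
  exact: arrival_le.
have Qcvg i : exp_quantile (X n) (renyi (p n) s i) @[n --> \oo] --> - ln (ssum s i.+1).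
  pose z n := if (i < p n)%N then renyi (p n) s i else 1.
  have zpos n : 0 < z n by rewrite /z; case: ifP => // ip; exact: renyi_gt0.
  have zE : \forall n \near \oo, renyi (p n) s i = z n.
    by near=> n; rewrite /z ifT//; near: n; exact: p_infty (nbhs_infty_gt i).
  have zc : (p n)%:R * (1 - expR (- z n)) @[n --> \oo] --> ssum s i.+1.
    by refine (cvg_eq_near (@renyi_cvg s i s0) _); apply: filterS zE => n ->.
  refine (cvg_eq_near (exp_quantile_cvg zpos (@arrival_gt0 _ s i s0) zc) _).
  by apply: filterS zE => n ->.
rewrite limE.
have fin : \sum_(i < k) sval f (exp_quantile (X n) (renyi (p n) s i)) @[n --> \oo] -->
    \sum_(i < k) sval f (- ln (ssum s i.+1)).
  elim: (k) => [|j IH].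
    by rewrite big_ord0; under eq_fun do rewrite big_ord0; exact: cvg_cst.
  rewrite big_ord_recr/=; under eq_fun do rewrite big_ord_recr/=.
  apply: cvgD => //; apply: continuous_cvg; last exact: Qcvg.
  by case: (svalP f) => cf _ _; exact: cf.
refine (cvg_eq_near fin _); near=> n; rewrite vague_eval_dirac_sum.
have kp : (k < p n)%N by near: n; exact: p_infty (nbhs_infty_gt k).
have Qk : exp_quantile (X n) (renyi (p n) s k) < - L%:R.
  by near: n; exact: (cvgr_lt _ (Qcvg k)).
rewrite -!(big_mkord xpredT (fun i => sval f (exp_quantile (X n) (renyi (p n) s i)))).
rewrite [RHS](big_cat_nat (leq0n k) (ltnW kp))/= [X in _ = _ + X]big_nat_cond [X in _ = _ + X]big1 ?addr0// => i.
rewrite andbT => /andP[ki ip]; apply: far; apply: le_lt_trans Qk.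
by apply: exp_quantile_nincr; [exact: renyi_gt0|exact: renyi_le].
Unshelve. all: by end_near. Qed.

Variables (xi : nat -> nat -> T -> R) (E : nat -> T -> R) (nu : probability R R).
Hypothesis iidxi : forall n, iid_law P (xi n) (distribution P (X n)).
Hypotheses (iidE : iid_law P E nu).
Hypothesis nuE : forall A, measurable A -> nu A = exponential_prob 1 A.

(** Applying the quantile transforms to iid exponential variables reproduces the
    law of the sample, and a point process does not see the order of its points,
    so the exponential variables may be replaced by their order statistics. *)
Lemma expect_coupling (H : pointMeasure R -> R) n : continuous H ->
  (exists C, forall m, `|H m| <= C) ->
  (\int[P]_w H (dirac_sum (p n) (fun i => xi n i w)) =
   \int[P]_w H (dirac_sum (p n) (fun i => exp_quantile (X n) (renyi (p n) (fun j => E j w) i))))%R.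
Proof.
move=> cH [C HC].
pose Phi s := H (dirac_sum (p n) s).
have bPhi : bounded_measurable (Phi : seqR R -> R).
  by split; [exact: measurable_H_dirac_sum|exists C => s; exact: HC].
have mQ := measurable_exp_quantile (X n).
have iidQ := iid_law_comp iidE mQ (exp_quantile_law (X n) nuE).
transitivity (\int[P]_w Phi (fun i => exp_quantile (X n) (E i w)))%R.
  exact: (iid_expect (iidxi n) iidQ bPhi).
pose psi (s : seqR R) := Phi (fun i => exp_quantile (X n) (s i)).
have mQs : measurable_fun setT (fun s : seqR R => (fun i => exp_quantile (X n) (s i)) : seqR R).
  by apply: measurable_seqP => i; apply: measurableT_comp mQ _; exact: measurable_coord.
have mpsi : measurable_fun setT psi by exact: measurableT_comp bPhi.1 mQs.
have mE := measurable_iid iidE.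
have C0 s : 0 <= psi s + C.
  by have /ler_normlP[h _] := HC (dirac_sum (p n) (fun i => exp_quantile (X n) (s i))); rewrite /psi /Phi; lra.
have := renyi_representation iidE nuE (p := p n) (psi := fun s => psi s + C).
have b1 : bounded_measurable (fun w => psi (fun i => E i w)).
  by split; [exact: measurableT_comp mpsi mE|exists C => w; exact: HC].
have b2 : bounded_measurable (fun w => psi (renyi (p n) (fun i => E i w))).
  split; last by exists C => w; exact: HC.
  exact: measurableT_comp mpsi (measurableT_comp (measurable_renyi (p n)) mE).
move=> /(_ (measurable_funD mpsi (measurable_cst C)) C0) h.
have sym : symmetric_in (p n) (fun s => psi s + C).
  move=> i j s ip jp.
  exact: (congr1 (fun z => z + C) (@H_dirac_sum_sym R H cH (p n) (exp_quantile (X n)) i j s ip jp)).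
have dep : depends_on (p n) (fun s => psi s + C).
  move=> s s' ss'.
  exact: (congr1 (fun z => z + C) (@H_dirac_sum_dep R H cH (p n) _ _
    (fun i ip => congr1 (exp_quantile (X n)) (ss' i ip)))).
have e := congr1 fine (h sym dep).
have bC : bounded_measurable (fun _ : T => C) by exact: bounded_measurable_cst.
have q1 : (\int[P]_w psi (fun i => E i w))%R + C = (\int[P]_w (psi (fun i => E i w) + C))%R.
  by rewrite (expectD P b1 bC) expect_cst.
have q2 : (\int[P]_w psi (renyi (p n) (fun i => E i w)))%R + C =
    (\int[P]_w (psi (renyi (p n) (fun i => E i w)) + C))%R.
  by rewrite (expectD P b2 bC) expect_cst.
by apply: (addIr C); exact: (etrans q1 (etrans e (esym q2))).
Qed.

(** The coupled processes converge almost surely, and dominated convergence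
    passes to the expectations of bounded continuous functionals. *)
Lemma point_process_cvg :
  cvg_in_distribution P (fun n w => dirac_sum (p n) (fun i => xi n i w)) (limit_process E).
Proof.
move=> H cH bH; have [C HC] := bH.
pose u n w := H (dirac_sum (p n) (fun i => exp_quantile (X n) (renyi (p n) (fun j => E j w) i))).
have mu n : measurable_fun setT (u n).
  apply: (measurableT_comp (measurable_H_dirac_sum cH (p n))).
  apply: measurable_seqP => i; apply: measurableT_comp (measurable_exp_quantile (X n)) _.
  exact: (measurableT_comp (measurable_coord i)
    (measurableT_comp (measurable_renyi (p n)) (measurable_iid iidE))).
have mlim := measurable_H_limit_process cH iidE.
have blim : bounded_measurable (fun w => H (limit_process E w)) by split => //; exists C.
have := @expect_cvg _ _ _ P u _ C mu blim (fun n w => HC _).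
have ae : {ae P, forall w, u n w @[n --> \oo] --> H (limit_process E w)}.
  apply: filterS2 (ae_regular_arrivals iidE nuE) (ae_point_measure iidE nuE) => w reg pm.
  exact: continuous_seq_cvg cH _ _ (coupled_process_cvg reg pm).
move=> /(_ ae) /cvg_EFinr.
have mxi n : measurable_fun setT (fun w => H (dirac_sum (p n) (fun i => xi n i w))).
  exact: (measurableT_comp (measurable_H_dirac_sum cH (p n)) (measurable_iid (iidxi n))).
have bxi n : bounded_measurable (fun w => H (dirac_sum (p n) (fun i => xi n i w))).
  by split => //; exists C.
rewrite unlock -(EFin_expect P blim) => h.
rewrite (_ : (fun n => _) = fun n => (\int[P]_w (u n w))%R%:E)//.
apply/funext => n.
transitivity ((\int[P]_w H (dirac_sum (p n) (fun i => xi n i w)))%R%:E).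
  exact: (esym (EFin_expect P (bxi n))).
by congr (_%:E); exact: expect_coupling.
Qed.

End quantile_limit.

(** * No escape of mass to infinity *)

Section norming_size.
Context {R : realType}.

Lemma norming_log_sqr_bounds : \forall L \near +oo,
  L <= (norming_log L : R) ^+ 2 <= 2 * L.
Proof.
near=> L.
have L1 : 1 <= L by near: L; exact: nbhs_pinfty_ge.
have L0 : 0 < L by exact: lt_le_trans L1.
have small : (ln L + ln (4 * pi)) / Num.sqrt L <= 1.
  by near: L; apply: (cvgr_le _ (@log_sqrt_cvg0 R (ln (4 * pi)))).
have s1 : 1 <= Num.sqrt L by rewrite -sqrtr1 ler_wsqrtr.
have s0 : 0 < Num.sqrt L by exact: lt_le_trans s1.
have ss : Num.sqrt L ^+ 2 = L by rewrite sqr_sqrtr// ltW.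
have sL : Num.sqrt L <= L by rewrite -[leRHS]ss expr2 ler_peMr// ltW.
rewrite norming_log_sqr//; set c := ln L + _ in small *.
have cs : c <= Num.sqrt L by move: small; rewrite ler_pdivrMr// mul1r.
have c0 : 0 <= c.
  rewrite addr_ge0 ?ln_ge0//; have := pi_ge2 R; lra.
have q0 : 0 <= c ^+ 2 / (8 * L) by rewrite divr_ge0 ?sqr_ge0// mulr_ge0// ltW.
have q1 : c ^+ 2 / (8 * L) <= c.
  by rewrite ler_pdivrMr ?mulr_gt0// expr2 ler_wpM2l//; lra.
by apply/andP; split; lra.
Unshelve. all: by end_near. Qed.

End norming_size.

Section tail_from_windows.
Context {R : realType} d (T : measurableType d) (P : probability T R).
Variables (xi : nat -> T -> R) (p : nat -> nat) (c : R).
Hypothesis mxi : forall n, measurable_fun setT (xi n).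
Hypothesis windows : forall a b : R, a < b ->
  (p n)%:R * pr P [set w | a < xi n w <= b] @[n --> \oo] --> expR (- a) - expR (- b).
Hypothesis c0 : 0 < c.
Hypothesis escape : forall K : R, exists2 bad : nat -> R,
  (p n)%:R * bad n @[n --> \oo] --> 0 &
  \forall n \near \oo, pr P [set w | K < xi n w] <=
    bad n + pr P [set w | K - c < xi n w <= K].

Let measurable_gt n a : measurable [set w | a < xi n w].
Proof.
exact: measurable_lt_set.
Qed.

Let measurable_window n a b : measurable [set w | a < xi n w <= b].
Proof.
rewrite (_ : [set w | _] = xi n @^-1` `]a, b]%classic).
  by rewrite -[X in measurable X]setTI; exact: mxi.
by apply/seteqP; split => w /=; rewrite in_itv.
Qed.

(** Beyond a high level [K] the tail is dominated by the window of width [c]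
    below [K], whose limit is small for [K] large; the windows below [K] give
    the rest of the limit. *)
Lemma tail_from_windows (x : R) :
  (p n)%:R * pr P [set w | x < xi n w] @[n --> \oo] --> expR (- x).
Proof.
apply/cvgrPdist_le => eps eps0.
have [K [xK Ksmall]] : exists K, x < K /\ expR (- (K - c)) <= eps / 4.
  exists (Num.max (x + 1) (c - ln (eps / 4))); split.
    by rewrite lt_max ltrDl ltr01.
  rewrite -[leRHS]lnK ?posrE ?divr_gt0// ler_expR lerNl lerBrDr addrC.
  by rewrite le_max lexx orbT.
have [bad cbad esc] := escape K.
have cK : K - c < K by rewrite ltrBlDr ltrDl.
have eK : expR (- K) <= eps / 4.
  by apply: le_trans Ksmall; rewrite ler_expR lerN2 ltW.
near=> n.
have p0 : 0 <= (p n)%:R :> R by rewrite ler0n.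
have w1 : `|expR (- x) - expR (- K) - (p n)%:R * pr P [set w | x < xi n w <= K]| <= eps / 8.
  by near: n; move/cvgrPdist_le : (windows xK) => /(_ (eps / 8)); apply; rewrite divr_gt0.
have w2 : (p n)%:R * pr P [set w | K - c < xi n w <= K] <= eps / 4 + eps / 8.
  near: n; apply: (cvgr_le _ (windows cK)).
  have e8 : 0 < eps / 8 by rewrite divr_gt0.
  by have := expR_gt0 (- K); lra.
have w3 : (p n)%:R * bad n <= eps / 8.
  by near: n; apply: (cvgr_le _ cbad); rewrite divr_gt0.
have w4 : pr P [set w | K < xi n w] <= bad n + pr P [set w | K - c < xi n w <= K].
  by near: n; exact: esc.
have add : pr P [set w | x < xi n w] = pr P [set w | x < xi n w <= K] + pr P [set w | K < xi n w].
  rewrite -(prE P (measurable_gt n x)) -(prE P (measurable_window n x K)) -(prE P (measurable_gt n K)).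
  rewrite -expectD; try exact: bounded_measurable_indic.
  congr fine; apply: eq_integral => w _; congr (_%:E); rewrite !indicE.
  have [Kw|wK] := ltP K (xi n w).
    rewrite (mem_set (A := [set w | x < xi n w])); last exact: lt_trans xK Kw.
    rewrite (mem_set (A := [set w | K < xi n w]))// memNset ?add0r//=.
    by move=> /andP[_]; rewrite leNgt Kw.
  rewrite [in X in _ + X]memNset /= ?addr0; last by rewrite ltNge wK.
  congr (nat_of_bool _)%:R; apply/idP/idP; rewrite !inE /= wK andbT//.
have tK0 := pr_ge0 P [set w | K < xi n w].
have := ler_wpM2l p0 w4; rewrite mulrDr => w4'.
have w5 := mulr_ge0 p0 tK0.
rewrite add mulrDr ler_distlC; move: w1; rewrite ler_distlC => /andP[a1 a2].
have e0 := expR_gt0 (- K).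
by apply/andP; split; lra.
Unshelve. all: by end_near. Qed.

End tail_from_windows.

Section escape.
Context {R : realType} d (T : measurableType d) (P : probability T R).
Variables (X : nat -> T -> R) (nu : probability R R).
Hypothesis iidX : iid_law P X nu.
Hypotheses (intX : nu.-integrable setT (EFin \o @id R))
  (meanX : (\int[nu]_x x%:E = 0)%E) (varX : (\int[nu]_x (x ^+ 2)%:E = 1)%E).

Variable D : R.
Hypotheses (D4 : 4 <= D) (D7 : 7 * 64 / D = 1 / 16).

Let D0 : 0 < D. Proof. by apply: lt_le_trans D4. Qed.

(** The resampling inequality with [m ~ D n / t^2] refreshed terms: [D] is large
    enough for the fluctuations of the refreshed block to be negligible against
    its typical drop [D sqrt n / t]. *)
Lemma resampling_scale (n : nat) (t b K : R) : 0 < t -> 0 <= b ->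
  2 * D <= t ^+ 2 -> 4 * t ^+ 2 <= D * n%:R -> (1 < n)%N ->
  pr P [set w | Num.sqrt n%:R * (t + K / t) <= ssum (trajectory X w) n] <=
  3 * pr P [set w | Num.sqrt n%:R * (t + (K - 9 * D) / t) <= ssum (trajectory X w) n /\
    ~ regular_sample n b (3 * n%:R) (t ^+ 2 / (16 * D)) (Num.sqrt n%:R * t / 2)
        (4 * Num.sqrt n%:R * t) (trajectory X w)] +
  pr P [set w | Num.sqrt n%:R * (t + (K - 9 * D) / t) <= ssum (trajectory X w) n <
    Num.sqrt n%:R * (t + K / t)].
Proof.
move=> t0 b0 tD tn n1; set q := Num.sqrt _.
have nR : 2 <= n%:R :> R by rewrite ler_nat.
have n0 : 0 < n%:R :> R by lra.
have q0 : 0 < q by rewrite sqrtr_gt0.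
have qq : q ^+ 2 = n%:R by rewrite sqr_sqrtr// ltW.
have t2 : 0 < t ^+ 2 by rewrite exprn_gt0.
pose y := D * n%:R / t ^+ 2.
have y0 : 0 <= y by rewrite divr_ge0 ?(ltW t2)// mulr_ge0 ?(ltW D0) ?(ltW n0).
pose m := (Num.trunc y).+1.
have /andP[tr1 tr2] := trunc_itv y0.
have m1 : y < m%:R by [].
have m2 : m%:R <= y + 1 by rewrite /m -natr1 lerD2r.
have yt : y * t ^+ 2 = D * n%:R by rewrite /y mulfVK// gt_eqF.
have y1 : 4 <= y by rewrite ler_pdivlMr.
have yn : y <= n%:R / 2 by rewrite ler_pdivrMr//; nra.
have mn : (m <= n)%N by rewrite -(ler_nat R); lra.
pose r := D * q / (8 * t); pose d2 := 9 * D * q / t.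
have r0 : 0 < r by rewrite divr_gt0// mulr_gt0.
have d20 : 0 <= d2 by rewrite divr_ge0 ?(ltW t0)// mulr_ge0 ?(ltW q0)// mulr_ge0// ltW.
have mu1 : D / t ^+ 2 <= m%:R / n%:R.
  by rewrite ler_pdivlMr//; apply: le_trans (ltW m1); rewrite /y mulrAC.
have mu2 : m%:R / n%:R <= D / t ^+ 2 + n%:R^-1.
  rewrite ler_pdivrMr// mulrDl mulVf ?gt_eqF//.
  by apply: le_trans m2 _; rewrite /y mulrAC.
have kap0 : 0 <= t ^+ 2 / (16 * D) by rewrite divr_ge0 ?sqr_ge0// mulr_ge0// ltW.
have v0 : 0 <= 3 * n%:R :> R by rewrite mulr_ge0.
have nq : n%:R^-1 = (q ^+ 2)^-1 by rewrite qq.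
have c1 : 2 * r < m%:R / n%:R * (q * t / 2).
  apply: lt_le_trans (ler_wpM2r _ mu1); last by rewrite divr_ge0// mulr_ge0// ltW.
  have -> : D / t ^+ 2 * (q * t / 2) = 2 * r + 2 * r.
    by rewrite /r; field; rewrite gt_eqF.
  by rewrite ltrDl mulr_gt0.
have c2 : m%:R / n%:R * (4 * q * t) + 2 * r <= d2.
  have q4 : 0 <= 4 * q * t by rewrite mulr_ge0 ?(ltW t0)// mulr_ge0// ltW.
  apply: le_trans (lerD (ler_wpM2r q4 mu2) (lexx _)) _.
  have -> : (D / t ^+ 2 + n%:R^-1) * (4 * q * t) + 2 * r = (q / t) * (4 * D + 4 * t ^+ 2 / n%:R + D / 4).
    by rewrite /r; field; rewrite !gt_eqF.
  have -> : d2 = (q / t) * (9 * D) by rewrite /d2; field; rewrite gt_eqF.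
  apply: ler_wpM2l; first by rewrite divr_ge0 ?ltW.
  have := D0; have : 4 * t ^+ 2 / n%:R <= D by rewrite ler_pdivrMr.
  by lra.
have c3 : m%:R * (t ^+ 2 / (16 * D)) / n%:R + 2 * m%:R * (3 * n%:R) / (n%:R * r ^+ 2) + m%:R / r ^+ 2 <= 4^-1.
  (* the three terms are those of rare large values, of the resampled terms and of
     the fresh ones; [D7] makes their sum 1/8 up to the rounding of [m] *)
  have -> : m%:R * (t ^+ 2 / (16 * D)) / n%:R + 2 * m%:R * (3 * n%:R) / (n%:R * r ^+ 2) + m%:R / r ^+ 2 =
      m%:R / y * (1 / 16 + 7 * 64 / D).
    by rewrite /r /y -qq; field; rewrite !gt_eqF.
  have my : m%:R / y <= 5 / 4 by rewrite ler_pdivrMr; lra.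
  rewrite D7; apply: le_trans (ler_wpM2r _ my) _; lra.
have := resampling_tail iidX intX meanX varX (isT : (0 < m)%N) mn b0 r0
  (q * (t + K / t)) d20 c1 c2 c3.
have -> : q * (t + K / t) - d2 = q * (t + (K - 9 * D) / t).
  by rewrite /d2; field; rewrite gt_eqF.
by [].
Qed.

Variables (s beta M : R) (p : nat -> nat) (t : nat -> R).
Hypotheses (s2 : 2 <= s) (sb : 1 < s * beta) (b0 : 0 < beta) (b2 : beta < 2^-1).
Hypothesis Ms : (\int[nu]_x (`|x| `^ s)%:E <= M%:E)%E.
Hypothesis t_infty : t n @[n --> \oo] --> (+oo%R : set_system R).
Hypothesis p_le : \forall n \near \oo, (p n)%:R <= expR (t n ^+ 2).
Hypothesis t_small : forall e : R, 0 < e ->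
  \forall n \near \oo, t n ^+ 2 <= e * n%:R `^ (1 - 2 * beta).
Local Notation b n := (n%:R `^ beta).
Hypothesis large : (p n)%:R * pr P [set w | Num.sqrt n%:R * t n / 4 <=
  large_sum (b n) n (trajectory X w)] @[n --> \oo] --> 0.

(** Each exceptional event of the resampling inequality has probability of
    smaller order than [1 / p]: the deviations of bounded variables because [p
    <= exp (t^2)], the large terms by hypothesis. *)
Lemma no_escape (K : R) : exists2 bad : nat -> R,
  (p n)%:R * bad n @[n --> \oo] --> 0 &
  \forall n \near \oo, pr P [set w | Num.sqrt n%:R * (t n + K / t n) <= ssum (trajectory X w) n] <=
    bad n + pr P [set w | Num.sqrt n%:R * (t n + (K - 9 * D) / t n) <= ssum (trajectory X w) n <
      Num.sqrt n%:R * (t n + K / t n)].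
Proof.
pose Z n := pr P [set w | Num.sqrt n%:R * t n / 4 <= large_sum (b n) n (trajectory X w)].
pose eta n : R := (s * beta - 1) * ln n%:R.
pose kap n : R := t n ^+ 2 / (16 * D).
pose bad n := 3 * (expR (- (n%:R / (2 * b n ^+ 2))) + expR (- (3 / 2 * t n ^+ 2)) +
  expR (M - eta n * kap n) + Z n).
have M0 := M_ge0 Ms.
have lnN : ln n%:R @[n --> \oo] --> (+oo%R : set_system R).
  by apply: ln_p_infty; exact: cvg_id.
have nR : (n%:R : R) @[n --> \oo] --> (+oo%R : set_system R) by exact: cvgr_idn.
have b1 : 0 < 1 - 2 * beta.
  by have := b2; rewrite -(ltr_pM2l (ltr0Sn R 1)) mulfV ?pnatr_eq0// subr_gt0.
have nb_ge n : (0 < n)%N -> n%:R / b n ^+ 2 = n%:R `^ (1 - 2 * beta).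
  move=> n0; have nn : n%:R != 0 :> R by rewrite pnatr_eq0 -lt0n.
  rewrite powRB; last by apply/implyP.
  rewrite powRr1//; congr (_ / _).
  by rewrite -powR_mulrn ?powR_ge0// -powRrM mulrC.
have t2_infty (C : R) : \forall n \near \oo, C <= t n ^+ 2.
  have h1 : \forall n \near \oo, `|C| + 1 <= t n by exact: (cvgry_ge t_infty).
  apply: filterS h1 => n tC; apply: le_trans (ler_norm C) _.
  by have := normr_ge0 C; nra.
exists bad.
  have low n : 0 <= (p n)%:R * bad n.
    by rewrite mulr_ge0// mulr_ge0// !addr_ge0 ?expR_ge0// pr_ge0.
  have hexp : expR (- (t n ^+ 2 / 2)) @[n --> \oo] --> (0 : R).
    apply/cvgr0Pnorm_le => e e0; near=> n; rewrite ger0_norm ?expR_ge0//.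
    rewrite -[leRHS]lnK ?posrE// ler_expR lerNl ler_pdivlMr//.
    by near: n; exact: t2_infty.
  have up : 3 * ((2 + expR M) * expR (- (t n ^+ 2 / 2)) + (p n)%:R * Z n) @[n --> \oo] --> (0 : R).
    have -> : 0 = 3 * ((2 + expR M) * 0 + 0) :> R by rewrite mulr0 addr0 mulr0.
    apply: cvgM; first exact: cvg_cst.
    by apply: cvgD => //; apply: cvgM => //; exact: cvg_cst.
  apply: (squeeze_cvgr _ (cvg_cst 0) up); near=> n; rewrite low/=.
  have n0 : (0 < n)%N by near: n; exact: nbhs_infty_gt.
  have pn : (p n)%:R <= expR (t n ^+ 2) by near: n.
  rewrite mulrCA ler_pM2l// !mulrDr lerD2r.
  have bound (u : R) : 3 / 2 * t n ^+ 2 <= u -> (p n)%:R * expR (- u) <= expR (- (t n ^+ 2 / 2)).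
    move=> tu; apply: le_trans (ler_wpM2r (expR_ge0 _) pn) _.
    by rewrite -expRD ler_expR; lra.
  have B1 : (p n)%:R * expR (- (n%:R / (2 * b n ^+ 2))) <= expR (- (t n ^+ 2 / 2)).
    apply: bound.
    have -> : n%:R / (2 * b n ^+ 2) = n%:R `^ (1 - 2 * beta) / 2.
      by rewrite -nb_ge// invfM mulrCA mulrC.
    have : t n ^+ 2 <= 8^-1 * n%:R `^ (1 - 2 * beta) by near: n; apply: t_small; rewrite invr_gt0.
    by have := sqr_ge0 (t n); lra.
  have B2 : (p n)%:R * expR (- (3 / 2 * t n ^+ 2)) <= expR (- (t n ^+ 2 / 2)) by exact: bound.
  have B3 : (p n)%:R * expR (M - eta n * kap n) <= expR M * expR (- (t n ^+ 2 / 2)).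
    rewrite expRD mulrCA ler_pM2l ?expR_gt0//; apply: bound.
    have : 24 * D <= eta n.
      rewrite /eta -ler_pdivrMl; last by rewrite subr_gt0.
      by near: n; exact: (cvgry_ge lnN).
    move=> h; have k0 : 0 <= kap n by rewrite /kap divr_ge0 ?sqr_ge0// mulr_ge0// ltW.
    apply: le_trans (ler_wpM2r k0 h).
    have -> : 24 * D * kap n = 3 / 2 * t n ^+ 2 by rewrite /kap; field; rewrite gt_eqF.
    by [].
  by lra.
near=> n.
have n1 : (1 < n)%N by near: n; exact: nbhs_infty_gt.
have n0 : (0 < n)%N by exact: ltnW.
have nn : n%:R != 0 :> R by rewrite pnatr_eq0 -lt0n.
have ngt : 0 < n%:R :> R by rewrite ltr0n.
have n1R : 1 <= n%:R :> R by rewrite ler1n.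
have t0 : 0 < t n by near: n; exact: (cvgry_gt t_infty).
have bn0 : 0 < b n by rewrite powR_gt0.
have h1 : 2 * D <= t n ^+ 2 by near: n; exact: t2_infty.
have h2 : t n ^+ 2 <= 1 * n%:R `^ (1 - 2 * beta) by near: n; exact: t_small.
have h3 : n%:R `^ (1 - 2 * beta) <= n%:R.
  by rewrite -[leRHS]powRr1 ?ler0n//; apply: ler_powR => //; have := b0; lra.
have h4 : 4 * t n ^+ 2 <= D * n%:R.
  by apply: ler_pM => //; [exact: sqr_ge0|apply: le_trans h2 _; rewrite mul1r].
have h5 : M <= t n / 2.
  by rewrite ler_pdivlMr//; near: n; exact: (cvgry_ge t_infty).
have h6 : 9 * D - K <= t n ^+ 2 / 4 by rewrite ler_pdivlMr//; near: n; exact: t2_infty.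
apply: le_trans (resampling_scale K t0 (ltW bn0) h1 h4 n1) _.
rewrite lerD2r /bad ler_pM2l//.
have q0 : 0 < Num.sqrt n%:R :> R by rewrite sqrtr_gt0.
have qE : Num.sqrt n%:R = n%:R `^ 2^-1 :> R by rewrite powR12_sqrt// ler0n.
apply: (irregular_tail iidX intX meanX varX s2 bn0 n0 Ms).
- exact: t0.
- rewrite -(@ler_pXn2r _ 2)// ?nnegrE ?mulr_ge0 ?(ltW t0) ?(ltW bn0) ?(ltW q0)//.
  rewrite exprMn sqr_sqrtr ?ler0n// -ler_pdivlMr ?exprn_gt0// nb_ge//.
  by rewrite mul1r in h2.
- rewrite qE mulrA -powRrM -powRD; last by apply/implyP.
  apply: le_trans h5; rewrite ler_piMl// -[leRHS](powRr0 n%:R).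
  by apply: ler_powR => //; have := sb; have := b2; lra.
- by rewrite /eta mulr_ge0 ?ln_ge0// subr_ge0 ltW.
- by rewrite divr_ge0 ?sqr_ge0// mulr_ge0// ltW.
- have -> : expR (eta n) = n%:R `^ (s * beta - 1) by rewrite /powR (negbTE nn).
  rewrite -powRrM mulrA -powRD; last by apply/implyP.
  have -> : s * beta - 1 + beta * - s = - 1 by ring.
  by rewrite powRN powRr1 ?ler0n// mulrC.
rewrite mulrAC [Num.sqrt _ * (_ + _)]mulrC ler_wpM2r ?(ltW q0)//.
have : - (t n / 4) <= (K - 9 * D) / t n.
  by rewrite ler_pdivlMr// mulNr mulrAC -expr2; lra.
by lra.
Unshelve. all: by end_near. Qed.

End escape.

(** * Window probabilities from the Laplace functional *)

Section trapezoid.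
Context {R : realType}.
Variables (a b e : R).
Hypotheses (e0 : 0 < e).

Definition trapezoid (x : R) : R :=
  Num.min 1 (Num.max 0 (Num.min ((x - a) / e) ((b - x) / e))) / 2.

Lemma trapezoid_continuous : continuous trapezoid.
Proof.
move=> x; apply: cvgM; last exact: cvg_cst.
apply: (@continuous_min R R (fun=> 1) (fun x => Num.max 0 (Num.min ((x - a) / e) ((b - x) / e)))).
  exact: cvg_cst.
apply: (@continuous_max R R (fun=> 0) (fun x => Num.min ((x - a) / e) ((b - x) / e))).
  exact: cvg_cst.
apply: (@continuous_min R R (fun x => (x - a) / e) (fun x => (b - x) / e)).
  by apply: cvgM; [apply: cvgB => //; exact: cvg_cst|exact: cvg_cst].
by apply: cvgM; [apply: cvgB => //; exact: cvg_cst|exact: cvg_cst].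
Qed.

Lemma trapezoid_ge0 x : 0 <= trapezoid x.
Proof. by rewrite divr_ge0// le_min ler01 le_max lexx. Qed.

Lemma trapezoid_le x : trapezoid x <= 2^-1.
Proof. by rewrite ler_pdivrMr// mulVf ?pnatr_eq0// ge_min lexx. Qed.

Lemma trapezoid_out x : ~~ (a < x <= b) -> trapezoid x = 0.
Proof.
move=> xab; suff h : Num.min ((x - a) / e) ((b - x) / e) <= 0.
  by rewrite /trapezoid (max_l h) min_r ?ler01// mul0r.
rewrite ge_min; move: xab; rewrite negb_and -!leNgt -ltNge => /orP[xa|bx].
  by rewrite ler_pdivrMr// mul0r subr_le0 xa.
by rewrite orbC ler_pdivrMr// mul0r subr_le0 ltW.
Qed.

Lemma trapezoid_in x : a + e <= x <= b - e -> trapezoid x = 2^-1.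
Proof.
move=> /andP[ax xb]; rewrite /trapezoid min_l ?mul1r// le_max; apply/orP; right.
by rewrite le_min !ler_pdivlMr// !mul1r; apply/andP; split; lra.
Qed.

Lemma Cc_of_support (f : R -> R) (u v : R) : continuous f -> (forall x, 0 <= f x) ->
  (forall x, ~~ (u <= x <= v) -> f x = 0) ->
  [/\ continuous f, forall x, 0 <= f x & compact (closure [set x | f x != 0])].
Proof.
move=> cf f0 fout; split => //.
apply: (subclosed_compact (@closed_closure _ _) (@segment_compact R u v)).
rewrite ((closure_id _).1 (compact_closed (@Rhausdorff R) (@segment_compact R u v))).
apply: closure_subset.
by move=> x /= fx; rewrite in_itv/=; apply: contraNT fx => /fout ->; rewrite eqxx.
Qed.

Definition trapezoid_Cc : Cc_nonneg R := exist _ trapezoid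
  (Cc_of_support trapezoid_continuous trapezoid_ge0
    (fun x h => @trapezoid_out x (contra (fun k => let: conj k1 k2 := andP k in
       introT andP (conj (ltW k1) k2)) h))).

End trapezoid.

Section laplace_windows.
Context {R : realType} d (T : measurableType d) (P : probability T R).
Variables (xi : nat -> nat -> T -> R) (mu : nat -> probability R R).
Variables (E : nat -> T -> R) (nu : probability R R) (p : nat -> nat).
Hypothesis iidxi : forall n, iid_law P (xi n) (mu n).
Hypothesis p_infty : p n @[n --> \oo] --> \oo.
Hypothesis iidE : iid_law P E nu.
Hypothesis nuE : forall A, measurable A -> nu A = exponential_prob 1 A.
Hypothesis cvg_process :
  cvg_in_distribution P (fun n w => dirac_sum (p n) (fun i => xi n i w)) (limit_process E).
Local Notation leb := (@lebesgue_measure R).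

Lemma measurable_opp_ln : measurable_fun setT (fun z : R => - ln z).
Proof. by apply: measurableT_comp => //; exact: measurable_ln. Qed.

(** The Laplace functional at [f = - ln (1 - h)] turns convergence in distribution
    of the point processes into convergence of [p E h]. *)
Lemma intensity_cvg (h : Cc_nonneg R) (A : R) : (forall x, sval h x <= 2^-1) ->
  (\int[leb]_(z in `[0%R, +oo[) (sval h (- ln z))%:E = A%:E)%E ->
  (p n)%:R * (\int[mu n]_x sval h x)%R @[n --> \oo] --> A.
Proof.
move=> h2 hA.
have h0 x := Cc_ge0 h x; have mh := measurable_Cc h.
have h1 x : 0 < 1 - sval h x by have := h2 x; lra.
pose f x := - ln (1 - sval h x).
have fE x : expR (- f x) = 1 - sval h x by rewrite opprK lnK// posrE.
have f0 x : 0 <= f x by rewrite oppr_ge0 ln_le0// lerBlDr lerDl.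
have cf : continuous f.
  move=> x; apply: cvgN; apply: continuous_cvg; first by apply: continuous_ln; exact: h1.
  by apply: cvgB; [exact: cvg_cst|case: (svalP h) => ch _ _; exact: ch].
have [L hL] := Cc_support h.
have fout x : ~~ (- L%:R <= x <= L%:R) -> f x = 0.
  move=> xL; rewrite /f hL ?subr0 ?ln1 ?oppr0//.
  by rewrite /sym_itv /= in_itv/=; exact/negP.
pose fc : Cc_nonneg R := exist _ f (Cc_of_support cf f0 fout).
pose H (m : pointMeasure R) := expR (- vague_eval m fc).
have cH : continuous H.
  move=> m; have c0 := @vague_eval_continuous R fc m.
  have c1 : - vague_eval m' fc @[m' --> m] --> - vague_eval m fc by exact: (cvgN c0).
  exact: (cvg_comp _ _ c1 (@continuous_expR R (- vague_eval m fc))).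
have HC m : `|H m| <= 1.
  by rewrite ger0_norm ?expR_ge0// -expR0 ler_expR oppr_le0 vague_eval_ge0.
have limE : ('E_P[H \o limit_process E] = (expR (- A))%:E)%E.
  have mF : measurable_fun setT (fun z => f (- ln z)).
    exact: measurableT_comp (measurable_Cc fc) measurable_opp_ln.
  have := arrival_laplace iidE nuE mF (fun z => f0 _).
  have eA : (\int[leb]_(z in `[0%R, +oo[) (1 - expR (- f (- ln z)))%:E = A%:E)%E.
    by rewrite -hA; apply: eq_integral => z _; rewrite fE subKr.
  rewrite eA /= => <-; rewrite unlock.
  have mH := measurable_H_limit_process cH iidE.
  apply: ae_eq_integral => //.
  - exact/measurable_EFinP.
  - apply/measurable_EFinP.
    exact: measurableT_comp (measurable_expNe_arrival_series mF (fun z => f0 _)) (measurable_iid iidE).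
  apply: filterS (ae_point_measure iidE nuE) => w pm _ /=; congr (_%:E).
  rewrite /H vague_eval_dirac_series//.
  have fin : (\sum_(i <oo) (f (- ln (partial_sum E i.+1 w)))%:E)%E \is a fin_num.
    rewrite ge0_fin_numE; first exact: (Cc_series_fin fc pm).
    by apply: nneseries_ge0 => i _ _; rewrite lee_fin.
  by rewrite /arrival_series -[in RHS](fineK fin).
have pre n : ('E_P[H \o (fun w => dirac_sum (p n) (fun i => xi n i w))] =
    ((1 - (\int[mu n]_x sval h x)%R) ^+ p n)%:E)%E.
  pose g x := 1 - sval h x.
  have mg : measurable_fun setT g by exact: measurable_funB.
  have g01 x : 0 <= g x <= 1 by rewrite (ltW (h1 x)) lerBlDr lerDl h0.
  have HE w : H (dirac_sum (p n) (fun i => xi n i w)) = \prod_(i < p n) g (xi n i w).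
    rewrite /H vague_eval_dirac_sum -sumrN expR_sum.
    by apply: eq_bigr => i _; rewrite /= fE.
  have bh : bounded_measurable (sval h : R -> R).
    by apply: bounded_measurable_le1 => // x; rewrite h0; have := h2 x; lra.
  have -> : 1 - (\int[mu n]_x sval h x)%R = (\int[mu n]_x g x)%R.
    rewrite expectB//; first by rewrite expect_cst.
    exact: bounded_measurable_cst.
  rewrite -(expect_iid_prod (iidxi n) (p n) mg g01) unlock.
  have bp : bounded_measurable (fun w => \prod_(i < p n) g (xi n i w)).
    apply: bounded_measurable_prod => i; apply: bounded_measurable_le1 => //.
    exact: measurableT_comp mg ((iidxi n).1 i).
  rewrite (EFin_expect P bp); apply: eq_integral => w _.
  by rewrite /= HE.
have bnd n : 0 <= (\int[mu n]_x sval h x)%R <= 1.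
  apply/andP; split; first by apply: Rintegral_ge0 => x _; exact: h0.
  rewrite -(expect_cst (mu n) 1); apply: expect_le.
  - by apply: bounded_measurable_le1 => // x; rewrite h0; have := h2 x; lra.
  - exact: bounded_measurable_cst.
  - by move=> x; have := h2 x; lra.
apply: (pow_onem_cvg_inv p_infty bnd).
have := cvg_process cH (ex_intro _ 1 HC); rewrite limE => /fine_cvg.
by under eq_fun do rewrite /= pre.
Qed.

Lemma exp_intensity_itvoc (u v : R) : u <= v ->
  exp_intensity `]u, v]%classic = (expR (- u) - expR (- v))%:E.
Proof.
move=> uv.
have : (exp_intensity (`]u, v]%classic `|` `]v, +oo[%classic : set R) =
    exp_intensity `]u, v]%classic + exp_intensity `]v, +oo[%classic)%E.
  apply: measureU => //; apply/seteqP; split => // x /=; rewrite !in_itv/= andbT.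
  by move=> [/andP[_ xv]]; rewrite ltNge xv.
have -> : `]u, v]%classic `|` `]v, +oo[%classic = `]u, +oo[%classic :> set R.
  apply/seteqP; split => x /=; rewrite !in_itv/= !andbT.
    by move=> [/andP[]//|]; exact: le_lt_trans.
  by move=> ux; have [xv|vx] := leP x v; [left; rewrite ux|right].
rewrite !exp_intensity_itvoy => e; rewrite EFinB e addeK//.
Qed.

Lemma halfline_indic (A : set R) : measurable A ->
  (\int[leb]_(z in `[0%R, +oo[) (\1_A (- ln z) : R)%:E = exp_intensity A)%E.
Proof.
by move=> mA; rewrite exp_intensityE.
Qed.

Lemma halfline_le (f g : R -> R) : measurable_fun setT f -> measurable_fun setT g ->
  (forall x, 0 <= f x <= g x) ->
  (\int[leb]_(z in `[0%R, +oo[) (f (- ln z))%:E <= \int[leb]_(z in `[0%R, +oo[) (g (- ln z))%:E)%E.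
Proof.
move=> mf mg fg; apply: ge0_le_integral => //.
- by move=> z _; rewrite lee_fin; have /andP[] := fg (- ln z).
- by apply/measurable_EFinP; apply: measurable_funTS; exact: measurableT_comp mf measurable_opp_ln.
- by apply/measurable_EFinP; apply: measurable_funTS; exact: measurableT_comp mg measurable_opp_ln.
- by move=> z _; rewrite lee_fin; have /andP[] := fg (- ln z).
Qed.

Lemma halfline_indicZ (c : R) (A : set R) : 0 <= c -> measurable A ->
  (\int[leb]_(z in `[0%R, +oo[) (c * \1_A (- ln z))%:E = c%:E * exp_intensity A)%E.
Proof.
move=> c0 mA; rewrite -halfline_indic//; under eq_integral do rewrite EFinM.
rewrite ge0_integralZl//.
apply/measurable_EFinP; apply: measurable_funTS.
exact: measurableT_comp (measurable_indic mA) measurable_opp_ln.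
Qed.

(** [A] is the intensity of the trapezoid, which lies between half the intensities
    of the interval where it is maximal and of the one where it is nonzero. *)
Lemma trapezoid_limit (a b e : R) : 0 < e -> a <= b ->
  exists A : R, [/\ (p n)%:R * (\int[mu n]_x trapezoid a b e x)%R @[n --> \oo] --> A,
    2 * A <= expR (- a) - expR (- b) &
    (a + e <= b - e -> expR (- (a + e)) - expR (- (b - e)) <= 2 * A)].
Proof.
move=> e0 ab.
have mtr : measurable_fun setT (trapezoid a b e).
  by apply: continuous_measurable_fun; exact: trapezoid_continuous.
set J := (\int[leb]_(z in `[0%R, +oo[) (trapezoid a b e (- ln z))%:E)%E.
have Jle : (J <= (2^-1 * (expR (- a) - expR (- b)))%:E)%E.
  rewrite EFinM -exp_intensity_itvoc// -halfline_indicZ ?invr_ge0//.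
  apply: (@halfline_le (trapezoid a b e) (fun x => 2^-1 * \1_(`]a, b]%classic : set R) x)) => //.
    by apply: measurable_funM => //; exact: measurable_indic.
  move=> x; rewrite trapezoid_ge0/= indicE; have [|xab] := boolP (x \in _).
    by rewrite mulr1 trapezoid_le.
  rewrite mulr0 trapezoid_out//.
  by move: xab; apply: contraNN => xab; rewrite inE /= in_itv.
have J0 : (0 <= J)%E by apply: integral_ge0 => z _; rewrite lee_fin trapezoid_ge0.
have Jfin : J \is a fin_num by rewrite ge0_fin_numE// (le_lt_trans Jle)// ltry.
exists (fine J); split.
- apply: (intensity_cvg (h := trapezoid_Cc a b e0)); first exact: trapezoid_le.
  by rewrite fineK.
- by move: Jle; rewrite -(fineK Jfin) lee_fin mulrC ler_pdivlMr// mulrC.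
move=> abe; rewrite -ler_pdivrMl// -lee_fin fineK// EFinM -exp_intensity_itvoc//.
rewrite -halfline_indicZ ?invr_ge0//.
apply: (@halfline_le (fun x => 2^-1 * \1_(`]a + e, b - e]%classic : set R) x) (trapezoid a b e)) => //.
  by apply: measurable_funM => //; exact: measurable_indic.
move=> x; rewrite mulr_ge0 ?invr_ge0//= indicE; have [xab|_] := boolP (x \in _).
  rewrite mulr1 trapezoid_in//; move: xab; rewrite inE /= in_itv/= => /andP[/ltW -> ->].
  by [].
by rewrite mulr0 trapezoid_ge0.
Qed.

(** The indicator of an interval lies between two trapezoids with sides of width
    [e], one inside and one outside of it. *)
Lemma window_cvg (a b : R) : a < b ->
  (p n)%:R * pr (mu n) `]a, b]%classic @[n --> \oo] --> expR (- a) - expR (- b).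
Proof.
move=> ab; apply/cvgrPdist_le => eps eps0.
pose lo e : R := expR (- (a + e)) - expR (- (b - e)).
pose hi e : R := expR (- (a - e)) - expR (- (b + e)).
have clo : lo e @[e --> 0^'+] --> expR (- a) - expR (- b).
  apply: cvg_at_right_filter; rewrite /lo -[in X in _ --> X](addr0 a) -[in X in _ --> X](subr0 b).
  apply: cvgB; (apply: continuous_cvg; [exact: continuous_expR|apply: cvgN]).
    by apply: cvgD; [exact: cvg_cst|exact: cvg_id].
  by apply: cvgB; [exact: cvg_cst|exact: cvg_id].
have chi : hi e @[e --> 0^'+] --> expR (- a) - expR (- b).
  apply: cvg_at_right_filter; rewrite /hi -[in X in _ --> X](subr0 a) -[in X in _ --> X](addr0 b).
  apply: cvgB; (apply: continuous_cvg; [exact: continuous_expR|apply: cvgN]).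
    by apply: cvgB; [exact: cvg_cst|exact: cvg_id].
  by apply: cvgD; [exact: cvg_cst|exact: cvg_id].
have [e [e0 eab elo ehi]] : exists e, [/\ 0 < e, a + e <= b - e,
    expR (- a) - expR (- b) - eps / 2 <= lo e & hi e <= expR (- a) - expR (- b) + eps / 2].
  have n1 : \forall e \near 0^'+, 0 < e :> R by exact: nbhs_right_gt.
  have n2 : \forall e \near 0^'+, e < (b - a) / 2 :> R.
    by apply: nbhs_right_lt; rewrite divr_gt0// subr_gt0.
  have n3 : \forall e \near 0^'+, expR (- a) - expR (- b) - eps / 2 <= lo e.
    by apply: (cvgr_ge _ clo); rewrite ltrBlDr ltrDl divr_gt0.
  have n4 : \forall e \near 0^'+, hi e <= expR (- a) - expR (- b) + eps / 2.
    by apply: (cvgr_le _ chi); rewrite ltrDl divr_gt0.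
  have [e [[[h1 h2] h3] h4]] := @filter_ex _ _ (at_right_proper_filter (0 : R)) _
    (filterI (filterI (filterI n1 n2) n3) n4).
  by exists e; split => //; lra.
have [A1 [cA1 _ A1lo]] := trapezoid_limit e0 (ltW ab).
have hiab : a - e <= b + e by lra.
have [A2 [cA2 A2hi _]] := trapezoid_limit e0 hiab.
have bm2 a' b' : bounded_measurable (fun x : R => 2 * trapezoid a' b' e x).
  apply: bounded_measurable_le1.
    by apply: measurable_funM => //; apply: continuous_measurable_fun; exact: trapezoid_continuous.
  by move=> x; have := trapezoid_ge0 a' b' e x; have := trapezoid_le a' b' e x; lra.
have bm a' b' : bounded_measurable (trapezoid a' b' e : R -> R).
  apply: bounded_measurable_le1.
    by apply: continuous_measurable_fun; exact: trapezoid_continuous.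
  by move=> x; rewrite trapezoid_ge0 (le_trans (trapezoid_le _ _ _ _))//; lra.
have bi : bounded_measurable (\1_(`]a, b]%classic : set R) : R -> R).
  by apply: bounded_measurable_indic; exact: measurable_itv.
have sand n : 2 * (\int[mu n]_x trapezoid a b e x)%R <= pr (mu n) `]a, b]%classic <=
    2 * (\int[mu n]_x trapezoid (a - e) (b + e) e x)%R.
  rewrite -(prE (mu n))//; apply/andP; split.
    rewrite -expectZl; last exact: bm.
    apply: expect_le => //.
    move=> x; rewrite indicE; have [xab|xab] := boolP (x \in _).
      by rewrite /= mulr1n; have := trapezoid_le a b e x; lra.
    by rewrite trapezoid_out ?mulr0//; move: xab; apply: contraNN => xab; rewrite inE /= in_itv.
  rewrite -expectZl; last exact: bm.
  apply: expect_le => //.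
  move=> x; rewrite indicE; have [xab|xab] := boolP (x \in _).
    rewrite trapezoid_in ?mulfV ?pnatr_eq0//; move: xab; rewrite inE /= in_itv/= => /andP[]; lra.
  by rewrite /= mulr0n; have := trapezoid_ge0 (a - e) (b + e) e x; lra.
have p0 n : 0 <= (p n)%:R :> R by rewrite ler0n.
near=> n; have /andP[s1 s2] := sand n.
have l1 : A1 - eps / 4 <= (p n)%:R * (\int[mu n]_x trapezoid a b e x)%R.
  by near: n; apply: (cvgr_ge _ cA1); rewrite ltrBlDr ltrDl divr_gt0.
have l2 : (p n)%:R * (\int[mu n]_x trapezoid (a - e) (b + e) e x)%R <= A2 + eps / 4.
  by near: n; apply: (cvgr_le _ cA2); rewrite ltrDl divr_gt0.
have := ler_wpM2l (p0 n) s1; have := ler_wpM2l (p0 n) s2.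
have := A1lo eab; rewrite -/(lo e); move: A2hi; rewrite -/(hi e).
rewrite ler_distlC => k1 k2 k3 k4; apply/andP; split; lra.
Unshelve. all: by end_near. Qed.

End laplace_windows.

(** * Large terms under the moment conditions *)

Section large_terms.
Context {R : realType} d (T : measurableType d) (P : probability T R).
Variables (X : nat -> T -> R) (nu : probability R R).
Hypothesis iidX : iid_law P X nu.

(** Where [gam x / x] is nonincreasing, the sum of the weights [gam] of the
    large terms dominates [gam] of their sum, up to the level [u]; hence
    Chernoff's bound with [gam / 2]. *)
Lemma large_sum_concave (gam : R -> R) (b u c : R) (n : nat) :
  measurable_fun setT gam -> 0 < b -> 0 < u -> 0 <= c -> 0 <= gam u ->
  (forall x, b < x -> x <= u -> gam u / u * x <= gam x) ->
  (forall x, b < x -> u <= x -> gam u <= gam x) ->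
  (\int[nu]_x (expR (2^-1 * (gam `|x| * exceeds b x)))%:E <= (1 + c)%:E)%E ->
  pr P [set w | u <= large_sum b n (trajectory X w)] <= expR (n%:R * c - gam u / 2).
Proof.
move=> mg b0 u0 c0 gu0 conc mono Eg.
have mabs : measurable_fun setT (fun x : R => gam `|x|).
  by apply: measurableT_comp mg _; exact: normr_measurable.
have mphi : measurable_fun setT (fun x : R => 2^-1 * (gam `|x| * exceeds b x)).
  apply: measurable_funM => //; apply: measurable_funM => //; exact: (bounded_exceeds b).1.
apply: le_trans (chernoff iidX n (gam u / 2) mphi c0 Eg).
apply: pr_le.
- apply: measurable_le_set; apply: (measurable_sum_coord iidX n (phi := fun x => `|x| * exceeds b x)).
  by apply: measurable_funM; [exact: normr_measurable|exact: (bounded_exceeds b).1].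
- exact/measurable_le_set/(measurable_sum_coord iidX n mphi).
move=> w /= uw; rewrite -mulr_sumr mulrC ler_wpM2l ?invr_ge0//.
pose z i := `|X i w| * exceeds b (X i w).
have term i : gam u / u * Num.min (z i) u <= gam `|X i w| * exceeds b (X i w).
  rewrite /z /exceeds; have [bx|xb] := ltP b `|X i w|; last first.
    by rewrite !mulr0 (min_l (ltW u0)) mulr0.
  rewrite !mulr1; have [xu|ux] := leP `|X i w| u; first exact: conc.
  by rewrite mulfVK ?gt_eqF//; apply: mono => //; exact: ltW.
have z0 i : 0 <= z i by rewrite mulr_ge0// /exceeds ler0n.
have msum : u <= \sum_(i < n) Num.min (z i) u.
  have [/forallP h|] := boolP [forall i : 'I_n, z i <= u].
    by apply: le_trans uw _; apply: ler_sum => i _; rewrite min_l.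
  rewrite negb_forall => /existsP[i]; rewrite -ltNge => uzi.
  rewrite (bigD1 i)//= (min_r (ltW uzi)) lerDl; apply: sumr_ge0 => j _.
  by rewrite le_min z0 (ltW u0).
apply: (@le_trans _ _ (\sum_(i < n) gam u / u * Num.min (z i) u)).
  rewrite -mulr_sumr -[leLHS](@mulfVK _ u) ?gt_eqF// ler_wpM2l//.
  by rewrite divr_ge0// ltW.
by apply: ler_sum => i _; exact: term.
Qed.

Variables (p : nat -> nat) (t : nat -> R).
Hypothesis t_infty : t n @[n --> \oo] --> (+oo%R : set_system R).

(** With exponent [gam / 2] the second half of [gam] pays for the restriction to
    the terms beyond [n^(1/3)], where [exp (gam / 2)] exceeds [n]. *)
Lemma large_sum_exp_moment (gam : R -> R) (x0 M : R) :
  measurable_fun setT gam -> 1 <= x0 ->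
  (forall x, x0 <= x -> 6 * ln x <= gam x) ->
  (forall x y, x0 <= x -> x <= y -> gam x <= gam y) ->
  (forall x y, x0 <= x -> x <= y -> gam y / y <= gam x / x) ->
  (\int[nu]_x (expR (gam `|x|))%:E <= M%:E)%E ->
  (\forall n \near \oo, (p n)%:R <= expR (t n ^+ 2)) ->
  (\forall n \near \oo, 4 * t n ^+ 2 <= gam (Num.sqrt n%:R * t n / 4)) ->
  (p n)%:R * pr P [set w | Num.sqrt n%:R * t n / 4 <=
    large_sum (n%:R `^ 3^-1) n (trajectory X w)] @[n --> \oo] --> 0.
Proof.
move=> mg x01 glog gmono gconc gM ple gt.
have x00 : 0 < x0 by exact: lt_le_trans x01.
have M0 : 0 <= M.
  by rewrite -lee_fin; apply: le_trans gM; apply: integral_ge0 => x _; rewrite lee_fin expR_ge0.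
have nR : (n%:R : R) @[n --> \oo] --> (+oo%R : set_system R) by exact: cvgr_idn.
have hexp : expR M * expR (- t n) @[n --> \oo] --> (0 : R).
  rewrite -(mulr0 (expR M)); apply: cvgM; first exact: cvg_cst.
  apply/cvgr0Pnorm_le => e e0; near=> n; rewrite ger0_norm ?expR_ge0//.
  rewrite -[leRHS]lnK ?posrE// ler_expR lerNl.
  by near: n; exact: (cvgry_ge t_infty).
apply: (squeeze_cvgr _ (cvg_cst 0) hexp); near=> n.
have n0 : (0 < n)%N by near: n; exact: nbhs_infty_gt.
have ngt : 0 < n%:R :> R by rewrite ltr0n.
have t1 : 4 <= t n by near: n; exact: (cvgry_ge t_infty).
have bx : x0 <= n%:R `^ 3^-1.
  have -> : x0 = (x0 ^+ 3) `^ 3^-1.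
    by rewrite -powR_mulrn ?(ltW x00)// -powRrM mulfV ?pnatr_eq0// powRr1// ltW.
  apply: ge0_ler_powR; rewrite ?nnegrE ?invr_ge0 ?exprn_ge0 ?(ltW x00) ?(ltW ngt)//.
  by near: n; exact: (cvgry_ge nR).
set b := _ `^ _ in bx *.
have b0 : 0 < b by exact: lt_le_trans bx.
set u := Num.sqrt n%:R * t n / 4.
have s1 : 1 <= n%:R :> R by rewrite ler1n.
have q0 : 0 < Num.sqrt n%:R :> R by rewrite sqrtr_gt0.
have xu : x0 <= u.
  have qx : x0 <= Num.sqrt n%:R.
    have -> : x0 = Num.sqrt (x0 ^+ 2) by rewrite sqrtr_sqr ger0_norm// ltW.
    by apply: ler_wsqrtr; near: n; exact: (cvgry_ge nR).
  by apply: le_trans qx _; rewrite /u -mulrA ler_peMr ?(ltW q0)// ler_pdivlMr// mul1r.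
have u0 : 0 < u by exact: lt_le_trans xu.
have gu : 4 * t n ^+ 2 <= gam u by rewrite /u; near: n.
have b3 : b ^+ 3 = n%:R by rewrite -powR_mulrn ?powR_ge0// -powRrM mulVf ?pnatr_eq0// powRr1// ltW.
rewrite mulr_ge0 ?pr_ge0//=.
have Eg : (\int[nu]_x (expR (2^-1 * (gam `|x| * exceeds b x)))%:E <= (1 + M / n%:R)%:E)%E.
  have mE : measurable_fun setT (fun x : R => (expR (gam `|x|))%:E).
    apply/measurable_EFinP; apply: measurableT_comp => //.
    by apply: measurableT_comp mg _; exact: normr_measurable.
  apply: (@le_trans _ _ (\int[nu]_x (1%:E + (n%:R^-1)%:E * (expR (gam `|x|))%:E))%E).
    apply: ge0_le_integral => //.
    - apply/measurable_EFinP; apply: measurableT_comp => //; apply: measurable_funM => //.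
      apply: measurable_funM; last exact: (bounded_exceeds b).1.
      by apply: measurableT_comp mg _; exact: normr_measurable.
    - by apply: emeasurable_funD => //; exact: measurable_funeM.
    move=> x _; rewrite -EFinM -EFinD lee_fin /exceeds; have [bx'|xb] := ltP b `|x|; last first.
      by rewrite !mulr0 expR0 lerDl mulr_ge0 ?invr_ge0 ?expR_ge0// ltW.
    rewrite mulr1; apply: (@le_trans _ _ (n%:R^-1 * expR (gam `|x|))); last by rewrite lerDr.
    have xx0 : x0 <= `|x| by exact: le_trans bx (ltW bx').
    have xp : 0 < `|x| by exact: lt_trans b0 bx'.
    rewrite ler_pdivlMl// -b3.
    have -> : expR (gam `|x|) = expR (2^-1 * gam `|x|) * expR (2^-1 * gam `|x|).
      by rewrite -expRD; congr expR; field.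
    rewrite ler_pM2r ?expR_gt0//.
    apply: (@le_trans _ _ (`|x| ^+ 3)).
      by apply: lerXn2r; rewrite ?nnegrE ?(ltW b0) ?(ltW bx').
    rewrite -[leLHS]lnK ?posrE ?exprn_gt0// ler_expR lnXn// -mulr_natl.
    by have := glog _ xx0; lra.
  rewrite ge0_integralD//; last exact: measurable_funeM.
  rewrite ge0_integralZl ?lee_fin ?invr_ge0 ?(ltW ngt)//.
  rewrite integral_cst// [X in (1%:E * X)%E]probability_setT mule1 EFinD.
  apply: leeD2l; rewrite mulrC EFinM; apply: lee_wpmul2l => //.
have c0 : 0 <= M / n%:R by rewrite divr_ge0// ltW.
have gu0 : 0 <= gam u by apply: le_trans gu; rewrite mulr_ge0// sqr_ge0.
have B := @large_sum_concave gam b u (M / n%:R) n mg b0 u0 c0 gu0.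
have {}B : pr P [set w | u <= large_sum b n (trajectory X w)] <= expR (M - gam u / 2).
  rewrite -[X in expR (X - _)](@mulfVK _ n%:R) ?gt_eqF// mulrC; apply: B => //.
  - move=> x bx' xu'; have xp : 0 < x by exact: lt_trans b0 bx'.
    rewrite -ler_pdivlMr//; apply: gconc => //; exact: le_trans bx (ltW bx').
  - by move=> x _ ux; exact: gmono.
have pn : (p n)%:R <= expR (t n ^+ 2) by near: n.
apply: le_trans (ler_pM _ _ pn B) _; rewrite ?ler0n ?pr_ge0//.
rewrite -!expRD ler_expR; nra.
Unshelve. all: by end_near. Qed.

(** With [s] moments a sum of large terms reaches [u] either because one of them
    exceeds [eps u], which has probability of order [n u^(- s)], or because at
    least [1 / eps] of them exceed [b], which has probability of order
    [n^(- s / 2)] for a suitable [eps]. *)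
Lemma large_sum_moment (s beta M C : R) :
  2 < s -> 1 < s * beta -> 0 < beta ->
  (\int[nu]_x (`|x| `^ s)%:E <= M%:E)%E ->
  (\forall n \near \oo, (p n)%:R <= C * n%:R `^ ((s - 2) / 2)) ->
  (p n)%:R * pr P [set w | Num.sqrt n%:R * t n / 4 <=
    large_sum (n%:R `^ beta) n (trajectory X w)] @[n --> \oo] --> 0.
Proof.
move=> s2 sb b0 Ms pC.
have s0 : 0 < s by lra.
have s2' : 2 <= s by exact: ltW.
pose eta := s * beta - 1; have eta0 : 0 < eta by rewrite subr_gt0.
pose eps := 2 * eta / s; have eps0 : 0 < eps by rewrite divr_gt0// mulr_gt0.
have M0 : 0 <= M := M_ge0 Ms.
have nR : (n%:R : R) @[n --> \oo] --> (+oo%R : set_system R) by exact: cvgr_idn.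
have tV : (t n)^-1 @[n --> \oo] --> (0 : R).
  by apply/gtr0_cvgV0 => //; exact: (cvgry_gt t_infty).
have nV : (n%:R : R)^-1 @[n --> \oo] --> (0 : R).
  by apply/gtr0_cvgV0 => //; exact: (cvgry_gt nR).
pose K1 := `|C| * M * (eps / 4) `^ (- s).
have bnd : K1 * (t n)^-1 + `|C| * expR M * n%:R^-1 @[n --> \oo] --> (0 : R).
  have -> : 0 = K1 * 0 + `|C| * expR M * 0 :> R by rewrite !mulr0 addr0.
  by apply: cvgD; (apply: cvgM => //; exact: cvg_cst).
apply: (squeeze_cvgr _ (cvg_cst 0) bnd); near=> n.
have n1 : (1 < n)%N by near: n; exact: nbhs_infty_gt.
have ngt : 0 < n%:R :> R by rewrite ltr0n ltnW.
have nn : n%:R != 0 :> R by rewrite gt_eqF.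
have lnn : 0 < ln n%:R :> R by rewrite ln_gt0// ltr1n.
have t1 : 1 <= t n by near: n; exact: (cvgry_ge t_infty).
have t0 : 0 < t n by exact: lt_le_trans t1.
have q0 : 0 < Num.sqrt n%:R :> R by rewrite sqrtr_gt0.
set b := n%:R `^ beta; set u := Num.sqrt n%:R * t n / 4.
have bgt : 0 < b by rewrite powR_gt0.
have u0 : 0 < u by rewrite divr_gt0// mulr_gt0.
have a0 : 0 < eps * u by rewrite mulr_gt0.
rewrite mulr_ge0 ?pr_ge0//=.
pose th := s / 2 * ln n%:R; have th0 : 0 < th by rewrite mulr_gt0// divr_gt0.
pose phi x := th / u * (Num.min `|x| (eps * u) * exceeds b x).
have mex := (bounded_exceeds b).1.
have mphi : measurable_fun setT phi.
  apply: measurable_funM => //; apply: measurable_funM => //.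
  by apply: measurable_minr => //; exact: normr_measurable.
have the : th * eps = eta * ln n%:R by rewrite /th /eps; field; exact: lt0r_neq0.
have Eexp : expR (th * eps) = n%:R `^ eta by rewrite the /powR (negbTE nn).
have bM : n%:R `^ eta * (b `^ (- s) * M) = M / n%:R.
  rewrite -powRrM mulrA -powRD; last by apply/implyP.
  have -> : eta + beta * - s = - 1 by rewrite /eta; ring.
  by rewrite powRN powRr1 ?ler0n// mulrC.
have c0 : 0 <= M / n%:R by rewrite divr_ge0// ltW.
have Ephi : (\int[nu]_x (expR (phi x))%:E <= (1 + M / n%:R)%:E)%E.
  apply: (@le_trans _ _ (\int[nu]_x (1%:E + (n%:R `^ eta)%:E * (exceeds b x)%:E))%E).
    apply: ge0_le_integral => //.
    - by apply/measurable_EFinP; exact: measurableT_comp.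
    - by apply: emeasurable_funD => //; apply: measurable_funeM; exact/measurable_EFinP.
    move=> x _; rewrite -EFinM -EFinD lee_fin /phi /exceeds.
    have [_|_] := ltP b `|x|; last by rewrite !mulr0 expR0 addr0.
    rewrite !mulr1; apply: (@le_trans _ _ (n%:R `^ eta)); last by rewrite lerDr.
    rewrite -Eexp ler_expR -[leRHS](_ : th / u * (eps * u) = _); last first.
      by field; exact: lt0r_neq0.
    apply: ler_wpM2l; first by rewrite divr_ge0 ?(ltW th0) ?(ltW u0).
    by rewrite ge_min lexx orbT.
  rewrite ge0_integralD//; last 2 first.
  - by move=> x _; rewrite mule_ge0// lee_fin ?powR_ge0 ?ler0n.
  - by apply: measurable_funeM; exact/measurable_EFinP.
  rewrite ge0_integralZl ?lee_fin ?powR_ge0//; last 2 first.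
  - exact/measurable_EFinP.
  - by move=> x _; rewrite lee_fin ler0n.
  rewrite integral_cst// [X in (1%:E * X)%E]probability_setT mule1 EFinD.
  apply: leeD2l; rewrite -bM EFinM; apply: lee_wpmul2l; first by rewrite lee_fin powR_ge0.
  exact: exceeds_moment.
have mA : measurable [set w | th <= \sum_(i < n) phi (X i w)].
  exact: measurable_le_set (measurable_sum_coord iidX n mphi).
have mexu := (bounded_exceeds (eps * u)).1.
have mB : measurable [set w | 1 <= \sum_(i < n) exceeds (eps * u) (X i w)].
  exact: measurable_le_set (measurable_sum_coord iidX n mexu).
have prA := chernoff iidX n th mphi c0 Ephi.
have prB : pr P [set w | 1 <= \sum_(i < n) exceeds (eps * u) (X i w)] <=
    n%:R * ((eps * u) `^ (- s) * M).
  have bex i : bounded_measurable (fun w => exceeds (eps * u) (X i w)).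
    by split; [exact: measurableT_comp mexu (iidX.1 i)|exists 1 => w; rewrite ger0_norm ?ler0n// lern1 leq_b1].
  rewrite -(prE P mB); apply: (@le_trans _ _ (\int[P]_w \sum_(i < n) exceeds (eps * u) (X i w))%R).
    apply: expect_le; [exact: bounded_measurable_indic|exact: bounded_measurable_sum|].
    move=> w; rewrite indicE; have [|_] := boolP (w \in _); first by rewrite inE.
    by apply: sumr_ge0 => i _; rewrite /exceeds ler0n.
  rewrite expect_sum//; apply: (@le_trans _ _ (\sum_(i < n) (eps * u) `^ (- s) * M)).
    apply: ler_sum => i _; rewrite -lee_fin (EFin_expect P (bex i)).
    rewrite (ge0_integral_coord iidX i (f := fun x => (exceeds (eps * u) x)%:E)).
    - exact: (exceeds_moment s2' a0 Ms).
    - exact/measurable_EFinP.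
    - by move=> x; rewrite lee_fin ler0n.
  by rewrite sumr_const card_ord mulr_natl.
have cover : pr P [set w | u <= large_sum b n (trajectory X w)] <=
    n%:R * ((eps * u) `^ (- s) * M) + expR (M - th).
  apply: le_trans (_ : _ <= pr P ([set w | 1 <= \sum_(i < n) exceeds (eps * u) (X i w)] `|`
    [set w | th <= \sum_(i < n) phi (X i w)])) _; last first.
    apply: le_trans (pr_setU_le P mB mA) _; apply: lerD prB _.
    by apply: le_trans prA _; rewrite mulrCA mulfV// mulr1.
  apply: pr_le; [|exact: measurableU|].
    apply: measurable_le_set; apply: (measurable_sum_coord iidX n (phi := fun x => `|x| * exceeds b x)).
    by apply: measurable_funM => //; exact: normr_measurable.
  move=> w /= uw.
  have [/forallP h|] := boolP [forall i : 'I_n, `|X i w| <= eps * u].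
    right; rewrite -mulr_sumr mulrAC ler_pdivlMr// ler_wpM2l ?(ltW th0)//.
    apply: le_trans uw _; rewrite /large_sum le_eqVlt; apply/orP; left; apply/eqP.
    by apply: eq_bigr => i _; rewrite min_l.
  rewrite negb_forall => /existsP[i]; rewrite -ltNge => hi; left.
  rewrite (bigD1 i)//= {1}/exceeds hi lerDl; apply: sumr_ge0 => j _.
  by rewrite /exceeds ler0n.
have pn : (p n)%:R <= `|C| * n%:R `^ ((s - 2) / 2).
  have := (ler_norm C); move=> hC; apply: (@le_trans _ _ (C * n%:R `^ ((s - 2) / 2))); first by near: n.
  by rewrite ler_wpM2r ?powR_ge0.
apply: le_trans (ler_wpM2l (ler0n _ (p n)) cover) _; rewrite mulrDr; apply: lerD.
  have -> : K1 / t n = `|C| * n%:R `^ ((s - 2) / 2) * (n%:R * ((eps / 4) `^ (- s) * n%:R `^ (2^-1 * - s) * M)) / t n.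
    have e1 : n%:R `^ ((s - 2) / 2) * n%:R * n%:R `^ (2^-1 * - s) = 1 :> R.
      rewrite -{2}[n%:R](powRr1 (ler0n R n)) -!powRD; try by apply/implyP.
      by rewrite (_ : _ + _ = 0) ?powRr0//; field.
    congr (_ / _); transitivity (K1 * (n%:R `^ ((s - 2) / 2) * n%:R * n%:R `^ (2^-1 * - s))).
      by rewrite e1 mulr1.
    by rewrite /K1; ring.
  apply: le_trans (ler_wpM2r _ pn) _.
    by rewrite mulr_ge0 ?ler0n// mulr_ge0 ?powR_ge0.
  rewrite -[leRHS]mulrA; apply: ler_wpM2l; first by rewrite mulr_ge0 ?powR_ge0.
  rewrite -[leRHS]mulrA; apply: ler_wpM2l; first by rewrite ler0n.
  rewrite [leRHS]mulrAC; apply: ler_wpM2r => //.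
  have -> : eps * u = eps / 4 * (n%:R `^ 2^-1 * t n) by rewrite /u powR12_sqrt ?ler0n//; ring.
  have e4 : 0 <= eps / 4 by rewrite divr_ge0// ltW.
  have nt : 0 <= n%:R `^ 2^-1 * t n by rewrite mulr_ge0 ?powR_ge0// ltW.
  rewrite (powRM _ e4 nt) (powRM _ (powR_ge0 _ _) (ltW t0)) -powRrM -[leRHS]mulrA.
  apply: ler_wpM2l; first by rewrite powR_ge0.
  apply: ler_wpM2l; first by rewrite powR_ge0.
  have -> : (t n)^-1 = t n `^ (- 1) by rewrite powRN powRr1// ltW.
  by apply: ler_powR => //; lra.
apply: le_trans (ler_wpM2r (expR_ge0 _) pn) _.
rewrite -!mulrA ler_wpM2l// expRD mulrCA ler_wpM2l ?expR_ge0//.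
have -> : expR (- th) = n%:R `^ (- (s / 2)) by rewrite /powR (negbTE nn) mulNr.
rewrite -powRD; last by apply/implyP.
rewrite (_ : (s - 2) / 2 + - (s / 2) = - 1); last by field.
by rewrite powRN powRr1 ?ler0n.
Unshelve. all: by end_near. Qed.

End large_terms.

(** * The moment conditions *)

Section conditions.
Context {R : realType} d (T : measurableType d) (P : probability T R).
Variables (X : nat -> {RV P >-> R}) (p : nat -> nat).
Hypotheses (iidX : iid P X) (meanX : ('E_P[X 0%N] = 0)%E)
  (secondX : ('E_P[fun w => (X 0%N w ^+ 2)%R] = 1)%E).
Hypotheses (p_gt0 : forall n, (0 < p n)%N) (p_infty : p n @[n --> \oo] --> \oo).

Let nu : probability R R := distribution P (X 0%N).
Let iidX' : iid_law P X nu := iid_iid_law iidX.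
Local Notation t n := (norming (p n)%:R : R).
Local Notation L n := (ln (p n)%:R : R).

Lemma law_second_moment : (\int[nu]_x (x ^+ 2)%:E = 1)%E.
Proof.
rewrite ge0_integral_distribution//=; first by rewrite -secondX unlock.
- by apply/measurable_EFinP; exact: measurable_funX.
- by move=> y; rewrite lee_fin sqr_ge0.
Qed.

Lemma law_integrable : nu.-integrable setT (EFin \o @id R).
Proof.
apply/integrableP; split; first exact/measurable_EFinP.
apply: (@le_lt_trans _ _ (\int[nu]_x (1%:E + (x ^+ 2)%:E))%E).
  apply: ge0_le_integral => //.
  - by apply: measurableT_comp => //; exact/measurable_EFinP.
  - by apply: emeasurable_funD => //; apply/measurable_EFinP; exact: measurable_funX.
  move=> x _ /=; rewrite -EFinD lee_fin -(real_normK (num_real x)).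
  have := sqr_ge0 (`|x| - 1); have := normr_ge0 x; nra.
rewrite ge0_integralD//; last 2 first.
- by move=> x _; rewrite lee_fin sqr_ge0.
- by apply/measurable_EFinP; exact: measurable_funX.
rewrite law_second_moment integral_cst// [X in (1%:E * X)%E]probability_setT mule1.
by rewrite -EFinD ltry.
Qed.

Lemma law_mean : (\int[nu]_x x%:E = 0)%E.
Proof.
rewrite integral_distribution//; last exact: (integrable_coord iidX' law_integrable 0).
by rewrite -meanX unlock.
Qed.

Lemma norming_sqr_bounds : \forall n \near \oo, L n <= t n ^+ 2 <= 2 * L n.
Proof. exact: (ln_p_infty p_infty norming_log_sqr_bounds). Qed.

Lemma p_le_norming : \forall n \near \oo, (p n)%:R <= expR (t n ^+ 2).
Proof.
apply: filterS norming_sqr_bounds => n /andP[Lt _].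
by rewrite -[leLHS]lnK ?posrE ?ltr0n// ler_expR.
Qed.

(** What the tail argument uses of the three moment conditions: a truncation
    level [n^beta] below [sqrt n / t], and a sum of the terms beyond it that is
    negligible at the scale [1 / p]. *)
Definition moderate : Prop := exists s beta M : R,
  [/\ 2 <= s, 1 < s * beta, 0 < beta, beta < 2^-1 &
      (\int[nu]_x (`|x| `^ s)%:E <= M%:E)%E] /\
  (forall e : R, 0 < e -> \forall n \near \oo, t n ^+ 2 <= e * n%:R `^ (1 - 2 * beta)) /\
  ((p n)%:R * pr P [set w | Num.sqrt n%:R * t n / 4 <=
     large_sum (n%:R `^ beta) n (trajectory X w)] @[n --> \oo] --> 0).

Lemma powR_cvgy (a : R) : 0 < a -> n%:R `^ a @[n --> \oo] --> (+oo%R : set_system R).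
Proof.
move=> a0; apply/cvgryPge => A; near=> n.
apply: le_trans (ler_norm A) _.
have -> : `|A| = (`|A| `^ a^-1) `^ a by rewrite -powRrM mulVf ?gt_eqF// powRr1.
apply: ge0_ler_powR; rewrite ?nnegrE ?powR_ge0 ?ler0n ?(ltW a0)//.
by near: n; exact: (cvgry_ge (@cvgr_idn R)).
Unshelve. all: by end_near. Qed.

Lemma ln_powR_small (a k1 k2 e : R) : 0 < a -> 0 < e ->
  \forall n \near \oo, k1 + k2 * ln n%:R <= e * n%:R `^ a.
Proof.
move=> a0 e0; pose c := `|k2| / (2 * a).
have c0 : 0 <= c by rewrite divr_ge0// mulr_ge0// ltW.
have h : (ln (n%:R `^ (2 * a)) + 0) / Num.sqrt (n%:R `^ (2 * a)) @[n --> \oo] --> (0 : R).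
  exact: (cvg_comp _ _ (powR_cvgy (mulr_gt0 (ltr0Sn R 1) a0)) (@log_sqrt_cvg0 R 0)).
have hp := powR_cvgy a0.
have c1 : 0 < c + 1 by lra.
have pos : 0 < e / (2 * (c + 1)) by rewrite divr_gt0// mulr_gt0.
near=> n.
have n0 : 0 < n%:R :> R by rewrite ltr0n; near: n; exact: nbhs_infty_gt.
have n1 : 1 <= n%:R :> R by rewrite ler1n -(ltr0n R).
have na : 0 < n%:R `^ a by rewrite powR_gt0.
have h1 : ln (n%:R `^ (2 * a)) / Num.sqrt (n%:R `^ (2 * a)) <= e / (2 * (c + 1)).
  near: n; move/cvgrPdist_le : h => /(_ _ pos); apply: filterS => n /=.
  by rewrite addr0 sub0r normrN; apply: le_trans; exact: ler_norm.
have sq : Num.sqrt (n%:R `^ (2 * a)) = n%:R `^ a.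
  by rewrite [2 * a]mulrC powRrM powR_mulrn ?powR_ge0// sqrtr_sqr ger0_norm ?powR_ge0.
rewrite sq ln_powR ler_pdivrMr// in h1.
have hk : k1 <= e / 2 * n%:R `^ a.
  rewrite -ler_pdivrMl ?divr_gt0//; near: n; exact: (cvgry_ge hp).
have l0 : 0 <= ln n%:R :> R by rewrite ln_ge0.
have hk2 : k2 * ln n%:R <= c * (2 * a * ln n%:R).
  have -> : c * (2 * a * ln n%:R) = `|k2| * ln n%:R by rewrite /c; field; rewrite gt_eqF.
  by rewrite ler_wpM2r// ler_norm.
have hc : c * (2 * a * ln n%:R) <= e / 2 * n%:R `^ a.
  apply: le_trans (ler_wpM2l c0 h1) _.
  rewrite mulrA ler_wpM2r ?(ltW na)//.
  have -> : c * (e / (2 * (c + 1))) = e / 2 * (c / (c + 1)) by field; rewrite gt_eqF.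
  rewrite ler_piMr ?divr_ge0 ?(ltW e0)//.
  by rewrite ler_pdivrMr// mul1r lerDl.
by lra.
Unshelve. all: by end_near. Qed.

(** If [p] grows at most polynomially then [t] is at most of order [sqrt (ln n)],
    so any truncation exponent between [1 / s] and [1 / 2] is allowed. *)
Lemma moderate_moment : condition_moment P (X 0%N) p -> moderate.
Proof.
move=> [s [s2 Es pO]].
have s0 : 0 < s by apply: lt_trans s2.
have mpow : measurable_fun setT (fun x : R => (`|x| `^ s)%:E).
  by apply/measurable_EFinP; exact: measurable_powRabs.
have E : (\int[nu]_x (`|x| `^ s)%:E = 'E_P[fun w => (`|X 0%N w| `^ s)%R])%E.
  by rewrite ge0_integral_distribution//= unlock.
have Efin : (\int[nu]_x (`|x| `^ s)%:E)%E \is a fin_num.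
  by rewrite ge0_fin_numE ?E//; rewrite -E; apply: integral_ge0 => x _; rewrite lee_fin powR_ge0.
pose beta : R := (s^-1 + 2^-1) / 2.
have sV : 0 < s^-1 by rewrite invr_gt0.
have sV2 : s^-1 < 2^-1 by rewrite ltf_pV2 ?posrE.
have sb : 1 < s * beta.
  have -> : s * beta = (1 + s / 2) / 2 by rewrite /beta; field; rewrite gt_eqF.
  by lra.
have b0 : 0 < beta by rewrite /beta; lra.
have b2 : beta < 2^-1 by rewrite /beta; lra.
have [C pC] : exists C : R, \forall n \near \oo, (p n)%:R <= C * n%:R `^ ((s - 2) / 2).
  move: pO => /eqOP[k0 [_ h]]; exists (k0 + 1).
  have : \forall n \near \oo, `|(p n)%:R : R| <= (k0 + 1) * `|n%:R `^ ((s - 2) / 2) : R|.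
    by apply: h; rewrite ltrDl.
  by apply: filterS => n; rewrite !ger0_norm ?powR_ge0 ?ler0n.
exists s, beta, (fine (\int[nu]_x (`|x| `^ s)%:E)%E); split.
  by split => //; [exact: ltW|rewrite fineK].
split; last first.
  have Ms : (\int[nu]_x (`|x| `^ s)%:E <= (fine (\int[nu]_x (`|x| `^ s)%:E))%:E)%E.
    by rewrite fineK.
  exact: (large_sum_moment iidX' (norming_infty p_infty) s2 sb b0 Ms pC).
move=> e e0; have a0 : 0 < 1 - 2 * beta by lra.
have small := ln_powR_small (2 * ln (`|C| + 1)) (s - 2) a0 e0.
near=> n.
have n0 : (0 < n)%N by near: n; exact: nbhs_infty_gt.
have n0R : 0 < n%:R :> R by rewrite ltr0n.
have /andP[_ t2] : L n <= t n ^+ 2 <= 2 * L n by near: n; exact: norming_sqr_bounds.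
apply: (@le_trans _ _ (2 * ln (`|C| + 1) + (s - 2) * ln n%:R)); last by near: n.
apply: le_trans t2 _.
have pn : (p n)%:R <= (`|C| + 1) * n%:R `^ ((s - 2) / 2).
  have h : (p n)%:R <= C * n%:R `^ ((s - 2) / 2) by near: n.
  apply: le_trans h _; rewrite ler_wpM2r ?powR_ge0//.
  by apply: le_trans (ler_norm C) _; rewrite lerDl.
have C0 : 0 < `|C| + 1 by rewrite ltr_pwDr.
have : ln (p n)%:R <= ln ((`|C| + 1) * n%:R `^ ((s - 2) / 2)).
  by rewrite ler_ln ?posrE ?ltr0n ?mulr_gt0 ?powR_gt0.
rewrite lnM ?posrE ?powR_gt0// ln_powR => h; lra.
Unshelve. all: by end_near. Qed.

(** The weight [gam] stands for [g] beyond a point where it dominates the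
    logarithm and where [g x / x] is nonincreasing. *)
Lemma moderate_exp (gam : R -> R) (x0 M : R) :
  measurable_fun setT gam -> 1 <= x0 ->
  (forall x, x0 <= x -> 6 * ln x <= gam x) ->
  (forall x y, x0 <= x -> x <= y -> gam x <= gam y) ->
  (forall x y, x0 <= x -> x <= y -> gam y / y <= gam x / x) ->
  (\int[nu]_x (expR (gam `|x|))%:E <= M%:E)%E ->
  (forall e : R, 0 < e -> \forall n \near \oo, L n <= e * n%:R `^ 3^-1) ->
  (\forall n \near \oo, 4 * t n ^+ 2 <= gam (Num.sqrt n%:R * t n / 4)) ->
  moderate.
Proof.
move=> mg x01 glog gmono gconc gM Lsmall gt.
have x00 : 0 < x0 by exact: lt_le_trans x01.
have mE : measurable_fun setT (fun x : R => (expR (gam `|x|))%:E).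
  apply/measurable_EFinP; apply: measurableT_comp => //.
  by apply: measurableT_comp mg _; exact: normr_measurable.
exists 4, 3^-1, (x0 `^ 4 + M); split.
  split; [lra|lra|lra|lra|].
  apply: (@le_trans _ _ (\int[nu]_x ((x0 `^ 4)%:E + (expR (gam `|x|))%:E))%E).
    apply: ge0_le_integral => //.
    - by apply/measurable_EFinP; exact: measurable_powRabs.
    - exact: emeasurable_funD.
    move=> x _; rewrite -EFinD lee_fin; have [xx|xx] := leP `|x| x0.
      apply: (@le_trans _ _ (x0 `^ 4)); last by rewrite lerDl expR_ge0.
      by apply: ge0_ler_powR; rewrite ?nnegrE ?(ltW x00).
    apply: (@le_trans _ _ (expR (gam `|x|))); last by rewrite lerDr powR_ge0.
    have xp : 0 < `|x| by exact: lt_trans xx.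
    rewrite /powR gt_eqF// ler_expR; apply: le_trans (glog _ (ltW xx)).
    by rewrite ler_wpM2r ?ln_ge0 ?(le_trans x01 (ltW xx))//; lra.
  rewrite ge0_integralD//; last by move=> x _; rewrite lee_fin powR_ge0.
  rewrite integral_cst// [X in (_ * X)%E]probability_setT mule1 EFinD.
  by apply: leeD2l.
split; last first.
  exact: (large_sum_exp_moment iidX' (norming_infty p_infty) mg x01 glog gmono gconc gM p_le_norming gt).
move=> e e0; near=> n.
have /andP[_ t2] : L n <= t n ^+ 2 <= 2 * L n by near: n; exact: norming_sqr_bounds.
have -> : 1 - 2 * 3^-1 = 3^-1 :> R by field.
have : L n <= e / 2 * n%:R `^ 3^-1 by near: n; apply: Lsmall; rewrite divr_gt0.
by lra.
Unshelve. all: by end_near. Qed.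

Lemma moderate_exponential : condition_exponential P (X 0%N) p -> moderate.
Proof.
move=> [[h h0 Eh] Lo].
have Lsmall e : 0 < e -> \forall n \near \oo, L n <= e * n%:R `^ 3^-1.
  move=> e0; move: Lo => /eqoP /(_ e e0); apply: filterS => n /=.
  by rewrite [X in _ <= _ * X]ger0_norm ?powR_ge0//; apply: le_trans; exact: ler_norm.
pose x0 := Num.max 1 ((12 / h) ^+ 2).
have x01 : 1 <= x0 by rewrite le_max lexx.
have mlin : measurable_fun setT (fun x : R => h * x) by exact: measurable_funM.
have mE : measurable_fun setT (fun x : R => (expR (h * `|x|))%:E).
  apply/measurable_EFinP; apply: measurableT_comp => //; apply: measurable_funM => //.
have E : (\int[nu]_x (expR (h * `|x|))%:E = 'E_P[fun w => expR (h * `|X 0%N w|)%R])%E.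
  by rewrite ge0_integral_distribution//= unlock.
have Efin : (\int[nu]_x (expR (h * `|x|))%:E)%E \is a fin_num.
  by rewrite ge0_fin_numE ?E//; rewrite -E; apply: integral_ge0 => x _; rewrite lee_fin expR_ge0.
apply: (@moderate_exp (fun x => h * x) x0 (fine (\int[nu]_x (expR (h * `|x|))%:E)%E)) => //.
- move=> x xx0; have x0' : 0 < x by apply: lt_le_trans (le_trans x01 xx0).
  have sx : 12 / h <= Num.sqrt x.
    rewrite -[leLHS]ger0_norm ?divr_ge0 ?(ltW h0)// -sqrtr_sqr ler_wsqrtr//.
    by apply: le_trans xx0; rewrite le_max lexx orbT.
  have s0 : 0 < Num.sqrt x by rewrite sqrtr_gt0.
  have sE : x = Num.sqrt x ^+ 2 by rewrite sqr_sqrtr// ltW.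
  have -> : ln x = 2 * ln (Num.sqrt x) by rewrite {1}sE lnXn// mulr_natl.
  have l1 : ln (Num.sqrt x) <= Num.sqrt x by apply/ltW/ln_sublinear.
  have -> : h * x = Num.sqrt x * (Num.sqrt x * h) by rewrite {1}sE; ring.
  rewrite ler_pdivrMr// in sx.
  by have := ler_wpM2l (ltW s0) sx; nra.
- by move=> x y _ xy; rewrite ler_wpM2l// ltW.
- move=> x y xx0 xy; have xp : 0 < x by apply: lt_le_trans (le_trans x01 xx0).
  have yp : 0 < y by exact: lt_le_trans xy.
  by rewrite !mulfK ?gt_eqF.
- by rewrite fineK.
pose c := (h / 16) ^+ 2 / 2.
have c0 : 0 < c by rewrite divr_gt0// exprn_gt0// divr_gt0.
near=> n.
have /andP[_ t2] : L n <= t n ^+ 2 <= 2 * L n by near: n; exact: norming_sqr_bounds.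
have n1 : 1 <= n%:R :> R by rewrite ler1n; near: n; exact: nbhs_infty_gt.
have tpos : 0 < t n by near: n; exact: norming_gt0.
have Le : L n <= c * n%:R `^ 3^-1 by near: n; exact: Lsmall c0.
have n3 : n%:R `^ 3^-1 <= n%:R :> R.
  by rewrite -[leRHS]powRr1 ?ler0n//; apply: ler_powR => //; lra.
have q0 : 0 <= Num.sqrt n%:R :> R by rewrite sqrtr_ge0.
have tq : t n <= h / 16 * Num.sqrt n%:R.
  rewrite -(@ler_pXn2r _ 2)// ?nnegrE ?mulr_ge0 ?divr_ge0 ?(ltW tpos) ?(ltW h0)//.
  rewrite exprMn sqr_sqrtr ?ler0n//.
  have := ler_wpM2l (ltW c0) n3.
  have -> : (h / 16) ^+ 2 * n%:R = 2 * (c * n%:R) by rewrite /c; field.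
  by lra.
by have := ler_wpM2l (ltW tpos) tq; nra.
Unshelve. all: by end_near. Qed.

(** The condition on the derivative makes [g x / x] nonincreasing. Since [t] is
    of smaller order than [g_n], this gives [g (sqrt n t / 4) >= g_n^2 (sqrt n t
    / 4) / (g_n sqrt n)], which is [g_n t / 4 >= 4 t^2]. *)
Lemma moderate_subexponential : condition_subexponential P (X 0%N) p -> moderate.
Proof.
move=> [g [gn [[gmono gder Eg [tau tau1 gtau] glog] [gnE Lo]]]].
have Lmin e : 0 < e -> \forall n \near \oo, L n <= e * Num.min (gn n ^+ 2) (n%:R `^ 3^-1).
  move=> e0; move: Lo => /eqoP /(_ e e0); apply: filterS => n /=.
  rewrite [X in _ <= _ * X]ger0_norm ?le_min ?sqr_ge0 ?powR_ge0//.
  by apply: le_trans; exact: ler_norm.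
have gcont x : 0 < x -> {for x, continuous g}.
  by move=> /gder dg; apply: differentiable_continuous; exact/derivable1_diffP.
have [x0 [x01 hlog hder]] : exists x0 : R, [/\ 1 < x0,
    forall x, x0 <= x -> 6 <= g x / ln x &
    forall x, x0 <= x -> derive1 g x <= tau * g x / x].
  have h1 : \forall x \near +oo, 6 <= g x / ln x by exact: (cvgry_ge glog).
  have [a1 [_ ha1]] := h1; have [a2 [_ ha2]] := gtau.
  exists (Num.max 2 (Num.max (a1 + 1) (a2 + 1))); split.
  - by rewrite lt_max ltr1n.
  - move=> x; rewrite !ge_max => /and3P[_ h _]; apply: ha1.
    by apply: lt_le_trans h; rewrite ltrDl.
  - move=> x; rewrite !ge_max => /and3P[_ _ h]; apply: ha2.
    by apply: lt_le_trans h; rewrite ltrDl.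
have x00 : 0 < x0 by exact: lt_trans x01.
have pos x : x0 <= x -> 0 < x by exact: lt_le_trans.
have lnpos x : x0 <= x -> 0 < ln x by move=> h; rewrite ln_gt0// (lt_le_trans x01).
have glog' x : x0 <= x -> 6 * ln x <= g x.
  by move=> h; rewrite -ler_pdivlMr ?lnpos//; exact: hlog.
have gpos x : x0 <= x -> 0 <= g x.
  by move=> h; apply: le_trans (glog' _ h); rewrite mulr_ge0// ltW// lnpos.
have gmono' x y : 0 < x -> x <= y -> g x <= g y.
  move=> xp xy; apply: gmono => //; rewrite in_itv/= andbT//.
  exact: lt_le_trans xy.
pose ratio x := g x / x.
have ratio_der x : x0 <= x -> is_derive x (1 : R) ratio
    ((derive1 g x) * x^-1 + g x * (- x ^- 2)).
  move=> xx0; have xp := pos x xx0.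
  have dg : is_derive x (1 : R) g (derive1 g x).
    by rewrite derive1E; apply: DeriveDef => //; exact: gder.
  have dV : is_derive x (1:R) (fun y : R => y^-1) (- x ^- 2).
    have := is_deriveV (lt0r_neq0 xp) (is_derive_id x (1:R)).
    by rewrite /GRing.scale /= mulr1.
  have := is_deriveM dg dV; rewrite /GRing.scale /= => dr.
  by rewrite addrC [_ * x^-1]mulrC.
have ratio_nincr x y : x0 <= x -> x <= y -> ratio y <= ratio x.
  move=> xx0 xy; apply: (@ler0_derive1_nincry _ ratio x0) => //.
  - by move=> z; rewrite in_itv/= andbT => /ltW h; have [] := ratio_der z h.
  - move=> z; rewrite in_itv/= andbT => /ltW h; rewrite derive1E.
    have [_ ->] := ratio_der z h; have zp := pos z h.
    have -> : derive1 g z / z + g z * (- z ^- 2) = (derive1 g z - g z / z) / z.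
      by field; rewrite gt_eqF.
    rewrite pmulr_lle0 ?invr_gt0// subr_le0; apply: le_trans (hder z h) _.
    rewrite -mulrA ler_piMl ?divr_ge0 ?gpos// ?ltW//.
  - apply: continuous_in_subspaceT => z; rewrite inE /= in_itv/= andbT => h.
    apply: differentiable_continuous; apply/derivable1_diffP.
    by have [] := ratio_der z h.
pose cut c x := g (Num.max x c).
have ccut c : 0 < c -> continuous (cut c).
  move=> cp x; have mx : 0 < Num.max x c by rewrite lt_max cp orbT.
  apply: (@continuous_comp _ _ _ (fun x => Num.max x c) g x); last exact: gcont.
  by apply: (@continuous_max R R id (fun=> c)); [exact: cvg_id|exact: cvg_cst].
pose gam := cut x0.
have cgam : continuous gam by exact: ccut.
have mgam : measurable_fun setT gam by exact: continuous_measurable_fun.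
have gamE x : x0 <= x -> gam x = g x by move=> h; rewrite /gam /cut max_l.
have mX : measurable_fun setT (fun w => `|X 0%N w|).
  by apply: (measurableT_comp (@normr_measurable R setT)); exact: measurable_funP.
(* the values of [g] on negative numbers are arbitrary, and [`|X|] does not reach them *)
pose g0 (x : R) := if 0 < x then g x else g 0.
have mg0 : measurable_fun setT g0.
  pose gk (k : nat) (x : R) := if 0 < x then cut k.+1%:R^-1 x else g 0.
  apply: (@measurable_fun_cvg _ _ _ setT gk) => [k|x _].
    apply: measurable_fun_ifT => //; first exact: measurable_fun_ltr.
    by apply: continuous_measurable_fun; apply: ccut; rewrite invr_gt0 ltr0n.
  rewrite /gk /g0; case: ifPn => xp; last exact: cvg_cst.
  refine (cvg_eq_near (cvg_cst (g x)) _); near=> k; rewrite /cut max_l//.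
  rewrite -[leRHS]invrK lef_pV2 ?posrE ?invr_gt0 ?ltr0n//.
  apply: (@le_trans _ _ k%:R); last by rewrite ler_nat.
  by near: k; exact: (cvgry_ge (@cvgr_idn R)).
have absE w : g `|X 0%N w| = g0 `|X 0%N w|.
  rewrite /g0; case: ifPn => //; rewrite -leNgt normr_le0 => /eqP ->.
  by rewrite normr0.
have Egam : (\int[nu]_x (expR (gam `|x|))%:E <= (expR (g x0) + fine 'E_P[fun w => expR (g `|X 0%N w|%R)])%:E)%E.
  have mexp : measurable_fun setT (fun w => (expR (g `|X 0%N w|))%:E).
    apply/measurable_EFinP; apply: measurableT_comp => //.
    under eq_fun do rewrite absE; exact: measurableT_comp mg0 mX.
  have Efin : ('E_P[fun w => expR (g `|X 0%N w|%R)])%E \is a fin_num.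
    by rewrite ge0_fin_numE// unlock; apply: integral_ge0 => w _; rewrite lee_fin expR_ge0.
  rewrite ge0_integral_distribution; last 2 first.
  - apply/measurable_EFinP; apply: measurableT_comp => //.
    by apply: measurableT_comp mgam _; exact: normr_measurable.
  - by move=> y; rewrite lee_fin expR_ge0.
  apply: (@le_trans _ _ (\int[P]_w ((expR (g x0))%:E + (expR (g `|X 0%N w|))%:E))%E).
    apply: ge0_le_integral => //.
    - by move=> w _; rewrite lee_fin expR_ge0.
    - apply/measurable_EFinP; apply: measurableT_comp => //.
      exact: measurableT_comp mgam mX.
    - exact: emeasurable_funD.
    move=> w _ /=; rewrite -EFinD lee_fin /gam /cut; have [h|h] := leP `|X 0%N w| x0.
      by rewrite lerDl expR_ge0.
    by rewrite lerDr expR_ge0.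
  rewrite ge0_integralD//.
  rewrite integral_cst// [X in (_ * X)%E]probability_setT mule1 EFinD fineK//.
  by apply: leeD2l; rewrite unlock.
apply: (@moderate_exp gam x0 _ mgam (ltW x01) _ _ _ Egam).
- by move=> x h; rewrite gamE//; exact: glog'.
- by move=> x y h xy; rewrite !gamE ?(le_trans h)//; apply: gmono' => //; exact: pos.
- by move=> x y h xy; rewrite !gamE ?(le_trans h)//; exact: ratio_nincr.
- move=> e e0; apply: filterS (Lmin e e0) => n h; apply: le_trans h _.
  by rewrite ler_pM2l// ge_min lexx orbT.
pose c : R := 16^-1 ^+ 2 / 2.
have c0 : 0 < c by rewrite divr_gt0// exprn_gt0// invr_gt0.
near=> n.
have /andP[_ t2] : L n <= t n ^+ 2 <= 2 * L n by near: n; exact: norming_sqr_bounds.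
have [gn0 gne] : 0 < gn n /\ gn n ^+ 2 = g (gn n * Num.sqrt n%:R) by near: n.
have tbig : 4 <= t n by near: n; exact: (cvgry_ge (norming_infty p_infty)).
have tpos : 0 < t n by exact: lt_le_trans tbig.
have Le : L n <= c * Num.min (gn n ^+ 2) (n%:R `^ 3^-1) by near: n; exact: Lmin c0.
have Lg : L n <= c * gn n ^+ 2.
  by apply: le_trans Le _; rewrite ler_pM2l// ge_min lexx.
have tg : 16 * t n <= gn n.
  rewrite -(@ler_pXn2r _ 2)// ?nnegrE ?mulr_ge0 ?(ltW tpos) ?(ltW gn0)//.
  have : 16 ^+ 2 * (2 * (c * gn n ^+ 2)) = gn n ^+ 2 by rewrite /c; field.
  by rewrite exprMn; lra.
have sx : x0 <= Num.sqrt n%:R.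
  have -> : x0 = Num.sqrt (x0 ^+ 2) by rewrite sqrtr_sqr ger0_norm// ltW.
  by apply: ler_wsqrtr; near: n; exact: (cvgry_ge (@cvgr_idn R)).
have q0 : 0 < Num.sqrt n%:R :> R by exact: lt_le_trans sx.
set u := Num.sqrt n%:R * t n / 4; set v := gn n * Num.sqrt n%:R in gne.
have xu : x0 <= u.
  by apply: le_trans sx _; rewrite /u -mulrA ler_peMr ?(ltW q0)// ler_pdivlMr// mul1r.
have uv : u <= v by rewrite /u /v; nra.
have u0 : 0 < u by exact: lt_le_trans xu.
have v0 : 0 < v by exact: lt_le_trans uv.
rewrite gamE//; have := ratio_nincr u v xu uv; rewrite /ratio -gne ler_pdivlMr//.
have -> : gn n ^+ 2 / v * u = gn n * t n / 4 by rewrite /u /v; field; rewrite !gt_eqF.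
by have := ler_wpM2l (ltW tpos) tg; nra.
Unshelve. all: by end_near. Qed.

End conditions.

(** * Normalized sums *)

Section normalized.
Context {R : realType} d (T : measurableType d) (P : probability T R).
Variables (X : nat -> {RV P >-> R}) (Sc : nat -> nat -> {RV P >-> R}) (p : nat -> nat).
Hypotheses (iidX : iid P X) (p_gt0 : forall n, (0 < p n)%N)
  (p_infty : p n @[n --> \oo] --> \oo).
Hypotheses (iidSc : forall n, iid P (Sc n))
  (lawSc : forall n i, same_law P (Sc n i) (partial_sum X n)).
Local Notation t n := (norming (p n)%:R : R).

Definition normalize (n : nat) (x : R) : R := t n * (x / Num.sqrt n%:R - t n).

Lemma measurable_normalize n : measurable_fun setT (normalize n).
Proof. by apply: measurable_funM => //; apply: measurable_funB => //; exact: measurable_funM. Qed.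

Lemma measurable_partial_sum n : measurable_fun setT (partial_sum X n).
Proof. by apply: measurable_sum => i; exact: measurable_funP. Qed.

Lemma measurable_normalized_copy n : measurable_fun setT (normalize n \o Sc n 0%N).
Proof. by apply: measurableT_comp (measurable_normalize n) _; exact: measurable_funP. Qed.

Definition normalized_copy (n : nat) : {RV P >-> R} :=
  HB.pack (normalize n \o Sc n 0%N)
    (isMeasurableFun.Build _ _ _ _ _ (measurable_normalized_copy n)).

Lemma iid_normalized n :
  iid_law P (fun i w => normalize n (Sc n i w)) (distribution P (normalized_copy n)).
Proof.
exact: (iid_law_comp (iid_iid_law (iidSc n)) (measurable_normalize n)).
Qed.

Lemma normalize_gtE n (x y : R) : 0 < t n ->
  (y < normalize n x) = (t n + y / t n < x / Num.sqrt n%:R).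
Proof. by move=> t0; rewrite /normalize -ltr_pdivrMl// ltrBrDl [_^-1 * y]mulrC. Qed.

Lemma pr_normalized_copy n (A : set R) : measurable A ->
  pr (distribution P (normalized_copy n)) A = pr P [set w | A (normalize n (partial_sum X n w))].
Proof.
move=> mA; rewrite /pr; congr fine.
apply: (lawSc n 0%N (A := normalize n @^-1` A)).
by rewrite -[X in measurable X]setTI; exact: measurable_normalize.
Qed.

Lemma tail_normalized_copy : tail_relation P p (partial_sum X) ->
  forall y : R, (p n)%:R * fine (ccdf (normalized_copy n) y) @[n --> \oo] --> expR (- y).
Proof.
move=> /(tail_relationE P p_infty) h y; refine (cvg_eq_near (h y) _).
near=> n; have t0 : 0 < t n by near: n; exact: norming_gt0.
congr (_ * _); rewrite -[RHS]/(pr (distribution P (normalized_copy n)) `]y, +oo[%classic).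
rewrite pr_normalized_copy//; congr (pr P _).
by apply/seteqP; split => w; rewrite /exceedance /= in_itv/= andbT normalize_gtE.
Unshelve. all: by end_near. Qed.

Lemma normalized_sum_windows (E : nat -> T -> R) (nu : probability R R) :
  iid_law P E nu -> (forall A, measurable A -> nu A = exponential_prob 1 A) ->
  cvg_in_distribution P (point_process p Sc) (limit_process E) ->
  forall a b : R, a < b ->
  (p n)%:R * pr P [set w | a < normalize n (partial_sum X n w) <= b] @[n --> \oo] -->
    expR (- a) - expR (- b).
Proof.
move=> iidE nuE cvgN a b ab.
have h := window_cvg iid_normalized p_infty iidE nuE cvgN ab.
refine (cvg_eq_near h _); near=> n; congr (_ * _); rewrite pr_normalized_copy//; congr (pr P _).
Unshelve. all: by end_near. Qed.

Hypotheses (meanX : ('E_P[X 0%N] = 0)%E)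
  (secondX : ('E_P[fun w => (X 0%N w ^+ 2)%R] = 1)%E).

(** Only the values of [S_n] far above the window can escape it, and the moment
    condition bounds their probability by that of a window of fixed width. *)
Lemma tail_of_windows : moderate X p ->
  (forall a b : R, a < b ->
    (p n)%:R * pr P [set w | a < normalize n (partial_sum X n w) <= b] @[n --> \oo] -->
    expR (- a) - expR (- b)) ->
  tail_relation P p (partial_sum X).
Proof.
move=> [s [beta [M [[s2 sb b0 b2 Ms] [tsmall large]]]]] windows.
have [D [D4 D7]] : exists D : R, 4 <= D /\ 7 * 64 / D = 1 / 16.
  (* 7168 = 16 * 7 * 64 *)
  by exists 7168; split; [rewrite ler_nat|field].
have mxi n : measurable_fun setT (fun w => normalize n (partial_sum X n w)).
  exact: measurableT_comp (measurable_normalize n) (measurable_partial_sum n).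
have c0 : 0 < 9 * D + 1 by lra.
have escape K : exists2 bad : nat -> R, (p n)%:R * bad n @[n --> \oo] --> 0 &
    \forall n \near \oo, pr P [set w | K < normalize n (partial_sum X n w)] <=
      bad n + pr P [set w | K - (9 * D + 1) < normalize n (partial_sum X n w) <= K].
  have [bad bad0 hbad] := no_escape (iid_iid_law iidX) (law_integrable secondX)
    (law_mean iidX meanX secondX) (law_second_moment secondX) D4 D7 s2 sb b0 b2 Ms
    (norming_infty p_infty) (p_le_norming p_gt0 p_infty) tsmall large K.
  exists bad => //; near=> n.
  have t0 : 0 < t n by near: n; exact: norming_gt0.
  have q0 : 0 < Num.sqrt n%:R :> R.
    by rewrite sqrtr_gt0 ltr0n; near: n; exact: nbhs_infty_gt.
  have mS := measurable_partial_sum n.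
  have hn : pr P [set w | Num.sqrt n%:R * (t n + K / t n) <= partial_sum X n w] <=
      bad n + pr P [set w | Num.sqrt n%:R * (t n + (K - 9 * D) / t n) <= partial_sum X n w
        < Num.sqrt n%:R * (t n + K / t n)] by near: n.
  have scale y x : (Num.sqrt n%:R * (t n + y / t n) <= x) = (y <= normalize n x).
    rewrite -ler_pdivlMl// /normalize -[in RHS]ler_pdivrMl// lerBrDl.
    by rewrite [_^-1 * y]mulrC [_^-1 * x]mulrC.
  apply: (@le_trans _ _ (pr P [set w | Num.sqrt n%:R * (t n + K / t n) <= partial_sum X n w])).
    apply: pr_le.
    - exact: measurable_lt_set.
    - exact: measurable_le_set.
    - by move=> w /=; rewrite scale; exact: ltW.
  apply: le_trans hn _; rewrite lerD2l; apply: pr_le.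
  - rewrite (_ : [set w | _] = [set w | Num.sqrt n%:R * (t n + (K - 9 * D) / t n) <= partial_sum X n w] `&`
      ~` [set w | Num.sqrt n%:R * (t n + K / t n) <= partial_sum X n w]).
      by apply: measurableI; [|apply: measurableC]; exact: measurable_le_set.
    apply/seteqP; split => w /=; first by move=> /andP[-> ]; rewrite ltNge => /negP.
    by move=> [-> /negP]; rewrite -ltNge => ->.
  - rewrite (_ : [set w | _] = [set w | K - (9 * D + 1) < normalize n (partial_sum X n w)] `&`
      ~` [set w | K < normalize n (partial_sum X n w)]).
      by apply: measurableI; [|apply: measurableC]; exact: measurable_lt_set.
    apply/seteqP; split => w /=; first by move=> /andP[-> ]; rewrite leNgt => /negP.
    by move=> [-> /negP]; rewrite -leNgt => ->.
  - move=> w /=; rewrite ltNge !scale -ltNge => /andP[h1 /ltW ->]; rewrite andbT.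
    by apply: lt_le_trans h1; lra.
have tails x := tail_from_windows mxi windows c0 escape (x := x).
apply/(tail_relationE P p_infty) => x; refine (cvg_eq_near (tails x) _).
near=> n; have t0 : 0 < t n by near: n; exact: norming_gt0.
congr (_ * pr P _).
by apply/seteqP; split => w; rewrite /exceedance /= normalize_gtE.
Unshelve. all: by end_near. Qed.

End normalized.

Theorem theorem2p3 (R : realType) (d : measure_display) (T : measurableType d)
    (P : probability T R)
    (X : nat -> {RV P >-> R}) (Sc : nat -> nat -> {RV P >-> R})
    (E : nat -> {RV P >-> R}) (p : nat -> nat)
    (iidX : iid P X)
    (meanX : ('E_P[X 0%N] = 0)%E)
    (secondX : ('E_P[fun w => (X 0%N w ^+ 2)%R] = 1)%E)
    (iidSc : forall n, iid P (Sc n))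
    (lawSc : forall n i, same_law P (Sc n i) (partial_sum X n))
    (iidE : iid P E)
    (expE : standard_exponential P (E 0%N))
    (p_gt0 : forall n, (0 < p n)%N)
    (p_infty : p n @[n --> \oo] --> \oo)
    (cond : condition_moment P (X 0%N) p \/
            condition_subexponential P (X 0%N) p \/
            condition_exponential P (X 0%N) p) :
  [/\ tail_relation P p (partial_sum X) <-> gumbel_relation P p Sc,
      tail_relation P p (partial_sum X) <->
        cvg_in_distribution P (point_process p Sc) (limit_process E) &
      exists mu : {measure set R -> \bar R},
        (forall x : R, mu `]x, +oo[%classic = (expR (- x))%:E) /\
        poisson_random_measure P mu (limit_process E)].
Proof.
have iidE' := iid_iid_law iidE.
have nuE A : measurable A -> distribution P (E 0%N) A = exponential_prob 1 A.
  exact: expE.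
have mod : moderate X p.
  case: cond => [|[|]] c.
  - exact: moderate_moment.
  - exact: moderate_subexponential.
  - exact: moderate_exponential.
split.
- apply: tail_gumbelE => // n; exact: measurable_partial_sum.
- split => [tail|cvgN].
    exact: (point_process_cvg p_infty (tail_normalized_copy p_infty lawSc tail)
      (fun n => iid_normalized p iidSc n) iidE' nuE).
  apply: tail_of_windows => //.
  by move=> a b ab; exact: (normalized_sum_windows p_infty iidSc lawSc iidE' nuE cvgN ab).
- exists exp_intensity; split; first exact: exp_intensity_itvoy.
  exact: poisson_limit_process iidE' nuE.
Qed.
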